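(* Let $f(z,w)=\sum_{l,m\ge 0}a_{l,m}z^lw^m$ be a polynomial in two complex variables and $\xi_0\in\mathbb C$. Suppose that the polynomial $f-\xi_0$ is non-degenerate with respect to its Newton polygon $P=P_{f-\xi_0}$, that $\dim P=2$, and that $P$ satisfies condition (i): for every point $(u,v)\in P$ one has $\operatorname{conv}\{(0,0),(u,0),(0,v),(u,v)\}\subseteq P$. For each side $\Gamma$ of $P$ not lying on the coordinate axes, let $n_\Gamma+1$ be the number of integer points on $\Gamma$, let $(\alpha_\Gamma,\beta_\Gamma)\in\mathbb Z^2$ be the primitive (irreducible) outer normal vector of $\Gamma$, and let $(u_0,v_0)\in\Gamma$ be any point of $\Gamma$ (the quantity $u_0\alpha_\Gamma+v_0\beta_\Gamma$ does not depend on the choice). Then there exist $\varepsilon>0$ and $R>0$ such that: 1) For each side $\Gamma$ of $P$ not lying on the coordinate axes there exist exactly $n_\Gamma$ holomorphic embeddings $$J_{\Gamma,n}:D^2_{\xi_0,\varepsilon}\times(D^2_{0,\varepsilon}\setminus\{0\})\to(\mathbb C\setminus\{0\})^2,\qquad 1\le n\le n_\Gamma,$$ such that for all $(\xi,u)\in D^2_{\xi_0,\varepsilon}\times(D^2_{0,\varepsilon}\setminus\{0\})$ $$f\circ J_{\Gamma,n}(\xi,u)=\xi,\qquad J_{\Gamma,n}^*(dz\wedge dw)=\varkappa_{\Gamma,n}\,u^{(u_0-1)\alpha_\Gamma+(v_0-1)\beta_\Gamma-1}\,d\xi\wedge du,$$ and $\lim_{u\to0}|J_{\Gamma,n}(\xi,u)|=\infty$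 uniformly in $\xi\in D^2_{\xi_0,\varepsilon}$. Here $\varkappa_{\Gamma,n}=1$ if $(1,1)\notin\Gamma$, and if $(1,1)\in\Gamma$ then $\varkappa_{\Gamma,(3\pm1)/2}=\pm(a_{1,1}^2-4a_{2,0}a_{0,2})^{-1/2}$ (that is, the sign $+$ for $n=2$ and the sign $-$ for $n=1$, for a choice of the square root). 2) The images of all these $n_\mu:=\sum_\Gamma n_\Gamma$ embeddings (corresponding to the same side and different values of $n$, or to different sides) are pairwise disjoint, and the union of these images contains $f^{-1}(D^2_{\xi_0,\varepsilon})\setminus D^4_{0,R}$ (i.e. the complement of this union in $f^{-1}(D^2_{\xi_0,\varepsilon})$ is bounded, and therefore has compact closure in $\mathbb C^2$). 3) Each map $$D^2_{\xi_0,\varepsilon}\times(D^2_{0,\varepsilon}\setminus\{0\})\to(\mathbb C\setminus\{0\})^2,\qquad (\xi,u)\mapsto\bigl(u^{\alpha_\Gamma}\mathrm{Pr}_z(J_{\Gamma,n}(\xi,u)),\,u^{\beta_\Gamma}\mathrm{Pr}_w(J_{\Gamma,n}(\xi,u))\bigr)$$ extends to a holomorphic map $\hat J_{\Gamma,n}:D^2_{\xi_0,\varepsilon}\times D^2_{0,\varepsilon}\to(\mathbb C\setminus\{0\})^2$ such that $f^{(\alpha_\Gamma,\beta_\Gamma)}(\hat J_{\Gamma,n}(\xi,0))=0$, where $\mathrm{Pr}_z,\mathrm{Pr}_w:\mathbb C^2\to\mathbb C$ are the projections to the first and second component.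
   Context: The Newton polygon $P_g\subset\mathbb R^2$ of a polynomial $g(z,w)=\sum_{l,m\ge0}b_{l,m}z^lw^m$ is the convex hull of the set of points $(l,m)\in\mathbb Z^2$ with $b_{l,m}\ne0$; $\dim P_g$ is the dimension of the minimal affine subspace of $\mathbb R^2$ containing $P_g$. For a covector $\eta\in\mathbb R^{2*}$, $P_g^\eta$ denotes the face (of dimension 0, 1 or 2) of $P_g$ on which the function $x\mapsto\langle\eta,x\rangle$, $x\in P_g$, attains its maximum (so $P_g^0=P_g$), and the truncated polynomial is $g^\eta(z,w)=\sum_{(l,m)\in P_g^\eta}b_{l,m}z^lw^m$. The polynomial $g$ is called non-degenerate with respect to its Newton polygon if for every $\eta\in\mathbb R^{2*}$ and every solution $(z,w)\in(\mathbb C\setminus\{0\})^2$ of $g^\eta(z,w)=0$ the differential $dg^\eta(z,w)\ne0$. $D^2_{z_0,\varepsilon}=\{z\in\mathbb C: |z-z_0|<\varepsilon\}$ is the open disc; $D^4_{0,R}$ is the open ball of radius $R$ centred at the origin in $\mathbb C^2$. ''conv'' denotes the convex hull. A side of $P$ ''not lying on the coordinate axes'' is a side not contained in either coordinate axis of $\mathbb R^2$.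
   Formalization: If Γ contains (1,1), is parallel to a coordinate axis and n_Γ≥2, the printed formula for ϰ fails (e.g. f=z(w²−1)+w²+w+1, ξ0=0); there ϰ_{Γ,n} is only claimed to be a nonzero constant. The square root is chosen separately for each side. *)

(* Defs.v *)
From HB Require Import structures.
From mathcomp Require Import all_boot all_order all_algebra finmap.
From mathcomp Require Import all_classical all_reals all_analysis.
From mathcomp Require Import complex.

Set Implicit Arguments.
Unset Strict Implicit.
Unset Printing Implicit Defensive.

Import Order.TTheory GRing.Theory Num.Theory.
Import numFieldNormedType.Exports.

Local Open Scope classical_set_scope.
Local Open Scope ring_scope.
Local Open Scope complex_scope.

(* [R[i]^o] is C as a normed module over itself, so that [differentiable] and
   ['d] on [Cplx R * Cplx R] are complex differentiability and the complex
   differential. *)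
Notation Cplx R := ((R[i])^o) (only parsing).
Notation C2 R := ((Cplx R * Cplx R)%type) (only parsing).
Notation plane R := ((R^o * R^o)%type) (only parsing).

Section PlaneConvexity.
Variable R : realType.

Definition conv_hull (A : set (plane R)) : set (plane R) :=
  smallest (@convex_set R (plane R)) A.

Definition translate (p : plane R) (V : {vspace plane R}) : set (plane R) :=
  [set p + v | v in [set v | v \in V]].

(* The smallest affine subspace containing [A] exists and has dimension [d]. *)
Definition affine_dim (A : set (plane R)) (d : nat) : Prop :=
  exists (p : plane R) (V : {vspace plane R}),
    [/\ A `<=` translate p V,
        forall (q : plane R) (W : {vspace plane R}),
          A `<=` translate q W -> translate p V `<=` translate q W
      & \dim V = d].

Definition pairing (eta x : plane R) : R := eta.1 * x.1 + eta.2 * x.2.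

Definition face (P : set (plane R)) (eta : plane R) : set (plane R) :=
  [set x | P x /\ forall y, P y -> pairing eta y <= pairing eta x].

Definition side (P G : set (plane R)) : Prop :=
  (exists eta : plane R, G = face P eta) /\ affine_dim G 1.

Definition on_coordinate_axis (G : set (plane R)) : Prop :=
  G `<=` [set x | x.1 = 0] \/ G `<=` [set x | x.2 = 0].

Definition free_side (P G : set (plane R)) : Prop :=
  side P G /\ ~ on_coordinate_axis G.

(* n_G, one less than the number of integer points of [G]; [fset_set] is
   meaningful because faces of Newton polygons are bounded. *)
Definition nseg (G : set (plane R)) : nat :=
  (#|` fset_set [set a : int * int | G (a.1%:~R, a.2%:~R)]|).-1.

Definition covec (a : int * int) : plane R := (a.1%:~R, a.2%:~R).

Definition primitive_outer_normal (P G : set (plane R)) (a : int * int) :=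
  coprimez a.1 a.2 /\
  forall x y, G x -> P y -> pairing (covec a) y <= pairing (covec a) x.

(* Condition (i). *)
Definition rectangle_closed (P : set (plane R)) : Prop :=
  forall u v : R, P (u, v) ->
    conv_hull [set x : plane R | [\/ x = (0, 0), x = (u, 0), x = (0, v) | x = (u, v)]]
      `<=` P.

End PlaneConvexity.

Section BivariatePolynomials.
Variable R : realType.
Implicit Types g : {poly {poly R[i]}}.

(* The outer variable is w and the inner one is z. *)
Definition bcoef g (l m : nat) : R[i] := g`_m`_l.

Definition beval g (p : C2 R) : Cplx R := g.[(p.2 : R[i])%:P].[p.1].

Definition newton g : set (plane R) :=
  conv_hull [set x : plane R |
    exists l m : nat, bcoef g l m != 0 /\ x = (l%:R, m%:R)].

Definition trunc g (eta : plane R) : {poly {poly R[i]}} :=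
  \poly_(m < size g) \poly_(l < size g`_m)
    (if `[< face (newton g) eta (l%:R, m%:R) >] then bcoef g l m else 0).

Definition torus : set (C2 R) := [set p | p.1 != 0 /\ p.2 != 0].

Definition newton_nondegenerate g : Prop :=
  forall (eta : plane R) (p : C2 R), torus p ->
    beval (trunc g eta) p = 0 ->
    ('d (beval (trunc g eta)) p : C2 R -> Cplx R) <> (fun=> 0).

End BivariatePolynomials.

Section HolomorphicMaps.
Variable R : realType.
Implicit Types (D : set (C2 R)) (F : C2 R -> C2 R).

Definition disc (z0 : Cplx R) (r : R) : set (Cplx R) :=
  [set z | `|z - z0| < r%:C].

(* Euclidean norm: the library norm on a product is the max norm. *)
Definition enorm (p : C2 R) : R[i] := sqrtC (`|p.1| ^+ 2 + `|p.2| ^+ 2).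

Definition ball4 (r : R) : set (C2 R) := [set p | enorm p < r%:C].

Definition bidisc (xi0 : Cplx R) (r : R) : set (C2 R) :=
  disc xi0 r `*` disc 0 r.

Definition punctured_bidisc (xi0 : Cplx R) (r : R) : set (C2 R) :=
  disc xi0 r `*` (disc 0 r `\ 0).

(* Meaningful for open [D]. *)
Definition holomorphic_on D F : Prop :=
  forall p, D p -> differentiable F p.

(* An injective holomorphic immersion which is a homeomorphism onto its
   image. *)
Definition holomorphic_embedding D F : Prop :=
  [/\ holomorphic_on D F,
      forall p, D p -> injective ('d F p : C2 R -> C2 R)
    & exists G : C2 R -> C2 R,
        (forall p, D p -> G (F p) = p) /\ {within F @` D, continuous G}].

(* The form dz /\ dw (equally, d xi /\ d u) on a pair of tangent vectors. *)
Definition area_form (v1 v2 : C2 R) : R[i] := v1.1 * v2.2 - v1.2 * v2.1.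

Definition pullback_area F (p v1 v2 : C2 R) : R[i] :=
  area_form ('d F p v1) ('d F p v2).

(* The constants [k n], 1 <= n <= nseg G, of a side [G] with normal [a].
   If (1,1) is on [G] then [s] is a square root, chosen for each side, of the
   discriminant.  The formula with this discriminant is asked for when
   nseg G = 1 or G is not parallel to an axis (then G joins (2,0) to (0,2) as
   soon as nseg G > 1).  If G lies on the line x = 1 or y = 1 and nseg G > 1,
   the formula fails, and k n is only required to be a nonzero constant: for
   f = z (w^2 - 1) + w^2 + w + 1 and xi0 = 0, the side from (1,0) to (1,2)
   contains (1,1), the constants are 1/2 and -1/2, but
   a_{1,1}^2 - 4 a_{2,0} a_{0,2} = 0. *)
Definition kappa_spec (f : {poly {poly R[i]}}) (G : set (plane R))
    (a : int * int) (k : nat -> R[i]) : Prop :=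
  [/\ forall n, (1 <= n <= nseg G)%N -> k n != 0,
      ~ G (1, 1) -> forall n, (1 <= n <= nseg G)%N -> k n = 1
    & G (1, 1) -> nseg G = 1%N \/ (a.1 != 0 /\ a.2 != 0) ->
      exists s : R[i],
        [/\ s ^+ 2 = bcoef f 1 1 ^+ 2 - 4%:R * bcoef f 2 0 * bcoef f 0 2,
            k 1%N = - s^-1 & k 2%N = s^-1]].

End HolomorphicMaps.

(* Main.v *)
Require Import Defs.
From HB Require Import structures.
From mathcomp Require Import all_boot all_order all_algebra finmap.
From mathcomp Require Import all_classical all_reals all_analysis.
From mathcomp Require Import complex ring lra zify.
Import Order.TTheory GRing.Theory Num.Theory.
Import numFieldNormedType.Exports.
Local Open Scope classical_set_scope.
Local Open Scope ring_scope.
Local Open Scope complex_scope.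
Set Implicit Arguments.
Unset Strict Implicit.
Unset Printing Implicit Defensive.

(** Put g = f - xi0. At a point near infinity with g = x small, the two largest
    monomials of g are comparable and dominate, so (ln |z|, ln |w|) lies at
    bounded distance from the ray of the outer normal (al, be) of one side
    al l + be m = c. With a al + b be = 1 the coordinates v = z^-a w^-b and
    tau = z^be w^-al satisfy: v is small, tau stays in a compact subset of
    C \ {0}, and v^c g = tau^N p(tau) + O(v), where p has degree n_G and is given
    by the coefficients of g on the side. Non-degeneracy makes the roots of p
    simple, and each root carries one embedding.

    To build it, write z = u^-al Z and w = u^-be W, and let
    F(u, Z, W) = u^c g(z, w). The conditions on the pullbacks of f and of
    dz /\ dw say that u Z_u = al Z - kap F_W and u W_u = be W + kap F_Z on
    F = x u^c. By quasi-homogeneity the nonlinear part of this system has zero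
    1-jet at a suitable base point, so inverting u d/du + (c - al - be) on power
    series vanishing at u = 0 gives a contraction. The operator has no resonance
    if al + be <= c, that is, if (1, 1) is below the side; by condition (i) this
    fails only for triangles with a unit side, where the right-hand side
    vanishes. Rescaling u gives kap = 1 unless al + be = c, in which case kap is
    read off from p' at the root. *)

(** Holomorphic functions are produced as limits of polynomials in x and u whose increments decrease
    like 2^-n in a weighted l^1 norm. At radius 2 sg this norm controls values, first derivatives
    and second-order Taylor remainders at radius sg, so a limit inherits a quadratic remainder
    estimate, and that gives complex differentiability.

    The equations for u Z_u, for u W_u and the level equation overdetermine (Z, W). Only the first
    is solved, together with the level equation, for which the iteration makes a Newton step; the
    equation for W then follows from Euler's relation after division by F_W. Since F_W is nonzero at
    the base point only if al > 0, the case al = 0 is reached by exchanging z and w, which changes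
    the sign of kap.

    Injectivity and continuity of the inverse are measured by ratios of coordinates, because the
    coordinates are unbounded. Nearly equal points give (u'/u)^al and (u'/u)^be near 1, and
    coprimality of al and be then excludes every root of unity other than 1.

    All radii are finally taken as minima over the finitely many pairs of a side and a root. *)

Notation cabs := Normc.normc.

(** * The complex modulus as a real number *)

Section ComplexAbs.
Variable R : realType.
Implicit Types z w : R[i].

Lemma norm_cabs z : `|z| = (cabs z)%:C.
Proof. by case: z => a b; rewrite normc_def. Qed.

Lemma cabs_norm z : cabs z = complex.Re `|z|.
Proof. by rewrite norm_cabs. Qed.

Lemma cabs_ge0 z : 0 <= cabs z.
Proof. by rewrite -lecR -norm_cabs normr_ge0. Qed.

Lemma cabsD z w : cabs (z + w) <= cabs z + cabs w.
Proof. exact: le_normcD. Qed.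

Lemma cabsN z : cabs (- z) = cabs z.
Proof. exact: normcN. Qed.

Lemma cabsM z w : cabs (z * w) = cabs z * cabs w.
Proof. exact: Normc.normcM. Qed.

Lemma cabs0 : cabs (0 : R[i]) = 0.
Proof. exact: Normc.normc0. Qed.

Lemma cabs1 : cabs (1 : R[i]) = 1.
Proof. exact: Normc.normc1. Qed.

Lemma cabsV z : cabs z^-1 = (cabs z)^-1.
Proof. exact: Normc.normcV. Qed.

Lemma cabsX z n : cabs (z ^+ n) = cabs z ^+ n.
Proof. by elim: n => [|n IH]; rewrite ?expr0 ?cabs1 // !exprS cabsM IH. Qed.

Lemma cabs_eq0 z : (cabs z == 0) = (z == 0).
Proof.
apply/eqP/eqP => [/Normc.eq0_normc //|->]; exact: cabs0.
Qed.

Lemma cabs_gt0 z : (0 < cabs z) = (z != 0).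
Proof. by rewrite lt_neqAle cabs_ge0 andbT eq_sym cabs_eq0. Qed.

Lemma cabs_nat n : cabs (n%:R : R[i]) = n%:R.
Proof. by rewrite cabs_norm normr_nat raddfMn. Qed.

Lemma cabsB z w : cabs (z - w) = cabs (w - z).
Proof. by rewrite -opprB cabsN. Qed.

Lemma cabs_triB z w t : cabs (z - t) <= cabs (z - w) + cabs (w - t).
Proof. by rewrite -(subrKA w); exact: cabsD. Qed.

Lemma cabs_ltP z (r : R) : (`|z| < r%:C) = (cabs z < r).
Proof. by rewrite norm_cabs ltcR. Qed.

End ComplexAbs.

(** * Polynomials with a weighted l^1 norm *)

Section PolyNorm.
Variable R : realType.

(** A submultiplicative seminorm. It is abstract so that the estimates apply to the modulus on
    [R[i]], then to [pnorm] over it, and once more to [pnorm] over that, for polynomials in two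
    variables. *)
Record absval (B : comNzRingType) (n : B -> R) : Prop := Absval {
  av_ge0 : forall a, 0 <= n a;
  av0 : n 0 = 0;
  avD : forall a b, n (a + b) <= n a + n b;
  avN : forall a, n (- a) = n a;
  avM : forall a b, n (a * b) <= n a * n b;
  av1 : n 1 <= 1 }.

Lemma absval_cabs : absval (@Normc.normc R).
Proof.
split; [exact: cabs_ge0 | exact: cabs0 | exact: cabsD | exact: cabsN
  | by move=> a b; rewrite cabsM | by rewrite cabs1].
Qed.

Section OneLevel.
Variables (B : comNzRingType) (n : B -> R) (an : absval n).

Lemma av_sum I (r : seq I) (P : pred I) (F : I -> B) :
  n (\sum_(i <- r | P i) F i) <= \sum_(i <- r | P i) n (F i).
Proof.
elim/big_rec2: _ => [|i y x _ h]; first by rewrite av0.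
by apply: le_trans (avD an _ _) _; rewrite lerD2l.
Qed.

Lemma avX a k : n (a ^+ k) <= n a ^+ k.
Proof.
elim: k => [|k IH]; first by rewrite !expr0; exact: av1.
rewrite !exprS; apply: le_trans (avM an _ _) _.
by apply: ler_wpM2l => //; exact: av_ge0.
Qed.

Lemma avX_le a k (r : R) : n a <= r -> n (a ^+ k) <= r ^+ k.
Proof.
move=> h; apply: le_trans (avX _ _) _.
by apply: lerXn2r => //; rewrite nnegrE; [exact: av_ge0 | exact: le_trans (av_ge0 an a) h].
Qed.

Lemma avMn a k : n (a *+ k) <= n a *+ k.
Proof.
elim: k => [|k IH]; first by rewrite !mulr0n av0.
by rewrite !mulrS; apply: le_trans (avD an _ _) _; rewrite lerD2l.
Qed.

Lemma avM_le a b (x y : R) : n a <= x -> n b <= y -> n (a * b) <= x * y.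
Proof.
move=> ha hb; apply: le_trans (avM an _ _) _.
by apply: ler_pM => //; exact: av_ge0.
Qed.

Lemma avD_le a b (x y : R) : n a <= x -> n b <= y -> n (a + b) <= x + y.
Proof. by move=> ha hb; apply: le_trans (avD an _ _) _; apply: lerD. Qed.

Definition pnorm (rho : R) (p : {poly B}) : R :=
  \sum_(k < size p) n p`_k * rho ^+ k.

Lemma pnormE rho (p : {poly B}) m : (size p <= m)%N ->
  pnorm rho p = \sum_(k < m) n p`_k * rho ^+ k.
Proof.
move=> h; rewrite /pnorm (big_ord_widen _ (fun k => n p`_k * rho ^+ k) h).
rewrite [RHS](bigID (fun k : 'I_m => (k < size p)%N)) /= [X in _ + X]big1 ?addr0 //.
by move=> i; rewrite -leqNgt => hi; rewrite nth_default // av0 // mul0r.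
Qed.

Lemma pnormC rho b : pnorm rho b%:P = n b.
Proof.
rewrite (@pnormE _ _ 1); last exact: size_polyC_leq1.
by rewrite big_ord1 coefC eqxx expr0 mulr1.
Qed.

Variables (rho : R) (rho0 : 0 <= rho).

Lemma pnormX : pnorm rho 'X <= rho.
Proof.
rewrite (@pnormE _ _ 2) ?size_polyX // big_ord_recl big_ord1 !coefX /=.
by rewrite av0 // mul0r add0r expr1 ler_piMl //; exact: av1.
Qed.

Lemma pnorm_absval : absval (pnorm rho).
Proof.
have ex k : 0 <= rho ^+ k by exact: exprn_ge0.
split.
- by move=> p; apply: sumr_ge0 => i _; rewrite mulr_ge0 // (av_ge0 an).
- by rewrite /pnorm size_poly0 big_ord0.
- move=> p q; set m := maxn (size p) (size q).
  rewrite (@pnormE _ p m) ?leq_maxl // (@pnormE _ q m) ?leq_maxr //.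
  rewrite (@pnormE _ (p + q) m) ?size_polyD // -big_split /=.
  apply: ler_sum => i _; rewrite coefD -mulrDl ler_wpM2r //; exact: avD.
- by move=> p; rewrite /pnorm size_polyN; apply: eq_bigr => i _; rewrite coefN avN.
- move=> p q; set m := (size p + size q)%N.
  rewrite (@pnormE _ (p * q) m); last first.
    by apply: leq_trans (size_polyMleq _ _) _; exact: leq_pred.
  have -> : pnorm rho p * pnorm rho q = \sum_(i < size p) \sum_(j < size q)
      n p`_i * rho ^+ i * (n q`_j * rho ^+ j).
    by rewrite /pnorm mulr_suml; apply: eq_bigr => i _; rewrite mulr_sumr.
  (* The convolution is written as a double sum with an indicator of i + j = k, so that after
     exchanging the sums each pair (i, j) meets exactly one k < m. *)
  have -> : \sum_(k < m) n (p * q)`_k * rho ^+ k =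
     \sum_(k < m) n (\sum_(i < size p) \sum_(j < size q) (p`_i * q`_j) *+ (i + j == k)%N) * rho ^+ k.
    apply: eq_bigr => k _; congr (n _ * _).
    rewrite {1}(_ : p = \sum_(i < size p) p`_i *: 'X^i); last by rewrite -{1}(coefK p) poly_def.
    rewrite {1}(_ : q = \sum_(i < size q) q`_i *: 'X^i); last by rewrite -{1}(coefK q) poly_def.
    rewrite mulr_suml coef_sum; apply: eq_bigr => i _.
    rewrite mulr_sumr coef_sum; apply: eq_bigr => j _.
    rewrite -scalerAl -scalerAr scalerA -exprD coefZ coefXn eq_sym.
    by case: eqP; rewrite ?mulr1 ?mulr0.
  apply: (@le_trans _ _ (\sum_(k < m) (\sum_(i < size p) \sum_(j < size q)
      (n p`_i * n q`_j) *+ (i + j == k)%N) * rho ^+ k)).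
    apply: ler_sum => k _; apply: ler_wpM2r => //.
    apply: le_trans (av_sum _ _ _) _; apply: ler_sum => i _.
    apply: le_trans (av_sum _ _ _) _; apply: ler_sum => j _.
    case: eqP => _; last by rewrite !mulr0n av0.
    by rewrite !mulr1n; exact: avM.
  under eq_bigr => k _ do rewrite mulr_suml.
  rewrite exchange_big /=; apply: ler_sum => i _.
  under eq_bigr => k _ do rewrite mulr_suml.
  rewrite exchange_big /=; apply: ler_sum => j _.
  have hij : (i + j < m)%N by rewrite /m -addSn leq_add // ltnW.
  rewrite (bigD1 (Ordinal hij)) //= eqxx mulr1n big1 ?addr0; last first.
    move=> k hk; case: eqP => [e|]; last by rewrite mulr0n mul0r.
    by case/eqP: hk; apply/val_inj.
  by rewrite exprD mulrACA.
- by rewrite -polyC1 pnormC; exact: av1.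
Qed.

Lemma pnorm_horner (p : {poly B}) y : n y <= rho -> n p.[y] <= pnorm rho p.
Proof.
move=> hy; rewrite horner_coef; apply: le_trans (av_sum _ _ _) _.
by apply: ler_sum => i _; apply: avM_le => //; exact: avX_le.
Qed.

End OneLevel.

Section Taylor.
Variables (B : comNzRingType) (n : B -> R) (an : absval n).
Variables (sg : R) (sg0 : 0 < sg).
Let rho := 2 * sg.
Let sgk k : 0 <= sg ^+ k. Proof. exact/exprn_ge0/ltW. Qed.
Let le2 k : (k%:R : R) <= 2 ^+ k.
Proof. by rewrite -natrX ler_nat ltnW // ltn_expl. Qed.

(** Doubling the radius pays for a derivative: the factor k is absorbed by 2^k. The difference
    quotient and the second-order remainder below are bounded at the same price. *)
Lemma pow_der y k : n y <= sg -> sg * n (y ^+ k.-1 *+ k) <= rho ^+ k.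
Proof.
move=> hy; case: k => [|k]; first by rewrite mulr0n av0 // mulr0 expr0.
rewrite /= exprMn; apply: (@le_trans _ _ (sg * (sg ^+ k *+ k.+1))).
  apply: ler_wpM2l; first exact: ltW.
  by apply: le_trans (avMn an _ _) _; rewrite lerMn2r avX_le ?orbT.
by rewrite mulrnAr -exprS -mulr_natl ler_wpM2r // le2.
Qed.

Lemma pow_diff y y' k : n y <= sg -> n y' <= sg ->
  sg * n (y' ^+ k - y ^+ k) <= rho ^+ k * n (y' - y).
Proof.
move=> hy hy'; have nd := av_ge0 an (y' - y).
elim: k => [|k IH]; first by rewrite !expr0 subrr av0 // mulr0 mul1r.
have -> : y' ^+ k.+1 - y ^+ k.+1 = y' * (y' ^+ k - y ^+ k) + y ^+ k * (y' - y).
  by rewrite !exprS; ring.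
apply: (@le_trans _ _ (sg * (n (y' ^+ k - y ^+ k) * sg + sg ^+ k * n (y' - y)))).
  rewrite ler_wpM2l // ?(ltW sg0) //; apply: avD_le => //.
    by rewrite mulrC; apply: avM_le.
  by apply: avM_le => //; exact: avX_le.
rewrite mulrDr mulrA.
apply: (@le_trans _ _ (rho ^+ k * n (y' - y) * sg + rho ^+ k * sg * n (y' - y))).
  apply: lerD; first by rewrite ler_wpM2r // ltW.
  rewrite mulrA ler_wpM2r // mulrC ler_wpM2r ?(ltW sg0) //.
  rewrite /rho exprMn ler_peMl // -natrX ler1n expn_gt0 //.
rewrite exprS; move: (rho ^+ k) => z; rewrite /rho; lra.
Qed.

(** The remainders satisfy E_(k+1) = y' E_k + k y^(k-1) (y' - y)^2, and [pow_der] bounds the second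
    summand. *)
Lemma pow_taylor y y' k : n y <= sg -> n y' <= sg ->
  sg ^+ 2 * n (y' ^+ k - y ^+ k - y ^+ k.-1 *+ k * (y' - y))
    <= rho ^+ k * n (y' - y) ^+ 2.
Proof.
move=> hy hy'; have nd := av_ge0 an (y' - y).
elim: k => [|k IH].
  by rewrite !expr0 mulr0n mul0r subrr subr0 av0 // mulr0 mul1r exprn_ge0.
have -> : y' ^+ k.+1 - y ^+ k.+1 - y ^+ k.+1.-1 *+ k.+1 * (y' - y) =
   y' * (y' ^+ k - y ^+ k - y ^+ k.-1 *+ k * (y' - y)) +
   y ^+ k.-1 *+ k * (y' - y) ^+ 2.
  case: k {IH} => [|k]; first by rewrite /= !expr0 !expr1 mulr0n mulr1n; ring.
  by rewrite /= !exprS -!(mulr_natr (y ^+ k)) -!(mulr_natr (y * y ^+ k)) -[k.+2%:R]natr1; ring.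
set E := y' ^+ k - _ - _; set D := y ^+ k.-1 *+ k.
have hD : sg * n D <= rho ^+ k by exact: pow_der.
have h1 : n (y' * E + D * (y' - y) ^+ 2) <= sg * n E + n D * n (y' - y) ^+ 2.
  by apply: avD_le => //; apply: avM_le => //; exact: avX.
have hE := IH; rewrite -/E -/D in hE.
have nE := av_ge0 an E; have nD := av_ge0 an D.
set d := n (y' - y) ^+ 2 in h1 hE *; have d0 : 0 <= d by exact: exprn_ge0.
apply: (le_trans (ler_wpM2l (sqr_ge0 sg) h1)).
have e1 := ler_wpM2l (ltW sg0) hE.
have e2 := ler_wpM2l (mulr_ge0 (ltW sg0) d0) hD.
rewrite [rho ^+ k.+1]exprS; move: e1 e2; move: (rho ^+ k) => z; rewrite /rho; lra.
Qed.

Lemma horner_sumE (p : {poly B}) y : p^`().[y] = \sum_(k < size p) p`_k * (y ^+ k.-1 *+ k).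
Proof.
rewrite {1}(_ : p = \sum_(i < size p) p`_i *: 'X^i); last by rewrite -{1}(coefK p) poly_def.
rewrite raddf_sum horner_sum; apply: eq_bigr => i _ /=.
by rewrite derivZ derivXn hornerZ hornerMn hornerXn.
Qed.

(** Passes from monomials to polynomials: [pnorm] weighs the k-th coefficient by exactly the rho^k
    of the monomial estimate. *)
Let lift_bound (p : {poly B}) (F : nat -> B) (K d : R) : 0 < K ->
  (forall k, K * n (F k) <= rho ^+ k * d) ->
  n (\sum_(k < size p) p`_k * F k) <= K^-1 * pnorm n rho p * d.
Proof.
move=> K0 h; apply: le_trans (av_sum an _ _ _) _.
rewrite /pnorm -mulrA mulr_suml mulr_sumr; apply: ler_sum => i _.
apply: le_trans (avM an _ _) _.
rewrite [X in _ <= X](_ : _ = n p`_i * (K^-1 * (rho ^+ i * d))); last ring.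
by rewrite ler_wpM2l ?(av_ge0 an) // ler_pdivlMl.
Qed.

Lemma horner_der_bound (p : {poly B}) y : n y <= sg ->
  n p^`().[y] <= sg^-1 * pnorm n rho p.
Proof.
move=> hy; rewrite horner_sumE -[X in _ <= X]mulr1.
by apply: (@lift_bound p (fun k => y ^+ k.-1 *+ k)) => // k; rewrite mulr1; exact: pow_der.
Qed.

Lemma horner_lip (p : {poly B}) y y' : n y <= sg -> n y' <= sg ->
  n (p.[y'] - p.[y]) <= sg^-1 * pnorm n rho p * n (y' - y).
Proof.
move=> hy hy'; rewrite !horner_coef -sumrB.
under eq_bigr do rewrite -mulrBr.
by apply: (@lift_bound p (fun k => y' ^+ k - y ^+ k)) => // k; exact: pow_diff.
Qed.

Lemma horner_taylor (p : {poly B}) y y' : n y <= sg -> n y' <= sg ->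
  n (p.[y'] - p.[y] - p^`().[y] * (y' - y))
   <= (sg ^+ 2)^-1 * pnorm n rho p * n (y' - y) ^+ 2.
Proof.
move=> hy hy'; rewrite horner_sumE !horner_coef mulr_suml -!sumrB.
rewrite (eq_bigr (fun i : 'I_(size p) => p`_i * (y' ^+ i - y ^+ i - y ^+ i.-1 *+ i * (y' - y)))).
  apply: (@lift_bound p (fun k => y' ^+ k - y ^+ k - y ^+ k.-1 *+ k * (y' - y))) => [|k].
    exact: exprn_gt0.
  exact: pow_taylor.
by move=> i _; rewrite -mulrA -!mulrBr.
Qed.

End Taylor.
End PolyNorm.

(** * Limits and complex differentiability *)

Section GeometricConvergence.
Variable R : realType.

Lemma cabs_ReIm (z : R[i]) :
  [/\ `|complex.Re z| <= cabs z, `|complex.Im z| <= cabs z &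
      cabs z <= `|complex.Re z| + `|complex.Im z|].
Proof.
case: z => a b /=; rewrite -!sqrtr_sqr; split.
- by rewrite ler_sqrt ?addr_ge0 ?sqr_ge0 // lerDl sqr_ge0.
- by rewrite ler_sqrt ?addr_ge0 ?sqr_ge0 // lerDr sqr_ge0.
- have ha : 0 <= Num.sqrt (a ^+ 2) + Num.sqrt (b ^+ 2) by rewrite addr_ge0 // sqrtr_ge0.
  rewrite -[X in _ <= X]ger0_norm // -sqrtr_sqr ler_sqrt ?sqr_ge0 //.
  rewrite sqrrD !sqr_sqrtr ?sqr_ge0 //.
  have : 0 <= Num.sqrt (a ^+ 2) * Num.sqrt (b ^+ 2) *+ 2.
    by rewrite mulrn_wge0 // mulr_ge0 // sqrtr_ge0.
  lra.
Qed.

Lemma geom_eq0 (C e : R) : 0 <= e -> (forall n, e <= C / 2 ^+ n) -> e = 0.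
Proof.
move=> e0 h; apply/eqP; case: ltgtP e0 => // e0 _.
have := archi_boundP (divr_ge0 (le_trans (ltW e0) (le_trans (h 0%N) _)) (ltW e0)).
rewrite expr0 divr1 => /(_ C (lexx _)); set n := Num.bound _ => hn.
have := h n; rewrite ler_pdivlMr ?exprn_gt0 // leNgt => /negP; case.
rewrite ltr_pdivrMr // in hn; apply: (lt_le_trans hn); rewrite mulrC ler_pM2l // ltW //.
by rewrite -natrX ltr_nat ltn_expl.
Qed.

(** The tail 2 C / 2^n bounds all later moves, so the intervals of this half-length around a n are
    nested, and the limit is the supremum of their left ends. *)
Lemma real_geom_limit (C : R) (a : nat -> R) :
  (forall n, `|a n.+1 - a n| <= C / 2 ^+ n) ->
  exists l, forall n, `|l - a n| <= 2 * C / 2 ^+ n.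
Proof.
move=> h; pose t n := 2 * C / 2 ^+ n.
have tS n : t n.+1 = t n - C / 2 ^+ n.
  rewrite /t exprS invfM; set z := (2 ^+ n)^-1; by field.
pose b n := a n - t n; pose c n := a n + t n.
have hh n : a n.+1 - a n <= C / 2 ^+ n /\ a n - a n.+1 <= C / 2 ^+ n.
  by have := h n; rewrite ler_norml => /andP [h1 h2]; split; lra.
have C0 : 0 <= C by have := h 0%N; rewrite expr0 divr1; apply: le_trans.
have bS n : b n <= b n.+1 by rewrite /b tS; have := hh n; case; lra.
have cS n : c n.+1 <= c n by rewrite /c tS; have := hh n; case; lra.
have bm n k : b n <= b (n + k)%N.
  by elim: k => [|k IH]; rewrite ?addn0 // addnS (le_trans IH).
have cm n k : c (n + k)%N <= c n.
  by elim: k => [|k IH]; rewrite ?addn0 // addnS; apply: le_trans (cS _) IH.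
have bc n m : b n <= c m.
  apply: le_trans (bm n m) _; apply: le_trans (_ : c (m + n)%N <= _); last exact: cm.
  rewrite addnC /b /c lerD2l; apply: (@le_trans _ _ 0); rewrite ?oppr_le0 /t divr_ge0 ?mulr_ge0 //.
pose l := sup (range b).
have ub : has_sup (range b).
  split; first by exists (b 0%N), 0%N.
  by exists (c 0%N) => _ [n _ <-].
exists l => n; rewrite ler_norml; apply/andP; split.
  have : b n <= l by apply: ub_le_sup; [exact: (proj2 ub)|exists n].
  rewrite /b -/(t n); lra.
have : l <= c n by apply: ge_sup; [exact: (proj1 ub)|move=> _ [m _ <-]].
rewrite /c -/(t n); lra.
Qed.

(** Convergence at the rate 2^-n, which is what the contractions deliver. One constant C takes the
    place of every epsilon, and the notion is stable under the ring operations. *)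
Definition gcv (a : nat -> R[i]) (l : R[i]) : Prop :=
  exists C, forall n, cabs (l - a n) <= C / 2 ^+ n.

Lemma gcv_exists (C : R) (a : nat -> R[i]) :
  (forall n, cabs (a n.+1 - a n) <= C / 2 ^+ n) -> exists l, gcv a l.
Proof.
move=> h.
have [l1 h1] : exists l, forall n, `|l - complex.Re (a n)| <= 2 * C / 2 ^+ n.
  by apply: real_geom_limit => n; rewrite -raddfB; have [+ _ _] := cabs_ReIm (a n.+1 - a n); move/le_trans; apply.
have [l2 h2] : exists l, forall n, `|l - complex.Im (a n)| <= 2 * C / 2 ^+ n.
  by apply: real_geom_limit => n; rewrite -raddfB; have [_ + _] := cabs_ReIm (a n.+1 - a n); move/le_trans; apply.
exists (Complex l1 l2), (4 * C) => n.
have [_ _ +] := cabs_ReIm (Complex l1 l2 - a n); move/le_trans; apply.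
move: (h1 n) (h2 n); case: (a n) => x y /=.
rewrite -!mulrA; lra.
Qed.

Lemma gcvC0 a l : gcv a l -> exists C, 0 <= C /\ forall n, cabs (l - a n) <= C / 2 ^+ n.
Proof.
case=> C h; exists C; split=> //.
by have := h 0%N; rewrite expr0 divr1; apply: le_trans; exact: cabs_ge0.
Qed.

Lemma gcv_cst l : gcv (fun=> l) l.
Proof. by exists 0 => n; rewrite subrr cabs0 mul0r. Qed.

Lemma gcv_ext a b l : (forall n, a n = b n) -> gcv b l -> gcv a l.
Proof. by move=> e; have -> : a = b by apply/funext. Qed.

Lemma gcv_shift a l : gcv a l -> gcv (fun n => a n.+1) l.
Proof.
case/gcvC0=> C [C0 h]; exists C => n; apply: le_trans (h _) _.
rewrite ler_wpM2l // lef_pV2 ?posrE ?exprn_gt0 // exprS ler_peMl ?exprn_ge0 //.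
by rewrite ler1n.
Qed.

Lemma gcvD a b l k : gcv a l -> gcv b k -> gcv (fun n => a n + b n) (l + k).
Proof.
move=> [C h] [D h']; exists (C + D) => n; rewrite opprD addrACA.
by apply: le_trans (cabsD _ _) _; rewrite mulrDl; apply: lerD.
Qed.

Lemma gcvM a b l k : gcv a l -> gcv b k -> gcv (fun n => a n * b n) (l * k).
Proof.
move=> /gcvC0[C [C0 h]] /gcvC0[D [D0 h']].
exists (C * (cabs k + D) + cabs l * D) => n.
have -> : l * k - a n * b n = (l - a n) * b n + l * (k - b n) by ring.
apply: le_trans (cabsD _ _) _; rewrite !cabsM.
have bn : cabs (b n) <= cabs k + D.
  have -> : b n = k + (b n - k) by ring.
  apply: le_trans (cabsD _ _) _; rewrite lerD2l cabsB; apply: le_trans (h' n) _.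
  by rewrite ler_pdivrMr ?exprn_gt0 // ler_peMr // exprn_ege1 // ler1n.
rewrite mulrDl; apply: lerD; last by rewrite -mulrA ler_wpM2l // cabs_ge0.
by rewrite [X in _ <= X]mulrAC; apply: ler_pM; rewrite ?cabs_ge0.
Qed.

Lemma gcvN a l : gcv a l -> gcv (fun n => - a n) (- l).
Proof. by case=> C h; exists C => n; rewrite -opprD cabsN. Qed.

Lemma gcvB a b l k : gcv a l -> gcv b k -> gcv (fun n => a n - b n) (l - k).
Proof. by move=> h h'; apply: gcvD => //; exact: gcvN. Qed.

Lemma gcvX a l m : gcv a l -> gcv (fun n => a n ^+ m) (l ^+ m).
Proof.
move=> h; elim: m => [|m IH]; first by under eq_fun do rewrite expr0; exact: gcv_cst.
by rewrite exprS; under eq_fun do rewrite exprS; apply: gcvM.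
Qed.

Lemma gcv_sum (T : Type) (r : seq T) (a : T -> nat -> R[i]) (l : T -> R[i]) :
  (forall t, gcv (a t) (l t)) ->
  gcv (fun n => \sum_(t <- r) a t n) (\sum_(t <- r) l t).
Proof.
move=> h; elim: r => [|t r IH].
  by rewrite big_nil; under eq_fun do rewrite big_nil; exact: gcv_cst.
by rewrite big_cons; under eq_fun do rewrite big_cons; apply: gcvD.
Qed.

Lemma gcv_bound a l M : gcv a l -> (forall n, cabs (a n) <= M) -> cabs l <= M.
Proof.
move=> [C h] ha; rewrite leNgt; apply/negP => hM.
suff : cabs l - M = 0 by lra.
apply: (@geom_eq0 C) => [|n]; first by lra.
have := h n; have := ha n; have := cabsD (l - a n) (a n); rewrite subrK; lra.
Qed.

Lemma gcv_unique a l k : gcv a l -> gcv a k -> l = k.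
Proof.
move=> h h'; apply/eqP; rewrite -subr_eq0 -cabs_eq0 eq_le cabs_ge0 andbT.
apply: (gcv_bound (gcvB h h')) => n; by rewrite subrr cabs0.
Qed.

End GeometricConvergence.

(** * Complex differentiability from a quadratic remainder *)

Section QuadraticDiff.
Variable R : realType.

Definition lin2 (a b : R[i]) (h : C2 R) : Cplx R := a * h.1 + b * h.2.

Lemma lin2_linear a b : linear (lin2 a b).
Proof. by move=> k x y; rewrite /lin2 /= /GRing.scale /=; ring. Qed.

HB.instance Definition _ a b := GRing.isLinear.Build R[i] (C2 R) (Cplx R) _ (lin2 a b) (lin2_linear a b).

Lemma lin2_continuous a b : continuous (lin2 a b).
Proof.
move=> p; rewrite /lin2.
apply: cvgD; apply: cvgM; try exact: cvg_cst; [exact: cvg_fst | exact: cvg_snd].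
Qed.

Lemma prod_cabs_lt (h : C2 R) (d : R) : `|h| < d%:C -> cabs h.1 < d /\ cabs h.2 < d.
Proof.
rewrite prod_normE /= => hd; split; rewrite -ltcR -norm_cabs.
  by apply: le_lt_trans hd; rewrite comparable_le_max ?lexx // real_comparable // normr_real.
by apply: le_lt_trans hd; rewrite comparable_le_max ?lexx ?orbT // real_comparable // normr_real.
Qed.

Lemma prod_cabs_le (h : C2 R) : (cabs h.1)%:C <= `|h| /\ (cabs h.2)%:C <= `|h|.
Proof.
rewrite prod_normE /= -!norm_cabs; split.
  by rewrite comparable_le_max ?lexx // real_comparable // normr_real.
by rewrite comparable_le_max ?lexx ?orbT // real_comparable // normr_real.
Qed.

(** The differentiability criterion behind polynomial maps, integer powers of u and limit functions
    alike; the pair (a, b) is the gradient. *)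
Lemma is_diff_quadratic (F : C2 R -> Cplx R) (p : C2 R) (a b : R[i]) (d M : R) : 0 < d ->
  (forall h : C2 R, cabs h.1 < d -> cabs h.2 < d ->
     cabs (F (h + p) - F p - (a * h.1 + b * h.2)) <= M * (cabs h.1 + cabs h.2) ^+ 2) ->
  is_diff p F (lin2 a b).
Proof.
move=> d0 hF.
have du := @diff_unique R[i] (C2 R) (Cplx R) F (lin2 a b) p (@lin2_continuous a b).
match type of du with ?A -> _ => have key : A end.
  (* Norms take values in [R[i]], so the tolerance [e] is a positive complex number, that is, a
     positive real one. *)
  apply/eqaddoP => e e0; have [er0 er er0_gt0] : exists2 r, e = r%:C & 0 < r.
    exists (complex.Re e); last by rewrite -ltcR RRe_real ?gtr0_real.
    by rewrite RRe_real ?gtr0_real.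
  pose M' := `|M| + 1; have M'0 : 0 < M' by rewrite /M' ltr_wpDl.
  (* With s the sum of the two moduli, s <= 2 r makes M' s at most er0 / 2; the remaining factor 2
     compares s with the max norm of h. *)
  pose r := Num.min d (er0 / (4 * M')); have hr : 0 < r.
    by rewrite /r lt_min d0 divr_gt0 ?mulr_gt0.
  have r0C : 0 < r%:C :> R[i] by rewrite ltcR.
  apply: filterS (nbhs0_lt r0C) => h /prod_cabs_lt [h1 h2].
  have {}hF := hF h (lt_le_trans h1 _) (lt_le_trans h2 _).
  rewrite !fctE /=; rewrite -/(lin2 a b h) in hF.
  rewrite opprD addrA norm_cabs.
  have [k1 k2] := prod_cabs_le h.
  apply: (@le_trans _ _ ((er0 / 2)%:C * ((cabs h.1)%:C + (cabs h.2)%:C))).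
    rewrite -rmorphD -rmorphM lecR; apply: le_trans (hF _ _) _; try by rewrite /r ge_min lexx.
    set s := cabs h.1 + cabs h.2.
    have s0 : 0 <= s by rewrite addr_ge0 // cabs_ge0.
    have sr : s <= er0 / (2 * M').
      have : r <= er0 / (4 * M') by rewrite /r ge_min lexx orbT.
      have -> : er0 / (2 * M') = 2 * (er0 / (4 * M')) by field; rewrite gt_eqF.
      rewrite /s; lra.
    apply: (@le_trans _ _ (M' * s ^+ 2)).
      by rewrite ler_wpM2r ?sqr_ge0 // /M'; have := ler_norm M; lra.
    rewrite expr2 mulrA ler_wpM2r //.
    have -> : er0 / 2 = M' * (er0 / (2 * M')) by field; rewrite gt_eqF.
    by rewrite ler_pM2l.
  rewrite er.
  have -> : er0%:C = (er0 / 2)%:C * 2 :> R[i].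
    by rewrite -[2]/(2%:R) -(rmorph_nat (real_complex R) 2) -rmorphM /= divfK // pnatr_eq0.
  rewrite -mulrA; apply: ler_wpM2l; first by rewrite ler0c divr_ge0 // ltW.
  apply: le_trans (lerD k1 k2) _; by rewrite mulr_natl mulr2n.
have dF := du key.
apply: DiffDef => //; apply/diff_locallyP; rewrite dF; split => //.
exact: lin2_continuous.
Qed.

End QuadraticDiff.

(** * Polynomials in two variables and their limits *)

Section TwoVariablePolynomials.
Variable R : realType.
Notation A2 := {poly {poly R[i]}}.
Implicit Types P Q : A2.

Definition norm2 (rho : R) : A2 -> R := pnorm (pnorm (@Normc.normc R) rho) rho.

(** The inner variable stands for x and the outer one for u; [evX] and [evU] are the two partial
    derivatives at (x, u). *)
Definition ev2 (x u : R[i]) P : R[i] := P.[u%:P].[x].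
Definition evX (x u : R[i]) P : R[i] := (P.[u%:P])^`().[x].
Definition evU (x u : R[i]) P : R[i] := P^`().[u%:P].[x].

Lemma absval_pnorm1 (rho : R) : 0 <= rho -> absval (pnorm (@Normc.normc R) rho).
Proof. by move=> h; apply: pnorm_absval => //; exact: absval_cabs. Qed.

Lemma absval_norm2 (rho : R) : 0 <= rho -> absval (norm2 rho).
Proof. by move=> h; apply: pnorm_absval => //; exact: absval_pnorm1. Qed.

Section Bounds.
Variables (sg : R) (sg0 : 0 < sg).
Let rho := 2 * sg.
Let rho0 : 0 <= rho. Proof. by rewrite mulr_ge0 // ltW. Qed.
Let a1 := absval_pnorm1 rho0.
Let sgr : sg <= rho. Proof. by rewrite /rho; move: (ltW sg0); lra. Qed.
Let nu (u : R[i]) : cabs u <= sg -> pnorm (@Normc.normc R) rho u%:P <= sg.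
Proof. by move=> h; rewrite pnormC //; exact: absval_cabs. Qed.

Lemma norm2_ge0 P : 0 <= norm2 rho P.
Proof. exact: av_ge0 (absval_norm2 rho0) P. Qed.

Let h1 (q : {poly R[i]}) x : cabs x <= sg -> cabs q.[x] <= pnorm (@Normc.normc R) rho q.
Proof. by move=> h; apply: pnorm_horner; [exact: absval_cabs | exact: le_trans h sgr]. Qed.

Let h2 P u : cabs u <= sg -> pnorm (@Normc.normc R) rho P.[u%:P] <= norm2 rho P.
Proof. by move=> h; apply: (pnorm_horner a1); apply: le_trans sgr; exact: nu. Qed.

Lemma ev2_bound x u P : cabs x <= sg -> cabs u <= sg -> cabs (ev2 x u P) <= norm2 rho P.
Proof. by move=> hx hu; apply: le_trans (h1 _ hx) (h2 _ hu). Qed.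

Lemma evX_bound x u P : cabs x <= sg -> cabs u <= sg ->
  cabs (evX x u P) <= sg^-1 * norm2 rho P.
Proof.
move=> hx hu; apply: le_trans (horner_der_bound (absval_cabs R) sg0 _ hx) _.
by rewrite ler_pM2l ?invr_gt0 //; exact: h2.
Qed.

Lemma evU_bound x u P : cabs x <= sg -> cabs u <= sg ->
  cabs (evU x u P) <= sg^-1 * norm2 rho P.
Proof.
move=> hx hu; apply: le_trans (h1 _ hx) _.
exact: (horner_der_bound a1 sg0 _ (nu hu)).
Qed.

Lemma ev2_lip x u x' u' P :
  cabs x <= sg -> cabs u <= sg -> cabs x' <= sg -> cabs u' <= sg ->
  cabs (ev2 x' u' P - ev2 x u P) <=
    sg^-1 * norm2 rho P * (cabs (x' - x) + cabs (u' - u)).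
Proof.
move=> hx hu hx' hu'.
have -> : ev2 x' u' P - ev2 x u P = (P.[u'%:P] - P.[u%:P]).[x'] +
   (P.[u%:P].[x'] - P.[u%:P].[x]) by rewrite hornerD hornerN /ev2; ring.
apply: le_trans (cabsD _ _) _; rewrite mulrDr addrC; apply: lerD.
  apply: le_trans (horner_lip (absval_cabs R) sg0 _ hx hx') _.
  by rewrite ler_wpM2r ?cabs_ge0 // ler_pM2l ?invr_gt0 //; exact: h2.
apply: le_trans (h1 _ hx') _.
apply: le_trans (horner_lip a1 sg0 _ (nu hu) (nu hu')) _.
by rewrite -polyCB pnormC //; exact: absval_cabs.
Qed.

Lemma ev2_taylor x u x' u' P :
  cabs x <= sg -> cabs u <= sg -> cabs x' <= sg -> cabs u' <= sg ->
  cabs (ev2 x' u' P - ev2 x u P - (evX x u P * (x' - x) + evU x u P * (u' - u))) <=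
    (sg ^+ 2)^-1 * norm2 rho P * (cabs (x' - x) + cabs (u' - u)) ^+ 2.
Proof.
move=> hx hu hx' hu'.
pose E1 := P.[u'%:P] - P.[u%:P] - P^`().[u%:P] * (u'%:P - u%:P).
pose E2 := P^`().[u%:P].[x'] - P^`().[u%:P].[x].
pose q := P.[u%:P].
pose E3 := q.[x'] - q.[x] - q^`().[x] * (x' - x).
have -> : ev2 x' u' P - ev2 x u P - (evX x u P * (x' - x) + evU x u P * (u' - u)) =
   E1.[x'] + E2 * (u' - u) + E3.
  rewrite /E1 /E2 /E3 /ev2 /evX /evU /q !(hornerD, hornerN, hornerM, hornerC); ring.
have n0 := norm2_ge0 P.
have b1 : cabs E1.[x'] <= (sg ^+ 2)^-1 * norm2 rho P * cabs (u' - u) ^+ 2.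
  apply: le_trans (h1 _ hx') _.
  apply: le_trans (horner_taylor a1 sg0 _ (nu hu) (nu hu')) _.
  by rewrite -polyCB pnormC //; exact: absval_cabs.
have b2 : cabs (E2 * (u' - u)) <= (sg ^+ 2)^-1 * norm2 rho P * (cabs (x' - x) * cabs (u' - u)).
  rewrite cabsM mulrA ler_wpM2r ?cabs_ge0 //.
  apply: le_trans (horner_lip (absval_cabs R) sg0 _ hx hx') _.
  rewrite ler_wpM2r ?cabs_ge0 // expr2 invfM -mulrA ler_pM2l ?invr_gt0 //.
  exact: (horner_der_bound a1 sg0 _ (nu hu)).
have b3 : cabs E3 <= (sg ^+ 2)^-1 * norm2 rho P * cabs (x' - x) ^+ 2.
  apply: le_trans (horner_taylor (absval_cabs R) sg0 _ hx hx') _.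
  rewrite ler_wpM2r ?exprn_ge0 ?cabs_ge0 // ler_wpM2l ?invr_ge0 ?sqr_ge0 //.
  exact: h2.
apply: le_trans (cabsD _ _) _.
apply: le_trans (lerD (cabsD _ _) (lexx _)) _.
have K0 : 0 <= (sg ^+ 2)^-1 * norm2 rho P by rewrite mulr_ge0 // invr_ge0 sqr_ge0.
move: b1 b2 b3 K0; set K := (sg ^+ 2)^-1 * _.
move: (cabs (E2 * _)) (cabs E1.[x']) (cabs E3) => e2 e1 e3 b1 b2 b3 K0.
have dx := cabs_ge0 (x' - x); have du := cabs_ge0 (u' - u).
set a := cabs (x' - x) in dx b1 b2 b3 *; set b := cabs (u' - u) in du b1 b2 b3 *.
have : 0 <= K * (a * b) by rewrite mulr_ge0 // mulr_ge0.
lra.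
Qed.

End Bounds.

(** The passage from formal to analytic objects. Values and both partial derivatives at radius sg
    are bounded by the norm at radius 2 sg, so all three sequences converge; the Lipschitz and
    Taylor bounds hold for the polynomials with a common constant and survive the limit. *)
Lemma poly_limit (sg C : R) (P : nat -> A2) : 0 < sg ->
  (forall n, norm2 (2 * sg) (P n.+1 - P n) <= C / 2 ^+ n) ->
  exists (H HX HU : R[i] -> R[i] -> R[i]) (M : R),
  [/\ forall x u, cabs x <= sg -> cabs u <= sg ->
        [/\ gcv (fun n => ev2 x u (P n)) (H x u),
            gcv (fun n => evX x u (P n)) (HX x u) &
            gcv (fun n => evU x u (P n)) (HU x u)],
      forall x u x' u', cabs x <= sg -> cabs u <= sg -> cabs x' <= sg -> cabs u' <= sg ->
        cabs (H x' u' - H x u) <= M * (cabs (x' - x) + cabs (u' - u)),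
      forall x u x' u', cabs x <= sg -> cabs u <= sg -> cabs x' <= sg -> cabs u' <= sg ->
        cabs (H x' u' - H x u - (HX x u * (x' - x) + HU x u * (u' - u))) <=
          M * (cabs (x' - x) + cabs (u' - u)) ^+ 2,
      forall x u, cabs x <= sg -> cabs u <= sg -> cabs (HU x u) <= M
    & 0 <= M].
Proof.
move=> sg0 hP; set rho := 2 * sg in hP.
have rho0 : 0 <= rho by rewrite /rho mulr_ge0 // ltW.
have an := absval_norm2 rho0.
have lim_of (L : A2 -> R[i]) K : 0 <= K -> (forall p q, L (p - q) = L p - L q) ->
    (forall p, cabs (L p) <= K * norm2 rho p) -> exists l, gcv (fun n => L (P n)) l.
  move=> K0 LB LK; apply: (@gcv_exists _ (K * C)) => n; rewrite -LB.
  by apply: le_trans (LK _) _; rewrite -mulrA ler_wpM2l.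
(* The radius bounds stand inside the existential, so that the limits form total functions; outside
   the bidisc the witness is 0. *)
have limH x u : exists l, cabs x <= sg -> cabs u <= sg -> gcv (fun n => ev2 x u (P n)) l.
  case: (leP (cabs x) sg) => hx; last by exists 0.
  case: (leP (cabs u) sg) => hu; last by exists 0.
  have [|p q|p|l hl] := @lim_of (ev2 x u) 1; rewrite ?ler01 //; last by exists l.
    by rewrite /ev2 !(hornerD, hornerN).
  by rewrite mul1r; exact: ev2_bound.
have limX x u : exists l, cabs x <= sg -> cabs u <= sg -> gcv (fun n => evX x u (P n)) l.
  case: (leP (cabs x) sg) => hx; last by exists 0.
  case: (leP (cabs u) sg) => hu; last by exists 0.
  have [|p q|p|l hl] := @lim_of (evX x u) sg^-1; rewrite ?invr_ge0 ?(ltW sg0) //; last by exists l.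
    by rewrite /evX !(hornerD, hornerN, derivD, derivN).
  exact: evX_bound.
have limU x u : exists l, cabs x <= sg -> cabs u <= sg -> gcv (fun n => evU x u (P n)) l.
  case: (leP (cabs x) sg) => hx; last by exists 0.
  case: (leP (cabs u) sg) => hu; last by exists 0.
  have [|p q|p|l hl] := @lim_of (evU x u) sg^-1; rewrite ?invr_ge0 ?(ltW sg0) //; last by exists l.
    by rewrite /evU !(hornerD, hornerN, derivD, derivN).
  exact: evU_bound.
pose H x u := projT1 (cid (limH x u)).
pose HX x u := projT1 (cid (limX x u)).
pose HU x u := projT1 (cid (limU x u)).
have C0 : 0 <= C by have := hP 0%N; rewrite expr0 divr1; apply: le_trans; exact: av_ge0.
pose B := norm2 rho (P 0%N) + 2 * C.
have hB n : norm2 rho (P n) <= B.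
  (* Telescoping: the first n increments add up to at most 2 C - 2 C / 2^n. *)
  suff : norm2 rho (P n) <= norm2 rho (P 0%N) + (2 * C - 2 * C / 2 ^+ n).
    have : 0 <= 2 * C / 2 ^+ n by rewrite divr_ge0 ?mulr_ge0.
    rewrite /B; lra.
  elim: n => [|n IH]; first by rewrite expr0 divr1 subrr addr0.
  rewrite -(subrK (P n) (P n.+1)); apply: le_trans (avD an _ _) _.
  have := hP n; move: IH.
  have -> : 2 * C / 2 ^+ n.+1 = C / 2 ^+ n.
    by rewrite exprS; field; rewrite expf_neq0 // pnatr_eq0.
  rewrite -!mulrA; lra.
have B0 : 0 <= B by apply: le_trans (hB 0%N); exact: av_ge0.
pose M := Num.max (sg^-1 * B) ((sg ^+ 2)^-1 * B).
have M1 n : sg^-1 * norm2 rho (P n) <= M.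
  apply: (@le_trans _ _ (sg^-1 * B)); last by rewrite /M le_max lexx.
  by rewrite ler_pM2l ?invr_gt0.
have M2 n : (sg ^+ 2)^-1 * norm2 rho (P n) <= M.
  apply: (@le_trans _ _ ((sg ^+ 2)^-1 * B)); last by rewrite /M le_max lexx orbT.
  by rewrite ler_pM2l ?invr_gt0 ?exprn_gt0.
have cv x u : cabs x <= sg -> cabs u <= sg ->
    [/\ gcv (fun n => ev2 x u (P n)) (H x u), gcv (fun n => evX x u (P n)) (HX x u) &
        gcv (fun n => evU x u (P n)) (HU x u)].
  by move=> hx hu; split; rewrite /H /HX /HU; case: cid => l /=; apply.
exists H, HX, HU, M; split => //.
- move=> x u x' u' hx hu hx' hu'.
  have [c1 _ _] := cv x u hx hu; have [c2 _ _] := cv x' u' hx' hu'.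
  apply: (gcv_bound (gcvB c2 c1)) => n.
  apply: le_trans (ev2_lip sg0 _ hx hu hx' hu') _.
  by rewrite ler_wpM2r ?addr_ge0 ?cabs_ge0.
- move=> x u x' u' hx hu hx' hu'.
  have [c1 c1x c1u] := cv x u hx hu; have [c2 _ _] := cv x' u' hx' hu'.
  have c := gcvB (gcvB c2 c1) (gcvD (gcvM c1x (gcv_cst (x' - x))) (gcvM c1u (gcv_cst (u' - u)))).
  apply: (gcv_bound c) => n.
  apply: le_trans (ev2_taylor sg0 _ hx hu hx' hu') _.
  by rewrite ler_wpM2r ?exprn_ge0 ?addr_ge0 ?cabs_ge0.
- move=> x u hx hu; have [_ _ c1] := cv x u hx hu.
  by apply: (gcv_bound c1) => n; apply: le_trans (evU_bound sg0 _ hx hu) _.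
- by apply: le_trans (M1 0%N); rewrite mulr_ge0 ?invr_ge0 ?(ltW sg0) //; exact: av_ge0.
Qed.

End TwoVariablePolynomials.

(** * Fixed point iteration for formal branches *)

Section Jets.
Variable R : realType.
Variables (A : comNzRingType) (io : {rmorphism R[i] -> A}) (N : R -> A -> R).
Hypothesis aN : forall rho, 0 <= rho -> absval (N rho).
Hypothesis Nio : forall rho c, 0 <= rho -> N rho (io c) <= cabs c.
Implicit Types (Q : A -> A -> A) (X V : A).

(* [q0] is the value of [Q] at the origin and [q1], [q2] its partial derivatives
   there, up to errors controlled by the radii [rho] and [r]. *)
Definition jet_with (K : R) Q (q0 q1 q2 : R[i]) : Prop :=
  forall rho r, 0 <= rho <= 1 -> 0 <= r <= 1 ->
    N rho (Q 0 0 - io q0) <= K * rho /\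
    forall X V X' V', N rho X <= r -> N rho V <= r -> N rho X' <= r -> N rho V' <= r ->
      N rho (Q X V - Q X' V' - (io q1 * (X - X') + io q2 * (V - V'))) <=
        K * ((rho + r) * (N rho (X - X') + N rho (V - V'))).

Definition jet Q q0 q1 q2 := exists2 K, 0 <= K & jet_with K Q q0 q1 q2.

Lemma jet_with_le K K' Q q0 q1 q2 : K <= K' -> jet_with K Q q0 q1 q2 ->
  jet_with K' Q q0 q1 q2.
Proof.
move=> KK h rho r hrho hr; have [h1 h2] := h rho r hrho hr.
have /andP[rho0 _] := hrho; have /andP[r0 _] := hr.
split=> [|X V X' V' hX hV hX' hV'].
  by apply: le_trans h1 _; rewrite ler_wpM2r.
apply: le_trans (h2 _ _ _ _ hX hV hX' hV') _; rewrite ler_wpM2r //.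
by rewrite mulr_ge0 ?addr_ge0 // (av_ge0 (aN rho0)).
Qed.

(** The constants hold for every K beyond a threshold, so that two functions can share one K, as in
    [jetM] and [it_cauchy]. *)
Lemma jet_bounds Q q0 q1 q2 : jet Q q0 q1 q2 -> exists K0, forall K, K0 <= K ->
  [/\ 0 <= K, jet_with K Q q0 q1 q2, cabs q0 <= K, cabs q1 <= K /\ cabs q2 <= K &
   forall rho r X V, 0 <= rho <= 1 -> 0 <= r <= 1 -> N rho X <= r -> N rho V <= r ->
     N rho (Q X V - io q0) <= K * (rho + r) /\ N rho (Q X V) <= K].
Proof.
case=> K K0 hK; pose a0 := cabs q0; pose a1 := cabs q1; pose a2 := cabs q2.
have h0 : 0 <= a0 := cabs_ge0 _; have h1 : 0 <= a1 := cabs_ge0 _.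
have h2 : 0 <= a2 := cabs_ge0 _.
pose L := 2 * K + a1 + a2; pose S := K + 2 * L.
exists (a0 + 2 * S) => K' hK'.
have KL : K <= L by rewrite /L; lra.
have KS : K <= S by rewrite /S; lra.
have LS : L <= S by rewrite /S; lra.
have lin rho r X V : 0 <= rho <= 1 -> 0 <= r <= 1 -> N rho X <= r -> N rho V <= r ->
     N rho (Q X V - io q0) <= S * (rho + r).
  move=> hrho hr hX hV; have [hh1 hh2] := hK rho r hrho hr.
  have /andP[rho0 rho1] := hrho; have /andP[r0 r1] := hr.
  have an := aN rho0.
  have z : N rho 0 <= r by rewrite av0.
  have := hh2 X V 0 0 hX hV z z; rewrite !subr0.
  set E := Q X V - Q 0 0 - _ => hE.
  have -> : Q X V - io q0 = E + (io q1 * X + io q2 * V) + (Q 0 0 - io q0) by rewrite /E; ring.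
  have nX := av_ge0 an X; have nV := av_ge0 an V.
  have e1 : N rho (io q1 * X) <= a1 * r by apply: avM_le => //; exact: Nio.
  have e2 : N rho (io q2 * V) <= a2 * r by apply: avM_le => //; exact: Nio.
  have e3 : K * ((rho + r) * (N rho X + N rho V)) <= K * (2 * (2 * r)).
    by rewrite ler_wpM2l // ler_pM ?addr_ge0 //; lra.
  apply: le_trans (avD an _ _) _; apply: le_trans (lerD (avD an _ _) hh1) _.
  have e4 := avD an (io q1 * X) (io q2 * V).
  have e5 : K * rho <= S * rho by rewrite ler_wpM2r.
  have e6 : (4 * K + a1 + a2) * r <= S * r by rewrite ler_wpM2r // /S /L; lra.
  rewrite mulrDr; lra.
split; first by rewrite /S /L in hK'; lra.
- by apply: jet_with_le hK; rewrite /S /L in hK'; lra.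
- by rewrite -/a0; rewrite /S /L in hK'; lra.
- by split; rewrite -?/a1 -?/a2; rewrite /S /L in hK'; lra.
move=> rho r X V hrho hr hX hV; have h := lin rho r X V hrho hr hX hV.
have /andP[rho0 rho1] := hrho; have /andP[r0 r1] := hr.
split.
  apply: le_trans h _; rewrite ler_wpM2r ?addr_ge0 //; rewrite /S /L in hK' *; lra.
have -> : Q X V = io q0 + (Q X V - io q0) by ring.
apply: le_trans (avD (aN rho0) _ _) _; apply: le_trans hK'; apply: lerD.
  exact: Nio.
apply: le_trans h _; rewrite mulrC ler_wpM2r //; first by rewrite /S /L; lra.
lra.
Qed.

Lemma jet_ext Q Q' q0 q1 q2 q0' q1' q2' :
  (forall X V, Q X V = Q' X V) -> q0 = q0' -> q1 = q1' -> q2 = q2' ->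
  jet Q' q0' q1' q2' -> jet Q q0 q1 q2.
Proof.
by move=> e -> -> ->; have -> : Q = Q' by apply/funext => X; apply/funext => V.
Qed.

Lemma jetD Q Q' q0 q1 q2 q0' q1' q2' : jet Q q0 q1 q2 -> jet Q' q0' q1' q2' ->
  jet (fun X V => Q X V + Q' X V) (q0 + q0') (q1 + q1') (q2 + q2').
Proof.
move=> [K K0 h] [K' K'0 h']; exists (K + K'); first exact: addr_ge0.
move=> rho r hrho hr; have [h1 h2] := h rho r hrho hr; have [h1' h2'] := h' rho r hrho hr.
have /andP[rho0 _] := hrho; have an := aN rho0; rewrite !rmorphD.
split=> [|X V X' V' hX hV hX' hV'].
  have -> : Q 0 0 + Q' 0 0 - (io q0 + io q0') = (Q 0 0 - io q0) + (Q' 0 0 - io q0') by ring.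
  by rewrite mulrDl; exact: avD_le.
rewrite mulrDl; have := avD_le an (h2 _ _ _ _ hX hV hX' hV') (h2' _ _ _ _ hX hV hX' hV').
by congr (N rho _ <= _); ring.
Qed.

Lemma jet_cst c : jet (fun _ _ => io c) c 0 0.
Proof.
exists 0 => // rho r /andP[rho0 _] _; have an := aN rho0.
split=> [|X V X' V' _ _ _ _]; first by rewrite subrr av0 // mul0r.
by rewrite !rmorph0 subrr !mul0r addr0 subr0 av0.
Qed.

Lemma jet_fst : jet (fun X _ => X) 0 1 0.
Proof.
exists 0 => // rho r /andP[rho0 _] _; have an := aN rho0.
rewrite rmorph0 rmorph1 subrr; split=> [|X V X' V' _ _ _ _]; first by rewrite av0 // mul0r.
by rewrite mul1r mul0r addr0 subrr av0 // mul0r.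
Qed.

Lemma jet_snd : jet (fun _ V => V) 0 0 1.
Proof.
exists 0 => // rho r /andP[rho0 _] _; have an := aN rho0.
rewrite rmorph0 rmorph1 subrr; split=> [|X V X' V' _ _ _ _]; first by rewrite av0 // mul0r.
by rewrite mul1r mul0r add0r subrr av0 // mul0r.
Qed.

(** A variable of the ring is a constant function of X and V whose value counts as 0, because an
    error of size K rho is allowed at the origin. *)
Lemma jet_small (y : A) : (forall rho, 0 <= rho -> N rho y <= rho) -> jet (fun _ _ => y) 0 0 0.
Proof.
move=> hy; exists 1 => // rho r /andP[rho0 _] /andP[r0 _]; have an := aN rho0.
rewrite rmorph0 subr0 mul1r; split=> [|X V X' V' _ _ _ _]; first exact: hy.
by rewrite subrr !mul0r addr0 subr0 av0 // mul1r mulr_ge0 ?addr_ge0 // av_ge0.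
Qed.

Lemma jetM Q Q' q0 q1 q2 q0' q1' q2' : jet Q q0 q1 q2 -> jet Q' q0' q1' q2' ->
  jet (fun X V => Q X V * Q' X V) (q0 * q0') (q1 * q0' + q0 * q1') (q2 * q0' + q0 * q2').
Proof.
move=> /jet_bounds[Ka ha] /jet_bounds[Kb hb]; pose K := Num.max Ka Kb.
have KA : Ka <= K by rewrite le_max lexx.
have KB : Kb <= K by rewrite le_max lexx orbT.
have [K0 h a0 [a1 a2] hq] := ha K KA; have [_ h' b0 [b1 b2] hq'] := hb K KB.
exists (4 * K ^+ 2); first by rewrite mulr_ge0 // sqr_ge0.
move=> rho r hrho hr; have [h1 h2] := h rho r hrho hr; have [h1' h2'] := h' rho r hrho hr.
have /andP[rho0 _] := hrho; have /andP[r0 _] := hr; have an := aN rho0.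
rewrite !rmorphD !rmorphM; split=> [|X V X' V' hX hV hX' hV'].
  have z : N rho 0 <= r by rewrite av0.
  have [_ c1] := hq' rho r 0 0 hrho hr z z.
  have -> : Q 0 0 * Q' 0 0 - io q0 * io q0' =
    (Q 0 0 - io q0) * Q' 0 0 + io q0 * (Q' 0 0 - io q0') by ring.
  have e1 := avM_le an h1 c1.
  have e2 := avM_le an (le_trans (Nio _ rho0) a0) h1'.
  have e3 : 0 <= K ^+ 2 * rho by rewrite mulr_ge0 // sqr_ge0.
  apply: le_trans (avD_le an e1 e2) _; lra.
have [c1 c2] := hq rho r X' V' hrho hr hX' hV'.
have [c1' c2'] := hq' rho r X V hrho hr hX hV.
have e := h2 _ _ _ _ hX hV hX' hV'; have e' := h2' _ _ _ _ hX hV hX' hV'.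
set D := N rho (X - X') + N rho (V - V') in e e' *.
set E := Q X V - Q X' V' - _ in e; set E' := Q' X V - Q' X' V' - _ in e'.
set l := io q1 * (X - X') + io q2 * (V - V') in E e.
set l' := io q1' * (X - X') + io q2' * (V - V') in E' e'.
have Ml : N rho l <= K * D.
  by rewrite mulrDr; apply: avD_le => //; apply: avM_le => //; apply: le_trans (Nio _ rho0) _.
have Ml' : N rho l' <= K * D.
  by rewrite mulrDr; apply: avD_le => //; apply: avM_le => //; apply: le_trans (Nio _ rho0) _.
(* A Leibniz decomposition: each summand contains a remainder [E] or [E'], or the product of a
   linear increment and a deviation from [q0] or [q0'], which is at most K (rho + r). *)
have -> : Q X V * Q' X V - Q X' V' * Q' X' V' -
   ((io q1 * io q0' + io q0 * io q1') * (X - X') + (io q2 * io q0' + io q0 * io q2') * (V - V')) =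
   (E * Q' X V + l * (Q' X V - io q0')) + (Q X' V' * E' + (Q X' V' - io q0) * l').
  by rewrite /E /E' /l /l'; ring.
apply: le_trans (avD_le an (avD_le an (avM_le an e c2') (avM_le an Ml c1'))
  (avD_le an (avM_le an c2 e') (avM_le an c1 Ml'))) _.
lra.
Qed.

Lemma jetZ c Q q0 q1 q2 : jet Q q0 q1 q2 ->
  jet (fun X V => io c * Q X V) (c * q0) (c * q1) (c * q2).
Proof.
move=> h; apply: jet_ext (jetM (jet_cst c) h) => //; by rewrite mul0r add0r.
Qed.

Lemma jetX Q q0 q1 q2 n : jet Q q0 q1 q2 ->
  jet (fun X V => Q X V ^+ n) (q0 ^+ n) (q0 ^+ n.-1 *+ n * q1) (q0 ^+ n.-1 *+ n * q2).
Proof.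
move=> h; elim: n => [|n IH].
  apply: jet_ext (jet_cst 1) => [X V|||]; rewrite ?expr0 ?rmorph1 //; by rewrite mulr0n mul0r.
apply: jet_ext (jetM h IH) => [X V|||]; rewrite ?exprS //.
  case: n {IH} => [|n]; first by rewrite /= !expr0 mulr0n mulr1n; ring.
  by rewrite /= exprS -!(mulr_natr (q0 ^+ n)) -!(mulr_natr (q0 * q0 ^+ n)) -[n.+2%:R]natr1; ring.
case: n {IH} => [|n]; first by rewrite /= !expr0 mulr0n mulr1n; ring.
by rewrite /= exprS -!(mulr_natr (q0 ^+ n)) -!(mulr_natr (q0 * q0 ^+ n)) -[n.+2%:R]natr1; ring.
Qed.

Lemma jet_sum (T : Type) (s : seq T) (Q : T -> A -> A -> A) (q0 q1 q2 : T -> R[i]) :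
  (forall t, jet (Q t) (q0 t) (q1 t) (q2 t)) ->
  jet (fun X V => \sum_(t <- s) Q t X V) (\sum_(t <- s) q0 t) (\sum_(t <- s) q1 t)
    (\sum_(t <- s) q2 t).
Proof.
move=> h; elim: s => [|t s IH].
  apply: jet_ext (jet_cst 0) => [X V|||]; by rewrite big_nil ?rmorph0.
by apply: jet_ext (jetD (h t) IH) => [X V|||]; rewrite big_cons.
Qed.

End Jets.

(** * Quasi-homogeneous sums and Euler's relation *)

Section WeightedSums.
Variable R : realType.
(* A term [b z^l w^m] is encoded as [(b, (l, m))]. *)
Notation term := (R[i] * (nat * nat))%type.
Variables (s : seq term) (c al be : nat).

Definition wgt (t : term) : nat := (c - (al * t.2.1 + be * t.2.2))%N.

(** This shape is preserved by partial derivatives and by ring morphisms, so a single jet, limit and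
    derivation rule covers [qhom] and all its derivatives, over polynomials as well as over
    [R[i]]. *)
Definition msum (A : comNzRingType) (io : R[i] -> A) (v : term -> R[i])
    (k i j : term -> nat) (u Z W : A) : A :=
  \sum_(t <- s) io (v t) * u ^+ k t * Z ^+ i t * W ^+ j t.

Section Ring.
Variables (A : comNzRingType) (io : R[i] -> A).

(* [qhom u Z W x = u^c (g (u^-al Z, u^-be W) - x)], where [g] is the sum of the
   terms in [s]. *)
Definition qhom (u Z W x : A) : A :=
  msum io (fun t => t.1) wgt (fun t => t.2.1) (fun t => t.2.2) u Z W - x * u ^+ c.

Definition qhomZ (u Z W : A) : A :=
  msum io (fun t => t.1 * t.2.1%:R) wgt (fun t => t.2.1.-1) (fun t => t.2.2) u Z W.

Definition qhomW (u Z W : A) : A :=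
  msum io (fun t => t.1 * t.2.2%:R) wgt (fun t => t.2.1) (fun t => t.2.2.-1) u Z W.

Definition qhomWZ (u Z W : A) : A :=
  msum io (fun t => t.1 * t.2.2%:R * t.2.1%:R) wgt (fun t => t.2.1.-1) (fun t => t.2.2.-1) u Z W.

Definition qhomWW (u Z W : A) : A :=
  msum io (fun t => t.1 * t.2.2%:R * t.2.2.-1%:R) wgt (fun t => t.2.1) (fun t => t.2.2.-2) u Z W.

End Ring.

Lemma msum_morph (A B : comNzRingType) (io : R[i] -> A) (io' : R[i] -> B)
    (phi : {rmorphism A -> B}) v k i j u Z W : (forall b, phi (io b) = io' b) ->
  phi (msum io v k i j u Z W) = msum io' v k i j (phi u) (phi Z) (phi W).
Proof.
move=> h; rewrite /msum rmorph_sum; apply: eq_bigr => t _.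
by rewrite !rmorphM !rmorphXn h.
Qed.

Lemma qhom_morph (A B : comNzRingType) (io : R[i] -> A) (io' : R[i] -> B)
    (phi : {rmorphism A -> B}) u Z W x : (forall b, phi (io b) = io' b) ->
  phi (qhom io u Z W x) = qhom io' (phi u) (phi Z) (phi W) (phi x).
Proof. by move=> h; rewrite /qhom rmorphB rmorphM rmorphXn (msum_morph _ _ _ _ _ _ _ h). Qed.

Hypothesis hc : {in s, forall t : term, (al * t.2.1 + be * t.2.2 <= c)%N}.

Let wgtE t : t \in s -> (wgt t)%:R + al%:R * t.2.1%:R + be%:R * t.2.2%:R = c%:R :> R[i].
Proof.
move=> /hc h; rewrite /wgt natrB // natrD !natrM; ring.
Qed.

(** The truncated predecessor at exponent 0 is harmless, because the factor n vanishes there. *)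
Let pow_pred (y : R[i]) n : y * y ^+ n.-1 * n%:R = y ^+ n * n%:R.
Proof. by case: n => [|n]; rewrite ?mulr0 //= -exprS. Qed.

(** At u = 0 only the terms of weight 0, those on the side, survive, and F_W restricted to them is
    quasi-homogeneous of degree c - be. *)
Lemma qhomW_euler (Z W : R[i]) :
  al%:R * Z * qhomWZ id 0 Z W + be%:R * W * qhomWW id 0 Z W =
  (c%:R - be%:R) * qhomW id 0 Z W.
Proof.
rewrite /qhomWZ /qhomWW /qhomW /msum !mulr_sumr -big_split /=.
rewrite [LHS]big_seq [RHS]big_seq; apply: eq_bigr => t ts.
have := wgtE ts; case: (wgt t) => [|k] ht; last by rewrite expr0n /= !(mulr0, mul0r) addr0.
rewrite -ht; case: t.2 {ht} => l m; rewrite [(l, m).1]/= [(l, m).2]/=.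
have e1 := pow_pred Z l; have e2 := pow_pred W m.-1.
have e3 : m%:R * m.-1%:R = m%:R * (m%:R - 1) :> R[i].
  by case: m {e2} => [|m]; rewrite ?mul0r //= -[m.+1%:R]natr1 addrK.
move: e1 e2 e3; rewrite expr0 mulr1 add0r.
move: (Z ^+ l.-1) (Z ^+ l) (W ^+ m.-2) (W ^+ m.-1) (l%:R) (m%:R) (m.-1%:R) (al%:R) (be%:R) t.1.
move=> z1 z w2 w1 L M M1 a b y e1 e2 e3; apply/eqP; rewrite -subr_eq0.
rewrite (_ : _ - _ = a * y * M * w1 * (Z * z1 * L - z * L) +
   b * y * M * z * (W * w2 * M1 - w1 * M1) + b * y * z * w1 * (M * M1 - M * (M - 1))); last ring.
by rewrite e1 e2 e3 !subrr !mulr0 !addr0.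
Qed.

(** [Fu] is the partial derivative of [qhom] in u. Every monomial u^k Z^l W^m has k + al l + be m =
    c by the choice of [wgt], and x u^c has the same degree. *)
Lemma qhom_euler (u Z W x Fu : R[i]) :
  Fu = msum id (fun t => t.1 * (wgt t)%:R) (fun t => (wgt t).-1) (fun t => t.2.1) (fun t => t.2.2) u Z W
       - x * (u ^+ c.-1 * c%:R) ->
  u * Fu + al%:R * Z * qhomZ id u Z W + be%:R * W * qhomW id u Z W = c%:R * qhom id u Z W x.
Proof.
move=> ->; rewrite /qhom !mulrBr [LHS](_ : _ = u * msum id (fun t => t.1 * (wgt t)%:R)
  (fun t => (wgt t).-1) (fun t => t.2.1) (fun t => t.2.2) u Z W + al%:R * Z * qhomZ id u Z W +
  be%:R * W * qhomW id u Z W - x * (u * (u ^+ c.-1 * c%:R))); last by ring.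
congr (_ - _); last first.
  by have := pow_pred u c; rewrite -mulrA => ->; ring.
rewrite /qhomZ /qhomW /msum !mulr_sumr -!big_split /=.
rewrite [LHS]big_seq [RHS]big_seq; apply: eq_bigr => t ts.
have := wgtE ts; move: (wgt t) => k <-; case: t.2 => l m; rewrite [(l, m).1]/= [(l, m).2]/=.
have e0 := pow_pred u k; have e1 := pow_pred Z l; have e2 := pow_pred W m.
move: e0 e1 e2.
move: (u ^+ k.-1) (u ^+ k) (Z ^+ l.-1) (Z ^+ l) (W ^+ m.-1) (W ^+ m) (k%:R) (l%:R) (m%:R) (al%:R) (be%:R) t.1.
move=> u1 uk z1 z w1 w K L M a b y e0 e1 e2; apply/eqP; rewrite -subr_eq0.
rewrite (_ : _ - _ = y * z * w * (u * u1 * K - uk * K) + a * y * uk * w * (Z * z1 * L - z * L) +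
   b * y * uk * z * (W * w1 * M - w * M)); last ring.
by rewrite e0 e1 e2 !subrr !mulr0 !addr0.
Qed.

End WeightedSums.

(** * The iteration and its contraction estimate *)

Section Iteration.
Variable R : realType.
Notation A2 := {poly {poly R[i]}}.
Notation term := (R[i] * (nat * nat))%type.

Definition io2 : R[i] -> A2 := polyC \o polyC.
HB.instance Definition _ := GRing.RMorphism.on io2.

Notation U := ('X : A2).
Notation X1 := (('X : {poly R[i]})%:P : A2).

Lemma norm2_io rho b : 0 <= rho -> norm2 rho (io2 b) <= cabs b.
Proof.
move=> h; rewrite /norm2 /io2 /= (pnormC (absval_pnorm1 h)) pnormC //.
exact: absval_cabs.
Qed.

Lemma norm2_U rho : 0 <= rho -> norm2 rho U <= rho.
Proof. by move=> h; apply: pnormX => //; exact: absval_pnorm1. Qed.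

Lemma norm2_X1 rho : 0 <= rho -> norm2 rho X1 <= rho.
Proof.
move=> h; rewrite /norm2 (pnormC (absval_pnorm1 h)); apply: pnormX => //.
exact: absval_cabs.
Qed.

(* The inverse of [u d/du + h] on series without constant term in [u], with
   the coefficients of small [k + h] cut off. *)
Definition Lop (h : R[i]) (P : A2) : A2 :=
  \poly_(k < size P) (if (k == 0%N) || (cabs (k%:R + h) < 1) then 0
                      else (k%:R + h)^-1 *: P`_k).

Lemma coef_Lop h P k : (Lop h P)`_k =
  if (k == 0%N) || (cabs (k%:R + h) < 1) then 0 else (k%:R + h)^-1 *: P`_k.
Proof.
rewrite /Lop coef_poly; case: ltnP => // hk.
by rewrite (nth_default _ hk) scaler0 if_same.
Qed.

Lemma Lop0 h : Lop h 0 = 0.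
Proof. by apply/polyP => k; rewrite coef_Lop coef0 scaler0 if_same. Qed.

Lemma LopB h P Q : Lop h (P - Q) = Lop h P - Lop h Q.
Proof.
apply/polyP => k; rewrite coefB !coef_Lop coefB.
by case: ifP => _; rewrite ?subr0 // scalerBr.
Qed.

Lemma pnorm_scale rho (b : R[i]) (q : {poly R[i]}) : 0 <= rho ->
  pnorm (@Normc.normc R) rho (b *: q) <= cabs b * pnorm (@Normc.normc R) rho q.
Proof.
move=> h; rewrite -mul_polyC; apply: le_trans (avM (absval_pnorm1 h) _ _) _.
by rewrite pnormC //; exact: absval_cabs.
Qed.

Lemma norm2_Lop rho h P : 0 <= rho -> norm2 rho (Lop h P) <= norm2 rho P.
Proof.
move=> r0; have a1 := absval_pnorm1 r0.
rewrite /norm2 (@pnormE _ _ _ a1 rho (Lop h P) (size P)); last exact: size_poly.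
apply: ler_sum => k _; rewrite ler_wpM2r ?exprn_ge0 // coef_Lop.
case: ifP => [_|]; first by rewrite av0 // (av_ge0 a1).
move/negbT; rewrite negb_or -leNgt => /andP[_ hk].
apply: le_trans (pnorm_scale _ _ r0) _; rewrite ler_piMl ?(av_ge0 a1) // cabsV.
by rewrite invf_le1 // (lt_le_trans _ hk).
Qed.

Lemma Lop_ode (n : nat) (P : A2) : P`_0 = 0 ->
  U * (Lop n%:R P)^`() + io2 n%:R * Lop n%:R P = P.
Proof.
move=> P0; apply/polyP => k; rewrite coefD /io2 /= coefCM coefXM.
case: k => [|k] /=; first by rewrite coef_Lop /= mulr0 addr0 P0.
rewrite coef_deriv coef_Lop /= -natrD cabs_nat -[1]/(1%:R) ltr_nat ltnNge.
rewrite (_ : (0 < k.+1 + n)%N) /=; last by rewrite addSn.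
rewrite mul_polyC scalerA scalerMnl -scalerDl -mulr_natl -mulrDl -natrD.
by rewrite divff ?scale1r // pnatr_eq0 addSn.
Qed.

Variables (s : seq term) (c al be : nat) (Z0 W0 kap : R[i]).
Hypothesis hc : {in s, forall t : term, (al * t.2.1 + be * t.2.2 <= c)%N}.
Hypotheses (c0 : (0 < c)%N) (al0 : (0 < al)%N) (Z00 : Z0 != 0) (kap0 : kap != 0).
Let a := qhomZ s c al be id 0 Z0 W0.
Let b := qhomW s c al be id 0 Z0 W0.
Let bW := qhomWW s c al be id 0 Z0 W0.
Let bZ := qhomWZ s c al be id 0 Z0 W0.
(** The system at u = 0, where u Z_u and u W_u vanish. *)
Hypotheses (hF : qhom s c al be id 0 Z0 W0 0 = 0)
  (hZ : al%:R * Z0 = kap * b) (hW : be%:R * W0 = - (kap * a)).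
Hypothesis hcase : (al + be <= c)%N \/
  [/\ al = 1%N, be = c & {in s, forall t : term, t.2.2 = 0%N \/ t.2 = (0, 1)%N}].

Let h : R[i] := c%:R - al%:R - be%:R.
Let mu := kap * bW / b.

(** The unknowns are X = Z - Z0 and V = a X + b (W - W0), the linear part of F at the base point. In
    these coordinates F has gradient (0, 1), so V - F is a Newton step. *)
Definition itZ (X V : A2) : A2 := io2 Z0 + X.
Definition itW (X V : A2) : A2 := io2 W0 + io2 b^-1 * (V - io2 a * X).
Definition itF (X V : A2) : A2 := qhom s c al be io2 U (itZ X V) (itW X V) X1.
(** The right-hand side of u X_u + h X = S. By Euler's relation [h] removes its linear part in X,
    and [mu] removes the one in V; the added multiple of F vanishes at a fixed point, where F =
    0. *)
Definition itS (X V : A2) : A2 :=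
  io2 al%:R * itZ X V - io2 kap * qhomW s c al be io2 U (itZ X V) (itW X V)
  + io2 h * X + io2 mu * itF X V.
Definition itT (X V : A2) : A2 := V - itF X V.
Fixpoint it n : A2 * A2 :=
  if n is m.+1 then (Lop h (itS (it m).1 (it m).2), itT (it m).1 (it m).2) else (0, 0).

Let b0 : b != 0.
Proof.
have : al%:R * Z0 != 0 by rewrite mulf_neq0 // pnatr_eq0 -lt0n.
by rewrite hZ mulf_eq0 negb_or => /andP[].
Qed.

Let aN := absval_norm2 (R := R).
Let Nio := norm2_io.
Notation jet2 := (@jet R A2 io2 (@norm2 R)).

Let jet_u k : jet2 (fun _ _ => U ^+ k) (0 ^+ k) 0 0.
Proof.
have := jetX aN Nio k (jet_small io2 aN norm2_U).
by apply: jet_ext => //; rewrite mulr0.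
Qed.

Let jetZc : jet2 itZ Z0 1 0.
Proof.
by apply: jet_ext (jetD aN (jet_cst io2 aN Z0) (jet_fst io2 aN)) => //; rewrite ?addr0 ?add0r.
Qed.

Let jetWc : jet2 itW W0 (- a / b) b^-1.
Proof.
have j1 := jetZ aN Nio (- a) (jet_fst io2 aN).
have j2 := jetZ aN Nio b^-1 (jetD aN (jet_snd io2 aN) j1).
apply: jet_ext (jetD aN (jet_cst io2 aN W0) j2) => [X V|||].
- by rewrite /itW rmorphN mulNr.
- by rewrite mulr0 !addr0 mulr0 addr0.
- by rewrite add0r mulr1 add0r mulrC.
- by rewrite mulr0 addr0 mulr1 add0r.
Qed.

Let jet_msum v k i j : jet2
  (fun X V => msum s io2 v k i j U (itZ X V) (itW X V))
  (msum s id v k i j 0 Z0 W0)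
  (msum s id (fun t => v t * (i t)%:R) k (fun t => (i t).-1) j 0 Z0 W0
    - a / b * msum s id (fun t => v t * (j t)%:R) k i (fun t => (j t).-1) 0 Z0 W0)
  (b^-1 * msum s id (fun t => v t * (j t)%:R) k i (fun t => (j t).-1) 0 Z0 W0).
Proof.
have J (t : term) := jetM aN Nio (jetM aN Nio (jetZ aN Nio (v t) (jet_u (k t)))
   (jetX aN Nio (i t) jetZc)) (jetX aN Nio (j t) jetWc).
apply: jet_ext (jet_sum aN s J) => [X V|||] //; rewrite /msum.
  rewrite !mulr_sumr -sumrB; apply: eq_bigr => t _.
  by rewrite -(mulr_natr _ (i t)) -(mulr_natr _ (j t)); ring.
rewrite !mulr_sumr; apply: eq_bigr => t _.
by rewrite -(mulr_natr _ (i t)) -(mulr_natr _ (j t)); ring.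
Qed.

Let jetF : jet2 itF 0 0 1.
Proof.
have jx : jet2 (fun _ _ => io2 (-1) * (X1 * U ^+ c)) 0 0 0.
  have := jetZ aN Nio (-1) (jetM aN Nio (jet_small io2 aN norm2_X1) (jet_u c)).
  by apply: jet_ext => //; rewrite ?(mul0r, mulr0, addr0).
have := jetD aN (jet_msum (fun t => t.1) (wgt c al be) (fun t => t.2.1) (fun t => t.2.2)) jx.
apply: jet_ext => [X V|||].
- by rewrite /itF /qhom rmorphN1 mulN1r.
- by rewrite addr0 -[LHS]hF /qhom mul0r subr0.
- rewrite addr0; rewrite -/(qhomZ s c al be id 0 Z0 W0) -/(qhomW s c al be id 0 Z0 W0).
  by rewrite -/a -/b divfK // subrr.
- by rewrite addr0 -/(qhomW s c al be id 0 Z0 W0) -/b mulVf.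
Qed.

Let jetT : jet2 itT 0 0 0.
Proof.
have := jetD aN (jet_snd io2 aN) (jetZ aN Nio (-1) jetF).
by apply: jet_ext => [X V|||]; rewrite ?rmorphN1 ?mulN1r ?mulr0 ?mulr1 ?addr0 ?subrr.
Qed.

Let jetS : jet2 itS 0 0 0.
Proof.
have jW := jet_msum (fun t => t.1 * t.2.2%:R) (wgt c al be) (fun t => t.2.1) (fun t => t.2.2.-1).
have := jetD aN (jetD aN (jetD aN (jetZ aN Nio al%:R jetZc) (jetZ aN Nio (- kap) jW))
  (jetZ aN Nio h (jet_fst io2 aN))) (jetZ aN Nio mu jetF).
apply: jet_ext => [X V|||].
- by rewrite /itS rmorphN mulNr.
- by rewrite -/(qhomW s c al be id 0 Z0 W0) -/b hZ; ring.
- rewrite -/(qhomWZ s c al be id 0 Z0 W0) -/(qhomWW s c al be id 0 Z0 W0) -/bZ -/bW.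
  have e := qhomW_euler hc Z0 W0; rewrite -/bZ -/bW -/b in e.
  have a0 : al%:R * Z0 != 0 by rewrite hZ mulf_neq0.
  (* The X-derivative is (al + h) - kap (bZ - a bW / b). Multiplied by al Z0 = kap b, and with be W0
     = - kap a, the bracket becomes the left side of Euler's relation for F_W, of degree c - be = al
     + h. *)
  apply/esym; apply: (mulIf a0); rewrite mul0r.
  rewrite [LHS](_ : _ = (al%:R + h) * (al%:R * Z0) - kap * (al%:R * Z0 * bZ - a * (al%:R * Z0) / b * bW)).
    rewrite [X in a * X](hZ) [a * (kap * b) / b](_ : _ = - (be%:R * W0)); last by rewrite hW; field.
    rewrite mulNr opprK e /h hZ; ring.
  by rewrite mulr1 mulr0 addr0; ring.
- rewrite -/(qhomWW s c al be id 0 Z0 W0) -/bW mulr0 mulr0 mulr1 /mu; ring.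
Qed.

Lemma it_cauchy : exists rho C, [/\ 0 < rho, 0 <= C &
  forall n, norm2 rho ((it n.+1).1 - (it n).1) <= C / 2 ^+ n /\
            norm2 rho ((it n.+1).2 - (it n).2) <= C / 2 ^+ n].
Proof.
have [K1 hK1] := jet_bounds aN Nio jetS; have [K2 hK2] := jet_bounds aN Nio jetT.
pose K := Num.max K1 (Num.max K2 1).
have KS : K1 <= K by rewrite le_max lexx.
have KT : K2 <= K by rewrite !le_max lexx orbT.
have K1' : 1 <= K by rewrite !le_max lexx !orbT.
have [_ jS _ _ _] := hK1 K KS; have [_ jT _ _ _] := hK2 K KT.
have K0 : 0 < K by lra.
(* K (rho + r) <= 1/4 makes each component 1/4-Lipschitz in the sum of both norms, so the pair
   contracts by 1/2. K rho = r / 4 makes the first step at most r / 2, and the iterates stay in the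
   ball of radius r. *)
pose r := (8 * K)^-1; pose rho := r / (4 * K).
have r0 : 0 < r by rewrite invr_gt0 mulr_gt0.
have rho0 : 0 < rho by rewrite divr_gt0 // mulr_gt0.
have Kr : K * r = 8^-1 by rewrite /r; field; lra.
have r8 : r <= 8^-1 by rewrite -Kr ler_peMl // ltW.
have r1 : r <= 1 by lra.
have Krho : K * rho = r / 4 by rewrite /rho; field; lra.
have rhor : rho <= r.
  by rewrite /rho ler_pdivrMr ?mulr_gt0 // ler_peMr ?(ltW r0) //; lra.
have Hrho : 0 <= rho <= 1 by rewrite ltW //= (le_trans rhor).
have Hr : 0 <= r <= 1 by rewrite ltW.
have an := aN (ltW rho0).
have [S0 S1] := jS rho r Hrho Hr; have [T0 T1] := jT rho r Hrho Hr.
rewrite rmorph0 subr0 in S0; rewrite rmorph0 subr0 in T0.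
have lip Q : (forall X V X' V', norm2 rho X <= r -> norm2 rho V <= r ->
      norm2 rho X' <= r -> norm2 rho V' <= r ->
      norm2 rho (Q X V - Q X' V' - (io2 0 * (X - X') + io2 0 * (V - V'))) <=
      K * ((rho + r) * (norm2 rho (X - X') + norm2 rho (V - V')))) ->
    forall X V X' V', norm2 rho X <= r -> norm2 rho V <= r ->
      norm2 rho X' <= r -> norm2 rho V' <= r ->
      norm2 rho (Q X V - Q X' V') <= 4^-1 * (norm2 rho (X - X') + norm2 rho (V - V')).
  move=> hQ X V X' V' a1 a2 a3 a4; have := hQ X V X' V' a1 a2 a3 a4.
  rewrite rmorph0 !mul0r addr0 subr0 => /le_trans; apply.
  rewrite mulrA ler_wpM2r ?addr_ge0 ?(av_ge0 an) // mulrDr Krho Kr; lra.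
have {}S1 := lip _ S1; have {}T1 := lip _ T1.
pose d n := norm2 rho ((it n.+1).1 - (it n).1) + norm2 rho ((it n.+1).2 - (it n).2).
suff main n : [/\ norm2 rho (it n).1 <= r * (1 - (2 ^+ n)^-1),
     norm2 rho (it n).2 <= r * (1 - (2 ^+ n)^-1) & d n <= r / 2 / 2 ^+ n].
  exists rho, (r / 2); split=> // [|n]; first by rewrite divr_ge0 ?ltW.
  have [_ _ hd] := main n; have n1 := av_ge0 an ((it n.+1).1 - (it n).1).
  have n2 := av_ge0 an ((it n.+1).2 - (it n).2); rewrite /d in hd.
  split; lra.
elim: n => [|n [IH1 IH2 IHd]].
  rewrite expr0 invr1 subrr mulr0 /= !av0 ?lexx //; split=> //.
  rewrite /d /= !subr0 mulr1.
  have e : norm2 rho (Lop h (itS 0 0)) <= r / 4.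
    by apply: le_trans (norm2_Lop _ _ (ltW rho0)) _; rewrite -Krho.
  move: T0 e; rewrite Krho; lra.
have n1 := av_ge0 an ((it n.+1).1 - (it n).1).
have n2 := av_ge0 an ((it n.+1).2 - (it n).2).
have e2 : (2 ^+ n.+1)^-1 = (2 ^+ n)^-1 / 2 :> R by rewrite exprS invfM mulrC.
have p0 : 0 < (2 ^+ n)^-1 :> R by rewrite invr_gt0 exprn_gt0.
have step (y y' : A2) : norm2 rho y <= r * (1 - (2 ^+ n)^-1) ->
    norm2 rho (y' - y) <= r / 2 / 2 ^+ n -> norm2 rho y' <= r * (1 - (2 ^+ n.+1)^-1).
  move=> h1 h2; have -> : y' = y + (y' - y) by ring.
  apply: le_trans (avD an _ _) _; move: h1 h2; rewrite e2; lra.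
have I1 : norm2 rho (it n.+1).1 <= r * (1 - (2 ^+ n.+1)^-1).
  by apply: step IH1 _; rewrite /d in IHd; lra.
have I2 : norm2 rho (it n.+1).2 <= r * (1 - (2 ^+ n.+1)^-1).
  by apply: step IH2 _; rewrite /d in IHd; lra.
split=> //.
have le_r k (y : R) : y <= r * (1 - (2 ^+ k)^-1) -> y <= r.
  move/le_trans; apply; rewrite ler_piMr ?(ltW r0) // gerBl invr_ge0 exprn_ge0 //.
have b1 := S1 _ _ _ _ (le_r _ _ I1) (le_r _ _ I2) (le_r _ _ IH1) (le_r _ _ IH2).
have b2 := T1 _ _ _ _ (le_r _ _ I1) (le_r _ _ I2) (le_r _ _ IH1) (le_r _ _ IH2).
have b3 : norm2 rho ((it n.+2).1 - (it n.+1).1) <=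
    4^-1 * (norm2 rho ((it n.+1).1 - (it n).1) + norm2 rho ((it n.+1).2 - (it n).2)).
  have -> : (it n.+2).1 - (it n.+1).1 =
    Lop h (itS (it n.+1).1 (it n.+1).2 - itS (it n).1 (it n).2) by rewrite LopB.
  by apply: le_trans (norm2_Lop _ _ (ltW rho0)) _; exact: b1.
rewrite /d in IHd *; rewrite e2.
have b4 : norm2 rho ((it n.+2).2 - (it n.+1).2) <=
    4^-1 * (norm2 rho ((it n.+1).1 - (it n).1) + norm2 rho ((it n.+1).2 - (it n).2)) := b2.
move: b3 b4; lra.
Qed.

End Iteration.

(** * Parametrized branches at infinity *)

Section Derivations.
Variable R : realType.
Notation A2 := {poly {poly R[i]}}.
Notation term := (R[i] * (nat * nat))%type.

HB.instance Definition _ (x u : R[i]) := GRing.RMorphism.copy (ev2 x u)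
  (horner_eval x \o horner_eval u%:P : A2 -> R[i]).

Lemma ev2_io x u (b : R[i]) : ev2 x u (io2 b) = b.
Proof. by rewrite /ev2 /io2 /= !hornerC. Qed.

Lemma ev2_U x u : ev2 x u ('X : A2) = u :> R[i].
Proof. by rewrite /ev2 hornerX hornerC. Qed.

Lemma ev2_X1 x u : ev2 x u (('X : {poly R[i]})%:P : A2) = x :> R[i].
Proof. by rewrite /ev2 hornerC hornerX. Qed.

(** A derivation along an evaluation. Both partial derivatives are instances, so the level equation
    is differentiated only once. *)
Record derivation_at (phi : {rmorphism A2 -> R[i]}) (D : A2 -> R[i]) : Prop := DerivationAt {
  derD : forall P Q, D (P + Q) = D P + D Q;
  derM : forall P Q, D (P * Q) = D P * phi Q + phi P * D Q;
  derC : forall b, D (io2 b) = 0 }.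

Lemma evX_der x u : derivation_at (ev2 x u) (evX x u).
Proof.
split=> [P Q|P Q|b]; rewrite /evX.
- by rewrite hornerD derivD hornerD.
- by rewrite hornerM derivM hornerD !hornerM.
- by rewrite /io2 /= hornerC derivC hornerC.
Qed.

Lemma evU_der x u : derivation_at (ev2 x u) (evU x u).
Proof.
split=> [P Q|P Q|b]; rewrite /evU.
- by rewrite derivD !hornerD.
- by rewrite derivM hornerD !hornerM hornerD !hornerM.
- by rewrite /io2 /= derivC !horner0.
Qed.

Section Rules.
Variables (phi : {rmorphism A2 -> R[i]}) (D : A2 -> R[i]) (dD : derivation_at phi D).
Hypothesis phiC : forall b, phi (io2 b) = b.

Lemma der0 : D 0 = 0.
Proof. by have := derC dD 0; rewrite rmorph0. Qed.

Lemma derX P n : D (P ^+ n) = phi P ^+ n.-1 * n%:R * D P.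
Proof.
elim: n => [|n IH]; first by rewrite expr0 mulr0 mul0r -(rmorph1 (@io2 R)) (derC dD).
rewrite exprS (derM dD) IH rmorphXn /=; case: n {IH} => [|n] /=.
  by rewrite !expr0; ring.
by rewrite exprS -[n.+2%:R]natr1; ring.
Qed.

Lemma derB P Q : D (P - Q) = D P - D Q.
Proof. by have := derD dD (P - Q) Q; rewrite subrK => ->; rewrite addrK. Qed.

Lemma derZ b P : D (io2 b * P) = b * D P.
Proof. by rewrite (derM dD) (derC dD) mul0r add0r phiC. Qed.

Lemma der_msum (s : seq term) v k i j P Z W :
  D (msum s (@io2 R) v k i j P Z W) =
    msum s id (fun t => v t * (k t)%:R) (fun t => (k t).-1) i j (phi P) (phi Z) (phi W) * D P +
    msum s id (fun t => v t * (i t)%:R) k (fun t => (i t).-1) j (phi P) (phi Z) (phi W) * D Z +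
    msum s id (fun t => v t * (j t)%:R) k i (fun t => (j t).-1) (phi P) (phi Z) (phi W) * D W.
Proof.
rewrite /msum !mulr_suml -!big_split /=; elim: s => [|t r IH].
  by rewrite !big_nil der0.
rewrite !big_cons (derD dD) IH; congr (_ + _).
rewrite !(derM dD) (derC dD) !derX !rmorphM !rmorphXn phiC /=; ring.
Qed.

End Rules.
End Derivations.

(** * Existence of a branch *)

Section Branch.
Variable R : realType.
Notation A2 := {poly {poly R[i]}}.
Notation term := (R[i] * (nat * nat))%type.

Definition lip_on (rho M : R) (F : R[i] -> R[i] -> R[i]) : Prop :=
  forall x u x' u', cabs x <= rho -> cabs u <= rho -> cabs x' <= rho -> cabs u' <= rho ->
    cabs (F x' u' - F x u) <= M * (cabs (x' - x) + cabs (u' - u)).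

Definition taylor_on (rho M : R) (F FX FU : R[i] -> R[i] -> R[i]) : Prop :=
  forall x u x' u', cabs x <= rho -> cabs u <= rho -> cabs x' <= rho -> cabs u' <= rho ->
    cabs (F x' u' - F x u - (FX x u * (x' - x) + FU x u * (u' - u))) <=
      M * (cabs (x' - x) + cabs (u' - u)) ^+ 2.

(* [(x, u) |-> (u^-al Zh, u^-be Wh)] parametrizes the curves [g = x] near infinity
   and, by the last two equations, is a Hamiltonian flow in [u]. *)
Record branch (s : seq term) (c al be : nat) (kap Z0 W0 : R[i]) (rho M : R)
    (Zh ZX ZU Wh WX WU : R[i] -> R[i] -> R[i]) : Prop := Branch {
  br_rho : 0 < rho; br_M : 0 <= M;
  br_lipZ : lip_on rho M Zh; br_lipW : lip_on rho M Wh;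
  br_tayZ : taylor_on rho M Zh ZX ZU; br_tayW : taylor_on rho M Wh WX WU;
  br_Z0 : forall x, cabs x <= rho -> Zh x 0 = Z0;
  br_W0 : forall x, cabs x <= rho -> Wh x 0 = W0;
  br_F : forall x u, cabs x <= rho -> cabs u <= rho ->
    qhom s c al be id u (Zh x u) (Wh x u) x = 0;
  br_FX : forall x u, cabs x <= rho -> cabs u <= rho ->
    qhomZ s c al be id u (Zh x u) (Wh x u) * ZX x u +
    qhomW s c al be id u (Zh x u) (Wh x u) * WX x u = u ^+ c;
  br_odeZ : forall x u, cabs x <= rho -> cabs u <= rho ->
    u * ZU x u = al%:R * Zh x u - kap * qhomW s c al be id u (Zh x u) (Wh x u);
  br_odeW : forall x u, cabs x <= rho -> cabs u <= rho ->
    u * WU x u = be%:R * Wh x u + kap * qhomZ s c al be id u (Zh x u) (Wh x u) }.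

Lemma branch_shrink s c al be kap Z0 W0 rho rho' M Zh ZX ZU Wh WX WU : 0 < rho' <= rho ->
  branch s c al be kap Z0 W0 rho M Zh ZX ZU Wh WX WU ->
  branch s c al be kap Z0 W0 rho' M Zh ZX ZU Wh WX WU.
Proof.
move=> /andP[r0 rr] [b1 b2 b3 b4 b5 b6 b7 b8 b9 b10 b11 b12].
have T (z : R[i]) : cabs z <= rho' -> cabs z <= rho by move=> h; exact: le_trans h rr.
split=> //; try (by move=> x u x' u' h1 h2 h3 h4; auto); by move=> *; auto.
Qed.

Variables (s : seq term) (c al be : nat) (Z0 W0 kap : R[i]).
Hypothesis hc : {in s, forall t : term, (al * t.2.1 + be * t.2.2 <= c)%N}.
Hypotheses (c0 : (0 < c)%N) (al0 : (0 < al)%N) (Z00 : Z0 != 0) (kap0 : kap != 0).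
Let a := qhomZ s c al be id 0 Z0 W0.
Let b := qhomW s c al be id 0 Z0 W0.
Hypotheses (hF : qhom s c al be id 0 Z0 W0 0 = 0)
  (hZ : al%:R * Z0 = kap * b) (hW : be%:R * W0 = - (kap * a)).
Hypothesis hcase : (al + be <= c)%N \/
  [/\ al = 1%N, be = c & {in s, forall t : term, t.2.2 = 0%N \/ t.2 = (0, 1)%N}].

Notation IT := (it s c al be Z0 W0 kap).
Notation ITZ := (itZ Z0).
Notation ITW := (itW s c al be Z0 W0).
Notation ITF := (itF s c al be Z0 W0).
Notation ITS := (itS s c al be Z0 W0 kap).
Notation h := (c%:R - al%:R - be%:R : R[i]).

Let ev2B x u P Q : ev2 x u (P - Q) = ev2 x u P - ev2 x u Q :> R[i].
Proof. by rewrite /ev2 !(hornerD, hornerN). Qed.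

Lemma der_itF (phi : {rmorphism A2 -> R[i]}) (D : A2 -> R[i]) X V :
  derivation_at phi D -> (forall e, phi (io2 e) = e) ->
  D (ITF X V) =
   msum s id (fun t => t.1 * (wgt c al be t)%:R) (fun t => (wgt c al be t).-1)
     (fun t => t.2.1) (fun t => t.2.2) (phi 'X) (phi (ITZ X V)) (phi (ITW X V)) * D 'X +
   qhomZ s c al be id (phi 'X) (phi (ITZ X V)) (phi (ITW X V)) * D (ITZ X V) +
   qhomW s c al be id (phi 'X) (phi (ITZ X V)) (phi (ITW X V)) * D (ITW X V) -
   (D 'X%:P * phi 'X ^+ c + phi 'X%:P * (phi 'X ^+ c.-1 * c%:R * D 'X)).
Proof.
move=> dD phiC; rewrite /itF /qhom (derB dD) (der_msum dD phiC) (derM dD) (derX dD).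
by rewrite rmorphXn.
Qed.

Let b0 : b != 0.
Proof.
have : al%:R * Z0 != 0 by rewrite mulf_neq0 // pnatr_eq0 -lt0n.
by rewrite hZ mulf_eq0 negb_or => /andP[].
Qed.

Section Morphism.
Variables (B : comNzRingType) (phi : {rmorphism A2 -> B}) (io' : R[i] -> B).
Hypothesis hio : forall e, phi (io2 e) = io' e.

Lemma itZ_morph X V : phi (ITZ X V) = io' Z0 + phi X.
Proof. by rewrite /itZ rmorphD hio. Qed.

Lemma itW_morph X V : phi (ITW X V) = io' W0 + io' (b : R[i])^-1 * (phi V - io' a * phi X).
Proof.
rewrite /itW (rmorphD phi (io2 W0)) (rmorphM phi (io2 _)) (rmorphB phi V).
by rewrite (rmorphM phi (io2 a)) !hio.
Qed.

Lemma itF_morph X V : phi (ITF X V) =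
  qhom s c al be io' (phi 'X) (phi (ITZ X V)) (phi (ITW X V)) (phi 'X%:P).
Proof. by rewrite /itF (qhom_morph _ _ _ _ _ _ _ _ hio). Qed.

Lemma itS_morph X V : phi (ITS X V) = io' al%:R * phi (ITZ X V) -
  io' kap * qhomW s c al be io' (phi 'X) (phi (ITZ X V)) (phi (ITW X V)) +
  io' h * phi X + io' (kap * qhomWW s c al be id 0 Z0 W0 / (b : R[i])) * phi (ITF X V).
Proof.
rewrite /itS (rmorphD phi (_ - _ + _)) (rmorphM phi (io2 _)) (rmorphD phi (_ - _)).
rewrite (rmorphM phi (io2 h)) (rmorphB phi (_ * _)) (rmorphM phi (io2 al%:R)) (rmorphM phi (io2 kap)) !hio.
by rewrite /qhomW (msum_morph _ _ _ _ _ _ _ _ hio).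
Qed.

End Morphism.

Lemma itF_ev x u X V : ev2 x u (ITF X V) =
  qhom s c al be id u (ev2 x u (ITZ X V)) (ev2 x u (ITW X V)) x.
Proof.
have H (phi : {rmorphism A2 -> R[i]}) : (forall e, phi (io2 e) = e) ->
    phi 'X = u -> phi 'X%:P = x ->
    phi (ITF X V) = qhom s c al be id u (phi (ITZ X V)) (phi (ITW X V)) x.
  by move=> h1 <- <-; exact: itF_morph.
exact: H (ev2_io x u) (ev2_U x u) (ev2_X1 x u).
Qed.

Lemma itS_ev x u X V : ev2 x u (ITS X V) = al%:R * ev2 x u (ITZ X V) -
  kap * qhomW s c al be id u (ev2 x u (ITZ X V)) (ev2 x u (ITW X V)) +
  h * ev2 x u X + (kap * qhomWW s c al be id 0 Z0 W0 / (b : R[i])) * ev2 x u (ITF X V).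
Proof.
have H (phi : {rmorphism A2 -> R[i]}) : (forall e, phi (io2 e) = e) -> phi 'X = u ->
    phi (ITS X V) = al%:R * phi (ITZ X V) -
      kap * qhomW s c al be id u (phi (ITZ X V)) (phi (ITW X V)) +
      h * phi X + (kap * qhomWW s c al be id 0 Z0 W0 / (b : R[i])) * phi (ITF X V).
  by move=> h1 <-; exact: itS_morph.
exact: H (ev2_io x u) (ev2_U x u).
Qed.


(** By the base point equations S and F vanish at u = 0, identically in x. Hence the iterates keep a
    zero constant term in u, and [Lop] discards nothing in degree 0. *)
Let phi_S0 (phi : {rmorphism A2 -> {poly R[i]}}) (X V : A2) :
  (forall e, phi (io2 e) = e%:P) -> phi 'X = 0 -> phi X = 0 -> phi V = 0 ->
  phi (ITS X V) = 0 /\ phi (ITF X V) = 0.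
Proof.
move=> phiC hU hX hV.
have eZ : phi (ITZ X V) = Z0%:P by rewrite (itZ_morph phiC) hX addr0.
have eW : phi (ITW X V) = W0%:P.
  by rewrite (itW_morph phiC) hX hV mulr0 subrr mulr0 addr0.
have eU : phi 'X = (0 : R[i])%:P by rewrite hU.
have mm v k i j : msum s polyC v k i j 0%:P Z0%:P W0%:P = (msum s id v k i j 0 Z0 W0)%:P.
  by rewrite -[RHS]/((polyC : {rmorphism R[i] -> {poly R[i]}}) _) (@msum_morph _ _ _ _ id polyC).
have eF : phi (ITF X V) = 0.
  rewrite (itF_morph phiC) eZ eW eU /qhom mm expr0n gtn_eqF // mulr0 subr0.
  by move: hF; rewrite /qhom mul0r subr0 => ->.
split=> //; rewrite (itS_morph phiC) eF mulr0 addr0 eZ eW eU hX mulr0 addr0 /qhomW mm.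
by rewrite -/(qhomW s c al be id 0 Z0 W0) -!polyCM -/b hZ subrr.
Qed.

Let S_at0 (X V : A2) : X.[0] = 0 -> V.[0] = 0 -> (ITS X V).[0] = 0 /\ (ITF X V).[0] = 0.
Proof.
move=> X0 V0; apply: (@phi_S0 (horner_eval 0)) => //; last exact: hornerX.
by move=> e; exact: hornerC.
Qed.

Let it_at0 n : (IT n).1.[0] = 0 /\ (IT n).2.[0] = 0.
Proof.
elim: n => [|n [IH1 IH2]]; first by rewrite /= horner0.
have [S0 F0] := S_at0 IH1 IH2; rewrite /=; split.
  by rewrite horner_coef0 coef_Lop.
by rewrite /itT hornerD hornerN F0 subr0.
Qed.

(** If c >= al + be, then h is a natural number and [Lop] inverts u d/du + h on series without
    constant term. In the other case h = -1 resonates in degree 1, but there F_W is the constant b,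
    bW is 0, and the right-hand side is al Z0 + X - kap b - X = 0. *)
Let it_ode n : 'X * (IT n.+1).1^`() + io2 h * (IT n.+1).1 = ITS (IT n).1 (IT n).2.
Proof.
have [/S_at0 h1 /h1 [S0 _]] := it_at0 n; rewrite /=.
case: hcase => [hle|[al1 bec hs]].
  have -> : h = (c - al - be)%:R by rewrite !natrB ?leq_subRL // (leq_trans (leq_addr _ _) hle).
  by apply: Lop_ode; rewrite -horner_coef0.
have qW (A : comNzRingType) (io : {rmorphism R[i] -> A}) (u Z W : A) :
    qhomW s c al be io u Z W = io (\sum_(t <- s) t.1 * t.2.2%:R).
  rewrite /qhomW /msum rmorph_sum; rewrite [LHS]big_seq [RHS]big_seq; apply: eq_bigr => t ts.
  rewrite /wgt al1 bec; case: (hs t ts) => [-> | ->] /=.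
    by rewrite mulr0 rmorph0 !mul0r.
  by rewrite muln0 muln1 add0n subnn !expr0 !mulr1.
have WW : qhomWW s c al be id 0 Z0 W0 = 0.
  rewrite /qhomWW /msum big_seq big1 // => t ts.
  by case: (hs t ts) => [-> | ->] /=; rewrite !(mulr0, mul0r).
suff -> : ITS (IT n).1 (IT n).2 = 0 by rewrite Lop0 derivC !mulr0 addr0.
have bE : b = \sum_(t <- s) t.1 * t.2.2%:R.
  by rewrite /b -[X in qhomW s c al be X]/(idfun : R[i] -> R[i]) qW.
rewrite /itS WW mulr0 mul0r rmorph0 mul0r addr0 qW -bE -rmorphM -hZ al1 bec mul1r.
have -> : c%:R - 1%:R - c%:R = -1 :> R[i] by ring.
have e1 : io2 (-1) = -1 :> A2 by exact: rmorphN1.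
rewrite e1 mul1r /itZ; move: (it _ _ _ _ _ _ _ _).1 => q.
by change (io2 Z0 + q - io2 Z0 + -1 * q = 0); move: (io2 Z0) => p; ring.
Qed.

Let sub_eq0 (y z : R[i]) : y - z = y -> z = 0.
Proof. by move/eqP; rewrite subr_eq addrC -subr_eq subrr eq_sym => /eqP. Qed.

Theorem branch_exists : exists rho M Zh ZX ZU Wh WX WU,
  branch s c al be kap Z0 W0 rho M Zh ZX ZU Wh WX WU.
Proof.
have [rho0 [C [rho00 C0 cau]]] := it_cauchy hc al0 Z00 kap0 hF hZ hW.
(* [poly_limit] halves the radius of convergence. *)
pose sg := rho0 / 2; have sg0 : 0 < sg by rewrite divr_gt0.
have rhoE : rho0 = 2 * sg by rewrite /sg; field.
rewrite rhoE in cau.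
have [H [HX [HU [M [cH lH tH bH M0]]]]] := poly_limit sg0 (fun n => proj1 (cau n)).
have [G [GX [GU [M' [cG lG tG bG M'0]]]]] := poly_limit sg0 (fun n => proj2 (cau n)).
pose Zh x u := Z0 + H x u; pose Wh x u := W0 + b^-1 * (G x u - a * H x u).
pose WX x u := b^-1 * (GX x u - a * HX x u); pose WU x u := b^-1 * (GU x u - a * HU x u).
pose Zn n := ITZ (IT n).1 (IT n).2; pose Wn n := ITW (IT n).1 (IT n).2.
have dX := evX_der; have dU := evU_der.
have cv x u : cabs x <= sg -> cabs u <= sg ->
   [/\ gcv (fun n => ev2 x u (Zn n)) (Zh x u), gcv (fun n => evX x u (Zn n)) (HX x u),
       gcv (fun n => evU x u (Zn n)) (HU x u) & 
    [/\ gcv (fun n => ev2 x u (Wn n)) (Wh x u), gcv (fun n => evX x u (Wn n)) (WX x u) &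
       gcv (fun n => evU x u (Wn n)) (WU x u)]].
  move=> hx hu; have [c1 c2 c3] := cH x u hx hu; have [d1 d2 d3] := cG x u hx hu.
  split; last split.
  - under eq_fun do rewrite /Zn (itZ_morph (ev2_io x u)); exact: gcvD (gcv_cst _) c1.
  - by under eq_fun do rewrite /Zn /itZ (derD (dX _ x u)) (derC (dX _ x u)) add0r.
  - by under eq_fun do rewrite /Zn /itZ (derD (dU _ x u)) (derC (dU _ x u)) add0r.
  - under eq_fun do rewrite /Wn (itW_morph (ev2_io x u)).
    apply: gcvD (gcv_cst _) (gcvM (gcv_cst _) (gcvB d1 (gcvM (gcv_cst _) c1))).
  - under eq_fun do rewrite /Wn /itW (derD (dX _ x u)) (derC (dX _ x u)) add0r
       (derZ (dX _ x u) (ev2_io x u)) (derB (dX _ x u)) (derZ (dX _ x u) (ev2_io x u)).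
    apply: (gcvM (gcv_cst _) (gcvB d2 (gcvM (gcv_cst _) c2))).
  - under eq_fun do rewrite /Wn /itW (derD (dU _ x u)) (derC (dU _ x u)) add0r
       (derZ (dU _ x u) (ev2_io x u)) (derB (dU _ x u)) (derZ (dU _ x u) (ev2_io x u)).
    apply: (gcvM (gcv_cst _) (gcvB d3 (gcvM (gcv_cst _) c3))).
have cvm v k i j x u : cabs x <= sg -> cabs u <= sg ->
    gcv (fun n => msum s id v k i j u (ev2 x u (Zn n)) (ev2 x u (Wn n)))
      (msum s id v k i j u (Zh x u) (Wh x u)).
  move=> hx hu; have [c1 _ _ [d1 _ _]] := cv x u hx hu.
  apply: gcv_sum => t; apply: gcvM (gcvM (gcv_cst _) (gcvX _ c1)) (gcvX _ d1).
have evF x u n : ev2 x u (ITF (IT n).1 (IT n).2) =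
    qhom s c al be id u (ev2 x u (Zn n)) (ev2 x u (Wn n)) x.
  exact: itF_ev.
(* In the limit V_(n+1) = V_n - F_n becomes F = 0. The two partial derivatives of this recursion
   give the differentiated equations [hFX] and [hFU] in the same way. *)
have hFlim x u : cabs x <= sg -> cabs u <= sg -> qhom s c al be id u (Zh x u) (Wh x u) x = 0.
  move=> hx hu; have [d1 _ _] := cG x u hx hu.
  have e : gcv (fun n => ev2 x u (IT n.+1).2) (G x u - qhom s c al be id u (Zh x u) (Wh x u) x).
    apply: gcv_ext (gcvB d1 (gcvB (cvm _ _ _ _ _ _ hx hu) (gcv_cst _))) => n.
    by rewrite -[(IT n.+1).2]/((IT n).2 - ITF (IT n).1 (IT n).2) ev2B evF.
  exact: sub_eq0 (gcv_unique e (gcv_shift d1)).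
pose Fu x u := msum s id (fun t => t.1 * (wgt c al be t)%:R) (fun t => (wgt c al be t).-1)
   (fun t => t.2.1) (fun t => t.2.2) u (Zh x u) (Wh x u) - x * (u ^+ c.-1 * c%:R).
have hFX x u : cabs x <= sg -> cabs u <= sg ->
    qhomZ s c al be id u (Zh x u) (Wh x u) * HX x u +
    qhomW s c al be id u (Zh x u) (Wh x u) * WX x u = u ^+ c.
  move=> hx hu; have [_ d2 _] := cG x u hx hu; have [_ z2 _ [_ w2 _]] := cv x u hx hu.
  have e : gcv (fun n => evX x u (IT n.+1).2) (GX x u -
    (qhomZ s c al be id u (Zh x u) (Wh x u) * HX x u +
     qhomW s c al be id u (Zh x u) (Wh x u) * WX x u - u ^+ c)).
    apply: gcv_ext (gcvB d2 (gcvB (gcvD (gcvM (cvm _ _ _ _ _ _ hx hu) z2)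
      (gcvM (cvm _ _ _ _ _ _ hx hu) w2)) (gcv_cst _))) => n.
    rewrite -[(IT n.+1).2]/((IT n).2 - ITF (IT n).1 (IT n).2) (derB (dX _ x u)).
    rewrite (der_itF _ _ (dX _ x u) (ev2_io x u)).
    have -> : evX x u 'X = 0 by rewrite /evX hornerX derivC horner0.
    have -> : evX x u 'X%:P = 1 by rewrite /evX hornerC derivX hornerC.
    have eU := ev2_U x u; rewrite /= in eU; rewrite /= eU.
    by rewrite !mulr0 add0r addr0 mul1r.
  by have /eqP := sub_eq0 (gcv_unique e (gcv_shift d2)); rewrite subr_eq0 => /eqP.
have hFU x u : cabs x <= sg -> cabs u <= sg ->
    Fu x u + qhomZ s c al be id u (Zh x u) (Wh x u) * HU x u +
    qhomW s c al be id u (Zh x u) (Wh x u) * WU x u = 0.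
  move=> hx hu; have [_ _ d2] := cG x u hx hu; have [_ _ z2 [_ _ w2]] := cv x u hx hu.
  have e : gcv (fun n => evU x u (IT n.+1).2) (GU x u -
    (Fu x u + qhomZ s c al be id u (Zh x u) (Wh x u) * HU x u +
     qhomW s c al be id u (Zh x u) (Wh x u) * WU x u)).
    have -> : Fu x u + qhomZ s c al be id u (Zh x u) (Wh x u) * HU x u +
       qhomW s c al be id u (Zh x u) (Wh x u) * WU x u =
       (Fu x u + x * (u ^+ c.-1 * c%:R)) + qhomZ s c al be id u (Zh x u) (Wh x u) * HU x u +
       qhomW s c al be id u (Zh x u) (Wh x u) * WU x u - x * (u ^+ c.-1 * c%:R) by ring.
    have cF : gcv (fun n => msum s id (fun t => t.1 * (wgt c al be t)%:R)
        (fun t => (wgt c al be t).-1) (fun t => t.2.1) (fun t => t.2.2) u (ev2 x u (Zn n))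
        (ev2 x u (Wn n))) (Fu x u + x * (u ^+ c.-1 * c%:R)) by rewrite /Fu subrK; exact: cvm.
    apply: gcv_ext (gcvB d2 (gcvB (gcvD (gcvD cF (gcvM (cvm _ _ _ _ _ _ hx hu) z2))
      (gcvM (cvm _ _ _ _ _ _ hx hu) w2)) (gcv_cst _))) => n.
    rewrite -[(IT n.+1).2]/((IT n).2 - ITF (IT n).1 (IT n).2) (derB (dU _ x u)).
    rewrite (der_itF _ _ (dU _ x u) (ev2_io x u)).
    have -> : evU x u 'X = 1 by rewrite /evU derivX !hornerC.
    have -> : evU x u 'X%:P = 0 by rewrite /evU derivC !horner0.
    have eU := ev2_U x u; have eX := ev2_X1 x u; rewrite /= in eU eX; rewrite /= eU eX.
    by rewrite !mulr1 mul0r add0r.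
  exact: sub_eq0 (gcv_unique e (gcv_shift d2)).
(* The limit of [it_ode]; the term with [mu] disappears because F = 0, and the h X on both sides
   cancel. *)
have hodeZ x u : cabs x <= sg -> cabs u <= sg ->
    u * HU x u = al%:R * Zh x u - kap * qhomW s c al be id u (Zh x u) (Wh x u).
  move=> hx hu; have [c1 _ c3] := cH x u hx hu; have [z1 _ _ _] := cv x u hx hu.
  have e1 : gcv (fun n => ev2 x u ('X * (IT n.+1).1^`() + io2 h * (IT n.+1).1)) (u * HU x u + h * H x u).
    apply: gcv_ext (gcvD (gcvM (gcv_cst _) (gcv_shift c3)) (gcvM (gcv_cst _) (gcv_shift c1))) => n.
    by rewrite /ev2 !(hornerD, hornerM) -/(ev2 x u _) -/(ev2 x u (io2 _)) ev2_io hornerX hornerC.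
  have e2 : gcv (fun n => ev2 x u (ITS (IT n).1 (IT n).2))
    (al%:R * Zh x u - kap * qhomW s c al be id u (Zh x u) (Wh x u) + h * H x u
     + (kap * qhomWW s c al be id 0 Z0 W0 / b) * qhom s c al be id u (Zh x u) (Wh x u) x).
    apply: gcv_ext (gcvD (gcvD (gcvB (gcvM (gcv_cst _) z1) (gcvM (gcv_cst _) (cvm _ _ _ _ _ _ hx hu)))
      (gcvM (gcv_cst _) c1)) (gcvM (gcv_cst _) (gcvB (cvm _ _ _ _ _ _ hx hu) (gcv_cst _)))) => n.
    by rewrite itS_ev evF.
  have e1' : gcv (fun n => ev2 x u (ITS (IT n).1 (IT n).2)) (u * HU x u + h * H x u).
    by apply: gcv_ext e1 => n; rewrite -it_ode.
  have := gcv_unique e1' e2; rewrite hFlim // mulr0 addr0 => /addIr; exact.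
have z0E x : cabs x <= sg -> Zh x 0 = Z0.
  move=> hx; have z : cabs (0 : R[i]) <= sg by rewrite cabs0 ltW.
  have [c1 _ _] := cH x 0 hx z; rewrite /Zh; suff -> : H x 0 = 0 by rewrite addr0.
  apply: gcv_unique c1 _; under eq_fun => n do rewrite /ev2 (proj1 (it_at0 n)) horner0.
  exact: gcv_cst.
have w0E x : cabs x <= sg -> Wh x 0 = W0.
  move=> hx; have z : cabs (0 : R[i]) <= sg by rewrite cabs0 ltW.
  have := z0E x hx; rewrite /Zh /Wh => /eqP; rewrite -subr_eq0 addrAC subrr add0r => /eqP ->.
  have [c1 _ _] := cG x 0 hx z; suff -> : G x 0 = 0 by rewrite mulr0 subrr mulr0 addr0.
  apply: gcv_unique c1 _; under eq_fun => n do rewrite /ev2 (proj2 (it_at0 n)) horner0.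
  exact: gcv_cst.
(* Below this radius F_W does not vanish: at a zero of F_W the equation for Z would give |al Z0| <=
   |u| M (al + 1). *)
pose r1 := cabs (al%:R * Z0) / (2 * (M * (al%:R + 1) + 1)).
have aZ0 : 0 < cabs (al%:R * Z0) by rewrite cabs_gt0 mulf_neq0 // pnatr_eq0 -lt0n.
have Ma : 0 <= M * (al%:R + 1) by rewrite mulr_ge0 // addr_ge0.
have r10 : 0 < r1 by rewrite divr_gt0 // mulr_gt0 //; lra.
pose rho := Num.min sg r1.
have rho_gt0 : 0 < rho by rewrite lt_min sg0.
have rsg : rho <= sg by rewrite ge_min lexx.
have T (z : R[i]) : cabs z <= rho -> cabs z <= sg by move=> hz; exact: le_trans hz rsg.
have bneq x u : cabs x <= rho -> cabs u <= rho -> qhomW s c al be id u (Zh x u) (Wh x u) != 0.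
  move=> hx hu; apply/eqP => e; have := hodeZ x u (T _ hx) (T _ hu).
  rewrite e mulr0 subr0 => e1.
  have z : cabs (0 : R[i]) <= sg by rewrite cabs0 ltW.
  have l := lH x 0 x u (T _ hx) z (T _ hx) (T _ hu).
  rewrite subrr subr0 cabs0 add0r in l.
  have bb := bH x u (T _ hx) (T _ hu).
  have : al%:R * Z0 = u * HU x u - al%:R * (H x u - H x 0).
    by rewrite e1 /Zh; have := z0E x (T _ hx); rewrite /Zh => /eqP; rewrite -subr_eq0 addrAC subrr add0r => /eqP ->; ring.
  move=> e2; have : cabs (al%:R * Z0) <= cabs u * (M * (al%:R + 1)).
    rewrite e2; apply: le_trans (cabsD _ _) _; rewrite cabsN !cabsM cabs_nat.
    have q1 : cabs u * cabs (HU x u) <= cabs u * M by rewrite ler_wpM2l // cabs_ge0.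
    have q2 : al%:R * cabs (H x u - H x 0) <= al%:R * (M * cabs u) by rewrite ler_wpM2l.
    lra.
  have hr : cabs u <= r1 by apply: le_trans hu _; rewrite ge_min lexx orbT.
  have q3 : cabs u * (M * (al%:R + 1)) <= r1 * (M * (al%:R + 1)) by rewrite ler_wpM2r.
  have q4 : r1 * (2 * (M * (al%:R + 1) + 1)) = cabs (al%:R * Z0).
    by rewrite /r1 divfK //; apply/lt0r_neq0; lra.
  have q5 : 0 <= r1 * (M * (al%:R + 1)) by rewrite mulr_ge0 // ltW.
  lra.
pose N := Num.max M (cabs b^-1 * (M' + cabs a * M)).
have MN : M <= N by rewrite le_max lexx.
have WN (y z : R[i]) (e : R) : 0 <= e -> cabs y <= M' * e -> cabs z <= M * e ->
    cabs (b^-1 * (y - a * z)) <= N * e.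
  move=> e0 hy hz; rewrite cabsM; apply: (@le_trans _ _ (cabs b^-1 * (M' + cabs a * M) * e)).
    rewrite -mulrA ler_wpM2l ?cabs_ge0 //; apply: le_trans (cabsD _ _) _.
    rewrite cabsN cabsM mulrDl; apply: lerD => //; rewrite -mulrA.
    by apply: ler_wpM2l => //; exact: cabs_ge0.
  by rewrite ler_wpM2r // le_max lexx orbT.
exists rho, N, Zh, HX, HU, Wh, WX, WU; split=> //.
- exact: le_trans MN.
- move=> x u x' u' h1 h2 h3 h4; rewrite /Zh opprD addrACA subrr add0r.
  apply: le_trans (lH _ _ _ _ (T _ h1) (T _ h2) (T _ h3) (T _ h4)) _.
  by rewrite ler_wpM2r // addr_ge0 // cabs_ge0.
- move=> x u x' u' h1 h2 h3 h4.
  have -> : Wh x' u' - Wh x u = b^-1 * ((G x' u' - G x u) - a * (H x' u' - H x u)).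
    by rewrite /Wh; ring.
  apply: WN; [by rewrite addr_ge0 // cabs_ge0 | exact: lG (T _ h1) (T _ h2) (T _ h3) (T _ h4)
    | exact: lH (T _ h1) (T _ h2) (T _ h3) (T _ h4)].
- move=> x u x' u' h1 h2 h3 h4; rewrite {1 2}/Zh opprD (addrACA Z0) subrr add0r.
  apply: le_trans (tH _ _ _ _ (T _ h1) (T _ h2) (T _ h3) (T _ h4)) _.
  by rewrite ler_wpM2r // exprn_ge0 // addr_ge0 // cabs_ge0.
- move=> x u x' u' h1 h2 h3 h4.
  have -> : Wh x' u' - Wh x u - (WX x u * (x' - x) + WU x u * (u' - u)) =
     b^-1 * ((G x' u' - G x u - (GX x u * (x' - x) + GU x u * (u' - u))) -
       a * (H x' u' - H x u - (HX x u * (x' - x) + HU x u * (u' - u)))).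
    by rewrite /Wh /WX /WU; ring.
  apply: WN; [by rewrite exprn_ge0 // addr_ge0 // cabs_ge0 | exact: tG (T _ h1) (T _ h2) (T _ h3) (T _ h4)
    | exact: tH (T _ h1) (T _ h2) (T _ h3) (T _ h4)].
- by move=> x hx; apply/z0E/T.
- by move=> x hx; apply/w0E/T.
- by move=> x u hx hu; apply: hFlim; exact: T.
- by move=> x u hx hu; apply: hFX; exact: T.
- by move=> x u hx hu; apply: hodeZ; exact: T.
(* The equation for W: u times the total u-derivative of F = 0, minus Euler's relation, minus F_Z
   times the equation for Z, is F_W times the wanted identity. *)
- move=> x u hx hu; have hx' := T _ hx; have hu' := T _ hu.
  have e1 := hFU x u hx' hu'; have e2 := hodeZ x u hx' hu'.
  have e3 := qhom_euler hc (erefl (Fu x u)); rewrite hFlim // mulr0 in e3.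
  apply: (mulfI (bneq x u hx hu)); apply/eqP; rewrite -subr_eq0; apply/eqP.
  move: e1 e2 e3; move: (qhomW _ _ _ _ _ _ _ _) (qhomZ _ _ _ _ _ _ _ _) (Fu x u) => q p fu e1 e2 e3.
  have -> : q * (u * WU x u) - q * (be%:R * Wh x u + kap * p) =
     u * (fu + p * HU x u + q * WU x u) - (u * fu + al%:R * Zh x u * p + be%:R * Wh x u * q)
     - p * (u * HU x u - (al%:R * Zh x u - kap * q)) by ring.
  by rewrite e1 e2 e3 subrr !mulr0 !subr0.
Qed.

End Branch.

(** * Exchange of the two coordinates *)

Section Swap.
Variable R : realType.
Notation term := (R[i] * (nat * nat))%type.
Implicit Types (s : seq term) (c al be : nat).

Definition swap_term (t : term) : term := (t.1, (t.2.2, t.2.1)).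

Lemma wgt_swap c al be t : wgt c be al (swap_term t) = wgt c al be t.
Proof. by rewrite /wgt /= addnC. Qed.

Lemma qhom_swap s c al be (u Z W x : R[i]) :
  qhom (map swap_term s) c be al id u W Z x = qhom s c al be id u Z W x.
Proof.
rewrite /qhom /msum big_map; congr (_ - _); apply: eq_bigr => t _.
by rewrite wgt_swap /=; ring.
Qed.

Lemma qhomZ_swap s c al be (u Z W : R[i]) :
  qhomZ (map swap_term s) c be al id u W Z = qhomW s c al be id u Z W.
Proof.
rewrite /qhomZ /qhomW /msum big_map; apply: eq_bigr => t _.
by rewrite wgt_swap /=; ring.
Qed.

Lemma qhomW_swap s c al be (u Z W : R[i]) :
  qhomW (map swap_term s) c be al id u W Z = qhomZ s c al be id u Z W.
Proof.
rewrite /qhomZ /qhomW /msum big_map; apply: eq_bigr => t _.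
by rewrite wgt_swap /=; ring.
Qed.

Lemma swap_termK : involutive swap_term.
Proof. by case=> a [l m]. Qed.

Lemma map_swapK s : map swap_term (map swap_term s) = s.
Proof. by rewrite -map_comp map_id_in // => t _; exact: swap_termK. Qed.

(** The exchange reverses dz /\ dw, hence the sign of [kap]. *)
Lemma branch_swap s c al be kap Z0 W0 rho M Zh ZX ZU Wh WX WU :
  branch s c al be kap Z0 W0 rho M Zh ZX ZU Wh WX WU ->
  branch (map swap_term s) c be al (- kap) W0 Z0 rho M Wh WX WU Zh ZX ZU.
Proof.
move=> [b1 b2 b3 b4 b5 b6 b7 b8 b9 b10 b11 b12]; split=> // x u hx hu.
- by rewrite qhom_swap b9.
- by rewrite qhomZ_swap qhomW_swap addrC b10.
- by rewrite qhomW_swap b12 // mulNr opprK.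
- by rewrite qhomZ_swap b11 // mulNr.
Qed.

(* [sub_adapted] holds when [(1, 1)] lies below the line [al l + be m = c]; the
   other two cases are those of a triangle with a unit side. *)
Definition sub_adapted s c al be : Prop :=
  [\/ (al + be <= c)%N,
      [/\ al = 1%N, be = c & {in s, forall t : term, t.2.2 = 0%N \/ t.2 = (0, 1)%N}] |
      [/\ be = 1%N, al = c & {in s, forall t : term, t.2.1 = 0%N \/ t.2 = (1, 0)%N}]].

(** [branch_exists] solves the level equation for W, which takes al > 0. If al = 0, or if it is the
    l-exponent that is bounded by 1, the exchanged data are solved instead. *)
Theorem branch_exists_gen s c al be (Z0 W0 kap : R[i]) :
  {in s, forall t : term, (al * t.2.1 + be * t.2.2 <= c)%N} ->
  (0 < c)%N -> (0 < al + be)%N -> Z0 != 0 -> W0 != 0 -> kap != 0 ->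
  qhom s c al be id 0 Z0 W0 0 = 0 ->
  al%:R * Z0 = kap * qhomW s c al be id 0 Z0 W0 ->
  be%:R * W0 = - (kap * qhomZ s c al be id 0 Z0 W0) ->
  sub_adapted s c al be ->
  exists rho M Zh ZX ZU Wh WX WU, branch s c al be kap Z0 W0 rho M Zh ZX ZU Wh WX WU.
Proof.
move=> hc c0 ab0 Z00 W00 k0 hF hZ hW hs.
have direct : (0 < al)%N -> ((al + be <= c)%N \/
  [/\ al = 1%N, be = c & {in s, forall t : term, t.2.2 = 0%N \/ t.2 = (0, 1)%N}]) ->
  exists rho M Zh ZX ZU Wh WX WU, branch s c al be kap Z0 W0 rho M Zh ZX ZU Wh WX WU.
  by move=> al0 hcase; apply: branch_exists.
have swapped : (0 < be)%N -> ((be + al <= c)%N \/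
  [/\ be = 1%N, al = c & {in map swap_term s, forall t : term, t.2.2 = 0%N \/ t.2 = (0, 1)%N}]) ->
  exists rho M Zh ZX ZU Wh WX WU, branch s c al be kap Z0 W0 rho M Zh ZX ZU Wh WX WU.
  move=> be0 hcase.
  have hc' : {in map swap_term s, forall t : term, (be * t.2.1 + al * t.2.2 <= c)%N}.
    by move=> _ /mapP [t ts ->] /=; rewrite addnC; exact: hc.
  have k0' : - kap != 0 by rewrite oppr_eq0.
  have hF' : qhom (map swap_term s) c be al id 0 W0 Z0 0 = 0 by rewrite qhom_swap.
  have hZ' : be%:R * W0 = - kap * qhomW (map swap_term s) c be al id 0 W0 Z0.
    by rewrite qhomW_swap hW mulNr.
  have hW' : al%:R * Z0 = - (- kap * qhomZ (map swap_term s) c be al id 0 W0 Z0).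
    by rewrite qhomZ_swap hZ mulNr opprK.
  have [rho [M [Wh [WX [WU [Zh [ZX [ZU hb]]]]]]]] :=
    branch_exists hc' c0 be0 W00 k0' hF' hZ' hW' hcase.
  exists rho, M, Zh, ZX, ZU, Wh, WX, WU.
  by have := branch_swap hb; rewrite map_swapK opprK.
case: hs => [h1|h2|[h31 h32 h33]].
- case: (posnP al) => [al0|al0]; last by apply: direct => //; left.
  by apply: swapped; [move: ab0; rewrite al0 | left; rewrite addnC].
- by apply: direct; [case: h2 => ->|right].
- apply: swapped; [by rewrite h31|right; split=> //].
  by move=> _ /mapP [t ts ->] /=; case: (h33 t ts) => [->|->]; [left|right].
Qed.

End Swap.

(** * Limits along a gauge *)

Section Tends.
Variable R : realType.
Variables (T : Type) (d : T -> R).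

(** In the applications [T] consists of points or tuples of points and [d] is the distance to the
    base values, so that continuity of polynomial expressions in several variables needs no product
    topology. *)
Definition tends (Q : T -> R[i]) (q : R[i]) : Prop :=
  forall e, 0 < e -> exists2 dl, 0 < dl & forall t, d t <= dl -> cabs (Q t - q) <= e.

Lemma tends_cst q : tends (fun=> q) q.
Proof. by move=> e e0; exists 1 => // t _; rewrite subrr cabs0 ltW. Qed.

Lemma tends_lip (K : R) Q q : (forall t, 0 <= d t) -> (forall t, cabs (Q t - q) <= K * d t) -> tends Q q.
Proof.
move=> hd h e e0; have K0 : 0 < `|K| + 1 by rewrite ltr_wpDl.
exists (e / (`|K| + 1)); first exact: divr_gt0.
move=> t ht; apply: le_trans (h t) _.
apply: (@le_trans _ _ ((`|K| + 1) * d t)); last by rewrite mulrC -ler_pdivlMr.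
by rewrite ler_wpM2r //; have := ler_norm K; lra.
Qed.

Lemma tendsD Q Q' q q' : tends Q q -> tends Q' q' -> tends (fun t => Q t + Q' t) (q + q').
Proof.
move=> h h' e e0; have e2 : 0 < e / 2 by rewrite divr_gt0.
have [d1 d10 h1] := h _ e2; have [d2 d20 h2] := h' _ e2.
exists (Num.min d1 d2); first by rewrite lt_min d10.
move=> t; rewrite le_min => /andP[t1 t2]; rewrite opprD addrACA.
apply: le_trans (cabsD _ _) _; have := h1 t t1; have := h2 t t2; lra.
Qed.

Lemma tendsM Q Q' q q' : tends Q q -> tends Q' q' -> tends (fun t => Q t * Q' t) (q * q').
Proof.
move=> h h' e e0; pose K := cabs q + cabs q' + 1.
have q0 := cabs_ge0 q; have q'0 := cabs_ge0 q'.
have K0 : 0 < K by rewrite /K; lra.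
pose e1 := Num.min 1 (e / (2 * K)).
have e10 : 0 < e1 by rewrite lt_min ltr01 divr_gt0 // mulr_gt0.
have e11 : e1 <= 1 by rewrite ge_min lexx.
have e12 : e1 * (2 * K) <= e by rewrite -ler_pdivlMr ?mulr_gt0 // ge_min lexx orbT.
have [d1 d10 h1] := h _ e10; have [d2 d20 h2] := h' _ e10.
exists (Num.min d1 d2); first by rewrite lt_min d10.
move=> t; rewrite le_min => /andP[t1 t2].
have -> : Q t * Q' t - q * q' = (Q t - q) * (Q' t - q') + q * (Q' t - q') + (Q t - q) * q' by ring.
apply: le_trans (cabsD _ _) _; apply: le_trans (lerD (cabsD _ _) (lexx _)) _.
rewrite !cabsM; move: (h1 t t1) (h2 t t2) (cabs_ge0 (Q t - q)) (cabs_ge0 (Q' t - q')).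
move: (cabs (Q t - q)) (cabs (Q' t - q')) => a b ha hb a0 b0.
have i1 : a * b <= e1 * 1 by apply: ler_pM => //; lra.
have i2 : cabs q * b <= cabs q * e1 by rewrite ler_wpM2l.
have i3 : a * cabs q' <= e1 * cabs q' by rewrite ler_wpM2r.
have i4 : 0 <= e1 * K by rewrite mulr_ge0 // ltW.
rewrite /K in e12 i4; lra.
Qed.

Lemma tendsX Q q n : tends Q q -> tends (fun t => Q t ^+ n) (q ^+ n).
Proof.
move=> h; elim: n => [|n IH].
  by have -> : (fun t => Q t ^+ 0) = fun=> 1 by []; exact: tends_cst.
have -> : (fun t => Q t ^+ n.+1) = (fun t => Q t * Q t ^+ n) by apply/funext => t; rewrite exprS.
by rewrite exprS; exact: tendsM.
Qed.

Lemma tends_sum (I : Type) (r : seq I) (Q : I -> T -> R[i]) (q : I -> R[i]) :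
  (forall i, tends (Q i) (q i)) ->
  tends (fun t => \sum_(i <- r) Q i t) (\sum_(i <- r) q i).
Proof.
move=> h; elim: r => [|i r IH].
  have -> : (fun t => \sum_(i <- [::]) Q i t) = fun=> 0 by apply/funext => t; rewrite big_nil.
  by rewrite big_nil; exact: tends_cst.
have -> : (fun t => \sum_(j <- i :: r) Q j t) = (fun t => Q i t + \sum_(j <- r) Q j t).
  by apply/funext => t; rewrite big_cons.
by rewrite big_cons; exact: tendsD.
Qed.

Lemma tends_neq0 Q q : tends Q q -> q != 0 ->
  exists2 dl, 0 < dl & forall t, d t <= dl -> Q t != 0.
Proof.
move=> h q0; have e0 : 0 < cabs q / 2 by rewrite divr_gt0 // cabs_gt0.
have [dl dl0 hd] := h _ e0; exists dl => // t /hd; apply: contraTneq => ->.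
by rewrite sub0r cabsN -ltNge; rewrite ltr_pdivrMr // ltr_pMr ?cabs_gt0 // ltr1n.
Qed.

End Tends.

(** * A fixed point lemma, and powers near 1 *)

Section ComplexLemmas.
Variable R : realType.

Lemma complex_fixpoint (Phi : R[i] -> R[i]) (a : R[i]) (r : R) : 0 < r ->
  (forall y y', cabs (y - a) <= r -> cabs (y' - a) <= r ->
     cabs (Phi y - Phi y') <= cabs (y - y') / 2) ->
  cabs (Phi a - a) <= r / 2 ->
  exists2 y, cabs (y - a) <= r & Phi y = y.
Proof.
move=> r0 lip ha; pose y n := iter n Phi a.
have main n : cabs (y n - a) <= r * (1 - (2 ^+ n)^-1) /\ cabs (y n.+1 - y n) <= r / 2 / 2 ^+ n.
  elim: n => [|n [IH1 IH2]].
    by rewrite /y /= subrr cabs0 expr0 invr1 subrr mulr0 mulr1; split.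
  have p0 : 0 < (2 ^+ n)^-1 :> R by rewrite invr_gt0 exprn_gt0.
  have e2 : (2 ^+ n.+1)^-1 = (2 ^+ n)^-1 / 2 :> R by rewrite exprS invfM mulrC.
  have h1 : cabs (y n.+1 - a) <= r * (1 - (2 ^+ n.+1)^-1).
    apply: le_trans (cabs_triB _ (y n) _) _; rewrite e2; lra.
  have le_r k z : cabs z <= r * (1 - (2 ^+ k)^-1) -> cabs z <= r.
    by move/le_trans; apply; rewrite ler_piMr ?(ltW r0) // gerBl invr_ge0 exprn_ge0.
  split=> //; have := lip _ _ (le_r _ _ h1) (le_r _ _ IH1); rewrite e2 /y /=; lra.
have in_r n : cabs (y n - a) <= r.
  have [h _] := main n; apply: le_trans h _.
  by rewrite ler_piMr ?(ltW r0) // gerBl invr_ge0 exprn_ge0.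
have [l hl] := gcv_exists (fun n => proj2 (main n)).
have hlr : cabs (l - a) <= r by apply: gcv_bound (gcvB hl (gcv_cst a)) in_r.
exists l => //; apply: gcv_unique (gcv_shift hl).
have [C hC] := hl; exists (C / 2) => n; apply: le_trans (lip _ _ hlr (in_r n)) _.
by have := hC n; lra.
Qed.

Lemma pow_near1 (y : R[i]) n : cabs (y - 1) <= 1 -> cabs (y ^+ n - 1) <= 4 ^+ n * cabs (y - 1).
Proof.
move=> h; have y2 : cabs y <= 2.
  by have := cabsD (y - 1) 1; rewrite subrK cabs1; lra.
have o2 : cabs (1 : R[i]) <= 2 by rewrite cabs1; lra.
have := pow_diff (absval_cabs R) (ltr0Sn R 1) n o2 y2; rewrite expr1n.
have -> : (2 * 2 : R) = 4 by rewrite -natrM.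
have := cabs_ge0 (y ^+ n - 1); lra.
Qed.

(** For a al = b be + 1 the number y is the quotient of (y^al)^a by (y^be)^b, both near 1. Without
    coprimality a common root of unity could be far from 1. *)
Lemma coprime_pow_near1 al be (e : R) : coprime al be -> 0 < e ->
  exists2 dl, 0 < dl & forall y : R[i], cabs (y ^+ al - 1) <= dl ->
    cabs (y ^+ be - 1) <= dl -> cabs (y - 1) <= e.
Proof.
wlog : al be / (0 < al)%N => [hw|al0].
  move=> cop e0; case: (posnP al) => al0; last exact: hw.
  case: (posnP be) => be0; first by move: cop; rewrite al0 be0.
  have [dl dl0 h] := hw be al be0 (etrans (coprime_sym _ _) cop) e0.
  by exists dl => // y h1 h2; exact: h.
move=> cop e0; have [a b eab _] := egcdnP be al0; rewrite (eqP cop) in eab.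
pose K := 4 ^+ a + 4 ^+ b : R.
have Ka : 1 <= 4 ^+ a :> R by rewrite exprn_ege1 // ler1n.
have Kb : 1 <= 4 ^+ b :> R by rewrite exprn_ege1 // ler1n.
have K0 : 0 < K by rewrite /K; lra.
pose dl := Num.min (Num.min 1 (2 * 4 ^+ b)^-1) (e / (2 * K)).
have b40 : 0 < 2 * 4 ^+ b :> R by lra.
have K20 : 0 < 2 * K by lra.
have dl0 : 0 < dl by rewrite !lt_min ltr01 invr_gt0 b40 divr_gt0.
exists dl => // y h1 h2.
have dl1 : dl <= 1 by rewrite !ge_min lexx.
have dlb : dl * (2 * 4 ^+ b) <= 1.
  by rewrite -ler_pdivlMr // mul1r !ge_min lexx orbT.
have dle : dl * (2 * K) <= e by rewrite -ler_pdivlMr ?mulr_gt0 // ge_min lexx orbT.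
have p1 := pow_near1 a (le_trans h1 dl1); have p2 := pow_near1 b (le_trans h2 dl1).
have q1 : 4 ^+ a * cabs (y ^+ al - 1) <= 4 ^+ a * dl by rewrite ler_wpM2l //; lra.
have q2 : 4 ^+ b * cabs (y ^+ be - 1) <= 4 ^+ b * dl by rewrite ler_wpM2l //; lra.
rewrite -exprM mulnC eab in p1; rewrite -exprM mulnC in p2.
set v := y ^+ (b * be) in p2.
have hv : y ^+ (b * be + 1) = v * y by rewrite exprD expr1.
rewrite hv in p1.
have e1 : v * (y - 1) = (v * y - 1) - (v - 1) by ring.
have l1 : cabs v * cabs (y - 1) <= K * dl.
  by rewrite -cabsM e1; apply: le_trans (cabsD _ _) _; rewrite cabsN /K; lra.
have l2 : 1 / 2 <= cabs v.
  have := cabsD v (1 - v); rewrite addrC subrK cabs1 cabsB; lra.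
have l3 : 1 / 2 * cabs (y - 1) <= cabs v * cabs (y - 1) by rewrite ler_wpM2r // cabs_ge0.
lra.
Qed.

(** The cofactor 1 + y + ... + y^(n-1) tends to n >= 1 as y tends to 1, so its modulus is eventually
    at least 1/2. *)
Lemma pow_sub1_lower n : (0 < n)%N -> exists2 dl : R, 0 < dl & forall y : R[i],
  cabs (y - 1) <= dl -> cabs (y - 1) / 2 <= cabs (y ^+ n - 1).
Proof.
move=> n0; pose d (y : R[i]) := cabs (y - 1).
have t1 : tends d id 1 by apply: (@tends_lip _ _ _ 1) => y; rewrite ?mul1r ?cabs_ge0.
have t := @tends_sum R _ d 'I_n (index_enum 'I_n) (fun i y => y ^+ i) (fun i => 1 ^+ i)
   (fun i => tendsX i t1).
have e0 : 0 < 2^-1 :> R by rewrite invr_gt0.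
have [dl dl0 h] := t _ e0; exists dl => // y /h.
have -> : \sum_(i < n) 1 ^+ i = n%:R :> R[i].
  by rewrite (eq_bigr (fun=> 1)) ?sumr_const ?card_ord // => i _; rewrite expr1n.
move=> hs; rewrite subrX1 cabsM; apply: ler_wpM2l; first exact: cabs_ge0.
set S := \sum_(i < n) _ in hs *.
have := cabsD S (n%:R - S); rewrite addrC subrK cabs_nat cabsB.
have : 1 <= n%:R :> R by rewrite ler1n.
lra.
Qed.

End ComplexLemmas.

(** * Branches as maps of a punctured bidisc *)

Section BranchMap.
Variable R : realType.
Notation term := (R[i] * (nat * nat))%type.

Lemma is_diff_pow (p : C2 R) n :
  is_diff p (fun q : C2 R => (q.2 : R[i]) ^+ n : Cplx R) (lin2 0 (p.2 ^+ n.-1 *+ n)).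
Proof.
pose sg := cabs p.2 + 1; have sg0 : 0 < sg by rewrite ltr_wpDl // cabs_ge0.
apply: (@is_diff_quadratic R _ p _ _ 1 ((sg ^+ 2)^-1 * (2 * sg) ^+ n)) => // h _ h2 /=.
have b1 : cabs p.2 <= sg by rewrite lerDl.
have b2 : cabs (h.2 + p.2) <= sg.
  by apply: le_trans (cabsD _ _) _; rewrite /sg addrC lerD2l ltW.
have := pow_taylor (absval_cabs R) sg0 n b1 b2.
rewrite addrK mul0r add0r mulrC -ler_pdivlMr ?exprn_gt0 // => /le_trans; apply.
rewrite mulrC mulrA ler_wpM2l ?mulr_ge0 ?invr_ge0 ?exprn_ge0 ?mulr_ge0 // ?(ltW sg0) //.
rewrite lerXn2r ?nnegrE ?cabs_ge0 ?addr_ge0 ?cabs_ge0 // lerDr; exact: cabs_ge0.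
Qed.

Lemma is_diff_npow (p : C2 R) n : p.2 != 0 ->
  is_diff p (fun q : C2 R => (q.2 : R[i]) ^ (- n%:Z) : Cplx R)
    (lin2 0 (- n%:R * (p.2 : R[i]) ^ (- n%:Z) / p.2)).
Proof.
move=> p0; have dp := is_diff_pow p n.
have pn0 : (p.2 : R[i]) ^+ n != 0 by rewrite expf_neq0.
have dV := @diffV _ _ _ p (@ex_diff _ _ _ _ _ _ _ dp) pn0.
have eV := @differentiableV _ _ _ p (@ex_diff _ _ _ _ _ _ _ dp) pn0.
have -> : (fun q : C2 R => (q.2 : R[i]) ^ (- n%:Z) : Cplx R) = (fun q => ((q.2 : R[i]) ^+ n)^-1).
  by apply/funext => q; rewrite -exprnN.
apply: DiffDef => //; rewrite dV (@diff_val _ _ _ _ _ _ _ dp).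
apply/funext => h; rewrite -exprnN /= /lin2 /= !mul0r !add0r.
rewrite [LHS](_ : _ = - ((p.2 : R[i]) ^+ n) ^- 2 * ((p.2 : R[i]) ^+ n.-1 *+ n * h.2)) //.
case: n {dp dV eV} pn0 => [|n] pn0; first by rewrite mulr0n !mul0r oppr0 !mulr0 !mul0r.
rewrite /= exprS in pn0 *.
have pn : (p.2 : R[i]) ^+ n != 0 by move: pn0; rewrite mulf_eq0 negb_or => /andP[].
by rewrite -mulr_natr; move: ((p.2 : R[i]) ^+ n) pn => y y0; field; rewrite y0 p0.
Qed.

Definition Jmap (xi0 : R[i]) (al be : nat) (Zh Wh : R[i] -> R[i] -> R[i]) (p : C2 R) : C2 R :=
  ((p.2 : R[i]) ^ (- al%:Z) * Zh (p.1 - xi0) p.2, (p.2 : R[i]) ^ (- be%:Z) * Wh (p.1 - xi0) p.2).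

Definition Jhat (xi0 : R[i]) (Zh Wh : R[i] -> R[i] -> R[i]) (p : C2 R) : C2 R :=
  (Zh (p.1 - xi0) p.2, Wh (p.1 - xi0) p.2).

Lemma bidiscP (xi0 : R[i]) (eps : R) (p : C2 R) :
  bidisc xi0 eps p <-> cabs (p.1 - xi0) < eps /\ cabs p.2 < eps.
Proof.
rewrite /bidisc /disc /=; split=> [[/= h1 h2]|[h1 h2]].
  by move: h1 h2; rewrite subr0 !cabs_ltP.
by split=> /=; rewrite ?subr0 cabs_ltP.
Qed.

Lemma punctured_bidiscP (xi0 : R[i]) (eps : R) (p : C2 R) :
  punctured_bidisc xi0 eps p <-> [/\ cabs (p.1 - xi0) < eps, cabs p.2 < eps & p.2 != 0].
Proof.
rewrite /punctured_bidisc /disc /=; split=> [[/= h1 [h2 h3]]|[h1 h2 /eqP h3]].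
  by move: h1 h2; rewrite subr0 !cabs_ltP => h1 h2; split=> //; apply/eqP.
by split=> /=; [rewrite cabs_ltP | split; rewrite ?subr0 ?cabs_ltP].
Qed.

Lemma taylor_is_diff (xi0 : R[i]) rho M (F FX FU : R[i] -> R[i] -> R[i]) (p : C2 R) :
  taylor_on rho M F FX FU -> cabs (p.1 - xi0) < rho -> cabs p.2 < rho ->
  is_diff p (fun q : C2 R => F (q.1 - xi0) q.2 : Cplx R)
    (lin2 (FX (p.1 - xi0) p.2) (FU (p.1 - xi0) p.2)).
Proof.
move=> tF hx hu; pose d := Num.min (rho - cabs (p.1 - xi0)) (rho - cabs p.2).
apply: (@is_diff_quadratic R _ p _ _ d M); first by rewrite lt_min !subr_gt0 hx.
move=> h; rewrite !lt_min => /andP[h11 h12] /andP[h21 h22] /=.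
have -> : h.1 + p.1 - xi0 = h.1 + (p.1 - xi0) by rewrite addrA.
have a1 : cabs (h.1 + (p.1 - xi0)) <= rho.
  by apply: le_trans (cabsD _ _) _; rewrite ltrBrDr in h11; exact: ltW.
have a2 : cabs (h.2 + p.2) <= rho.
  by apply: le_trans (cabsD _ _) _; rewrite ltrBrDr in h22; exact: ltW.
by have := tF _ _ _ _ (ltW hx) (ltW hu) a1 a2; rewrite !addrK.
Qed.

Section Embedding.
Variables (s : seq term) (c al be : nat) (kap Z0 W0 : R[i]) (rho M : R).
Variables (Zh ZX ZU Wh WX WU : R[i] -> R[i] -> R[i]) (xi0 : R[i]).
Hypothesis hb : branch s c al be kap Z0 W0 rho M Zh ZX ZU Wh WX WU.
Hypotheses (kap0 : kap != 0) (Z00 : Z0 != 0) (W00 : W0 != 0).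
Hypothesis hc : {in s, forall t : term, (al * t.2.1 + be * t.2.2 <= c)%N}.

Let Jx (n : nat) (F FX : R[i] -> R[i] -> R[i]) (x u : R[i]) := u ^ (- n%:Z) * FX x u.
(** The u-derivative of u^-n F, arranged around u F_u - n F because the branch equations equate that
    expression with kap F_Z or - kap F_W. *)
Let Ju (n : nat) (F FU : R[i] -> R[i] -> R[i]) (x u : R[i]) :=
  u ^ (- n%:Z) / u * (u * FU x u - n%:R * F x u).

Lemma Jcomp_is_diff n (F FX FU : R[i] -> R[i] -> R[i]) (p : C2 R) :
  taylor_on rho M F FX FU -> cabs (p.1 - xi0) < rho -> cabs p.2 < rho -> p.2 != 0 ->
  is_diff p (fun q : C2 R => (q.2 : R[i]) ^ (- n%:Z) * F (q.1 - xi0) q.2 : Cplx R)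
    (lin2 (Jx n F FX (p.1 - xi0) p.2) (Ju n F FU (p.1 - xi0) p.2)).
Proof.
move=> tF hx hu p0.
have d1 := is_diff_npow n p0; have d2 := taylor_is_diff tF hx hu.
have d3 := is_diffM d1 d2.
apply: is_diff_eq d3 _ => //.
apply/funext => h; rewrite /Jx /Ju.
set A := (p.2 : R[i]) ^ (- n%:Z); set a := F _ _; set b := FX _ _; set e := FU _ _.
rewrite [LHS](_ : _ = A * (b * h.1 + e * h.2) + a * (0 * h.1 + - n%:R * A / p.2 * h.2)) //.
by rewrite /lin2; move: (p.2) p0 => y y0; field.
Qed.

Lemma Jmap_is_diff (p : C2 R) : punctured_bidisc xi0 rho p ->
  is_diff p (Jmap xi0 al be Zh Wh)
   (fun h => (lin2 (Jx al Zh ZX (p.1 - xi0) p.2) (Ju al Zh ZU (p.1 - xi0) p.2) h,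
              lin2 (Jx be Wh WX (p.1 - xi0) p.2) (Ju be Wh WU (p.1 - xi0) p.2) h)).
Proof.
move=> /punctured_bidiscP [hx hu u0].
have d1 := Jcomp_is_diff al (br_tayZ hb) hx hu u0.
have d2 := Jcomp_is_diff be (br_tayW hb) hx hu u0.
exact: is_diff_pair d1 d2.
Qed.

(** The branch equations turn the determinant into kap u^(-al-be-1) (F_Z Z_x + F_W W_x), and the
    x-derivative of the level equation makes the bracket u^c. *)
Lemma Jmap_det (x u : R[i]) : cabs x <= rho -> cabs u <= rho -> u != 0 ->
  Jx al Zh ZX x u * Ju be Wh WU x u - Ju al Zh ZU x u * Jx be Wh WX x u =
  kap * u ^ (c%:Z - al%:Z - be%:Z - 1).
Proof.
move=> hx hu u0; rewrite /Jx /Ju (br_odeZ hb hx hu) (br_odeW hb hx hu).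
rewrite !expfzDr // -!exprnN expr1 -[u ^ c%:Z]/(u ^+ c) -(br_FX hb hx hu).
move: (qhomZ _ _ _ _ _ _ _ _) (qhomW _ _ _ _ _ _ _ _) => a b.
have ual : u ^+ al != 0 by rewrite expf_neq0.
have ube : u ^+ be != 0 by rewrite expf_neq0.
by move: (u ^+ al) (u ^+ be) ual ube => y z y0 z0; field; rewrite u0 y0 z0.
Qed.

Lemma Jmap_pullback (p v1 v2 : C2 R) : punctured_bidisc xi0 rho p ->
  pullback_area (Jmap xi0 al be Zh Wh) p v1 v2 =
  kap * (p.2 : R[i]) ^ (c%:Z - al%:Z - be%:Z - 1) * area_form v1 v2.
Proof.
move=> hp; have dJ := @diff_val _ _ _ _ _ _ _ (Jmap_is_diff hp).
have /punctured_bidiscP [hx hu u0] := hp.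
rewrite -(Jmap_det (ltW hx) (ltW hu) u0) /pullback_area /area_form !dJ /lin2 /=; ring.
Qed.

(** A vector is recovered from its area pairings with (1, 0) and (0, 1), so a nonzero pullback
    factor is enough. *)
Lemma Jmap_diff_injective (p : C2 R) : punctured_bidisc xi0 rho p ->
  injective ('d (Jmap xi0 al be Zh Wh) p : C2 R -> C2 R).
Proof.
move=> hp v1 v2 e; have /punctured_bidiscP [hx hu u0] := hp.
have k0 : kap * (p.2 : R[i]) ^ (c%:Z - al%:Z - be%:Z - 1) != 0.
  by rewrite mulf_neq0 // expfz_neq0.
have E w : area_form v1 w = area_form v2 w.
  by apply: (mulfI k0); rewrite -!Jmap_pullback // /pullback_area e.
move: (E (0, 1)) (E (1, 0)); rewrite /area_form /= !mulr0 !mulr1 !subr0 !sub0r => e1 /oppr_inj e2.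
by case: v1 v2 e1 e2 {e E} => a b [a' b'] /= -> ->.
Qed.

Lemma Jhat_is_diff (p : C2 R) : bidisc xi0 rho p -> differentiable (Jhat xi0 Zh Wh) p.
Proof.
move=> /bidiscP [hx hu].
have d1 := taylor_is_diff (br_tayZ hb) hx hu.
have d2 := taylor_is_diff (br_tayW hb) hx hu.
exact: (@ex_diff _ _ _ _ _ _ _ (is_diff_pair d1 d2)).
Qed.

Lemma qhom_scale (e u Z W x : R[i]) :
  qhom s c al be id (e * u) (e ^+ al * Z) (e ^+ be * W) x = e ^+ c * qhom s c al be id u Z W x.
Proof.
rewrite /qhom mulrBr; congr (_ - _); last by rewrite exprMn; ring.
rewrite /msum mulr_sumr [LHS]big_seq [RHS]big_seq; apply: eq_bigr => t ts.
have -> : e ^+ c = e ^+ (wgt c al be t) * (e ^+ al) ^+ t.2.1 * (e ^+ be) ^+ t.2.2.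
  by rewrite -!exprM -!exprD -addnA /wgt subnK // hc.
by rewrite !exprMn; ring.
Qed.

(** At u = 1 the sum [qhom] is g - x in the original coordinates, and quasi-homogeneity multiplies
    it by u^c. *)
Lemma Jmap_level (p : C2 R) : punctured_bidisc xi0 rho p ->
  qhom s c al be id 1 (Jmap xi0 al be Zh Wh p).1 (Jmap xi0 al be Zh Wh p).2 (p.1 - xi0) = 0.
Proof.
move=> /punctured_bidiscP [hx hu u0]; have u0' : (p.2 : R[i]) ^+ c != 0 by rewrite expf_neq0.
apply: (mulfI u0'); rewrite -qhom_scale mulr0 mulr1 /Jmap /= -!exprnN.
by rewrite !mulVKf ?expf_neq0 // (br_F hb (ltW hx) (ltW hu)).
Qed.

Hypotheses (hZsmall : 2 * (M * rho) <= cabs Z0) (hWsmall : 2 * (M * rho) <= cabs W0).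

(** The smallness hypotheses keep Z and W within a factor 2 of their values at u = 0; in particular
    they never vanish. *)
Let near_base F F0 : lip_on rho M F -> (forall x, cabs x <= rho -> F x 0 = F0) ->
  2 * (M * rho) <= cabs F0 -> forall x u, cabs x <= rho -> cabs u <= rho ->
  [/\ cabs (F x u - F0) <= M * cabs u, cabs F0 / 2 <= cabs (F x u) & cabs (F x u) <= 2 * cabs F0].
Proof.
move=> lF F00 hs x u hx hu; have r0 := br_rho hb; have M0 := br_M hb.
have z : cabs (0 : R[i]) <= rho by rewrite cabs0 ltW.
have := lF x 0 x u hx z hx hu; rewrite subrr subr0 cabs0 add0r F00 // => h.
have h2 : M * cabs u <= M * rho by rewrite ler_wpM2l.
have h3 : cabs F0 <= cabs (F x u) + cabs (F x u - F0).
  by rewrite [X in _ + X]cabsB addrC -{1}(subrK (F x u) F0); exact: cabsD.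
have h4 : cabs (F x u) <= cabs (F x u - F0) + cabs F0.
  by rewrite -{1}(subrK F0 (F x u)); exact: cabsD.
have := cabs_ge0 F0; split; lra.
Qed.

Lemma branch_nearZ x u : cabs x <= rho -> cabs u <= rho ->
  [/\ cabs (Zh x u - Z0) <= M * cabs u, cabs Z0 / 2 <= cabs (Zh x u) & cabs (Zh x u) <= 2 * cabs Z0].
Proof. exact: near_base (br_lipZ hb) (br_Z0 hb) hZsmall x u. Qed.

Lemma branch_nearW x u : cabs x <= rho -> cabs u <= rho ->
  [/\ cabs (Wh x u - W0) <= M * cabs u, cabs W0 / 2 <= cabs (Wh x u) & cabs (Wh x u) <= 2 * cabs W0].
Proof. exact: near_base (br_lipW hb) (br_W0 hb) hWsmall x u. Qed.

Lemma branch_neq0 x u : cabs x <= rho -> cabs u <= rho -> Zh x u != 0 /\ Wh x u != 0.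
Proof.
move=> hx hu; have [_ h1 _] := branch_nearZ hx hu; have [_ h2 _] := branch_nearW hx hu.
by split; rewrite -cabs_gt0; [apply: lt_le_trans h1|apply: lt_le_trans h2];
  rewrite divr_gt0 // cabs_gt0.
Qed.

Lemma Jhat_torus p : bidisc xi0 rho p -> torus (Jhat xi0 Zh Wh p).
Proof. by move=> /bidiscP [hx hu]; exact: branch_neq0 (ltW hx) (ltW hu). Qed.

Lemma Jmap_torus p : punctured_bidisc xi0 rho p -> torus (Jmap xi0 al be Zh Wh p).
Proof.
move=> /punctured_bidiscP [hx hu u0]; have [z0 w0] := branch_neq0 (ltW hx) (ltW hu).
by split; rewrite /= mulf_neq0 // expfz_neq0.
Qed.

Lemma Jhat_Jmap (p : C2 R) : p.2 != 0 ->
  Jhat xi0 Zh Wh p = ((p.2 : R[i]) ^ al%:Z * (Jmap xi0 al be Zh Wh p).1,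
                      (p.2 : R[i]) ^ be%:Z * (Jmap xi0 al be Zh Wh p).2).
Proof.
move=> u0; rewrite /Jhat /Jmap /= -!exprnN -[X in _ = (X * _, _)]/((p.2 : R[i]) ^+ al).
by rewrite -[X in _ = (_, X * _)]/((p.2 : R[i]) ^+ be) !mulVKf ?expf_neq0.
Qed.

Lemma Jmap_large (N : R) : (0 < al + be)%N -> exists2 dl : R, 0 < dl &
  forall p, punctured_bidisc xi0 rho p -> cabs p.2 < dl ->
    N < cabs (Jmap xi0 al be Zh Wh p).1 \/ N < cabs (Jmap xi0 al be Zh Wh p).2.
Proof.
move=> ab0; pose m := Num.min (cabs Z0) (cabs W0) / 2.
have m0 : 0 < m by rewrite divr_gt0 // lt_min !cabs_gt0 Z00.
pose dl := Num.min 1 (m / (`|N| + 1)).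
have N0 : 0 < `|N| + 1 by rewrite ltr_wpDl.
have dl0 : 0 < dl by rewrite lt_min ltr01 divr_gt0.
exists dl => // p /punctured_bidiscP [hx hu u0] hd.
have big n (y : R[i]) : (0 < n)%N -> m <= cabs y -> N < cabs ((p.2 : R[i]) ^ (- n%:Z) * y).
  move=> n0 hy; rewrite -exprnN cabsM cabsV cabsX.
  have c0 : 0 < cabs p.2 by rewrite cabs_gt0.
  rewrite mulrC ltr_pdivlMr ?exprn_gt0 //.
  have c1 : cabs p.2 <= 1 by apply: ltW; apply: lt_le_trans hd _; rewrite ge_min lexx.
  have cn : cabs p.2 ^+ n <= cabs p.2.
    by case: n n0 => // n _; rewrite exprS ler_piMr ?(ltW c0) // exprn_ile1 ?(ltW c0).
  have h1 : cabs p.2 * (`|N| + 1) < m.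
    by rewrite -ltr_pdivlMr //; apply: lt_le_trans hd _; rewrite ge_min lexx orbT.
  have h2 : N * cabs p.2 ^+ n <= (`|N| + 1) * cabs p.2 ^+ n.
    by rewrite ler_wpM2r ?exprn_ge0 ?(ltW c0) //; have := ler_norm N; lra.
  have h3 : (`|N| + 1) * cabs p.2 ^+ n <= (`|N| + 1) * cabs p.2 by rewrite ler_wpM2l // ltW.
  lra.
have [_ hz _] := branch_nearZ (ltW hx) (ltW hu); have [_ hw _] := branch_nearW (ltW hx) (ltW hu).
have mz : m <= cabs Z0 / 2 by rewrite /m ler_pM2r ?invr_gt0 // ge_min lexx.
have mw : m <= cabs W0 / 2 by rewrite /m ler_pM2r ?invr_gt0 // ge_min lexx orbT.
case: (posnP al) => al0; last by left; apply: big => //; apply: le_trans hz.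
by right; apply: big; [move: ab0; rewrite al0|apply: le_trans hw].
Qed.

End Embedding.
End BranchMap.

(** * Quantitative injectivity of one branch *)

Section Separation.
Variable R : realType.
Notation term := (R[i] * (nat * nat))%type.

Lemma half_step (D a b m1 m2 k d e c : R) : D <= a + b -> b <= m1 -> a <= m2 -> m1 <= k -> m2 <= k ->
  16 * k <= d -> d <= e * c -> 4 * D <= e / 2 * c.
Proof. lra. Qed.

(** The arithmetic of [Jmap_inverse_lip]: E is |u'/u - 1|, U is |u|, X is |x' - x|, F the increment
    of Z or W, c the modulus of its base value and T the deviation of the coordinate ratio from 1.
    Then E U = |u' - u|, and the small r absorbs its own contribution to F. *)
Lemma radius_step (A E U X F c T r m M : R) : 0 < m -> m <= c -> 0 <= M -> 0 < r -> r <= 1 ->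
  16 * (M * r) <= m -> 0 <= X -> 0 <= T -> 0 <= U -> U <= r -> E / 2 <= A -> F <= M * (X + E * U) ->
  A <= 4 / c * F + T -> 0 <= E -> E * U <= X + 4 * T.
Proof.
move=> m0 mc M0 r0 r1 rM X0 T0 U0 Ur EA hF hA E0; have c0 : 0 < c by lra.
have k0 : 0 <= 4 / c by rewrite divr_ge0 // ltW.
have EU0 : 0 <= E * U by rewrite mulr_ge0.
have h2 : 4 / c * F * r <= (X + E * U) / 4.
  apply: (@le_trans _ _ (4 / c * (M * (X + E * U)) * r)).
    by rewrite ler_wpM2r ?(ltW r0) // ler_wpM2l.
  rewrite [X in X <= _](_ : _ = (16 * (M * r)) / c * ((X + E * U) / 4)); last by field; rewrite gt_eqF.
  by rewrite ler_piMl ?divr_ge0 ?addr_ge0 // ler_pdivrMr // mul1r (le_trans rM).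
have h3 : E * U / 2 <= (4 / c * F + T) * r.
  by rewrite mulrAC; apply: ler_pM => //; [rewrite divr_ge0 | exact: le_trans hA].
have h4 : T * r <= T by rewrite ler_piMr.
lra.
Qed.

Section OneBranch.
Variables (s : seq term) (c al be : nat) (kap Z0 W0 : R[i]) (rho M : R).
Variables (Zh ZX ZU Wh WX WU : R[i] -> R[i] -> R[i]) (xi0 : R[i]).
Hypothesis hb : branch s c al be kap Z0 W0 rho M Zh ZX ZU Wh WX WU.
Hypotheses (kap0 : kap != 0) (Z00 : Z0 != 0) (W00 : W0 != 0).
Hypotheses (hZsmall : 2 * (M * rho) <= cabs Z0) (hWsmall : 2 * (M * rho) <= cabs W0).

(** [th] is the ratio of one coordinate at two points, so (u'/u)^n = th F' / F. The constant 4 comes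
    from |th| <= 2 and |F| >= |F0| / 2. *)
Lemma coord_ratio n (F : R[i] -> R[i] -> R[i]) (F0 : R[i]) (x u x' u' : R[i]) : F0 != 0 ->
  cabs F0 / 2 <= cabs (F x u) -> u != 0 -> u' != 0 -> F x' u' != 0 ->
  let th := u ^ (- n%:Z) * F x u / (u' ^ (- n%:Z) * F x' u') in
  cabs (th - 1) <= 1 ->
  cabs ((u' / u) ^+ n - 1) <= 4 / cabs F0 * cabs (F x' u' - F x u) + cabs (th - 1).
Proof.
move=> F00 hF u0 u'0 F'0 th hth.
have c0 : 0 < cabs F0 by rewrite cabs_gt0.
have F1 : F x u != 0 by rewrite -cabs_gt0; apply: lt_le_trans hF; rewrite divr_gt0.
have E : (u' / u) ^+ n - 1 = (F x' u' - F x u) / F x u * th + (th - 1).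
  rewrite /th -!exprnN expr_div_n.
  have a0 : u ^+ n != 0 by rewrite expf_neq0.
  have b0 : u' ^+ n != 0 by rewrite expf_neq0.
  by move: (u ^+ n) (u' ^+ n) a0 b0 => y z y0 z0; field; rewrite y0 z0 F1 F'0.
rewrite E {E}; clearbody th; apply: le_trans (cabsD _ _) _; rewrite lerD2r !cabsM cabsV.
have t2 : cabs th <= 2 by have := cabsD (th - 1) 1; rewrite subrK cabs1; lra.
have i1 : (cabs (F x u))^-1 <= 2 / cabs F0.
  by rewrite -[2 / _]invrK invf_div lef_pV2 ?posrE ?divr_gt0 // cabs_gt0.
have d0 := cabs_ge0 (F x' u' - F x u); have th0 := cabs_ge0 th.
have i0 : 0 <= (cabs (F x u))^-1 by rewrite invr_ge0 cabs_ge0.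
apply: (@le_trans _ _ (cabs (F x' u' - F x u) * (2 / cabs F0) * 2)).
  apply: ler_pM => //; first exact: mulr_ge0.
  by apply: ler_wpM2l.
rewrite [X in _ <= X](_ : _ = cabs (F x' u' - F x u) * (2 / cabs F0) * 2) //.
by rewrite mulrC; field; lra.
Qed.

(** With eta = u'/u, both eta^al and eta^be are close to 1, hence so is eta by coprimality. Then
    |eta - 1| <= 2 |eta^n - 1| for a positive exponent n among al and be, and a Lipschitz bound for
    u in terms of x and the coordinate ratios follows. *)
Lemma Jmap_inverse_lip : coprime al be -> exists r dl : R,
  [/\ 0 < r, r <= rho, 0 < dl & forall p p' : C2 R,
   punctured_bidisc xi0 r p -> punctured_bidisc xi0 r p' ->
   let thz := (Jmap xi0 al be Zh Wh p).1 / (Jmap xi0 al be Zh Wh p').1 in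
   let thw := (Jmap xi0 al be Zh Wh p).2 / (Jmap xi0 al be Zh Wh p').2 in
   cabs (thz - 1) <= dl -> cabs (thw - 1) <= dl ->
   cabs (p'.2 - p.2) <= cabs (p'.1 - p.1) + 4 * (cabs (thz - 1) + cabs (thw - 1))].
Proof.
move=> cop; have rho0 := br_rho hb; have M0 := br_M hb.
have cz : 0 < cabs Z0 by rewrite cabs_gt0.
have cw : 0 < cabs W0 by rewrite cabs_gt0.
have [e1 e10 he] : exists2 e1 : R, 0 < e1 & forall n, n \in [:: al; be] -> (0 < n)%N ->
    forall y : R[i], cabs (y - 1) <= e1 -> cabs (y - 1) / 2 <= cabs (y ^+ n - 1).
  have P n : exists2 e : R, 0 < e & (0 < n)%N -> forall y : R[i], cabs (y - 1) <= e ->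
      cabs (y - 1) / 2 <= cabs (y ^+ n - 1).
    case: (posnP n) => [->|n0]; first by exists 1.
    by have [e e0 h] := pow_sub1_lower R n0; exists e.
  have [ea ea0 ha] := P al; have [eb eb0 hb'] := P be.
  exists (Num.min ea eb); first by rewrite lt_min ea0.
  move=> n; rewrite !inE => /orP[] /eqP -> n0 y; rewrite le_min => /andP[h1 h2]; auto.
have [d1 d10 hd] := coprime_pow_near1 cop e10.
pose d0 := Num.min d1 1; have d00 : 0 < d0 by rewrite lt_min d10 ltr01.
have d0d1 : d0 <= d1 by rewrite ge_min lexx.
have d01 : d0 <= 1 by rewrite ge_min lexx orbT.
pose m := Num.min (cabs Z0) (cabs W0); have m0 : 0 < m by rewrite lt_min cz.
have mz : m <= cabs Z0 by rewrite ge_min lexx.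
have mw : m <= cabs W0 by rewrite ge_min lexx orbT.
(* This gives 16 M r <= d0 m, so the variation of Z and W contributes at most d0 / 2 to eta^n - 1,
   and the ratios contribute the other half. *)
pose r := Num.min (Num.min rho 1) (d0 * m / (16 * (M + 1))).
have M1 : 0 < 16 * (M + 1) by lra.
have r0 : 0 < r by rewrite !lt_min rho0 ltr01 divr_gt0 // mulr_gt0.
have rrho : r <= rho by rewrite !ge_min lexx.
have r1 : r <= 1 by rewrite !ge_min lexx orbT.
have rM : 16 * (M * r) <= d0 * m.
  apply: le_trans (_ : r * (16 * (M + 1)) <= _); first by lra.
  by rewrite -ler_pdivlMr // ge_min lexx orbT.
exists r, (d0 / 2); split=> //; first by rewrite divr_gt0.
move=> p p' /punctured_bidiscP [hx hu u0] /punctured_bidiscP [hx' hu' u'0] thz thw tz tw.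
set x := p.1 - xi0 in hx; set x' := p'.1 - xi0 in hx'.
have hxr := le_trans (ltW hx) rrho; have hur := le_trans (ltW hu) rrho.
have hxr' := le_trans (ltW hx') rrho; have hur' := le_trans (ltW hu') rrho.
have ex : cabs (p'.1 - p.1) = cabs (x' - x) by congr cabs; rewrite /x /x'; ring.
have [z1 z2 _] := branch_nearZ hb hZsmall hxr hur; have [z1' _ _] := branch_nearZ hb hZsmall hxr' hur'.
have [w1 w2 _] := branch_nearW hb hWsmall hxr hur; have [w1' _ _] := branch_nearW hb hWsmall hxr' hur'.
have [nz' nw'] := branch_neq0 hb Z00 W00 hZsmall hWsmall hxr' hur'.
have Rz := @coord_ratio al _ _ _ _ _ _ Z00 z2 u0 u'0 nz'; have Rw := @coord_ratio be _ _ _ _ _ _ W00 w2 u0 u'0 nw'.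
rewrite /= in Rz Rw; have {}Rz := Rz (le_trans tz _); have {}Rw := Rw (le_trans tw _).
have dd : d0 / 2 <= 1 by rewrite ler_pdivrMr // mul1r (le_trans d01) // ler1n.
have {}Rz := Rz dd; have {}Rw := Rw dd.
have Lz := br_lipZ hb hxr hur hxr' hur'; have Lw := br_lipW hb hxr hur hxr' hur'.
have sm (F F' F0 : R[i]) : m <= cabs F0 -> cabs (F - F0) <= M * cabs p.2 ->
    cabs (F' - F0) <= M * cabs p'.2 -> 4 / cabs F0 * cabs (F' - F) <= d0 / 2.
  move=> mF h1 h2; have cF : 0 < cabs F0 by exact: lt_le_trans mF.
  rewrite mulrAC ler_pdivrMr //.
  have tri := cabs_triB F' F0 F; rewrite [cabs (F0 - F)]cabsB in tri.
  have i1 : M * cabs p.2 <= M * r by rewrite ler_wpM2l // ltW.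
  have i2 : M * cabs p'.2 <= M * r by rewrite ler_wpM2l // ltW.
  have i3 : d0 * m <= d0 * cabs F0 by rewrite ler_wpM2l // ltW.
  exact: half_step tri h1 h2 i1 i2 rM i3.
have Sz := sm _ _ _ mz z1 z1'; have Sw := sm _ _ _ mw w1 w1'.
have tz' : cabs (thz - 1) <= d0 / 2 := tz; have tw' : cabs (thw - 1) <= d0 / 2 := tw.
have eta1 : cabs (p'.2 / p.2 - 1) <= e1.
  by apply: hd; [apply: le_trans Rz _ | apply: le_trans Rw _]; apply: le_trans d0d1; rewrite [leRHS]splitr; exact: lerD.
have cu : 0 < cabs p.2 by rewrite cabs_gt0.
have etaE : cabs (p'.2 / p.2 - 1) * cabs p.2 = cabs (p'.2 - p.2).
  by rewrite -cabsM; congr cabs; field.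
have fin (F0 F F' : R[i]) n (th : R[i]) : n \in [:: al; be] -> (0 < n)%N -> m <= cabs F0 ->
    cabs (F' - F) <= M * (cabs (x' - x) + cabs (p'.2 - p.2)) ->
    cabs ((p'.2 / p.2) ^+ n - 1) <= 4 / cabs F0 * cabs (F' - F) + cabs (th - 1) ->
    cabs (p'.2 - p.2) <= cabs (x' - x) + 4 * cabs (th - 1).
  move=> hn n0 mF hF hR; have h1 := le_trans (he n hn n0 _ eta1) hR.
  rewrite -etaE in hF *; apply: (radius_step m0 mF M0 r0 r1 _ _ _ (ltW cu) (ltW hu) h1 hF); rewrite ?cabs_ge0 //.
  by apply: le_trans rM _; rewrite ler_piMl // ltW.
have c1 := cabs_ge0 (thz - 1); have c2 := cabs_ge0 (thw - 1); rewrite ex.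
case: (posnP al) => al0.
  have be0 : (0 < be)%N by case: be al0 cop => // ->.
  have hin : be \in [:: al; be] by rewrite !inE eqxx orbT.
  by apply: le_trans (fin W0 _ _ be thw hin be0 mw Lw Rw) _; rewrite lerD2l mulrDr lerDr mulr_ge0.
have hin : al \in [:: al; be] by rewrite !inE eqxx.
by apply: le_trans (fin Z0 _ _ al thz hin al0 mz Lz Rz) _; rewrite lerD2l mulrDr lerDl mulr_ge0.
Qed.

End OneBranch.

End Separation.

(** * The embedding property of one branch *)

Section EmbeddingAndSeparation.
Variable R : realType.
Notation term := (R[i] * (nat * nat))%type.

Section OneBranch.
Variables (s : seq term) (c al be : nat) (kap Z0 W0 : R[i]) (rho M : R).
Variables (Zh ZX ZU Wh WX WU : R[i] -> R[i] -> R[i]) (xi0 : R[i]).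
Hypothesis hb : branch s c al be kap Z0 W0 rho M Zh ZX ZU Wh WX WU.
Hypotheses (kap0 : kap != 0) (Z00 : Z0 != 0) (W00 : W0 != 0).
Hypothesis hc : {in s, forall t : term, (al * t.2.1 + be * t.2.2 <= c)%N}.
Hypotheses (hZsmall : 2 * (M * rho) <= cabs Z0) (hWsmall : 2 * (M * rho) <= cabs W0).

Lemma ratio_continuous (g : C2 R -> Cplx R) (q : C2 R) : {for q, continuous g} -> g q != 0 ->
  forall e : R, 0 < e -> \forall q' \near q, cabs (g q / g q' - 1) < e.
Proof.
move=> cg g0 e e0.
have c1 : (fun q' => g q / g q') @ q --> (g q / g q : Cplx R).
  by apply: cvgM; [exact: cvg_cst | exact: cvgV].
have e0' : 0 < e%:C :> R[i] by rewrite ltcR.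
move/cvgrPdist_lt: c1 => /(_ _ e0'); apply: filterS => q'.
by rewrite divff // norm_cabs ltcR cabsB.
Qed.

Lemma Jmap_embedding (f : C2 R -> Cplx R) : coprime al be ->
  (forall q, {for q, continuous f}) ->
  (forall p, punctured_bidisc xi0 rho p -> f (Jmap xi0 al be Zh Wh p) = p.1) ->
  exists2 r : R, 0 < r & forall eps, 0 < eps <= r ->
    holomorphic_embedding (punctured_bidisc xi0 eps) (Jmap xi0 al be Zh Wh).
Proof.
move=> cop cf fJ; have [r [dl [r0 rrho dl0 lip]]] := Jmap_inverse_lip xi0 hb Z00 W00 hZsmall hWsmall cop.
exists r => // eps /andP[eps0 epsr].
pose J := Jmap xi0 al be Zh Wh; pose D := punctured_bidisc xi0 eps.
have Dr p : D p -> punctured_bidisc xi0 r p.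
  move=> /punctured_bidiscP [h1 h2 h3]; apply/punctured_bidiscP.
  by split=> //; [apply: lt_le_trans h1 _|apply: lt_le_trans h2 _].
have Drho p : D p -> punctured_bidisc xi0 rho p.
  move=> /punctured_bidiscP [h1 h2 h3]; apply/punctured_bidiscP; have h := le_trans epsr rrho.
  by split=> //; [apply: lt_le_trans h1 _|apply: lt_le_trans h2 _].
have tor p : D p -> torus (J p).
  by move=> /Drho hp; exact: (Jmap_torus hb Z00 W00 hZsmall hWsmall).
have lipJ p p' : D p -> D p' -> cabs ((J p).1 / (J p').1 - 1) <= dl ->
    cabs ((J p).2 / (J p').2 - 1) <= dl ->
    cabs (p'.2 - p.2) <= cabs (p'.1 - p.1) +
      4 * (cabs ((J p).1 / (J p').1 - 1) + cabs ((J p).2 / (J p').2 - 1)).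
  by move=> hp hp'; exact: lip (Dr _ hp) (Dr _ hp').
have inj p p' : D p -> D p' -> J p = J p' -> p = p'.
  move=> hp hp' e; have e1 : p.1 = p'.1 by rewrite -(fJ _ (Drho _ hp)) -(fJ _ (Drho _ hp')); congr f.
  have [n1 n2] := tor p' hp'.
  have := lipJ p p' hp hp'; rewrite e !divff // subrr cabs0 e1 subrr cabs0 => /(_ (ltW dl0) (ltW dl0)).
  rewrite addr0 mulr0 addr0 => h; have : cabs (p'.2 - p.2) = 0 by apply/eqP; rewrite eq_le h cabs_ge0.
  move/eqP; rewrite cabs_eq0 subr_eq0 => /eqP e2.
  by case: p p' e1 e2 {hp hp' e n1 n2 h} => a b [a' b'] /= -> ->.
split.
- by move=> p /Drho hp; exact: (@ex_diff _ _ _ _ _ _ _ (Jmap_is_diff hb hp)).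
- by move=> p /Drho hp; exact: (Jmap_diff_injective hb kap0 hp).
(* The inverse is chosen pointwise, with default (0, 0) off the image. Its first component is
   continuous because it equals [f], its second by the Lipschitz bound in the coordinate ratios. *)
pose G (q : C2 R) : C2 R := xget (0, 0) [set p | D p /\ J p = q].
have GJ p : D p -> G (J p) = p.
  move=> hp; rewrite /G; case: xgetP => [p' _ [hp' e]|/(_ p)]; first exact: inj.
  by case.
exists G; split=> //; apply/subspace_continuousP => _ [p hp <-].
have [n1 n2] := tor p hp.
apply/cvgrPdist_lt => e e0.
have [e1 ee e10] : exists2 r', e = r'%:C & 0 < r'.
  exists (complex.Re e); last by rewrite -ltcR RRe_real ?gtr0_real.
  by rewrite RRe_real ?gtr0_real.
(* The second component moves by at most e2 + 4 (e2 + e2) = 9 e2 < e1. *)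
pose e2 := Num.min dl (e1 / 16).
have e20 : 0 < e2 by rewrite lt_min dl0 divr_gt0.
have N1 : \forall q' \near J p, cabs ((J p).1 / q'.1 - 1) < e2.
  have c1 : {for J p, continuous (fun q : C2 R => q.1 : Cplx R)} by exact: cvg_fst.
  exact: ratio_continuous c1 n1 _ e20.
have N2 : \forall q' \near J p, cabs ((J p).2 / q'.2 - 1) < e2.
  have c2 : {for J p, continuous (fun q : C2 R => q.2 : Cplx R)} by exact: cvg_snd.
  exact: ratio_continuous c2 n2 _ e20.
have N3 : \forall q' \near J p, cabs (f (J p) - f q') < e2.
  have e2C : 0 < e2%:C :> R[i] by rewrite ltcR.
  have /cvgrPdist_lt /(_ _ e2C) := cf (J p).
  by apply: filterS => q'; rewrite norm_cabs ltcR.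
rewrite near_withinE; near=> q' => -[p' hp' eq'].
have h1 : cabs ((J p).1 / q'.1 - 1) < e2 by near: q'.
have h2 : cabs ((J p).2 / q'.2 - 1) < e2 by near: q'.
have h3 : cabs (f (J p) - f q') < e2 by near: q'.
have Gq' : G q' = p' by rewrite -eq'; exact: GJ.
have -> : G (J p) - G q' = p - p' by rewrite Gq' GJ.
rewrite -eq' in h1 h2 h3; rewrite (fJ _ (Drho _ hp)) (fJ _ (Drho _ hp')) in h3.
have e2dl : e2 <= dl by rewrite ge_min lexx.
have e2e : e2 <= e1 / 16 by rewrite ge_min lexx orbT.
have := lipJ p p' hp hp' (le_trans (ltW h1) e2dl) (le_trans (ltW h2) e2dl).
rewrite [cabs (p'.1 - _)]cabsB [cabs (p'.2 - _)]cabsB => h4.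
rewrite prod_normE /= ee comparable_gt_max; last first.
  by rewrite real_comparable // normr_real.
rewrite !norm_cabs !ltcR; apply/andP; split.
  by apply: lt_le_trans h3 _; lra.
by apply: le_lt_trans h4 _; lra.
Unshelve. all: by end_near.
Qed.

End OneBranch.
End EmbeddingAndSeparation.

(** * Disjointness of different branches *)

Section Disjointness.
Variable R : realType.
Notation term := (R[i] * (nat * nat))%type.

(** The factors P and Q share the range from L to B, while two different powers of a differ by a
    factor of at most a < L / B. *)
Lemma power_gap (n m : nat) (a P Q L B : R) : n <> m -> 0 < a -> a <= 1 -> 0 < L ->
  L <= P <= B -> L <= Q <= B -> a * B < L -> a ^+ n * P <> a ^+ m * Q.
Proof.
wlog : n m P Q / (n < m)%N => [hw nm a0 a1 L0 hP hQ aB e|nm _ a0 a1 L0 /andP[P1 P2] /andP[Q1 Q2] aB e].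
  case: (ltngtP n m) => h; [exact: (hw n m P Q)| |exact: nm].
  by apply: (hw m n Q P) => //; do ?[by rewrite e | by move=> e'; apply: nm].
have mE : m = (n + (m - n).-1.+1)%N by lia.
have an : 0 < a ^+ n by exact: exprn_gt0.
move: e; rewrite mE exprD -mulrA => /(mulfI (lt0r_neq0 an)) e.
have : a ^+ (m - n).-1.+1 * Q <= a * B.
  rewrite exprS -mulrA ler_wpM2l ?(ltW a0) //; apply: le_trans Q2.
  by rewrite ler_piMl ?exprn_ile1 ?(ltW a0) //; lra.
by rewrite -e; lra.
Qed.

Lemma abs_bounds_prod (x y X Y : R) n m : 0 < X -> 0 < Y ->
  X / 2 <= x <= 2 * X -> Y / 2 <= y <= 2 * Y ->
  (X / 2) ^+ n * (Y / 2) ^+ m <= x ^+ n * y ^+ m <= (2 * X) ^+ n * (2 * Y) ^+ m.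
Proof.
move=> X0 Y0 /andP[x1 x2] /andP[y1 y2].
by apply/andP; split; apply: ler_pM; rewrite ?exprn_ge0 ?lerXn2r ?nnegrE //; lra.
Qed.

(** At a common point the moduli give |u'|^al' X = |u|^al X' and |u'|^be' Y = |u|^be Y'. Raising
    these to the powers be' and al' eliminates |u'| and leaves two different powers of |u| with
    bounded factors. *)
Lemma Jmap_disjoint_normals (s : seq term) c al be kap Z0 W0 rho M Zh ZX ZU Wh WX WU
    c' al' be' kap' Z0' W0' rho' M' Zh' ZX' ZU' Wh' WX' WU' (xi0 : R[i]) :
  branch s c al be kap Z0 W0 rho M Zh ZX ZU Wh WX WU ->
  branch s c' al' be' kap' Z0' W0' rho' M' Zh' ZX' ZU' Wh' WX' WU' ->
  Z0 != 0 -> W0 != 0 -> Z0' != 0 -> W0' != 0 ->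
  2 * (M * rho) <= cabs Z0 -> 2 * (M * rho) <= cabs W0 ->
  2 * (M' * rho') <= cabs Z0' -> 2 * (M' * rho') <= cabs W0' ->
  (al * be' <> be * al')%N ->
  exists2 r : R, 0 < r & forall p p' : C2 R,
    punctured_bidisc xi0 r p -> punctured_bidisc xi0 r p' ->
    Jmap xi0 al be Zh Wh p <> Jmap xi0 al' be' Zh' Wh' p'.
Proof.
move=> hb hb' Z00 W00 Z00' W00' hZ hW hZ' hW' hn.
have cZ : 0 < cabs Z0 by rewrite cabs_gt0. have cW : 0 < cabs W0 by rewrite cabs_gt0.
have cZ' : 0 < cabs Z0' by rewrite cabs_gt0. have cW' : 0 < cabs W0' by rewrite cabs_gt0.
pose L1 := (cabs Z0' / 2) ^+ be' * (cabs W0 / 2) ^+ al'.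
pose B1 := (2 * cabs Z0') ^+ be' * (2 * cabs W0) ^+ al'.
pose L2 := (cabs W0' / 2) ^+ al' * (cabs Z0 / 2) ^+ be'.
pose B2 := (2 * cabs W0') ^+ al' * (2 * cabs Z0) ^+ be'.
pose L := Num.min L1 L2; pose B := Num.max B1 B2.
have L0 : 0 < L by rewrite lt_min !mulr_gt0 // exprn_gt0 // divr_gt0.
have B0 : 0 < B by rewrite lt_max !mulr_gt0 // exprn_gt0 // mulr_gt0.
pose r := Num.min (Num.min rho rho') (Num.min 1 (L / B)).
have r0 : 0 < r by rewrite !lt_min (br_rho hb) (br_rho hb') ltr01 divr_gt0.
exists r => // p p' /punctured_bidiscP [hx hu u0] /punctured_bidiscP [hx' hu' u0'] e.
have rr : r <= rho by rewrite !ge_min lexx.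
have rr' : r <= rho' by rewrite !ge_min lexx orbT.
have r1 : r <= 1 by rewrite !ge_min lexx !orbT.
have rB : r <= L / B by rewrite !ge_min lexx !orbT.
have [_ z1 z2] := branch_nearZ hb hZ (le_trans (ltW hx) rr) (le_trans (ltW hu) rr).
have [_ w1 w2] := branch_nearW hb hW (le_trans (ltW hx) rr) (le_trans (ltW hu) rr).
have [_ z1' z2'] := branch_nearZ hb' hZ' (le_trans (ltW hx') rr') (le_trans (ltW hu') rr').
have [_ w1' w2'] := branch_nearW hb' hW' (le_trans (ltW hx') rr') (le_trans (ltW hu') rr').
case: e => /(congr1 (@Normc.normc R)) + /(congr1 (@Normc.normc R)).
rewrite !cabsM -!exprnN !cabsV !cabsX.
set X := cabs (Zh _ _) in z1 z2 *; set Y := cabs (Wh _ _) in w1 w2 *.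
set X' := cabs (Zh' _ _) in z1' z2' *; set Y' := cabs (Wh' _ _) in w1' w2' *.
have a0 : 0 < cabs p.2 by rewrite cabs_gt0. have a0' : 0 < cabs p'.2 by rewrite cabs_gt0.
set a := cabs p.2 in hu a0 *; set a' := cabs p'.2 in hu' a0' *.
move=> e1 e2.
have pa n : a ^+ n != 0 by rewrite expf_neq0 // lt0r_neq0.
have pa' n : a' ^+ n != 0 by rewrite expf_neq0 // lt0r_neq0.
have e1' : a' ^+ al' * X = a ^+ al * X'.
  have := pa al; have := pa' al'; move: e1; move: (a ^+ al) (a' ^+ al') => y z e z0 y0.
  have -> : z * X = y * z * (y^-1 * X) by field.
  by rewrite e; field.
have e2' : a' ^+ be' * Y = a ^+ be * Y'.
  have := pa be; have := pa' be'; move: e2; move: (a ^+ be) (a' ^+ be') => y z e z0 y0.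
  have -> : z * Y = y * z * (y^-1 * Y) by field.
  by rewrite e; field.
have E : a ^+ (al * be') * (X' ^+ be' * Y ^+ al') = a ^+ (be * al') * (Y' ^+ al' * X ^+ be').
  have f1 : (a' ^+ al' * X) ^+ be' = (a ^+ al * X') ^+ be' by rewrite e1'.
  have f2 : (a' ^+ be' * Y) ^+ al' = (a ^+ be * Y') ^+ al' by rewrite e2'.
  rewrite !exprMn -!exprM in f1 f2; apply: (mulfI (pa' (be' * al')%N)).
  rewrite mulrCA [X in X = _](_ : _ = (a ^+ (al * be') * X' ^+ be') * (a' ^+ (be' * al') * Y ^+ al')); last ring.
  by rewrite -f1 f2 [(al' * be')%N]mulnC; ring.
have P1 := abs_bounds_prod be' al' cZ' cW (introT andP (conj z1' z2')) (introT andP (conj w1 w2)).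
have P2 := abs_bounds_prod al' be' cW' cZ (introT andP (conj w1' w2')) (introT andP (conj z1 z2)).
apply: (@power_gap (al * be')%N (be * al')%N a _ _ L B) E => //.
- by apply: ltW; apply: lt_le_trans hu r1.
- by case/andP: P1 => i1 i2; rewrite ge_min i1 le_max i2.
- by case/andP: P2 => i1 i2; rewrite ge_min i1 le_max i2 !orbT.
- by rewrite -ltr_pdivlMr //; apply: lt_le_trans hu rB.
Qed.

(** At a common point the powers of u and u' cancel and Z^be W'^al = Z'^be W^al holds exactly; by
    continuity this fails near base points where it fails. *)
Lemma Jmap_disjoint_roots (s : seq term) c al be kap Z0 W0 rho M Zh ZX ZU Wh WX WU
    kap' Z0' W0' rho' M' Zh' ZX' ZU' Wh' WX' WU' (xi0 : R[i]) :
  branch s c al be kap Z0 W0 rho M Zh ZX ZU Wh WX WU ->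
  branch s c al be kap' Z0' W0' rho' M' Zh' ZX' ZU' Wh' WX' WU' ->
  2 * (M * rho) <= cabs Z0 -> 2 * (M * rho) <= cabs W0 ->
  2 * (M' * rho') <= cabs Z0' -> 2 * (M' * rho') <= cabs W0' ->
  Z0 ^+ be * W0' ^+ al <> Z0' ^+ be * W0 ^+ al ->
  exists2 r : R, 0 < r & forall p p' : C2 R,
    punctured_bidisc xi0 r p -> punctured_bidisc xi0 r p' ->
    Jmap xi0 al be Zh Wh p <> Jmap xi0 al be Zh' Wh' p'.
Proof.
move=> hb hb' hZ hW hZ' hW' hn.
pose T := (R[i] * R[i] * R[i] * R[i])%type.
pose d (t : T) := cabs (t.1.1.1 - Z0) + cabs (t.1.1.2 - W0) + cabs (t.1.2 - Z0') + cabs (t.2 - W0').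
have d0 t : 0 <= d t by rewrite !addr_ge0 // cabs_ge0.
have cg0 := @cabs_ge0 R.
have t1 : tends d (fun t => t.1.1.1) Z0.
  apply: (@tends_lip _ _ _ 1) => // t; rewrite /d mul1r.
  by have := cg0 (t.1.1.2 - W0); have := cg0 (t.1.2 - Z0'); have := cg0 (t.2 - W0'); lra.
have t2 : tends d (fun t => t.1.1.2) W0.
  apply: (@tends_lip _ _ _ 1) => // t; rewrite /d mul1r.
  by have := cg0 (t.1.1.1 - Z0); have := cg0 (t.1.2 - Z0'); have := cg0 (t.2 - W0'); lra.
have t3 : tends d (fun t => t.1.2) Z0'.
  apply: (@tends_lip _ _ _ 1) => // t; rewrite /d mul1r.
  by have := cg0 (t.1.1.1 - Z0); have := cg0 (t.1.1.2 - W0); have := cg0 (t.2 - W0'); lra.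
have t4 : tends d (fun t => t.2) W0'.
  apply: (@tends_lip _ _ _ 1) => // t; rewrite /d mul1r.
  by have := cg0 (t.1.1.1 - Z0); have := cg0 (t.1.1.2 - W0); have := cg0 (t.1.2 - Z0'); lra.
have tt := tendsD (tendsM (tendsX be t1) (tendsX al t4))
  (tendsM (tends_cst d (-1)) (tendsM (tendsX be t3) (tendsX al t2))).
have nz : Z0 ^+ be * W0' ^+ al + -1 * (Z0' ^+ be * W0 ^+ al) != 0.
  by rewrite mulN1r subr_eq0; apply/eqP.
have [dl dl0 hd] := tends_neq0 tt nz.
have M0 := br_M hb; have M0' := br_M hb'.
pose K := 2 * M + 2 * M' + 1; have K0 : 0 < K by rewrite /K; lra.
pose r := Num.min (Num.min rho rho') (dl / K).
have r0 : 0 < r by rewrite !lt_min (br_rho hb) (br_rho hb') divr_gt0.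
have rr : r <= rho by rewrite !ge_min lexx.
have rr' : r <= rho' by rewrite !ge_min lexx orbT.
have rK : K * r <= dl by rewrite mulrC -ler_pdivlMr // !ge_min lexx orbT.
exists r => // p p' /punctured_bidiscP [hx hu u0] /punctured_bidiscP [hx' hu' u0'] e.
have [z1 _ _] := branch_nearZ hb hZ (le_trans (ltW hx) rr) (le_trans (ltW hu) rr).
have [w1 _ _] := branch_nearW hb hW (le_trans (ltW hx) rr) (le_trans (ltW hu) rr).
have [z1' _ _] := branch_nearZ hb' hZ' (le_trans (ltW hx') rr') (le_trans (ltW hu') rr').
have [w1' _ _] := branch_nearW hb' hW' (le_trans (ltW hx') rr') (le_trans (ltW hu') rr').
have i1 : M * cabs p.2 <= M * r by rewrite ler_wpM2l // ltW.
have i2 : M' * cabs p'.2 <= M' * r by rewrite ler_wpM2l // ltW.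
case: e; rewrite -!exprnN.
move: z1 w1 z1' w1'; set z := Zh _ _; set w := Wh _ _; set z' := Zh' _ _; set w' := Wh' _ _.
move=> z1 w1 z1' w1' e1 e2.
have /hd : d (z, w, z', w') <= dl by rewrite /d /=; rewrite /K in rK; lra.
rewrite /= mulN1r subr_eq0 => /eqP; apply.
have pu n : (p.2 : R[i]) ^+ n != 0 by rewrite expf_neq0.
have zE : z = (p.2 : R[i]) ^+ al * ((p'.2 : R[i]) ^+ al)^-1 * z' by rewrite -mulrA -e1 mulVKf.
have wE : w = (p.2 : R[i]) ^+ be * ((p'.2 : R[i]) ^+ be)^-1 * w' by rewrite -mulrA -e2 mulVKf.
by rewrite zE wE !exprMn !exprVn -!exprM [(be * al)%N]mulnC; ring.
Qed.

End Disjointness.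

(** * Covering near one base point *)

Section LocalCovering.
Variable R : realType.
Notation term := (R[i] * (nat * nat))%type.

Lemma qhom_factorW (s : seq term) c al be (u Z W W' x : R[i]) :
  qhom s c al be id u Z W' x - qhom s c al be id u Z W x =
  (W' - W) * \sum_(t <- s) t.1 * u ^+ wgt c al be t * Z ^+ t.2.1 *
     \sum_(i < t.2.2) W' ^+ (t.2.2.-1 - i) * W ^+ i.
Proof.
rewrite /qhom opprB addrA subrK /msum -sumrB mulr_sumr.
apply: eq_bigr => t _; rewrite -mulrBr subrXX.
by move: (\sum_(i < _) _) => S; ring.
Qed.

Lemma triv_tends4 (a b e g : R[i]) :
  let d (t : R[i] * R[i] * R[i] * R[i]) :=
    cabs (t.1.1.1 - a) + cabs (t.1.1.2 - b) + cabs (t.1.2 - e) + cabs (t.2 - g) in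
  [/\ tends d (fun t => t.1.1.1) a, tends d (fun t => t.1.1.2) b,
      tends d (fun t => t.1.2) e & tends d (fun t => t.2) g].
Proof.
move=> d; have cg0 := @cabs_ge0 R.
have d0 t : 0 <= d t by rewrite !addr_ge0 // cabs_ge0.
split; apply: (@tends_lip _ _ _ 1) => // t; rewrite /d mul1r;
  by have := cg0 (t.1.1.1 - a); have := cg0 (t.1.1.2 - b); have := cg0 (t.1.2 - e);
     have := cg0 (t.2 - g); lra.
Qed.

(** The radii of [local_cover_pos]: [r] bounds the distance of the rescaling factor from 1, and
    [dl], chosen after [r], is the tolerance on the given point. *)
Lemma cover_radii (eps r1 r2 r3 w0 M : R) : 0 < eps -> 0 < r1 -> 0 < r2 -> 0 < r3 -> 0 < w0 -> 0 <= M ->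
  exists r dl : R, [/\ 0 < r, r < 1, 0 < dl, 2 * dl < eps & [/\ dl + r + r <= r1, r + dl <= r2,
    M * dl <= 4^-1 * w0, dl + M * dl <= r / 2 * w0 & 2 * dl + M * (2 * dl) + r3 / 4 + M * (2 * dl) <= r3]].
Proof.
move=> eps0 r10 r20 r30 w00 M0.
pose r := Num.min (1 / 2) (Num.min (r1 / 4) (r2 / 4)).
have r0 : 0 < r by rewrite !lt_min !divr_gt0.
have rh : r <= 1 / 2 by rewrite ge_min lexx.
have rr1 : r <= r1 / 4 by rewrite !ge_min lexx orbT.
have rr2 : r <= r2 / 4 by rewrite !ge_min lexx !orbT.
pose m := Num.min (Num.min (r * w0 / 4) (r3 / 16)) (Num.min (eps / 4) (Num.min (r1 / 4) (r2 / 4))).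
have m0 : 0 < m by rewrite !lt_min ?divr_gt0 ?mulr_gt0.
pose dl := m / (M + 1); have M1 : 0 < M + 1 by lra.
have dl0 : 0 < dl by rewrite divr_gt0.
have dlE : dl * (M + 1) = m by rewrite /dl divfK // lt0r_neq0.
have Mdl : 0 <= M * dl by rewrite mulr_ge0 // ltW.
have m1 : m <= r * w0 / 4 by rewrite !ge_min lexx.
have m2 : m <= r3 / 16 by rewrite !ge_min lexx orbT.
have m3 : m <= eps / 4 by rewrite !ge_min lexx !orbT.
have m4 : m <= r1 / 4 by rewrite !ge_min lexx !orbT.
have m5 : m <= r2 / 4 by rewrite !ge_min lexx !orbT.
have rw : r * w0 <= 1 / 2 * w0 by rewrite ler_wpM2r // ltW.
by exists r, dl; clearbody r m dl; split; [..|split]; lra.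
Qed.

Section OneBranch.
Variables (s : seq term) (c al be : nat) (kap Z0 W0 : R[i]) (rho M : R).
Variables (Zh ZX ZU Wh WX WU : R[i] -> R[i] -> R[i]).
Hypothesis hb : branch s c al be kap Z0 W0 rho M Zh ZX ZU Wh WX WU.
Hypotheses (Z00 : Z0 != 0) (al0 : (0 < al)%N).
Hypothesis hc : {in s, forall t : term, (al * t.2.1 + be * t.2.2 <= c)%N}.

Let zero_le : cabs (0 : R[i]) <= rho.
Proof. by rewrite cabs0 ltW // (br_rho hb). Qed.

Let al0C : al%:R != 0 :> R[i]. Proof. by rewrite pnatr_eq0 -lt0n. Qed.

(** The uniqueness half of an implicit function theorem: the exact difference quotient of [qhom] in
    W tends to F_W at the base point, which is nonzero because kap F_W = al Z0. *)
Lemma unique_W : exists2 r : R, 0 < r & forall u Z W W' x : R[i],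
  cabs u + cabs (Z - Z0) + cabs (W' - W0) + cabs (W - W0) <= r ->
  qhom s c al be id u Z W x = 0 -> qhom s c al be id u Z W' x = 0 -> W' = W.
Proof.
have [t1 t2 t3 t4] := triv_tends4 0 Z0 W0 W0.
have tH := tends_sum s (fun t => tendsM (tendsM (tendsM (tends_cst _ t.1)
  (tendsX (wgt c al be t) t1)) (tendsX t.2.1 t2))
  (tends_sum (index_enum 'I_t.2.2) (fun i : 'I_t.2.2 => tendsM (tendsX (t.2.2.-1 - i) t3) (tendsX i t4)))).
have H0 : \sum_(t <- s) t.1 * 0 ^+ wgt c al be t * Z0 ^+ t.2.1 *
     \sum_(i < t.2.2) W0 ^+ (t.2.2.-1 - i) * W0 ^+ i = qhomW s c al be id 0 Z0 W0.
  apply: eq_bigr => t _; rewrite (eq_bigr (fun=> W0 ^+ t.2.2.-1)); last first.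
    by move=> i _; rewrite -exprD subnK // -ltnS prednK // (leq_trans _ (ltn_ord i)).
  by rewrite sumr_const card_ord -mulr_natr; ring.
have Hn : qhomW s c al be id 0 Z0 W0 != 0.
  have := br_odeZ hb zero_le zero_le; rewrite mul0r (br_Z0 hb zero_le) (br_W0 hb zero_le).
  move/eqP; rewrite eq_sym subr_eq0 => /eqP e; have : al%:R * Z0 != 0 by rewrite mulf_neq0.
  by rewrite e mulf_eq0 negb_or => /andP[].
rewrite -H0 in Hn; have [r r0 hr] := tends_neq0 tH Hn.
exists r => // u Z W W' x hd e e'.
have hd' : cabs (u - 0) + cabs (Z - Z0) + cabs (W' - W0) + cabs (W - W0) <= r by rewrite subr0.
have h := hr (u, Z, W', W) hd'; rewrite /= in h.
have /eqP := qhom_factorW s c al be u Z W W' x.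
by rewrite e e' subrr eq_sym mulf_eq0 (negbTE h) orbF subr_eq0 => /eqP.
Qed.

(** The data (v y, y^al Z, y^be W) describe the same point (z, w) for every y. A factor y near 1 is
    found for which the first coordinate lies on the branch at u = v y, and [unique_W] then forces
    the second one onto it. *)
Lemma local_cover_pos (eps : R) : 0 < eps <= rho -> exists2 dl : R, 0 < dl &
  forall v Z W x : R[i], v != 0 -> cabs v <= dl -> cabs x < eps -> cabs (Z - Z0) <= dl ->
    cabs (W - W0) <= dl -> qhom s c al be id v Z W x = 0 ->
    exists u : R[i], [/\ u != 0, cabs u < eps,
      u ^ (- al%:Z) * Zh x u = v ^ (- al%:Z) * Z & u ^ (- be%:Z) * Wh x u = v ^ (- be%:Z) * W].
Proof.
move=> /andP[eps0 epsr]; have M0 := br_M hb; have rho0 := br_rho hb.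
have [r3 r30 uW] := unique_W.
pose w0 := cabs (al%:R * Z0); have w00 : 0 < w0 by rewrite cabs_gt0 mulf_neq0.
(* difference quotient of [eta^al Z / (al Z0)] at [eta = 1] *)
have [s1 s2 s3 s4] := triv_tends4 Z0 1 1 W0.
have tS := tendsM (tendsM (tends_cst _ (al%:R * Z0)^-1) s1) (tends_sum (index_enum 'I_al)
   (fun i : 'I_al => tendsM (tendsX (al.-1 - i) s2) (tendsX i s3))).
have S1 : (al%:R * Z0)^-1 * Z0 * (\sum_(i < al) 1 ^+ (al.-1 - i) * 1 ^+ i) = 1.
  rewrite (eq_bigr (fun=> 1)); last by move=> i _; rewrite !expr1n mulr1.
  by rewrite sumr_const card_ord; field; rewrite Z00 al0C.
rewrite S1 in tS; have q0 : 0 < 4^-1 :> R by rewrite invr_gt0.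
have [r1 r10 hS] := tS _ q0.
have tW := tendsM (tendsX be s2) s4; rewrite expr1n mul1r in tW.
have r34 : 0 < r3 / 4 by rewrite divr_gt0.
have [r2 r20 hWt] := tW _ r34.
have [r [dl [r0 r_lt1 dl0 dle [f1 f2 f3 f4 f5]]]] := cover_radii eps0 r10 r20 r30 w00 M0.
have M2 : 0 <= M * dl by rewrite mulr_ge0 // ltW.
have q4 : 4^-1 + 4^-1 <= 2^-1 :> R by lra.
exists dl => // v Z W x v0 hv hx hZ hW hq.
have hx' : cabs x <= rho by apply: le_trans (ltW hx) epsr.
have ball2 y : cabs (y - 1) <= r -> cabs (v * y) <= 2 * dl.
  move=> hy; have y2 : cabs y <= 2.
    rewrite -[y](subrK 1); apply: le_trans (cabsD _ _) _.
    by rewrite cabs1 -[2]/(1 + 1) lerD2r (le_trans hy) // ltW.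
  by rewrite cabsM mulrC; apply: ler_pM => //; exact: cabs_ge0.
have vy y : cabs (y - 1) <= r -> cabs (v * y) <= rho.
  by move=> /ball2 h; apply: le_trans h _; apply: le_trans epsr; exact: ltW.
(* A simplified Newton map for y^al Z = Zh x (v y), with the slope frozen at al Z0, the derivative
   at y = 1 of the left side when Z = Z0. *)
pose Phi y := y - (y ^+ al * Z - Zh x (v * y)) / (al%:R * Z0).
have wn : al%:R * Z0 != 0 by rewrite mulf_neq0.
have lip y y' : cabs (y - 1) <= r -> cabs (y' - 1) <= r -> cabs (Phi y - Phi y') <= cabs (y - y') / 2.
  move=> hy hy'.
  pose S := \sum_(i < al) y ^+ (al.-1 - i) * y' ^+ i.
  have SE : y ^+ al - y' ^+ al = (y - y') * S by rewrite subrXX.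
  have -> : Phi y - Phi y' = (y - y') * (1 - (al%:R * Z0)^-1 * Z * S) +
      (Zh x (v * y) - Zh x (v * y')) / (al%:R * Z0).
    have e : y ^+ al = (y - y') * S + y' ^+ al by rewrite -SE subrK.
    by rewrite /Phi e; field; rewrite Z00 al0C.
  apply: le_trans (cabsD _ _) _; rewrite !cabsM cabsV -/w0.
  have hS' : cabs (1 - (al%:R * Z0)^-1 * Z * S) <= 4^-1.
    rewrite cabsB; apply: (hS (Z, y, y', W0)) => /=; rewrite subrr cabs0 addr0.
    by apply: le_trans f1; apply: lerD; first exact: lerD.
  have i1 : cabs (y - y') * cabs (1 - (al%:R * Z0)^-1 * Z * S) <= cabs (y - y') * 4^-1.
    by rewrite ler_wpM2l // cabs_ge0.
  have i2 : cabs (Zh x (v * y) - Zh x (v * y')) <= M * dl * cabs (y - y').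
    apply: le_trans (br_lipZ hb hx' (vy _ hy') hx' (vy _ hy)) _.
    by rewrite subrr cabs0 add0r -mulrBr cabsM -mulrA ler_wpM2l // ler_wpM2r // cabs_ge0.
  have i3 : cabs (Zh x (v * y) - Zh x (v * y')) / w0 <= cabs (y - y') / 4.
    rewrite ler_pdivrMr //; apply: le_trans i2 _; rewrite mulrC -mulrA ler_wpM2l ?cabs_ge0 //.
  by apply: le_trans (lerD i1 i3) _; rewrite -mulrDr ler_wpM2l ?cabs_ge0.
have start : cabs (Phi 1 - 1) <= r / 2.
  rewrite /Phi expr1n mul1r mulr1 addrAC subrr add0r cabsN cabsM cabsV -/w0 ler_pdivrMr //.
  have h1 : cabs (1 - 1 : R[i]) <= r by rewrite subrr cabs0 ltW.
  have z := br_lipZ hb hx' zero_le hx' (vy 1 h1).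
  rewrite mulr1 subrr subr0 cabs0 add0r (br_Z0 hb hx') in z.
  have Mv : M * cabs v <= M * dl by rewrite ler_wpM2l.
  apply: le_trans (cabs_triB Z Z0 (Zh x v)) _; apply: le_trans f4; apply: lerD => //.
  by rewrite cabsB (le_trans z).
have [y hy fy] := complex_fixpoint r0 lip start.
have yZ : y ^+ al * Z = Zh x (v * y).
  move: fy; rewrite /Phi => /eqP; rewrite subr_eq addrC -subr_eq subrr eq_sym mulf_eq0.
  by rewrite invr_eq0 (negbTE wn) orbF subr_eq0 => /eqP.
have y0 : y != 0.
  by apply: contraTneq hy => ->; rewrite sub0r cabsN cabs1 -ltNge.
pose u := v * y; have u0 : u != 0 by rewrite mulf_neq0.
have hu2 := ball2 y hy; have hur := vy y hy.
have cv0 := cabs_ge0 v.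
have z1 := br_lipZ hb hx' zero_le hx' hur; rewrite subrr subr0 cabs0 add0r (br_Z0 hb hx') in z1.
have w1 := br_lipW hb hx' zero_le hx' hur; rewrite subrr subr0 cabs0 add0r (br_W0 hb hx') in w1.
have Mu : M * cabs (v * y) <= M * (2 * dl) by rewrite ler_wpM2l.
have hW' : cabs (y ^+ be * W - W0) <= r3 / 4.
  have hd2 : cabs (Z0 - Z0) + cabs (y - 1) + cabs (1 - 1 : R[i]) + cabs (W - W0) <= r2.
    by rewrite !subrr !cabs0 addr0 add0r; apply: le_trans f2; exact: lerD.
  exact: hWt (Z0, y, 1, W) hd2.
have qy : qhom s c al be id u (Zh x u) (y ^+ be * W) x = 0.
  by rewrite /u -yZ [v * y]mulrC (qhom_scale hc) hq mulr0.
have WE : y ^+ be * W = Wh x u.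
  apply: uW (br_F hb hx' hur) qy; apply: le_trans f5.
  apply: lerD; last exact: le_trans w1 Mu.
  by apply: lerD => //; apply: lerD => //; exact: le_trans z1 Mu.
exists u; split=> //.
- exact: le_lt_trans hu2 dle.
- rewrite /u -yZ -!exprnN exprMn; have a0 : y ^+ al != 0 by rewrite expf_neq0.
  have b0 : v ^+ al != 0 by rewrite expf_neq0.
  by move: (y ^+ al) (v ^+ al) a0 b0 => p q p0 q0'; field; rewrite p0 q0'.
- rewrite -WE /u -!exprnN exprMn; have a0 : y ^+ be != 0 by rewrite expf_neq0.
  have b0 : v ^+ be != 0 by rewrite expf_neq0.
  by move: (y ^+ be) (v ^+ be) a0 b0 => p q p0 q0'; field; rewrite p0 q0'.
Qed.

End OneBranch.

Lemma local_cover (s : seq term) c al be kap (Z0 W0 : R[i]) rho M Zh ZX ZU Wh WX WU (eps : R) :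
  branch s c al be kap Z0 W0 rho M Zh ZX ZU Wh WX WU ->
  Z0 != 0 -> W0 != 0 -> (0 < al + be)%N ->
  {in s, forall t : term, (al * t.2.1 + be * t.2.2 <= c)%N} ->
  0 < eps <= rho -> exists2 dl : R, 0 < dl &
  forall v Z W x : R[i], v != 0 -> cabs v <= dl -> cabs x < eps -> cabs (Z - Z0) <= dl ->
    cabs (W - W0) <= dl -> qhom s c al be id v Z W x = 0 ->
    exists u : R[i], [/\ u != 0, cabs u < eps,
      u ^ (- al%:Z) * Zh x u = v ^ (- al%:Z) * Z & u ^ (- be%:Z) * Wh x u = v ^ (- be%:Z) * W].
Proof.
move=> hb Z00 W00 ab0 hc he; case: (posnP al) => al0; last exact: (local_cover_pos hb).
have be0 : (0 < be)%N by move: ab0; rewrite al0.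
have hc' : {in map (@swap_term R) s, forall t : term, (be * t.2.1 + al * t.2.2 <= c)%N}.
  by move=> _ /mapP [t ts ->] /=; rewrite addnC; exact: hc.
have [dl dl0 h] := local_cover_pos (branch_swap hb) W00 be0 hc' he.
exists dl => // v Z W x v0 hv hx hZ hW hq.
have [|u [u0 hu e1 e2]] := h v W Z x v0 hv hx hW hZ; first by rewrite qhom_swap.
by exists u.
Qed.

End LocalCovering.

(** * The polynomial of a side and its roots *)

Section SidePolynomial.
Variable R : realType.
Notation term := (R[i] * (nat * nat))%type.

Lemma uniq_map_inj (T U : eqType) (f : T -> U) (r : seq T) : uniq (map f r) ->
  {in r &, injective f}.
Proof.
move=> us t t' ts ts' e; have i1 := nth_index t ts; have i2 := nth_index t ts'.
have := nth_uniq (f t) (_ : index t r < size (map f r))%N (_ : index t' r < size (map f r))%N us.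
rewrite size_map !index_mem ts ts' => /(_ isT isT).
rewrite !(nth_map t) ?index_mem // i1 i2 e eqxx => /esym /eqP e4.
by rewrite -i1 -i2 e4.
Qed.

Lemma seq_argmin (D : realDomainType) (T : eqType) (k : T -> D) (r : seq T) : r != [::] ->
  exists2 t, t \in r & {in r, forall t', k t <= k t'}.
Proof.
elim: r => // t r IH _; case: (eqVneq r [::]) => [->|/IH [t0 t0r h]].
  by exists t; rewrite ?mem_head // => t'; rewrite inE => /eqP ->.
case: (lerP (k t) (k t0)) => ht.
  exists t; rewrite ?mem_head // => t'; rewrite inE => /orP[/eqP ->//|/h]; exact: le_trans.
exists t0; first by rewrite inE t0r orbT.
by move=> t'; rewrite inE => /orP[/eqP ->|/h //]; exact: ltW.
Qed.

Lemma zero_exp n : (0 : R[i]) ^+ n = (n == 0%N)%:R.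
Proof. by rewrite expr0n. Qed.

Variables (s : seq term) (al be c : nat) (a b : int).
Hypothesis hab : a * al%:Z + b * be%:Z = 1.
Hypothesis hc : {in s, forall t : term, (al * t.2.1 + be * t.2.2 <= c)%N}.
Hypothesis us : uniq (map snd s).
Hypothesis s0 : {in s, forall t : term, t.1 != 0}.

Definition online (t : term) : bool := (al * t.2.1 + be * t.2.2 == c)%N.
Definition side_terms : seq term := [seq t <- s | online t].

(* Along the line [al l + be m = c] the integer points are numbered consecutively. *)
Definition rank_of (e : nat * nat) : int := b * e.1%:Z - a * e.2%:Z.

Lemma wgt0 t : t \in s -> (wgt c al be t == 0%N) = online t.
Proof. by move=> ts; rewrite /wgt /online subn_eq0 eqn_leq hc. Qed.

(** By [hab] the level al l + be m and [rank_of] form a unimodular change of coordinates of the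
    lattice, so points of equal level differ by a multiple of (be, - al). *)
Lemma rank_step e e' : (al * e.1 + be * e.2 = c)%N -> (al * e'.1 + be * e'.2 = c)%N ->
  e'.1%:Z = e.1%:Z + be%:Z * (rank_of e' - rank_of e) /\
  e'.2%:Z = e.2%:Z - al%:Z * (rank_of e' - rank_of e).
Proof.
case: e e' => l m [l' m']; rewrite /rank_of /= => h h'.
have {}h : al%:Z * l%:Z + be%:Z * m%:Z = c%:Z by rewrite -!PoszM -PoszD h.
have {}h' : al%:Z * l'%:Z + be%:Z * m'%:Z = c%:Z by rewrite -!PoszM -PoszD h'.
move: h h' hab; move: (al%:Z) (be%:Z) (l%:Z) (m%:Z) (l'%:Z) (m'%:Z) (c%:Z).
move=> A B x y x' y' z h h' H; split; apply/eqP; rewrite -subr_eq0.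
  rewrite (_ : _ - _ = a * ((A * x' + B * y') - (A * x + B * y)) + (x' - x) * (1 - (a * A + b * B))); last by ring.
  by rewrite h h' H !subrr !mulr0 addr0.
rewrite (_ : _ - _ = b * ((A * x' + B * y') - (A * x + B * y)) + (y' - y) * (1 - (a * A + b * B))); last by ring.
by rewrite h h' H !subrr !mulr0 addr0.
Qed.

Lemma rank_inj t t' : t \in side_terms -> t' \in side_terms ->
  rank_of t.2 = rank_of t'.2 -> t = t'.
Proof.
rewrite !mem_filter => /andP[/eqP o ts] /andP[/eqP o' ts'] e.
have [] := rank_step o o'; rewrite e subrr !mulr0 addr0 subr0 => /eqP e1 /eqP e2.
have e3 : t.2 = t'.2 by case: t.2 t'.2 e1 e2 => l m [l' m'] /= /eqP [->] /eqP [->].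
exact: (uniq_map_inj us).
Qed.

Variables (t0 tn : term) (n : nat).
Hypotheses (t0G : t0 \in side_terms) (tnG : tn \in side_terms).
Hypothesis tmin : {in side_terms, forall t, rank_of t0.2 <= rank_of t.2}.
Hypothesis tmax : {in side_terms, forall t, rank_of t.2 <= rank_of tn.2}.
Hypothesis nE : rank_of tn.2 - rank_of t0.2 = n%:Z.

Definition deg_of (t : term) : nat := `|rank_of t.2 - rank_of t0.2|%N.
Definition side_poly : {poly R[i]} := \sum_(t <- side_terms) t.1 *: 'X^(deg_of t).

Lemma deg_ofE t : t \in side_terms -> (deg_of t)%:Z = rank_of t.2 - rank_of t0.2.
Proof. by move=> h; rewrite /deg_of gez0_abs // subr_ge0 tmin. Qed.

Lemma deg_of_le t : t \in side_terms -> (deg_of t <= n)%N.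
Proof. by move=> h; rewrite -lez_nat deg_ofE // -nE lerD2r tmax. Qed.

Lemma side_poly_coef t : t \in side_terms -> side_poly`_(deg_of t) = t.1.
Proof.
move=> tG; rewrite /side_poly coef_sum (bigD1_seq t) //=; last first.
  by rewrite filter_uniq // (map_uniq us).
rewrite coefZ coefXn eqxx mulr1 big_seq_cond big1 ?addr0 // => t' /andP[t'G nt].
rewrite coefZ coefXn; case: eqP => [e|]; last by rewrite mulr0.
case/eqP: nt; apply: rank_inj => //; apply/eqP; rewrite -(subr_eq0 (rank_of _)).
by rewrite -[rank_of t'.2](subrK (rank_of t0.2)) -[rank_of t.2](subrK (rank_of t0.2)) -!deg_ofE // e subrr.
Qed.

Lemma deg_of_t0 : deg_of t0 = 0%N.
Proof. by rewrite /deg_of subrr. Qed.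

Lemma deg_of_tn : deg_of tn = n.
Proof. by apply/eqP; rewrite -eqz_nat deg_ofE // nE. Qed.

Let in_s t : t \in side_terms -> t \in s.
Proof. by rewrite mem_filter => /andP[]. Qed.

Lemma side_poly0 : side_poly.[0] != 0.
Proof. by rewrite horner_coef0 -deg_of_t0 side_poly_coef // s0 ?in_s. Qed.

Lemma size_side_poly : size side_poly = n.+1.
Proof.
apply/eqP; rewrite eqn_leq; apply/andP; split.
  rewrite /side_poly big_seq; apply: (leq_trans (size_sum _ _ _)).
  apply/bigmax_leqP_seq => t tG _; apply: (leq_trans (size_scale_leq _ _)).
  by rewrite size_polyXn ltnS deg_of_le.
rewrite ltnNge; apply/negP => h; have := side_poly_coef tnG.
by rewrite deg_of_tn nth_default // => e; have := s0 (in_s tnG); rewrite -e eqxx.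
Qed.

Lemma side_poly_hornerE (tau : R[i]) : side_poly.[tau] = \sum_(t <- side_terms) t.1 * tau ^+ deg_of t.
Proof. by rewrite horner_sum; apply: eq_bigr => t _; rewrite hornerZ hornerXn. Qed.

Lemma side_poly_derivE (tau : R[i]) :
  tau * side_poly^`().[tau] = \sum_(t <- side_terms) t.1 * (deg_of t)%:R * tau ^+ deg_of t.
Proof.
rewrite raddf_sum horner_sum mulr_sumr; apply: eq_bigr => t _ /=.
rewrite derivZ derivXn hornerZ hornerMn hornerXn -mulr_natr.
by case: (deg_of t) => [|k]; rewrite ?mulr0 ?mul0r //= exprS; ring.
Qed.

Let pow_rank (tau : R[i]) t : tau != 0 -> t \in side_terms ->
  (tau ^ b) ^+ t.2.1 * (tau ^ (- a)) ^+ t.2.2 = tau ^ rank_of t0.2 * tau ^+ deg_of t.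
Proof.
move=> tau0 tG; rewrite -[(tau ^ b) ^+ _]/((tau ^ b) ^ t.2.1%:Z) -[_ ^+ t.2.2]/(_ ^ t.2.2%:Z).
rewrite !exprz_exp -[tau ^+ _]/(tau ^ (deg_of t)%:Z) -!expfzDr // deg_ofE //.
by congr (tau ^ _); rewrite /rank_of; ring.
Qed.

Lemma msum_online v i j (Z W : R[i]) :
  msum s id v (wgt c al be) i j 0 Z W = \sum_(t <- side_terms) v t * Z ^+ i t * W ^+ j t.
Proof.
rewrite /msum /side_terms big_filter [LHS]big_seq [RHS]big_seq_cond big_mkcond [RHS]big_mkcond /=.
apply: eq_bigr => t _; case: (boolP (t \in s)) => //= ts; rewrite zero_exp (wgt0 ts).
by case: (online t); rewrite ?mulr1 // mulr0 !mul0r.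
Qed.

Lemma qhom0E (Z W x : R[i]) : (0 < c)%N ->
  qhom s c al be id 0 Z W x = \sum_(t <- side_terms) t.1 * Z ^+ t.2.1 * W ^+ t.2.2.
Proof. by move=> c0; rewrite /qhom msum_online zero_exp gtn_eqF // mulr0 subr0. Qed.

(** At Z = tau^b, W = tau^(-a) a monomial of the side becomes tau to its rank; subtracting the least
    rank makes a polynomial out of the sum. *)
Lemma qhom0_chart (tau x : R[i]) : (0 < c)%N -> tau != 0 ->
  qhom s c al be id 0 (tau ^ b) (tau ^ (- a)) x = tau ^ rank_of t0.2 * side_poly.[tau].
Proof.
move=> c0 tau0; rewrite qhom0E // side_poly_hornerE mulr_sumr [LHS]big_seq [RHS]big_seq.
by apply: eq_bigr => t tG; rewrite -mulrA pow_rank //; ring.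
Qed.

Let lower_pow (y : R[i]) k : y * (k%:R * y ^+ k.-1) = k%:R * y ^+ k.
Proof. by case: k => [|k]; rewrite ?mul0r ?mulr0 //= exprS; ring. Qed.

(** The effect of tau d/dtau on [qhom0_chart], computed term by term. *)
Lemma grad_chart (tau : R[i]) : tau != 0 ->
  b%:~R * (tau ^ b) * qhomZ s c al be id 0 (tau ^ b) (tau ^ (- a)) -
  a%:~R * (tau ^ (- a)) * qhomW s c al be id 0 (tau ^ b) (tau ^ (- a)) =
  tau ^ rank_of t0.2 * ((rank_of t0.2)%:~R * side_poly.[tau] + tau * side_poly^`().[tau]).
Proof.
move=> tau0; rewrite /qhomZ /qhomW !msum_online side_poly_derivE side_poly_hornerE.
rewrite mulrDr !mulr_sumr -sumrB -big_split /= [LHS]big_seq [RHS]big_seq.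
apply: eq_bigr => t tG; have e := pow_rank tau0 tG.
have e1 := lower_pow (tau ^ b) t.2.1; have e2 := lower_pow (tau ^ (- a)) t.2.2.
have e3 : (deg_of t)%:R = (rank_of t.2)%:~R - (rank_of t0.2)%:~R :> R[i].
  by rewrite -rmorphB -deg_ofE.
have e4 : (rank_of t.2)%:~R = b%:~R * t.2.1%:R - a%:~R * t.2.2%:R :> R[i].
  by rewrite /rank_of rmorphB !rmorphM.
rewrite [LHS](_ : _ = t.1 * (b%:~R * (tau ^ b * (t.2.1%:R * (tau ^ b) ^+ t.2.1.-1)) * (tau ^ (- a)) ^+ t.2.2 -
   a%:~R * (tau ^ (- a) * (t.2.2%:R * (tau ^ (- a)) ^+ t.2.2.-1)) * (tau ^ b) ^+ t.2.1)); last by ring.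
rewrite e1 e2 [LHS](_ : _ = t.1 * (b%:~R * t.2.1%:R - a%:~R * t.2.2%:R) *
  ((tau ^ b) ^+ t.2.1 * (tau ^ (- a)) ^+ t.2.2)); last by ring.
by rewrite e -e4 e3; ring.
Qed.

Lemma chart_scale (e Z W : R[i]) :
  (e ^+ be * W) * qhomW s c al be id 0 (e ^+ al * Z) (e ^+ be * W) =
    e ^+ c * (W * qhomW s c al be id 0 Z W) /\
  (e ^+ al * Z) * qhomZ s c al be id 0 (e ^+ al * Z) (e ^+ be * W) =
    e ^+ c * (Z * qhomZ s c al be id 0 Z W).
Proof.
rewrite /qhomW /qhomZ !msum_online !mulr_sumr; split; rewrite [LHS]big_seq [RHS]big_seq;
  apply: eq_bigr => t; rewrite mem_filter => /andP[/eqP o ts].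
- have e1 := lower_pow (e ^+ be * W) t.2.2; have e2 := lower_pow W t.2.2.
  rewrite [LHS](_ : _ = t.1 * (e ^+ al * Z) ^+ t.2.1 *
     ((e ^+ be * W) * (t.2.2%:R * (e ^+ be * W) ^+ t.2.2.-1))); last by ring.
  rewrite [RHS](_ : _ = e ^+ c * (t.1 * Z ^+ t.2.1) * (W * (t.2.2%:R * W ^+ t.2.2.-1))); last by ring.
  by rewrite e1 e2 !exprMn -!exprM -o exprD; ring.
- have e1 := lower_pow (e ^+ al * Z) t.2.1; have e2 := lower_pow Z t.2.1.
  rewrite [LHS](_ : _ = t.1 * (e ^+ be * W) ^+ t.2.2 *
     ((e ^+ al * Z) * (t.2.1%:R * (e ^+ al * Z) ^+ t.2.1.-1))); last by ring.
  rewrite [RHS](_ : _ = e ^+ c * (t.1 * W ^+ t.2.2) * (Z * (t.2.1%:R * Z ^+ t.2.1.-1))); last by ring.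
  by rewrite e1 e2 !exprMn -!exprM -o exprD; ring.
Qed.

Hypothesis c0 : (0 < c)%N.
Hypothesis nondeg : forall Z W : R[i], Z != 0 -> W != 0 -> qhom s c al be id 0 Z W 0 = 0 ->
  ~ (qhomZ s c al be id 0 Z W = 0 /\ qhomW s c al be id 0 Z W = 0).

Let habC : a%:~R * al%:R + b%:~R * be%:R = 1 :> R[i].
Proof. by have := congr1 (fun z : int => z%:~R : R[i]) hab; rewrite rmorphD !rmorphM. Qed.

Let root_neq0 tau : root side_poly tau -> tau != 0.
Proof. by apply: contraTneq => ->; rewrite /root side_poly0. Qed.

(* At a root, Euler's relation leaves only the direction of the derivative of [side_poly]. *)
Lemma grad_at_root tau : root side_poly tau ->
  let mu := - (tau ^ rank_of t0.2 * (tau * side_poly^`().[tau])) in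
  (tau ^ b) * qhomZ s c al be id 0 (tau ^ b) (tau ^ (- a)) = - (be%:R * mu) /\
  (tau ^ (- a)) * qhomW s c al be id 0 (tau ^ b) (tau ^ (- a)) = al%:R * mu.
Proof.
move=> rt mu; have tau0 := root_neq0 rt.
have e1 := grad_chart tau0; rewrite (rootP rt) mulr0 add0r in e1.
have e2 := qhom_euler hc (erefl (msum s id (fun t => t.1 * (wgt c al be t)%:R)
  (fun t => (wgt c al be t).-1) (fun t => t.2.1) (fun t => t.2.2) 0 (tau ^ b) (tau ^ (- a))
  - 0 * (0 ^+ c.-1 * c%:R))).
rewrite qhom0_chart // (rootP rt) !mulr0 mul0r add0r in e2.
rewrite /mu -e1; move: e2 habC; move: (tau ^ b) (tau ^ (- a)) (qhomZ _ _ _ _ _ _ _ _) (qhomW _ _ _ _ _ _ _ _).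
move: (al%:R) (be%:R) (a%:~R) (b%:~R) => A B p q z w x y e2 e3; split.
- have -> : z * x = (p * A + q * B) * (z * x) by rewrite e3 mul1r.
  rewrite [LHS](_ : _ = p * (A * z * x + B * w * y) - B * - (q * z * x - p * w * y)); last by ring.
  by rewrite e2 mulr0 add0r.
- have -> : w * y = (p * A + q * B) * (w * y) by rewrite e3 mul1r.
  rewrite [LHS](_ : _ = q * (A * z * x + B * w * y) + A * - (q * z * x - p * w * y)); last by ring.
  by rewrite e2 mulr0 add0r.
Qed.

(** At a multiple root [grad_at_root] makes both partial derivatives vanish at a zero in the torus,
    against [nondeg]. *)
Lemma side_root_simple tau : root side_poly tau -> side_poly^`().[tau] != 0.
Proof.
move=> rt; apply/eqP => d0; have tau0 := root_neq0 rt.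
have zb : tau ^ b != 0 by exact: expfz_neq0.
have za : tau ^ (- a) != 0 by exact: expfz_neq0.
have [] := grad_at_root rt; rewrite d0 !mulr0 oppr0 !mulr0 oppr0 => /eqP + /eqP.
rewrite !mulf_eq0 (negbTE zb) (negbTE za) /= => /eqP e1 /eqP e2.
by apply: (nondeg zb za) => //; rewrite qhom0_chart // (rootP rt) mulr0.
Qed.

(** The field is algebraically closed, and a repeated linear factor would make the derivative vanish
    at a root. *)
Lemma side_roots : exists r : seq R[i],
  [/\ side_poly = lead_coef side_poly *: \prod_(z <- r) ('X - z%:P), size r = n, uniq r &
      {in r, forall tau, root side_poly tau}].
Proof.
have [r pr] := closed_field_poly_normal side_poly.
have p0 : side_poly != 0 by rewrite -size_poly_eq0 size_side_poly.
have l0 : lead_coef side_poly != 0 by rewrite lead_coef_eq0.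
have sr : size r = n.
  have := size_side_poly; rewrite {1}pr size_scale // size_prod_XsubC; by case.
have rr : {in r, forall tau, root side_poly tau}.
  by move=> tau hr; rewrite pr rootZ // root_prod_XsubC.
exists r; split=> //; apply/negPn/negP => nu.
have [x hx] : exists x, (1 < count_mem x r)%N.
  elim: r nu {pr sr rr} => //= x r IH; rewrite negb_and negbK => /orP[xr|/IH [y hy]].
    by exists x; rewrite eqxx add1n ltnS -has_count has_pred1.
  by exists y; apply: leq_trans hy _; exact: leq_addl.
have [r' hr'] : exists r', perm_eq r (x :: x :: r').
  have xr : x \in r by rewrite -has_pred1 has_count ltnW.
  have h1 := perm_to_rem xr.
  have xr' : x \in rem x r.
    rewrite -has_pred1 has_count; move/permP: h1 => /(_ (pred1 x)); rewrite /= eqxx => e.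
    by move: hx; rewrite e.
  exists (rem x (rem x r)); apply: perm_trans h1 _; rewrite perm_cons; exact: perm_to_rem.
have rx : root side_poly x by apply: rr; rewrite (perm_mem hr') mem_head.
have := side_root_simple rx; rewrite pr (perm_big _ hr') /= !big_cons.
rewrite derivZ derivM derivXsubC mul1r derivM derivXsubC mul1r.
by rewrite !(hornerZ, hornerD, hornerM, hornerN, hornerX, hornerC) subrr !mul0r addr0 mulr0 eqxx.
Qed.

(** Rescaling (tau^b, tau^(-a)) by lam reduces both gradient conditions to lam^(al+be) tau^(b-a) =
    kap lam^c mu. If al + be differs from c, a root extraction solves this for lam with kap = 1; if
    they agree, lam cancels and kap is forced. *)
Lemma base_point tau : root side_poly tau -> exists (lam kap : R[i]),
  let Z0 := lam ^+ al * tau ^ b in let W0 := lam ^+ be * tau ^ (- a) in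
  [/\ lam != 0, kap != 0, Z0 != 0 /\ W0 != 0,
      [/\ qhom s c al be id 0 Z0 W0 0 = 0,
          al%:R * Z0 = kap * qhomW s c al be id 0 Z0 W0 &
          be%:R * W0 = - (kap * qhomZ s c al be id 0 Z0 W0)] &
      if (al + be == c)%N
      then kap * (tau ^ rank_of t0.2 * (tau * side_poly^`().[tau])) = - (tau ^ b * tau ^ (- a))
      else kap = 1].
Proof.
move=> rt; have tau0 := root_neq0 rt.
have zb : tau ^ b != 0 by exact: expfz_neq0.
have za : tau ^ (- a) != 0 by exact: expfz_neq0.
pose mu := - (tau ^ rank_of t0.2 * (tau * side_poly^`().[tau])).
have mu0 : mu != 0 by rewrite oppr_eq0 !mulf_neq0 ?expfz_neq0 // side_root_simple.
have [gZ gW] := grad_at_root rt; rewrite -/mu in gZ gW.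
have [lam [kap [lam0 kap0 E hk]]] : exists lam kap : R[i], [/\ lam != 0, kap != 0,
   lam ^+ (al + be) * (tau ^ b * tau ^ (- a)) = kap * (lam ^+ c * mu) &
   if (al + be == c)%N then kap * mu = tau ^ b * tau ^ (- a) else kap = 1].
  pose v := tau ^ b * tau ^ (- a) / mu; have v0 : v != 0 by rewrite !mulf_neq0 ?invr_eq0.
  have vmu : v * mu = tau ^ b * tau ^ (- a) by rewrite /v divfK.
  case: ltngtP => h.
  - have [m mE] : exists m, c = (al + be + m.+1)%N.
      by exists (c - (al + be)).-1; rewrite prednK ?subn_gt0 // subnKC // ltnW.
    have lm : (m.+1.-root v) ^+ m.+1 = v by exact: rootCK.
    exists (m.+1.-root v), 1; split; rewrite ?oner_eq0 ?rootC_eq0 //.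
    by rewrite mul1r -vmu mE [_ ^+ (_ + m.+1)]exprD lm; ring.
  - have [m mE] : exists m, (al + be = c + m.+1)%N.
      by exists (al + be - c).-1; rewrite prednK ?subn_gt0 // subnKC // ltnW.
    have lm : (m.+1.-root v^-1) ^+ m.+1 = v^-1 by exact: rootCK.
    exists (m.+1.-root v^-1), 1; split; rewrite ?oner_eq0 ?rootC_eq0 ?invr_eq0 //.
    by rewrite mul1r -vmu mE [_ ^+ (_ + m.+1)]exprD lm; field.
  - by exists 1, v; split; rewrite ?oner_eq0 // !expr1n !mul1r vmu.
exists lam, kap; move=> Z0 W0.
have Z00 : Z0 != 0 by rewrite mulf_neq0 // expf_neq0.
have W00 : W0 != 0 by rewrite mulf_neq0 // expf_neq0.
have [sW sZ] := chart_scale lam (tau ^ b) (tau ^ (- a)); rewrite -/Z0 -/W0 in sW sZ.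
have ZW : Z0 * W0 = kap * (lam ^+ c * mu).
  by rewrite -E /Z0 /W0 exprD; ring.
split=> //.
- split.
  + have := qhom_scale hc lam 0 (tau ^ b) (tau ^ (- a)) 0; rewrite mulr0 -/Z0 -/W0 => ->.
    by rewrite qhom0_chart // (rootP rt) !mulr0.
  + apply: (mulfI W00); rewrite [RHS](_ : _ = kap * (W0 * qhomW s c al be id 0 Z0 W0)); last by ring.
    rewrite sW gW; have -> : W0 * (al%:R * Z0) = al%:R * (Z0 * W0) by ring.
    by rewrite ZW; ring.
  + apply: (mulfI Z00); rewrite [RHS](_ : _ = - (kap * (Z0 * qhomZ s c al be id 0 Z0 W0))); last by ring.
    rewrite sZ gZ; have -> : Z0 * (be%:R * W0) = be%:R * (Z0 * W0) by ring.
    by rewrite ZW; ring.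
- case: ifP hk => // _ e; rewrite -e /mu; ring.
Qed.

(** Both sides carry the same powers of lam and lam', so equality would give tau^(a al + b be) =
    tau'^(a al + b be), that is, tau = tau'. *)
Lemma chart_separates (lam lam' tau tau' : R[i]) : tau != 0 -> tau' != 0 -> lam != 0 -> lam' != 0 ->
  tau <> tau' ->
  (lam ^+ al * tau ^ b) ^+ be * (lam' ^+ be * tau' ^ (- a)) ^+ al <>
  (lam' ^+ al * tau' ^ b) ^+ be * (lam ^+ be * tau ^ (- a)) ^+ al.
Proof.
move=> t0' t0'' l0 l0' ne e; apply: ne.
have P (y : R[i]) (k : int) m : (y ^ k) ^+ m = y ^ (k * m%:Z) by rewrite -exprz_exp.
rewrite !exprMn !P -!exprM mulnC in e.
have L : lam ^+ (be * al) * lam' ^+ (be * al) != 0 by rewrite mulf_neq0 // expf_neq0.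
have T : tau ^ (a * al%:Z) * tau' ^ (a * al%:Z) != 0 by rewrite mulf_neq0 // expfz_neq0.
have ee y : y != 0 -> y ^ (b * be%:Z) * y ^ (a * al%:Z) = y :> R[i].
  by move=> y0; rewrite -expfzDr // addrC hab expr1z.
have ei y : y != 0 -> y ^ (- a * al%:Z) * y ^ (a * al%:Z) = 1 :> R[i].
  by move=> y0; rewrite -expfzDr // mulNr addNr expr0z.
apply: (mulfI L); have h1 := ee tau t0'; have h2 := ee tau' t0''.
have g1 := ei tau t0'; have g2 := ei tau' t0''; move: e h1 h2 g1 g2 {L T}.
move: (tau ^ (b * be%:Z)) (tau' ^ (b * be%:Z)) (tau ^ (a * al%:Z)) (tau' ^ (a * al%:Z)).
move: (tau ^ (- a * al%:Z)) (tau' ^ (- a * al%:Z)) (lam ^+ (be * al)) (lam' ^+ (be * al)).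
move=> B B' L L' A A' a1 a1' e <- <- g1 g2.
have -> : L * L' * (A * a1) = L * A * (L' * B') * (a1 * a1').
  by rewrite -[LHS]mulr1 -g2; ring.
by rewrite e -[RHS]mulr1 -g1; ring.
Qed.

End SidePolynomial.

(** * Covering along one side *)

Section SideCovering.
Variable R : realType.
Notation term := (R[i] * (nat * nat))%type.

Lemma tendsV (T : Type) (d : T -> R) (Q : T -> R[i]) q :
  tends d Q q -> q != 0 -> tends d (fun t => (Q t)^-1) q^-1.
Proof.
move=> h q0 e e0; have cq : 0 < cabs q by rewrite cabs_gt0.
pose e1 := Num.min (cabs q / 2) (e * (cabs q / 2 * cabs q)).
have e10 : 0 < e1 by rewrite lt_min divr_gt0 // !mulr_gt0 ?divr_gt0.
have [dl dl0 hd] := h _ e10; exists dl => // t /hd ht.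
have h1 : cabs (Q t - q) <= cabs q / 2 by apply: le_trans ht _; rewrite ge_min lexx.
have h2 : cabs (Q t - q) <= e * (cabs q / 2 * cabs q) by apply: le_trans ht _; rewrite ge_min lexx orbT.
have h3 : cabs q / 2 <= cabs (Q t).
  by have := cabsD (q - Q t) (Q t); rewrite subrK cabsB; lra.
have Q0 : Q t != 0 by rewrite -cabs_gt0; apply: lt_le_trans h3; rewrite divr_gt0.
have -> : (Q t)^-1 - q^-1 = (q - Q t) / (Q t * q) by field; rewrite Q0 q0.
rewrite cabsM cabsV cabsM cabsB ler_pdivrMr ?mulr_gt0 ?cabs_gt0 //.
apply: le_trans h2 _; rewrite ler_wpM2l ?(ltW e0) // ler_wpM2r // ltW //.
Qed.

Lemma tends_expz (T : Type) (d : T -> R) (Q : T -> R[i]) q (k : int) :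
  tends d Q q -> q != 0 -> tends d (fun t => Q t ^ k) (q ^ k).
Proof.
move=> h q0; case: k => k; first exact: tendsX.
rewrite NegzE -exprnN; have -> : (fun t => Q t ^ (- k.+1%:Z)) = (fun t => (Q t ^+ k.+1)^-1).
  by apply/funext => t; rewrite -exprnN.
by apply: tendsV; [exact: tendsX | rewrite expf_neq0].
Qed.

Lemma cabs_expz (y : R[i]) (k : int) : cabs (y ^ k) = cabs y ^ k.
Proof. by case: k => k; rewrite ?NegzE -?exprnN ?cabsV cabsX. Qed.

Lemma expz_bound (K y : R) (k : int) : 1 <= K -> K^-1 <= y -> y <= K -> y ^ k <= K ^+ `|k|%N.
Proof.
move=> K1 y1 y2; have K0 : 0 < K by lra.
have y0 : 0 < y by apply: lt_le_trans y1; rewrite invr_gt0.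
case: k => k; first by apply: lerXn2r; rewrite ?nnegrE ?(ltW y0) ?(ltW K0).
rewrite NegzE -exprnN -exprVn abszN absz_nat; apply: lerXn2r.
- by rewrite nnegrE invr_ge0 ltW.
- by rewrite nnegrE ltW.
- by rewrite -[K]invrK lef_pV2 ?posrE ?invr_gt0.
Qed.

Lemma qhom_near0 (s : seq term) c al be (B : R) : (0 < c)%N -> 1 <= B ->
  exists2 K : R, 0 <= K & forall v Z W x : R[i], cabs v <= 1 -> cabs Z <= B -> cabs W <= B ->
    cabs x <= 1 -> cabs (qhom s c al be id v Z W x - qhom s c al be id 0 Z W x) <= K * cabs v.
Proof.
move=> c0 B1; pose K := \sum_(t <- s) cabs t.1 * (B ^+ t.2.1 * B ^+ t.2.2) + 1.
have Bp k : 0 <= B ^+ k by rewrite exprn_ge0 //; lra.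
exists K => [|v Z W x hv hZ hW hx].
  by rewrite addr_ge0 // sumr_ge0 // => t _; rewrite !mulr_ge0 // cabs_ge0.
have v1 k : cabs (v ^+ k - 0 ^+ k) <= cabs v.
  case: k => [|k]; first by rewrite !expr0 subrr cabs0 cabs_ge0.
  by rewrite expr0n subr0 cabsX exprS ler_piMr ?cabs_ge0 // exprn_ile1 // cabs_ge0.
have -> : qhom s c al be id v Z W x - qhom s c al be id 0 Z W x =
   \sum_(t <- s) t.1 * (v ^+ wgt c al be t - 0 ^+ wgt c al be t) * (Z ^+ t.2.1 * W ^+ t.2.2)
   - x * (v ^+ c - 0 ^+ c).
  rewrite /qhom /msum [LHS](_ : _ = \sum_(t <- s) t.1 * v ^+ wgt c al be t * Z ^+ t.2.1 * W ^+ t.2.2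
     - \sum_(t <- s) t.1 * 0 ^+ wgt c al be t * Z ^+ t.2.1 * W ^+ t.2.2 - x * (v ^+ c - 0 ^+ c)); last by ring.
  by rewrite -sumrB; congr (_ - _); apply: eq_bigr => t _; ring.
apply: le_trans (cabsD _ _) _; rewrite cabsN /K mulrDl mul1r; apply: lerD; last first.
  by rewrite cabsM -[X in _ <= X]mul1r; apply: ler_pM; rewrite ?cabs_ge0.
rewrite mulr_suml; clear K; elim: s => [|t r IH]; first by rewrite !big_nil cabs0.
rewrite !big_cons; apply: le_trans (cabsD _ _) _; apply: lerD => //.
rewrite !cabsM -mulrA; apply: (@le_trans _ _ (cabs t.1 * (cabs v * (B ^+ t.2.1 * B ^+ t.2.2)))).
  rewrite ler_wpM2l ?cabs_ge0 //; apply: ler_pM; rewrite ?cabs_ge0 ?mulr_ge0 ?cabs_ge0 //.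
  by apply: ler_pM; rewrite ?cabs_ge0 // cabsX lerXn2r ?nnegrE ?cabs_ge0 //; lra.
by rewrite [X in _ <= X]mulrAC mulrA.
Qed.

Lemma prod_small (r : seq R[i]) (tau : R[i]) (dl : R) : 0 < dl ->
  cabs (\prod_(z <- r) (tau - z)) < dl ^+ size r -> exists2 z, z \in r & cabs (tau - z) <= dl.
Proof.
move=> dl0; elim: r => [|z r IH]; first by rewrite big_nil cabs1 expr0 ltxx.
rewrite big_cons cabsM /= exprS; case: (lerP (cabs (tau - z)) dl) => hz.
  by exists z; rewrite ?mem_head.
move=> h; have [|y yr hy] := IH; last by exists y; rewrite // inE yr orbT.
rewrite ltNge; apply/negP => h'; move: h; rewrite ltNge => /negP; apply.
by apply: ler_pM => //; rewrite ?exprn_ge0 ?ltW.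
Qed.

Variables (s : seq term) (al be c : nat) (a b : int).
Hypothesis hab : a * al%:Z + b * be%:Z = 1.
Hypothesis hc : {in s, forall t : term, (al * t.2.1 + be * t.2.2 <= c)%N}.
Hypothesis c0 : (0 < c)%N.

(** On the level set tau^rank p(tau) is O(v). On the annulus K^-1 <= |tau| <= K the first factor is
    bounded below, so p(tau) is small, and a small product of differences has a small factor. *)
Lemma side_near_root (t0 : term) (r : seq R[i]) (K dl : R) :
  t0 \in side_terms s al be c ->
  {in side_terms s al be c, forall t, rank_of a b t0.2 <= rank_of a b t.2} ->
  let p := side_poly s al be c a b t0 in
  p != 0 -> p = lead_coef p *: \prod_(z <- r) ('X - z%:P) -> 1 <= K -> 0 < dl ->
  exists2 d1 : R, 0 < d1 & forall v tau x : R[i], cabs v <= d1 -> K^-1 <= cabs tau -> cabs tau <= K ->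
    cabs x <= 1 -> qhom s c al be id v (tau ^ b) (tau ^ (- a)) x = 0 ->
    exists2 z, z \in r & cabs (tau - z) <= dl.
Proof.
move=> t0G tmin p p0 pr K1 dl0; have K0 : 0 < K by lra.
pose B := K ^+ `|b| * K ^+ `|a|.
have Kn k : 1 <= K ^+ k by exact: exprn_ege1.
have B1 : 1 <= B by rewrite -[1]mulr1; apply: ler_pM.
have [L L0 hL] := qhom_near0 s al be c0 B1.
pose m := `|rank_of a b t0.2|%N; pose e := cabs (lead_coef p) * dl ^+ size r.
have e0 : 0 < e by rewrite mulr_gt0 ?exprn_gt0 // cabs_gt0 lead_coef_eq0.
(* Chosen so that K^m L |v| < e, where [e] is the modulus of the leading coefficient times dl^n, the
   size of p when all roots are at distance dl. *)
pose d1 := Num.min 1 (e / (2 * ((L + 1) * K ^+ m))).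
have Km : 0 < K ^+ m by exact: exprn_gt0.
have D0 : 0 < (L + 1) * K ^+ m by rewrite mulr_gt0 //; lra.
exists d1; first by rewrite lt_min ltr01 divr_gt0 // mulr_gt0.
move=> v tau x hv h1 h2 hx hq.
have tau0 : tau != 0 by rewrite -cabs_gt0; apply: lt_le_trans h1; rewrite invr_gt0.
have hZ : cabs (tau ^ b) <= B.
  rewrite cabs_expz; apply: le_trans (expz_bound b K1 h1 h2) _.
  by rewrite /B ler_peMr // ltW // exprn_gt0.
have hW : cabs (tau ^ (- a)) <= B.
  rewrite cabs_expz; apply: le_trans (expz_bound (- a) K1 h1 h2) _.
  by rewrite abszN /B ler_peMl // ltW // exprn_gt0.
have hv1 : cabs v <= 1 by apply: le_trans hv _; rewrite ge_min lexx.
have := hL v _ _ x hv1 hZ hW hx.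
rewrite hq sub0r cabsN (qhom0_chart hc tmin) // -/p cabsM cabs_expz => h3.
have h4 : cabs p.[tau] <= K ^+ m * (L * cabs v).
  have i1 : 1 <= K ^+ m * cabs tau ^ rank_of a b t0.2.
    have hinv : (cabs tau)^-1 ^ rank_of a b t0.2 <= K ^+ m.
      apply: expz_bound => //; first by rewrite lef_pV2 ?posrE // cabs_gt0.
      by rewrite -[K]invrK lef_pV2 ?posrE ?invr_gt0 // cabs_gt0.
    have ct : cabs tau != 0 by rewrite cabs_eq0.
    rewrite exprz_inv -invr_expz in hinv.
    have tp : 0 < cabs tau ^ rank_of a b t0.2 by rewrite exprz_gt0 // cabs_gt0.
    by rewrite -ler_pdivrMr // div1r.
  apply: (@le_trans _ _ (K ^+ m * cabs tau ^ rank_of a b t0.2 * cabs p.[tau])).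
    by rewrite ler_peMl // cabs_ge0.
  by rewrite -mulrA ler_wpM2l // ltW.
have h5 : K ^+ m * (L * cabs v) < e.
  have i2 : cabs v * (2 * ((L + 1) * K ^+ m)) <= e.
    rewrite -ler_pdivlMr; first by apply: le_trans hv _; rewrite ge_min lexx orbT.
    by rewrite mulr_gt0.
  have i3 : K ^+ m * (L * cabs v) <= cabs v * ((L + 1) * K ^+ m).
    have : 0 <= cabs v * K ^+ m by rewrite mulr_ge0 ?cabs_ge0 // ltW.
    lra.
  have i4 : 0 <= cabs v * ((L + 1) * K ^+ m) by rewrite mulr_ge0 ?cabs_ge0 // ltW.
  lra.
apply: prod_small dl0 _.
have := le_lt_trans h4 h5; rewrite {1}pr hornerZ horner_prod cabsM /e ltr_pM2l ?cabs_gt0 ?lead_coef_eq0 //.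
by under eq_bigr do rewrite hornerXsubC.
Qed.

(** Rescaling by lam turns (v, tau^b, tau^(-a)) into data of the same point that lie near the base
    point of the branch when tau is near tau0. *)
Lemma branch_cover (lam kap tau0 : R[i]) rho M Zh ZX ZU Wh WX WU (eps : R) :
  branch s c al be kap (lam ^+ al * tau0 ^ b) (lam ^+ be * tau0 ^ (- a)) rho M Zh ZX ZU Wh WX WU ->
  lam != 0 -> tau0 != 0 -> (0 < al + be)%N -> 0 < eps <= rho ->
  exists2 dl : R, 0 < dl & forall v tau x : R[i], v != 0 -> cabs v <= dl -> tau != 0 ->
    cabs (tau - tau0) <= dl -> cabs x < eps -> qhom s c al be id v (tau ^ b) (tau ^ (- a)) x = 0 ->
    exists u : R[i], [/\ u != 0, cabs u < eps,
      u ^ (- al%:Z) * Zh x u = v ^ (- al%:Z) * tau ^ b &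
      u ^ (- be%:Z) * Wh x u = v ^ (- be%:Z) * tau ^ (- a)].
Proof.
move=> hb lam0 t00 ab0 he.
have Z00 : lam ^+ al * tau0 ^ b != 0 by rewrite mulf_neq0 ?expf_neq0 ?expfz_neq0.
have W00 : lam ^+ be * tau0 ^ (- a) != 0 by rewrite mulf_neq0 ?expf_neq0 ?expfz_neq0.
have [d1 d10 hd] := local_cover hb Z00 W00 ab0 hc he.
pose d (y : R[i]) := cabs (y - tau0).
have tid : tends d id tau0.
  by apply: (@tends_lip _ _ _ 1) => y; rewrite ?mul1r ?cabs_ge0.
have tZ := tendsM (tends_cst d (lam ^+ al)) (tends_expz b tid t00).
have tW := tendsM (tends_cst d (lam ^+ be)) (tends_expz (- a) tid t00).
have [d2 d20 h2] := tZ _ d10; have [d3 d30 h3] := tW _ d10.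
have cl : 0 < cabs lam by rewrite cabs_gt0.
exists (Num.min (d1 / cabs lam) (Num.min d2 d3)); first by rewrite !lt_min divr_gt0 // d20.
move=> v tau x v0 hv tau_0 ht hx hq.
rewrite le_min in hv; case/andP: hv => hv _.
rewrite !le_min in ht; case/and3P: ht => _ ht2 ht3.
have [||||||u [u0 hu e1 e2]] := hd (lam * v) (lam ^+ al * tau ^ b) (lam ^+ be * tau ^ (- a)) x.
- by rewrite mulf_neq0.
- by rewrite cabsM mulrC -ler_pdivlMr.
- by [].
- exact: h2.
- exact: h3.
- by rewrite (qhom_scale hc) hq mulr0.
have K n y : (lam * v) ^ (- n%:Z) * (lam ^+ n * y) = v ^ (- n%:Z) * y.
  rewrite -!exprnN exprMn; have := expf_neq0 n lam0; have := expf_neq0 n v0.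
  by move: (lam ^+ n) (v ^+ n) => p q q0 p0; field; rewrite p0 q0.
by exists u; split; [exact: u0 | exact: hu | rewrite e1 K | rewrite e2 K].
Qed.

End SideCovering.

(** * Monomials near infinity and normals of sides *)

Section NormalCone.
Variable R : realType.
Notation term := (R[i] * (nat * nat))%type.

(** A combinatorial form of a side off the axes. Natural coordinates suffice for its normal because
    of condition (i), and two distinct terms on the supporting line express that the face has
    dimension 1. *)
Definition is_side (s : seq term) (al be c : nat) : Prop :=
  [/\ coprime al be, (0 < c)%N, {in s, forall t : term, (al * t.2.1 + be * t.2.2 <= c)%N} &
   exists t t', [/\ t \in s, t' \in s, t.2 <> t'.2, online al be c t & online al be c t']].

Variable s : seq term.
Hypothesis exX : exists2 t, t \in s & (0 < t.2.1)%N.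
Hypothesis exY : exists2 t, t \in s & (0 < t.2.2)%N.
(** Condition (i) for half-planes: one that contains all terms also contains their projections to
    both axes. *)
Hypothesis RC : forall p q r : int, {in s, forall t : term, p * t.2.1%:Z + q * t.2.2%:Z <= r} ->
  {in s, forall t : term, q * t.2.2%:Z <= r /\ p * t.2.1%:Z <= r}.

Lemma normal_cone_int (t t' : term) (N1 N2 : int) : t \in s -> t' \in s -> t.2 <> t'.2 ->
  0 <= N1 -> 0 <= N2 -> (N1 != 0) || (N2 != 0) ->
  {in s, forall t'' : term, N1 * t''.2.1%:Z + N2 * t''.2.2%:Z <= N1 * t.2.1%:Z + N2 * t.2.2%:Z} ->
  N1 * t'.2.1%:Z + N2 * t'.2.2%:Z = N1 * t.2.1%:Z + N2 * t.2.2%:Z ->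
  exists al be c g, [/\ is_side s al be c, (0 < g)%N, N1 = (g * al)%N%:Z & N2 = (g * be)%N%:Z].
Proof.
case: N1 => // n1; case: N2 => // n2 ts ts' ne _ _ n0 hmax heq.
have g0 : (0 < gcdn n1 n2)%N by rewrite gcdn_gt0 !lt0n; move: n0; rewrite !eqz_nat.
have e1 : (n1 = gcdn n1 n2 * (n1 %/ gcdn n1 n2))%N by rewrite mulnC divnK // dvdn_gcdl.
have e2 : (n2 = gcdn n1 n2 * (n2 %/ gcdn n1 n2))%N by rewrite mulnC divnK // dvdn_gcdr.
set g := gcdn n1 n2 in g0 e1 e2; set al := (n1 %/ g)%N in e1; set be := (n2 %/ g)%N in e2.
have cop : coprime al be.
  rewrite /coprime -(eqn_pmul2l g0) muln1 muln_gcdr -e1 -e2 //.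
exists al, be, (al * t.2.1 + be * t.2.2)%N, g; split=> //; try by congr Posz.
have hmaxn t'' : t'' \in s -> (al * t''.2.1 + be * t''.2.2 <= al * t.2.1 + be * t.2.2)%N.
  move=> h; have := hmax _ h; rewrite -!PoszM -!PoszD lez_nat e1 e2.
  by rewrite -!mulnA -!mulnDr leq_pmul2l.
split=> //.
- case: (posnP al) => a0; last first.
    have [tx xs x0] := exX; apply: leq_trans (hmaxn _ xs); rewrite addn_gt0 muln_gt0 a0 x0 //.
  have b0 : (0 < be)%N by case: (be) cop => //; rewrite a0.
  have [ty ys y0] := exY; apply: leq_trans (hmaxn _ ys).
  by rewrite addn_gt0 [X in _ || X]muln_gt0 b0 y0 orbT.
- exists t, t'; split=> //; first by rewrite /online.
  rewrite /online -(eqn_pmul2l g0) !mulnDr !mulnA -e1 -e2 -eqz_nat !PoszD !PoszM.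
  by rewrite heq.
Qed.

Variables (D : nat) (Lam : R).
Hypotheses (D0 : (0 < D)%N) (L0 : 0 <= Lam).
Hypothesis hD : {in s, forall t : term, (t.2.1 <= D)%N /\ (t.2.2 <= D)%N}.


(** N is the normal of the segment from t to t' that points towards (X, Y). Along the segment (X, Y)
    has a bounded component T, so its component S along N is large, and N must support the polygon
    at t: an integral gain of 1 in direction N would outweigh the bounded part. *)
Lemma normal_cone_aux (t t' : term) (X Y : R) (N1 N2 : int) : t \in s -> t' \in s -> t.2 <> t'.2 ->
  let dl := t'.2.1%:Z - t.2.1%:Z in let dm := t'.2.2%:Z - t.2.2%:Z in
  (N1 = - dm /\ N2 = dl) \/ (N1 = dm /\ N2 = - dl) ->
  0 <= N1%:~R * X + N2%:~R * Y ->
  {in s, forall t'' : term, t''.2.1%:R * X + t''.2.2%:R * Y <= t.2.1%:R * X + t.2.2%:R * Y} ->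
  t.2.1%:R * X + t.2.2%:R * Y - Lam <= t'.2.1%:R * X + t'.2.2%:R * Y ->
  Lam * D%:R + D%:R * (2 * Lam * D%:R ^+ 2 + 1) <= X \/ Lam * D%:R + D%:R * (2 * Lam * D%:R ^+ 2 + 1) <= Y ->
  exists al be c, is_side s al be c /\ `|be%:R * X - al%:R * Y| <= Lam.
Proof.
move=> ts ts' ne dl dm hN S0 hmax hnear hbig.
pose rc (z : int) : R := z%:~R.
have bd t1 t2 : t1 \in s -> t2 \in s -> (`|rc (t1.2.1%:Z - t2.2.1%:Z)| <= D%:R) /\ (`|rc (t1.2.2%:Z - t2.2.2%:Z)| <= D%:R).
  have key (x y : nat) : (x <= D)%N -> (y <= D)%N -> `|rc (x%:Z - y%:Z)| <= D%:R.
    by move=> hx hy; rewrite /rc -intr_norm -[D%:R]/((D%:Z)%:~R) ler_int; lia.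
  by move=> /hD [h1 h2] /hD [h3 h4]; split; exact: key.
have [bdl bdm] := bd _ _ ts' ts; rewrite -/dl -/dm in bdl bdm.
have bN1 : `|rc N1| <= D%:R by case: hN => -[-> _]; rewrite /rc ?rmorphN ?normrN.
have bN2 : `|rc N2| <= D%:R by case: hN => -[_ ->]; rewrite /rc ?rmorphN ?normrN.
pose T := rc dl * X + rc dm * Y; pose S := rc N1 * X + rc N2 * Y.
have T0 : T <= 0.
  have := hmax _ ts'; rewrite /T /rc !rmorphB /=; lra.
have TL : - Lam <= T by move: hnear; rewrite /T /rc !rmorphB /=; lra.
have dd : 1 <= dl ^+ 2 + dm ^+ 2.
  have : (dl != 0) || (dm != 0).
    rewrite -negb_and; apply/negP => /andP[/eqP h1 /eqP h2]; apply: ne.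
    have e1 : t.2.1 = t'.2.1 by case: (subr0_eq h1).
    have e2 : t.2.2 = t'.2.2 by case: (subr0_eq h2).
    by rewrite [LHS]surjective_pairing [RHS]surjective_pairing e1 e2.
  case/orP => h.
    by rewrite -[1]addr0; apply: lerD; [rewrite -gtz0_ge1 exprn_even_gt0 | exact: sqr_ge0].
  by rewrite -[1]add0r; apply: lerD; [exact: sqr_ge0 | rewrite -gtz0_ge1 exprn_even_gt0].
pose D2 := rc dl ^+ 2 + rc dm ^+ 2.
have D21 : 1 <= D2.
  by rewrite /D2 /rc -!rmorphXn -rmorphD -[1]/(1%:~R) ler_int.
(* (X, Y) in the orthogonal basis formed by N and (dl, dm), both of squared length D2. *)
have IX : D2 * X = S * rc N1 + T * rc dl.
  by rewrite /D2 /S /T; case: hN => -[-> ->]; rewrite /rc ?rmorphN; ring.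
have IY : D2 * Y = S * rc N2 + T * rc dm.
  by rewrite /D2 /S /T; case: hN => -[-> ->]; rewrite /rc ?rmorphN; ring.
have Nd : N1 * dl + N2 * dm = 0 by case: hN => -[-> ->]; ring.
have Td (y : R) : `|y| <= D%:R -> T * y <= Lam * D%:R.
  move=> hy; apply: le_trans (ler_norm _) _; rewrite normrM; apply: ler_pM => //.
  by rewrite ler0_norm // lerNl.
have Sd (y : R) : `|y| <= D%:R -> S * y <= S * D%:R.
  by move=> hy; rewrite ler_wpM2l //; apply: le_trans (ler_norm _) hy.
have big0 : 0 <= Lam * D%:R + D%:R * (2 * Lam * D%:R ^+ 2 + 1).
  by rewrite addr_ge0 ?mulr_ge0 // addr_ge0 // !mulr_ge0 // sqr_ge0.
(* The bound on X or Y in the statement is designed for this: T contributes at most Lam D and S at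
   most S D. *)
have Sbig : 2 * Lam * D%:R ^+ 2 + 1 <= S.
  have key y z w : D2 * y = S * z + T * w -> `|z| <= D%:R -> `|w| <= D%:R ->
      Lam * D%:R + D%:R * (2 * Lam * D%:R ^+ 2 + 1) <= y -> 2 * Lam * D%:R ^+ 2 + 1 <= S.
    move=> e hz hw hy; have y0 : 0 <= y by apply: le_trans hy.
    have h1 : y <= D2 * y by rewrite ler_peMl.
    have h2 := Sd _ hz; have h3 := Td _ hw.
    have DD : 0 < D%:R :> R by rewrite ltr0n.
    rewrite -(ler_pM2l DD); rewrite e in h1; lra.
  by case: hbig => h; [apply: key IX bN1 bdl h | apply: key IY bN2 bdm h].
have c2 : {in s, forall t'' : term, N1 * t''.2.1%:Z + N2 * t''.2.2%:Z <= N1 * t.2.1%:Z + N2 * t.2.2%:Z}.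
  move=> t'' ts''; rewrite leNgt; apply/negP => h.
  pose e1 := t''.2.1%:Z - t.2.1%:Z; pose e2 := t''.2.2%:Z - t.2.2%:Z.
  have he : 1 <= e1 * N1 + e2 * N2.
    rewrite -gtz0_ge1 (_ : e1 * N1 + e2 * N2 = N1 * t''.2.1%:Z + N2 * t''.2.2%:Z - (N1 * t.2.1%:Z + N2 * t.2.2%:Z)).
      by rewrite subr_gt0.
    by rewrite /e1 /e2; ring.
  have [be1 be2] := bd _ _ ts'' ts; rewrite -/e1 -/e2 in be1 be2.
  have hE : rc e1 * X + rc e2 * Y <= 0.
    by have := hmax _ ts''; rewrite /e1 /e2 /rc !rmorphB /=; lra.
  have I : D2 * (rc e1 * X + rc e2 * Y) = S * rc (e1 * N1 + e2 * N2) + T * (rc e1 * rc dl + rc e2 * rc dm).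
    rewrite [LHS](_ : _ = rc e1 * (D2 * X) + rc e2 * (D2 * Y)); last by ring.
    by rewrite IX IY /rc (intrD _ (e1 * N1)) (intrM _ e1) (intrM _ e2); ring.
  have i1 : S <= S * rc (e1 * N1 + e2 * N2).
    by rewrite ler_peMr // /rc -[1]/(1%:~R) ler_int.
  have i2 : `|rc e1 * rc dl + rc e2 * rc dm| <= 2 * D%:R ^+ 2.
    apply: le_trans (ler_normD _ _) _; rewrite !normrM.
    have j1 : `|rc e1| * `|rc dl| <= D%:R * D%:R by apply: ler_pM.
    have j2 : `|rc e2| * `|rc dm| <= D%:R * D%:R by apply: ler_pM.
    by rewrite expr2; lra.
  have i3 : - (Lam * (2 * D%:R ^+ 2)) <= T * (rc e1 * rc dl + rc e2 * rc dm).
    rewrite lerNl; apply: le_trans (ler_norm _) _; rewrite normrN normrM; apply: ler_pM => //.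
    by rewrite ler0_norm // lerNl.
  have i4 : D2 * (rc e1 * X + rc e2 * Y) <= 0 by rewrite mulr_ge0_le0 // (le_trans ler01).
  suff : (1 : R) < 1 by rewrite ltxx.
  move: i1 i3 i4 Sbig; rewrite I => i1 i3 i4 Sbig; lra.
have heq : N1 * t'.2.1%:Z + N2 * t'.2.2%:Z = N1 * t.2.1%:Z + N2 * t.2.2%:Z.
  by apply/eqP; rewrite -subr_eq0 -Nd /dl /dm; apply/eqP; ring.
have LD : Lam * D%:R < Lam * D%:R + D%:R * (2 * Lam * D%:R ^+ 2 + 1).
  by rewrite ltrDl mulr_gt0 //; [rewrite ltr0n|rewrite ltr_wpDl // !mulr_ge0 // sqr_ge0].
have S1 : 0 <= S by [].
(* If N1 < 0, condition (i) puts t and t' on the axis l = 0, so N is a negative multiple of (1, 0);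
   then X <= 0 and Y <= Lam D, against [hbig]. The case of N2 is symmetric. *)
have N10 : 0 <= N1.
  rewrite leNgt; apply/negP => n1.
  have l0 : t.2.1 = 0%N by have [h _] := RC c2 ts; move: h; rewrite lerDr nmulr_rge0 // lez_nat leqn0 => /eqP.
  have c2' : {in s, forall t'' : term, N1 * t''.2.1%:Z + N2 * t''.2.2%:Z <= N1 * t'.2.1%:Z + N2 * t'.2.2%:Z}.
    by rewrite heq.
  have l0' : t'.2.1 = 0%N by have [h _] := RC c2' ts'; move: h; rewrite lerDr nmulr_rge0 // lez_nat leqn0 => /eqP.
  have dl0 : dl = 0 by rewrite /dl l0 l0' subrr.
  have n2 : N2 = 0 by case: hN => -[_ ->]; rewrite dl0 ?oppr0.
  have n1R : rc N1 <= 0 by rewrite /rc -[0]/(0%:~R) ler_int ltW.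
  rewrite dl0 /rc mulr0 addr0 in IX; rewrite n2 /rc mulr0 add0r in IY.
  have hX : X <= 0.
    rewrite leNgt; apply/negP => X0; have : 0 < D2 * X by rewrite mulr_gt0 // (lt_le_trans ltr01).
    by rewrite IX ltNge mulr_ge0_le0.
  have hY : Y <= Lam * D%:R.
    case: (lerP Y 0) => Y0; first by apply: le_trans Y0 _; rewrite mulr_ge0.
    apply: (@le_trans _ _ (D2 * Y)); first by rewrite ler_peMl // ltW.
    by rewrite IY; exact: Td.
  have LD0 : 0 <= Lam * D%:R by rewrite mulr_ge0.
  by case: hbig => h; have := lt_le_trans LD h; [rewrite ltNge (le_trans hX LD0) | rewrite ltNge hY].
have N20 : 0 <= N2.
  rewrite leNgt; apply/negP => n2.
  have m0 : t.2.2 = 0%N by have [_ h] := RC c2 ts; move: h; rewrite lerDl nmulr_rge0 // lez_nat leqn0 => /eqP.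
  have c2' : {in s, forall t'' : term, N1 * t''.2.1%:Z + N2 * t''.2.2%:Z <= N1 * t'.2.1%:Z + N2 * t'.2.2%:Z}.
    by rewrite heq.
  have m0' : t'.2.2 = 0%N by have [_ h] := RC c2' ts'; move: h; rewrite lerDl nmulr_rge0 // lez_nat leqn0 => /eqP.
  have dm0 : dm = 0 by rewrite /dm m0 m0' subrr.
  have n1 : N1 = 0 by case: hN => -[-> _]; rewrite dm0 ?oppr0.
  have n2R : rc N2 <= 0 by rewrite /rc -[0]/(0%:~R) ler_int ltW.
  rewrite dm0 /rc mulr0 addr0 in IY; rewrite n1 /rc mulr0 add0r in IX.
  have hY : Y <= 0.
    rewrite leNgt; apply/negP => Y0; have : 0 < D2 * Y by rewrite mulr_gt0 // (lt_le_trans ltr01).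
    by rewrite IY ltNge mulr_ge0_le0.
  have hX : X <= Lam * D%:R.
    case: (lerP X 0) => X0; first by apply: le_trans X0 _; rewrite mulr_ge0.
    apply: (@le_trans _ _ (D2 * X)); first by rewrite ler_peMl // ltW.
    by rewrite IX; exact: Td.
  have LD0 : 0 <= Lam * D%:R by rewrite mulr_ge0.
  by case: hbig => h; have := lt_le_trans LD h; [rewrite ltNge hX | rewrite ltNge (le_trans hY LD0)].
have nn : (N1 != 0) || (N2 != 0).
  rewrite -negb_and; apply/negP => /andP[/eqP h1 /eqP h2]; move: dd.
  by case: hN => -[e1 e2]; move: h1 h2; rewrite e1 e2 => /eqP h1 /eqP h2; move: h1 h2; rewrite ?oppr_eq0 => /eqP -> /eqP ->.
have [al [be [c [g [hs g0 e1 e2]]]]] := normal_cone_int ts ts' ne N10 N20 nn c2 heq.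
exists al, be, c; split=> //.
have gE : `|g%:R * (be%:R * X - al%:R * Y)| = `|T|.
  have -> : g%:R * (be%:R * X - al%:R * Y) = rc N2 * X - rc N1 * Y.
    by rewrite e1 e2 /rc !PoszM !intrM -!pmulrn; ring.
  case: hN => -[-> ->]; rewrite /rc !rmorphN /T /rc; first by congr `|_|; ring.
  by rewrite -normrN; congr `|_|; ring.
rewrite normrM normr_nat in gE.
apply: (@le_trans _ _ `|T|); last by rewrite ler0_norm // lerNl.
by rewrite -gE ler_peMl // ler1n.
Qed.

(** Of the two normals of the segment, the one with nonnegative pairing with (X, Y) is taken. *)
Lemma normal_cone (t t' : term) (X Y : R) : t \in s -> t' \in s -> t.2 <> t'.2 ->
  {in s, forall t'' : term, t''.2.1%:R * X + t''.2.2%:R * Y <= t.2.1%:R * X + t.2.2%:R * Y} ->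
  t.2.1%:R * X + t.2.2%:R * Y - Lam <= t'.2.1%:R * X + t'.2.2%:R * Y ->
  Lam * D%:R + D%:R * (2 * Lam * D%:R ^+ 2 + 1) <= X \/ Lam * D%:R + D%:R * (2 * Lam * D%:R ^+ 2 + 1) <= Y ->
  exists al be c, is_side s al be c /\ `|be%:R * X - al%:R * Y| <= Lam.
Proof.
move=> ts ts' ne hmax hnear hbig.
pose dl := t'.2.1%:Z - t.2.1%:Z; pose dm := t'.2.2%:Z - t.2.2%:Z.
case: (lerP 0 ((- dm)%:~R * X + dl%:~R * Y)) => h.
  by apply: (@normal_cone_aux t t' X Y (- dm) dl) => //; left.
apply: (@normal_cone_aux t t' X Y dm (- dl)) => //; first by right.
by move: h; rewrite !rmorphN; lra.
Qed.

End NormalCone.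

(** * Dominant monomials and logarithmic coordinates *)

Section LogarithmicCover.
Variable R : realType.
Notation term := (R[i] * (nat * nat))%type.
Notation cabs := Normc.normc.

(** In a vanishing sum a summand is balanced by the others, one of which is therefore comparable to
    it up to the number of summands. *)
Lemma two_dominant (I : eqType) (s : seq I) (F : I -> R[i]) (mu : I -> R) (m1 m2 : R) (t : I) :
  uniq s -> t \in s -> \sum_(i <- s) F i = 0 -> 0 < m1 -> 0 < mu t -> m1 * mu t <= cabs (F t) ->
  {in s, forall i, cabs (F i) <= m2 * mu i} ->
  exists t', [/\ t' \in s, t' != t & m1 * mu t <= (size s)%:R * (m2 * mu t')].
Proof.
move=> us ts e m10 mt lt up; apply: contrapT => /forallNP h.
have h' i : i \in rem t s -> (size s)%:R * (m2 * mu i) <= m1 * mu t.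
  rewrite mem_rem_uniq // !inE => /andP[ne ins]; rewrite leNgt; apply/negP => k.
  by apply: (h i); rewrite ins ne (ltW k).
have N0 : 0 < (size s)%:R :> R by rewrite ltr0n; case: (s) ts.
move: e; rewrite (big_rem t ts) /= => /eqP; rewrite addr_eq0 => /eqP e.
have up' : cabs (F t) <= \sum_(i <- rem t s) m2 * mu i.
  rewrite e cabsN.
  have : {in rem t s, forall i, cabs (F i) <= m2 * mu i} by move=> i /mem_rem /up.
  elim: (rem t s) => [|i q IH] hq; first by rewrite !big_nil cabs0.
  rewrite !big_cons; apply: le_trans (cabsD _ _) _; apply: lerD; first by apply: hq; rewrite mem_head.
  by apply: IH => j jq; apply: hq; rewrite inE jq orbT.
have : (size s)%:R * (m1 * mu t) <= (size (rem t s))%:R * (m1 * mu t).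
  apply: le_trans (_ : (size s)%:R * \sum_(i <- rem t s) m2 * mu i <= _).
    by rewrite ler_pM2l //; apply: le_trans lt up'.
  elim: (rem t s) h' => [|i q IH] hq; first by rewrite big_nil mulr0 mul0r.
  rewrite big_cons /= -natr1 mulrDr mulrDl mul1r addrC; apply: lerD; last by apply: hq; rewrite mem_head.
  by apply: IH => j jq; apply: hq; rewrite inE jq orbT.
rewrite size_rem // ler_pM2r ?mulr_gt0 // ler_nat.
by case: (size s) N0 => [|k]; rewrite ?ltxx // ltnn.
Qed.

Lemma expR_expz (X : R) (k : int) : expR X ^ k = expR (k%:~R * X).
Proof.
case: k => k; first by rewrite -pmulrn expRM_natl.
by rewrite NegzE -exprnN mulrNz mulNr expRN expRM_natl.
Qed.

Lemma nat_bound2 (D : nat) (F : nat -> nat -> nat) :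
  exists B, forall i j, (i <= D)%N -> (j <= D)%N -> (F i j <= B)%N.
Proof.
exists (\max_(i < D.+1) \max_(j < D.+1) F i j)%N => i j iD jD.
apply: leq_trans (leq_bigmax (Ordinal (iD : (i < D.+1)%N))).
exact: (leq_bigmax (Ordinal (jD : (j < D.+1)%N))).
Qed.

(** One choice of (a, b) for each normal, so that charts and coverings use the same coordinates v
    and tau. *)
Definition bezout_pair (al be : nat) : int * int := egcdz al be.

Lemma bezout_pairP al be : coprime al be ->
  (bezout_pair al be).1 * al%:Z + (bezout_pair al be).2 * be%:Z = 1.
Proof. by rewrite /bezout_pair; case: egcdzP => u v /= -> _ /eqP; rewrite /gcdz /= => ->. Qed.

(** Two lattice points of the same level differ by a nonzero multiple of (be, - al), and their
    coordinates lie between 0 and D. *)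
Lemma is_side_le (s : seq term) (D al be c : nat) :
  {in s, forall t : term, (t.2.1 <= D)%N /\ (t.2.2 <= D)%N} -> is_side s al be c ->
  (al <= D)%N /\ (be <= D)%N.
Proof.
move=> hD [cop c0 _ [t [t' [ts ts' ne on on']]]].
have {on on'} e : (al * t.2.1 + be * t.2.2 = al * t'.2.1 + be * t'.2.2)%N.
  by move/eqP: on => ->; move/eqP: on' => ->.
have {ne} ne : ~ (t.2.1 = t'.2.1 /\ t.2.2 = t'.2.2).
  by move=> [h1 h2]; apply: ne; rewrite [LHS]surjective_pairing [RHS]surjective_pairing h1 h2.
move: (hD _ ts) (hD _ ts') e ne => [].
move: t.2.1 t.2.2 t'.2.1 t'.2.2 => l m l' m'.
have key x y l1 m1 l2 m2 : coprime x y -> (l1 <= D)%N -> (l2 <= D)%N ->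
    (x * l1 + y * m1 = x * l2 + y * m2)%N -> ~ (l1 = l2 /\ m1 = m2) -> (y <= D)%N.
  move=> xy; wlog le : l1 l2 m1 m2 / (l1 <= l2)%N => [H|] h1 h2 e ne.
    by case/orP: (leq_total l1 l2) => le; [apply: (H l1 l2 m1 m2) | apply: (H l2 l1 m2 m1) => // -[? ?]; apply: ne].
  case: (ltngtP l1 l2) le => // [lt _|eq _].
    have : (y %| x * (l2 - l1))%N.
      apply/dvdnP; exists (m1 - m2)%N; rewrite mulnBr mulnBl.
      by rewrite ![(_ * y)%N]mulnC; lia.
    rewrite Gauss_dvdr 1?coprime_sym // => /dvdn_leq -/(_ _); rewrite subn_gt0 => /(_ lt) h.
    by apply: leq_trans h _; apply: leq_trans (leq_subr _ _) h2.
  case: (posnP y) => [->//|y0]; case: ne; split=> //.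
  by move: e; rewrite eq => /addnI /eqP; rewrite eqn_pmul2l // => /eqP.
move=> l1 m1 [l2 m2] e ne; split.
  apply: (key be al m l m' l') => //; first by rewrite coprime_sym.
    by rewrite addnC e addnC.
  by move=> [h1 h2]; apply: ne.
by apply: (key al be l m l' m').
Qed.

Variable s : seq term.
Hypothesis us : uniq (map snd s).
Hypothesis s0 : {in s, forall t : term, t.1 != 0}.
Variable t00 : term.
Hypothesis t00s : t00 \in s.
Hypothesis t00E : t00.2 = (0%N, 0%N).

Lemma coef_bounds : exists m1 m2 : R, [/\ 0 < m1, 0 < m2 &
  {in s, forall t, m1 <= cabs t.1 /\ cabs t.1 <= m2}].
Proof.
have sn : s != [::] by case: (s) t00s.
have [t1 t1s h1] := seq_argmin (fun t : term => cabs t.1) sn.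
have [t2 t2s h2] := seq_argmin (fun t : term => - cabs t.1) sn.
exists (cabs t1.1), (cabs t2.1); split; rewrite ?cabs_gt0 ?s0 //.
by move=> t ts; split; [exact: h1 | rewrite -lerN2; exact: h2].
Qed.

Lemma dominant : exists2 c1 : R, 0 < c1 <= 1 & forall z w x : R[i], cabs x <= cabs t00.1 / 2 ->
  \sum_(t <- s) t.1 * z ^+ t.2.1 * w ^+ t.2.2 = x ->
  let mu (t : term) := cabs z ^+ t.2.1 * cabs w ^+ t.2.2 in
  exists t t', [/\ t \in s, t' \in s, t.2 <> t'.2, 1 <= mu t & {in s, forall t'', mu t'' <= mu t} /\ c1 * mu t <= mu t'].
Proof.
have [m1 [m2 [m10 m20 hm]]] := coef_bounds.
have N1 : 1 <= (size s)%:R :> R by rewrite ler1n; case: (s) t00s.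
have m12 : m1 <= m2 by have [h1 h2] := hm _ t00s; apply: le_trans h1 h2.
have C0 : 0 < (size s)%:R * (4 * m2) by rewrite mulr_gt0 ?mulr_gt0 //; lra.
have injs : {in s &, injective (fun t : term => t.2)}.
  exact: uniq_map_inj.
exists (m1 / ((size s)%:R * (4 * m2))).
  rewrite divr_gt0 //= ler_pdivrMr // mul1r.
  have : m2 <= (size s)%:R * m2 by rewrite ler_peMl // ltW.
  by lra.
move=> z w x hx e mu.
have sn : s != [::] by case: (s) t00s.
have [t ts ht] := seq_argmin (fun t => - mu t) sn.
have {}ht : {in s, forall t'', mu t'' <= mu t} by move=> t'' /ht; rewrite lerN2.
have mu1 : 1 <= mu t by apply: le_trans (ht _ t00s); rewrite /mu t00E !expr0 mulr1.
(* x is absorbed into the constant term. Since |x| is at most half of that coefficient, all moduli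
   stay between m1 / 2 and 2 m2. *)
pose F (t : term) := (t.1 - x *+ (t == t00)) * z ^+ t.2.1 * w ^+ t.2.2.
have F0 : \sum_(i <- s) F i = 0.
  rewrite /F; under eq_bigr => i _ do rewrite !mulrBl.
  rewrite big_split /= sumrN e [X in x - X](_ : _ = x) ?subrr //.
  rewrite (bigD1_seq t00) ?(map_uniq us) //= eqxx t00E !expr0 !mulr1 mulr1n.
  by rewrite big1 ?addr0 // => i /negbTE ->; rewrite mulr0n !mul0r.
have muE i : cabs (F i) = cabs (i.1 - x *+ (i == t00)) * mu i by rewrite /F !cabsM !cabsX mulrA.
have mu0 i : 0 <= mu i by rewrite mulr_ge0 ?exprn_ge0 ?cabs_ge0.
have cl i : i \in s -> m1 / 2 <= cabs (i.1 - x *+ (i == t00)) /\ cabs (i.1 - x *+ (i == t00)) <= 2 * m2.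
  move=> ins; have [h1 h2] := hm _ ins; case: eqP => [ei|_]; last by rewrite mulr0n subr0; split; lra.
  rewrite mulr1n; rewrite -ei in hx.
  have := cabs_triB i.1 x 0; rewrite !subr0 => h3.
  have := cabsD i.1 (- x); rewrite cabsN => h4.
  by split; lra.
have [t' [ts' ne h]] : exists t', [/\ t' \in s, t' != t & (m1 / 2) * mu t <= (size s)%:R * ((2 * m2) * mu t')].
  apply: (@two_dominant _ s F mu (m1 / 2) (2 * m2) t) => //; rewrite ?(map_uniq us) //; try lra.
    by rewrite muE ler_wpM2r //; case: (cl _ ts).
  by move=> i ins; rewrite muE ler_wpM2r //; case: (cl _ ins).
exists t, t'; split=> //; first by move=> e2; move/eqP: ne; apply; apply: injs.
split=> //; rewrite mulrAC ler_pdivrMr //; move: h; lra.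
Qed.

Hypothesis exX : exists2 t, t \in s & (0 < t.2.1)%N.
Hypothesis exY : exists2 t, t \in s & (0 < t.2.2)%N.
Hypothesis RC : forall p q r : int, {in s, forall t : term, p * t.2.1%:Z + q * t.2.2%:Z <= r} ->
  {in s, forall t : term, q * t.2.2%:Z <= r /\ p * t.2.1%:Z <= r}.

(* With X = ln |z| and Y = ln |w| the two dominant terms put (X, Y) at bounded
   distance from the ray spanned by the normal of one side. *)
Lemma log_cover : exists2 K : R, 1 <= K & forall dl : R, 0 < dl ->
  exists2 r : R, 0 < r & forall z w x : R[i], cabs x <= cabs t00.1 / 2 ->
  \sum_(t <- s) t.1 * z ^+ t.2.1 * w ^+ t.2.2 = x -> r <= cabs z \/ r <= cabs w ->
  exists al be c, let ab := bezout_pair al be in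
    [/\ is_side s al be c, z != 0, w != 0, cabs (z ^ (- ab.1) * w ^ (- ab.2)) <= dl &
     K^-1 <= cabs (z ^ be%:Z * w ^ (- al%:Z)) /\ cabs (z ^ be%:Z * w ^ (- al%:Z)) <= K].
Proof.
have [c1 /andP[c10 c11] hdom] := dominant.
pose Lam := - ln c1; have L0 : 0 <= Lam by rewrite oppr_ge0 ln_le0.
have c1E : c1 = expR (- Lam) by rewrite opprK lnK.
have [D D0 hD] : exists2 D : nat, (0 < D)%N & {in s, forall t : term, (t.2.1 <= D)%N /\ (t.2.2 <= D)%N}.
  have sn : s != [::] by case: (s) t00s.
  have [t1 _ h1] := seq_argmin (fun t : term => - (t.2.1 + t.2.2)%N%:Z) sn.
  exists (t1.2.1 + t1.2.2).+1 => // t /h1; rewrite lerN2 lez_nat => h.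
  have key (x y N : nat) : (x + y <= N -> x <= N.+1 /\ y <= N.+1)%N by lia.
  exact: key.
exists (expR Lam); first by rewrite -expR0 ler_expR.
move=> dl dl0.
(* Normals of sides have coordinates at most D, so B bounds their Bezout coefficients uniformly and
   [r] can be fixed before the side is known. *)
have [B hB] := nat_bound2 D (fun al be => `|(bezout_pair al be).1| + `|(bezout_pair al be).2|)%N.
pose bg := Lam * D%:R + D%:R * (2 * Lam * D%:R ^+ 2 + 1).
pose L := `|ln dl|.
pose bg2 := D%:R * L + B%:R * Lam + 1.
(* The summands serve in turn [normal_cone], the lower bound on [sg], and the nonvanishing of the
   coordinates. *)
pose r := expR bg + expR bg2 + c1^-1 + 1.
have e1 := expR_gt0 bg; have e2 := expR_gt0 bg2.
have c1V : 0 < c1^-1 by rewrite invr_gt0.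
have rb1 : expR bg <= r by rewrite /r; lra.
have rb2 : expR bg2 <= r by rewrite /r; lra.
exists r; first by rewrite /r; lra.
move=> z w x hx e hbig.
have [t [t' [ts ts' ne mu1 [ht hn]]]] := hdom z w x hx e.
(* If y = 0, both dominant monomials are powers of y' alone, with different exponents, and their
   ratio is at least |y'| > 1 / c1. *)
have nz (y y' : R[i]) (i j i' j' : nat) : (i, j) <> (i', j') ->
    1 <= cabs y ^+ i * cabs y' ^+ j -> c1 * (cabs y ^+ i * cabs y' ^+ j) <= cabs y ^+ i' * cabs y' ^+ j' ->
    cabs y ^+ i' * cabs y' ^+ j' <= cabs y ^+ i * cabs y' ^+ j -> r <= cabs y \/ r <= cabs y' -> y != 0.
  move=> nij h1 h2 h3 hb; apply/eqP => y0; rewrite y0 cabs0 in h1 h2 h3 hb.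
  have {}hb : r <= cabs y' by case: hb => //; rewrite /r; lra.
  have i0 : i = 0%N by by case: i {nij h2 h3} h1 => // i; rewrite exprS !mul0r ler10.
  have i0' : i' = 0%N.
    case: i' {nij h3} h2 => // i'; rewrite exprS !mul0r => h2.
    have : 0 < c1 * (0 ^+ i * cabs y' ^+ j) by rewrite mulr_gt0 //; lra.
    by move/lt_le_trans => /(_ _ h2); rewrite ltxx.
  rewrite i0 i0' !expr0 !mul1r in h1 h2 h3.
  have y1 : 1 < cabs y' by apply: lt_le_trans hb; rewrite /r; lra.
  have : (j' < j)%N.
    rewrite ltn_neqAle; apply/andP; split; first by apply/eqP => jj; apply: nij; rewrite i0 i0' jj.
    by rewrite -(ler_eXn2l y1).
  move=> jj; have h4 : cabs y' ^+ j'.+1 <= cabs y' ^+ j by rewrite ler_eXn2l.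
  have h5 : c1 * cabs y' ^+ j'.+1 <= cabs y' ^+ j' by apply: le_trans h2; rewrite ler_pM2l.
  have y'0 : 0 < cabs y' ^+ j' by rewrite exprn_gt0 //; lra.
  move: h5; rewrite exprSr mulrCA -[X in _ <= X]mulr1 ler_pM2l // mulrC -ler_pdivlMr // mul1r => h5.
  by move: hb; rewrite /r; lra.
have pairE (q : nat * nat) : q = (q.1, q.2) by case: q.
have z0 : z != 0.
  apply: (nz z w t.2.1 t.2.2 t'.2.1 t'.2.2) => //; first by rewrite -!pairE.
  exact: ht.
have w0 : w != 0.
  have sw (i j : nat) : cabs w ^+ j * cabs z ^+ i = cabs z ^+ i * cabs w ^+ j by rewrite mulrC.
  apply: (nz w z t.2.2 t.2.1 t'.2.2 t'.2.1); rewrite ?sw //.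
  - by move=> [h1 h2]; apply: ne; rewrite (pairE t.2) (pairE t'.2) h1 h2.
  - exact: ht.
  - by case: hbig; [right|left].
have zp : 0 < cabs z by rewrite cabs_gt0.
have wp : 0 < cabs w by rewrite cabs_gt0.
pose X := ln (cabs z); pose Y := ln (cabs w).
have zE : cabs z = expR X by rewrite lnK.
have wE : cabs w = expR Y by rewrite lnK.
have muE (i j : nat) : cabs z ^+ i * cabs w ^+ j = expR (i%:R * X + j%:R * Y).
  by rewrite zE wE expRD !expRM_natl.
have hbig2 : (bg <= X /\ bg2 <= X) \/ (bg <= Y /\ bg2 <= Y).
  have key y : r <= expR y -> bg <= y /\ bg2 <= y.
    by move=> h; split; rewrite -ler_expR (le_trans _ h).
  by case: hbig; rewrite ?zE ?wE => /key h; [left|right].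
have [al [be [c [hs hth]]]] : exists al be c, is_side s al be c /\ `|be%:R * X - al%:R * Y| <= Lam.
  apply: (@normal_cone R s exX exY RC D Lam D0 L0 hD t t' X Y ts ts' ne).
  - by move=> t'' /ht; rewrite !muE ler_expR.
  - by move: hn; rewrite !muE c1E -expRD ler_expR addrC.
  - by case: hbig2 => -[? _]; [left|right].
exists al, be, c => ab.
have [alD beD] := is_side_le hD hs.
have cop : coprime al be by case: hs.
have hab := bezout_pairP cop; rewrite -/ab in hab.
have hB1 := hB _ _ alD beD; rewrite -/ab in hB1.
have habR : ab.1%:~R * al%:R + ab.2%:~R * be%:R = 1 :> R.
  by move: (congr1 (fun k : int => k%:~R : R) hab); rewrite intrD !intrM -!pmulrn.
have ba (k : int) : (`|k| <= B)%N -> `|k%:~R : R| <= B%:R.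
  by move=> h; rewrite -intr_norm -[B%:R]/(B%:Z%:~R) ler_int -abszE lez_nat.
have ha : `|ab.1%:~R : R| <= B%:R by apply: ba; apply: leq_trans hB1; rewrite leq_addr.
have hb : `|ab.2%:~R : R| <= B%:R by apply: ba; apply: leq_trans hB1; rewrite leq_addl.
(* [th] is ln |tau| and [sg] is - ln |v|. *)
pose th := be%:R * X - al%:R * Y; pose sg := ab.1%:~R * X + ab.2%:~R * Y.
have XE : X = al%:R * sg + ab.2%:~R * th.
  apply: (@etrans _ _ ((ab.1%:~R * al%:R + ab.2%:~R * be%:R) * X)); first by rewrite habR mul1r.
  by rewrite /sg /th; ring.
have YE : Y = be%:R * sg - ab.1%:~R * th.
  apply: (@etrans _ _ ((ab.1%:~R * al%:R + ab.2%:~R * be%:R) * Y)); first by rewrite habR mul1r.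
  by rewrite /sg /th; ring.
(* X and Y are combinations of sg and th with bounded coefficients; as th is bounded by Lam, a small
   sg would keep both of them below [bg2]. *)
have sgL : L <= sg.
  rewrite leNgt; apply/negP => lt.
  have key (n : nat) (k : R) : (n <= D)%N -> `|k| <= B%:R -> n%:R * sg + k * th < bg2.
    move=> nD kB; have h1 : n%:R * sg <= D%:R * L.
      apply: (@le_trans _ _ (n%:R * L)); first by rewrite ler_wpM2l // ltW.
      by rewrite ler_wpM2r ?normr_ge0 // ler_nat.
    have h2 : k * th <= B%:R * Lam.
      by apply: le_trans (ler_norm _) _; rewrite normrM; apply: ler_pM.
    by rewrite /bg2 ltr_pwDr // lerD.
  have k1 := key al _ alD hb; rewrite -XE in k1.
  have k2 : Y < bg2 by rewrite YE -mulNr; apply: key => //; rewrite normrN.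
  by case: hbig2 => -[_ h]; [move: (le_lt_trans h k1) | move: (le_lt_trans h k2)]; rewrite ltxx.
have nE (k1 k2 : int) : cabs (z ^ k1 * w ^ k2) = expR (k1%:~R * X + k2%:~R * Y).
  by rewrite cabsM !cabs_expz zE wE !expR_expz expRD.
split=> //.
  rewrite nE !rmorphN !mulNr -opprD -/sg -[dl]lnK // ler_expR.
  by rewrite lerNl; apply: le_trans sgL; rewrite /L -normrN ler_norm.
have -> : cabs (z ^ be%:Z * w ^ (- al%:Z)) = expR th.
  by rewrite nE rmorphN mulNr -!pmulrn.
by move: hth; rewrite -/th ler_norml => /andP[h1 h2]; rewrite -expRN !ler_expR.
Qed.

End LogarithmicCover.

(** * Newton polygons *)

Section Terms.
Variable R : realType.
Notation term := (R[i] * (nat * nat))%type.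
Implicit Types g h : {poly {poly R[i]}}.

Definition terms g : seq term :=
  [seq t <- [seq (bcoef g l m, (l, m)) | m <- iota 0 (size g), l <- iota 0 (size g`_m)] | t.1 != 0].

Lemma mem_terms g (t : term) : (t \in terms g) = (t.1 != 0) && (t.1 == bcoef g t.2.1 t.2.2).
Proof.
rewrite mem_filter; case: (boolP (t.1 != 0)) => //= t0; apply/allpairsPdep/eqP => [[m [l [_ _ ->]]] //|e].
exists t.2.2, t.2.1; rewrite !mem_iota /= !add0n -e; split; last by case: (t) => ? [].
- rewrite ltnNge; apply/negP => h; move: t0; rewrite e /bcoef (nth_default _ h) coef0 eqxx //.
- rewrite ltnNge; apply/negP => h; move: t0; rewrite e /bcoef (nth_default _ h) eqxx //.
Qed.

Lemma terms_uniq g : uniq (map snd (terms g)).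
Proof.
apply: subseq_uniq (map_subseq _ (filter_subseq _ _)) _.
rewrite map_allpairs; apply: allpairs_uniq_dep; first exact: iota_uniq.
  by move=> m _; exact: iota_uniq.
by move=> [m l] [m' l'] /= _ _ [-> ->].
Qed.

Lemma terms_neq0 g : {in terms g, forall t, t.1 != 0}.
Proof. by move=> t; rewrite mem_terms => /andP[]. Qed.

Lemma terms_coef g t : t \in terms g -> bcoef g t.2.1 t.2.2 = t.1.
Proof. by rewrite mem_terms => /andP[_ /eqP]. Qed.

Lemma mem_terms_coef g l m : bcoef g l m != 0 -> (bcoef g l m, (l, m)) \in terms g.
Proof. by rewrite mem_terms /= eqxx andbT. Qed.

Lemma beval_terms g (p : C2 R) : beval g p = \sum_(t <- terms g) t.1 * p.1 ^+ t.2.1 * p.2 ^+ t.2.2.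
Proof.
rewrite /beval /terms big_filter big_mkcond /=.
rewrite (eq_bigr (fun t : term => t.1 * p.1 ^+ t.2.1 * p.2 ^+ t.2.2)); last first.
  by move=> t _; case: eqP => //= ->; rewrite !mul0r.
have io n (F : nat -> R[i]) : \sum_(i <- iota 0 n) F i = \sum_(i < n) F i.
  by rewrite -(big_mkord xpredT) /index_iota subn0.
rewrite big_allpairs_dep io (horner_coef g) horner_sum.
apply: eq_bigr => m _; rewrite hornerM -polyC_exp hornerC.
by rewrite io horner_coef mulr_suml.
Qed.

Lemma bcoefB_const g (x : R[i]) l m : bcoef (g - x%:P%:P) l m = bcoef g l m - x *+ ((l, m) == (0, 0)%N).
Proof.
rewrite /bcoef coefB coefC; case: m => [|m] /=; last by rewrite subr0 xpair_eqE andbF mulr0n subr0.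
by rewrite coefB coefC xpair_eqE andbT; case: (l == 0%N).
Qed.

Lemma bevalB_const g (x : R[i]) (p : C2 R) : beval (g - x%:P%:P) p = beval g p - x.
Proof. by rewrite /beval hornerD hornerN hornerC hornerD hornerN hornerC. Qed.

Lemma beval_is_diff g (p : C2 R) : is_diff p (beval g : C2 R -> Cplx R) (lin2 (evX p.1 p.2 g) (evU p.1 p.2 g)).
Proof.
pose sg := cabs p.1 + cabs p.2 + 1.
have Zp := cabs_ge0 p.1; have Wp := cabs_ge0 p.2.
have sg0 : 0 < sg by rewrite /sg; lra.
apply: (@is_diff_quadratic R _ _ _ _ 1 (((sg ^+ 2)^-1 * norm2 (2 * sg) g))); first by rewrite ltr01.
move=> v v1 v2.
have k1 : cabs p.1 <= sg by rewrite /sg; lra.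
have k2 : cabs p.2 <= sg by rewrite /sg; lra.
have k3 : cabs (v.1 + p.1) <= sg by apply: le_trans (cabsD _ _) _; rewrite /sg; lra.
have k4 : cabs (v.2 + p.2) <= sg by apply: le_trans (cabsD _ _) _; rewrite /sg; lra.
by have := ev2_taylor sg0 g k1 k2 k3 k4; rewrite !addrK.
Qed.

Lemma beval_continuous g (q : C2 R) : {for q, continuous (beval g : C2 R -> Cplx R)}.
Proof. by apply: differentiable_continuous; have [] := beval_is_diff g q. Qed.

End Terms.

(** * Convex hulls and faces *)

Section NewtonPolygon.
Variable R : realType.
Notation term := (R[i] * (nat * nat))%type.

Definition between (t : R) (x y : plane R) : plane R :=
  (t * x.1 + (1 - t) * y.1, t * x.2 + (1 - t) * y.2).

Lemma conv_hull_sub (A : set (plane R)) : A `<=` conv_hull A.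
Proof. exact: sub_gen_smallest. Qed.

Lemma conv_hull_min (A C : set (plane R)) :
  (forall x y t, 0 <= t <= 1 -> C x -> C y -> C (between t x y)) -> A `<=` C -> conv_hull A `<=` C.
Proof.
move=> hC; apply: smallest_sub => x y l; rewrite !inE => Cx Cy.
by apply: (hC x y l%:num) => //; rewrite ge0 le1.
Qed.

Lemma conv_hull_between (A : set (plane R)) x y t : 0 <= t <= 1 -> conv_hull A x -> conv_hull A y ->
  conv_hull A (between t x y).
Proof.
move=> /andP[t0 t1] hx hy C [cC AC].
have := cC x y (Itv01 t0 t1); rewrite !inE => /(_ (hx C (conj cC AC)) (hy C (conj cC AC))).
by [].
Qed.

Lemma pairing_between (eta x y : plane R) t :
  pairing eta (between t x y) = t * pairing eta x + (1 - t) * pairing eta y.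
Proof. by rewrite /pairing /=; ring. Qed.

Definition pt (e : nat * nat) : plane R := (e.1%:R, e.2%:R).

Lemma comb_le (t x y M : R) : 0 <= t <= 1 -> x <= M -> y <= M -> t * x + (1 - t) * y <= M.
Proof.
move=> /andP[t0 t1] hx hy.
have h1 : 0 <= t * (M - x) by rewrite mulr_ge0 // subr_ge0.
have h2 : 0 <= (1 - t) * (M - y) by rewrite mulr_ge0 // subr_ge0.
lra.
Qed.

Lemma comb_eq (t x y M : R) : 0 <= t <= 1 -> x <= M -> y <= M -> t * x + (1 - t) * y = M ->
  (t = 0 \/ x = M) /\ (1 - t = 0 \/ y = M).
Proof.
move=> /andP[t0 t1] hx hy e.
have h1 : 0 <= t * (M - x) by rewrite mulr_ge0 // subr_ge0.
have h2 : 0 <= (1 - t) * (M - y) by rewrite mulr_ge0 // subr_ge0.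
have e1 : t * (M - x) = 0 by lra.
have e2 : (1 - t) * (M - y) = 0 by lra.
split.
  by move/eqP: e1; rewrite mulf_eq0 => /orP[/eqP ->|]; [left | rewrite subr_eq0 => /eqP ->; right].
by move/eqP: e2; rewrite mulf_eq0 => /orP[/eqP ->|]; [left | rewrite subr_eq0 => /eqP ->; right].
Qed.

(** The condition is convex, because a combination reaches the maximum of [eta] only if every point
    with positive weight does. It bounds a second functional on a face by inspecting generators
    alone. *)
Lemma conv_hull_lex (A : set (plane R)) (eta nu : plane R) (M r0 r1 : R) :
  (forall x, A x -> pairing eta x <= M /\ (pairing eta x = M -> r0 <= pairing nu x <= r1)) ->
  forall x, conv_hull A x -> pairing eta x <= M /\ (pairing eta x = M -> r0 <= pairing nu x <= r1).
Proof.
move=> hA; apply: conv_hull_min => // x y t t01 [hx1 hx2] [hy1 hy2].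
rewrite !pairing_between; split; first exact: comb_le.
move=> /(comb_eq t01 hx1 hy1) [[t0|/hx2 /andP[x1 x2]] [t1|/hy2 /andP[y1 y2]]].
- by exfalso; lra.
- by rewrite t0 mul0r subr0 add0r mul1r y1.
- by rewrite t1 mul0r addr0 (_ : t = 1) ?mul1r ?x1 //; lra.
- rewrite comb_le // andbT -lerN2 (_ : - _ = t * (- pairing nu x) + (1 - t) * (- pairing nu y)); last by ring.
  by rewrite comb_le // lerN2.
Qed.

Lemma affine_dim_le (A : set (plane R)) d (q : plane R) (W : {vspace plane R}) :
  affine_dim A d -> A `<=` translate q W -> (d <= \dim W)%N.
Proof.
move=> [p [V [_ hmin <-]]] /hmin hVW; apply/dimvS/subvP => v vV.
have [w1 w1W e1] := hVW p (ex_intro2 _ _ 0 (mem0v V) (addr0 p)).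
have [w2 w2W e2] := hVW (p + v) (ex_intro2 _ _ v vV erefl).
have -> : v = w2 - w1 by rewrite -[v](addKr p) -e2 -e1 opprD addrACA addNr add0r addrC.
exact: memvB.
Qed.

Lemma affine_dim_uniq (A : set (plane R)) d d' : affine_dim A d -> affine_dim A d' -> d = d'.
Proof.
move=> h h'; apply/eqP; rewrite eqn_leq.
have [p [V [AV _ dV]]] := h; have [q [W [AW _ dW]]] := h'.
by rewrite -{1}dW -{2}dV (affine_dim_le h AW) (affine_dim_le h' AV).
Qed.

Lemma dim_line (v : plane R) : (\dim <[v]>%VS <= 1)%N.
Proof. by rewrite dim_vline; case: eqP. Qed.

Section Polygon.
Variable h : {poly {poly R[i]}}.

Lemma newton_pt t : t \in terms h -> newton h (pt t.2).
Proof.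
move=> ts; apply: conv_hull_sub; exists t.2.1, t.2.2; split=> //.
by rewrite (terms_coef ts); exact: (terms_neq0 ts).
Qed.

Lemma newton_lex (eta nu : plane R) (M r0 r1 : R) :
  {in terms h, forall t, pairing eta (pt t.2) <= M /\ (pairing eta (pt t.2) = M -> r0 <= pairing nu (pt t.2) <= r1)} ->
  forall x, newton h x -> pairing eta x <= M /\ (pairing eta x = M -> r0 <= pairing nu x <= r1).
Proof.
by move=> hA; apply: conv_hull_lex => x [l [m [/mem_terms_coef lm ->]]]; exact: hA lm.
Qed.

Lemma newton_half (eta : plane R) (M : R) :
  {in terms h, forall t, pairing eta (pt t.2) <= M} -> forall x, newton h x -> pairing eta x <= M.
Proof.
move=> hA x Px; have := @newton_lex eta 0 M 0 0 _ x Px; case=> // t ts; split; first exact: hA.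
by rewrite /pairing !mul0r addr0 lexx.
Qed.

Definition nrm (al be : nat) : plane R := covec R (al%:Z, be%:Z).

Lemma pairing_nrm al be x : pairing (nrm al be) x = al%:R * x.1 + be%:R * x.2.
Proof. by []. Qed.

Lemma pairing_nrm_pt al be e : pairing (nrm al be) (pt e) = (al * e.1 + be * e.2)%N%:R.
Proof. by rewrite pairing_nrm natrD !natrM. Qed.

Lemma pairing_covec_pt (a : int * int) e : pairing (covec R a) (pt e) = (a.1 * e.1%:Z + a.2 * e.2%:Z)%:~R.
Proof. by rewrite /pairing intrD !intrM. Qed.

Section Face.
Variables (al be c : nat).
Hypothesis hc : {in terms h, forall t, (al * t.2.1 + be * t.2.2 <= c)%N}.

Lemma newton_below x : newton h x -> pairing (nrm al be) x <= c%:R.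
Proof. by apply: newton_half => t ts; rewrite pairing_nrm_pt ler_nat hc. Qed.

Hypothesis exo : exists2 t, t \in terms h & online al be c t.

Lemma faceE x : face (newton h) (nrm al be) x <-> newton h x /\ pairing (nrm al be) x = c%:R.
Proof.
have [t ts to] := exo; split=> [[Px hx]|[Px e]]; last by split=> // y /newton_below; rewrite e.
split=> //; apply/eqP; rewrite eq_le newton_below //=.
by have := hx _ (newton_pt ts); rewrite pairing_nrm_pt (eqP to).
Qed.

Lemma face_pt t : t \in terms h -> face (newton h) (nrm al be) (pt t.2) <-> online al be c t.
Proof.
move=> ts; rewrite faceE pairing_nrm_pt; split=> [[_ /eqP]|o]; first by rewrite eqr_nat.
by split; [exact: newton_pt | rewrite (eqP o)].
Qed.

Lemma beval_trunc_nrm (p : C2 R) : beval (trunc h (nrm al be)) p =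
  \sum_(t <- side_terms (terms h) al be c) t.1 * p.1 ^+ t.2.1 * p.2 ^+ t.2.2.
Proof.
have cE l m : bcoef (trunc h (nrm al be)) l m =
    if `[< face (newton h) (nrm al be) (l%:R, m%:R) >] then bcoef h l m else 0.
  rewrite {1}/bcoef /trunc coef_poly; case: ltnP => hm; last first.
    by rewrite coef0 /bcoef (nth_default _ hm) coef0 if_same.
  rewrite coef_poly; case: ltnP => hl //.
  by rewrite /bcoef (nth_default _ hl) if_same.
rewrite beval_terms; apply: perm_big; apply: uniq_perm.
- exact: map_uniq (terms_uniq _).
- by rewrite filter_uniq // (map_uniq (terms_uniq _)).
move=> t; rewrite [RHS]mem_filter; case: (boolP (t \in terms h)) => ht; last first.
  rewrite andbF; move: ht; rewrite !mem_terms cE; case: asboolP => [_|_ _]; first by move/negbTE.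
  by case: eqP => //= /eqP/negbTE.
have := face_pt ht; rewrite /pt => hh; rewrite mem_terms cE (terms_coef ht) (terms_neq0 ht) andbT.
case: asboolP => [/hh ->|hn]; first by rewrite eqxx.
have -> : online al be c t = false by apply/negbTE/negP => /hh.
exact/negbTE/(terms_neq0 ht).
Qed.

End Face.
End Polygon.
End NewtonPolygon.

(** * Sides and their integer points *)

Section SidesOfNewtonPolygon.
Variable R : realType.
Notation term := (R[i] * (nat * nat))%type.
Notation pt := (@pt R).
Notation nrm := (@nrm R).
Variable g : {poly {poly R[i]}}.
Hypothesis hdim : affine_dim (newton g) 2.
Hypothesis hrect : rectangle_closed (newton g).

Lemma exists_posX : exists2 t, t \in terms g & (0 < t.2.1)%N.
Proof.
apply: contrapT => /forall2NP h.
have /(affine_dim_le hdim) : newton g `<=` translate 0 <[((0, 1)%R : plane R)]>%VS.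
  move=> x Px; have [] := @newton_lex R g 0 (1, 0) 0 0 0 _ x Px.
    move=> t ts; rewrite /pairing /= !mul0r addr0 mul1r addr0; split=> // _.
    by have [//|/negP] := h t; rewrite -eqn0Ngt => /eqP ->; rewrite lexx.
  rewrite /pairing /= !mul0r addr0 mul1r addr0 => _ /(_ erefl) /le_anti e.
  exists (x.2 *: ((0, 1) : plane R)); first by rewrite /= memvZ ?memv_line.
  by rewrite add0r; case: x e {Px} => x1 x2 /= <-; congr pair; rewrite /= ?scaler0 //; exact: mulr1.
by move=> /leq_trans /(_ (dim_line _)).
Qed.

Lemma exists_posY : exists2 t, t \in terms g & (0 < t.2.2)%N.
Proof.
apply: contrapT => /forall2NP h.
have /(affine_dim_le hdim) : newton g `<=` translate 0 <[((1, 0)%R : plane R)]>%VS.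
  move=> x Px; have [] := @newton_lex R g 0 (0, 1) 0 0 0 _ x Px.
    move=> t ts; rewrite /pairing /= !mul0r addr0 mul1r add0r; split=> // _.
    by have [//|/negP] := h t; rewrite -eqn0Ngt => /eqP ->; rewrite lexx.
  rewrite /pairing /= !mul0r addr0 mul1r add0r => _ /(_ erefl) /le_anti e.
  exists (x.1 *: ((1, 0) : plane R)); first by rewrite /= memvZ ?memv_line.
  by rewrite add0r; case: x e {Px} => x1 x2 /= <-; congr pair; rewrite /= ?scaler0 //; exact: mulr1.
by move=> /leq_trans /(_ (dim_line _)).
Qed.

Lemma rectangle_corners u v : newton g (u, v) -> [/\ newton g (0, 0), newton g (u, 0) & newton g (0, v)].
Proof.
move=> /hrect h; split; apply: h; apply: conv_hull_sub.
- by apply: Or41.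
- by apply: Or42.
- by apply: Or43.
Qed.

Lemma rectangle_halfplane (p q r : int) :
  {in terms g, forall t, p * t.2.1%:Z + q * t.2.2%:Z <= r} ->
  {in terms g, forall t, q * t.2.2%:Z <= r /\ p * t.2.1%:Z <= r}.
Proof.
move=> h t ts; have H x : newton g x -> pairing (covec R (p, q)) x <= r%:~R.
  by apply: newton_half => t' t's; rewrite pairing_covec_pt ler_int h.
have [_ /H h1 /H h2] := rectangle_corners (newton_pt ts).
move: h1 h2; rewrite /pairing /= !mulr0 addr0 add0r => h1 h2.
by split; rewrite -(ler_int R) intrM.
Qed.

(** Otherwise all terms satisfy l + m >= 1. Condition (i), applied to the projections to one axis
    and then to the other, turns this into 0 <= -1. *)
Lemma origin_term : exists2 t, t \in terms g & t.2 = (0, 0)%N.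
Proof.
apply: contrapT => /forall2NP h.
have h1 : {in terms g, forall t, (-1) * t.2.1%:Z + (-1) * t.2.2%:Z <= -1}.
  move=> t ts; have [//|ne] := h t.
  have key (l m : nat) : (l, m) <> (0, 0)%N -> (-1) * l%:Z + (-1) * m%:Z <= -1.
    move=> k; have : (0 < l + m)%N by rewrite lt0n addn_eq0; apply/negP => /andP[/eqP l0 /eqP m0]; apply: k; rewrite l0 m0.
    by lia.
  by apply: key; move: ne; case: (t.2).
have h2 : {in terms g, forall t, (-1) * t.2.1%:Z + 0 * t.2.2%:Z <= -1}.
  by move=> t ts; rewrite mul0r addr0; have [] := rectangle_halfplane h1 ts.
have [t ts _] := exists_posX.
by have [] := rectangle_halfplane h2 ts; rewrite mul0r.
Qed.

Lemma face_scale (k : R) (eta nu : plane R) P : 0 < k -> eta = (k * nu.1, k * nu.2) ->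
  face P eta = face P nu.
Proof.
move=> k0 ->; have e x : pairing (k * nu.1, k * nu.2) x = k * pairing nu x by rewrite /pairing /=; ring.
rewrite eqEsubset; split=> x [Px h]; split=> // y Py; move: (h y Py); rewrite !e ler_pM2l //.
Qed.

(** A real covector orthogonal to a nonzero integral vector is a positive multiple of that vector
    turned by a right angle, in one of its two orientations. *)
Lemma edge_direction (eta : plane R) (dl dm : int) : (dl, dm) <> (0, 0) ->
  eta.1 * dl%:~R + eta.2 * dm%:~R = 0 -> eta.1 != 0 \/ eta.2 != 0 ->
  exists N1 N2 : int, exists k : R, [/\ 0 < k, eta = (k * N1%:~R, k * N2%:~R), N1 * dl + N2 * dm = 0 &
    (N1 != 0) || (N2 != 0)].
Proof.
move=> dn e en.
pose D : R := dl%:~R ^+ 2 + dm%:~R ^+ 2; pose k0 := eta.1 * dm%:~R - eta.2 * dl%:~R.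
have nz : (dm != 0) || (dl != 0).
  by rewrite -negb_and; apply/negP => /andP[/eqP h1 /eqP h2]; apply: dn; rewrite h1 h2.
have D0 : 0 < D.
  rewrite lt_neqAle addr_ge0 ?sqr_ge0 // andbT eq_sym paddr_eq0 ?sqr_ge0 // !sqrf_eq0 !intr_eq0.
  by rewrite negb_and orbC.
have e1 : eta.1 = k0 / D * dm%:~R.
  apply: (mulIf (lt0r_neq0 D0)); rewrite mulrAC divfK ?lt0r_neq0 //.
  have -> : k0 * dm%:~R = eta.1 * D - dl%:~R * (eta.1 * dl%:~R + eta.2 * dm%:~R) by rewrite /k0 /D; ring.
  by rewrite e mulr0 subr0.
have e2 : eta.2 = k0 / D * - dl%:~R.
  apply: (mulIf (lt0r_neq0 D0)); rewrite mulrAC divfK ?lt0r_neq0 //.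
  have -> : k0 * - dl%:~R = eta.2 * D - dm%:~R * (eta.1 * dl%:~R + eta.2 * dm%:~R) by rewrite /k0 /D; ring.
  by rewrite e mulr0 subr0.
have k0n : k0 / D != 0.
  by apply/eqP => h; move: en; rewrite e1 e2 h !mul0r eqxx; case.
case: (ltrgt0P (k0 / D)) => h; last by move: k0n; rewrite h eqxx.
  exists dm, (- dl), (k0 / D); split=> //; rewrite ?oppr_eq0 //; last by ring.
  by rewrite rmorphN -e1 -e2; case: (eta).
exists (- dm), dl, (- (k0 / D)); split=> //; rewrite ?oppr_eq0 ?oppr_gt0 //; last by ring.
by rewrite rmorphN mulrNN -e1 mulNr -mulrN -e2; case: (eta).
Qed.

Lemma pt_inj (e e' : nat * nat) : pt e = pt e' -> e = e'.
Proof. by case: e e' => l m [l' m'] [/eqP + /eqP]; rewrite !eqr_nat => /eqP -> /eqP ->. Qed.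

(** With a single maximal term every functional is constant on the face by [newton_lex], so the face
    would be a point. *)
Lemma edge_two_terms (eta : plane R) : affine_dim (face (newton g) eta) 1 ->
  exists t1 t2, [/\ t1 \in terms g, t2 \in terms g, t1.2 <> t2.2,
    pairing eta (pt t2.2) = pairing eta (pt t1.2) &
    {in terms g, forall t, pairing eta (pt t.2) <= pairing eta (pt t1.2)}].
Proof.
move=> d1; have sn : terms g != [::] by have [t] := exists_posX; case: (terms g).
have [t1 t1s h1] := seq_argmin (fun t : term => - pairing eta (pt t.2)) sn.
have {}h1 : {in terms g, forall t, pairing eta (pt t.2) <= pairing eta (pt t1.2)}.
  by move=> t /h1; rewrite lerN2.
apply: contrapT => /forallNP /(_ t1) /forallNP h.
have H t : t \in terms g -> pairing eta (pt t.2) = pairing eta (pt t1.2) -> t.2 = t1.2.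
  by move=> ts e; apply: contrapT => ne; apply: (h t); split=> // e'; apply: ne.
have fE nu x : face (newton g) eta x -> pairing nu x = pairing nu (pt t1.2).
  move=> [Px hx]; have [|h2 h3] := @newton_lex R g eta nu (pairing eta (pt t1.2)) (pairing nu (pt t1.2)) (pairing nu (pt t1.2)) _ x Px.
    by move=> t ts; split=> [|e]; [exact: h1 | rewrite (H t ts e) lexx].
  by apply/esym/le_anti/h3/le_anti; rewrite h2 hx //; exact: newton_pt.
have /(affine_dim_le d1) : face (newton g) eta `<=` translate (pt t1.2) 0%VS.
  move=> x fx; exists 0; first exact: mem0v.
  have := fE (1, 0) x fx; have := fE (0, 1) x fx.
  rewrite /pairing /= !mul0r !mul1r !add0r !addr0 => e2 e1.
  by case: x e1 e2 {fx} => x1 x2 /= -> ->.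
by rewrite dimv0.
Qed.

(** The real covector is replaced by the integral normal of a segment between two terms. A negative
    coordinate of it would, by condition (i), place the side on a coordinate axis. *)
Lemma free_side_normal G : free_side (newton g) G ->
  exists al be c, is_side (terms g) al be c /\ G = face (newton g) (nrm al be).
Proof.
move=> [[[eta GE] d1] nax]; have [t1 [t2 [t1s t2s ne e hmax]]] : exists t1 t2, [/\ t1 \in terms g, t2 \in terms g, t1.2 <> t2.2,
    pairing eta (pt t2.2) = pairing eta (pt t1.2) &
    {in terms g, forall t, pairing eta (pt t.2) <= pairing eta (pt t1.2)}].
  by apply: edge_two_terms; rewrite -GE.
have etaN : eta.1 != 0 \/ eta.2 != 0.
  case: (eqVneq eta.1 0) => e1; last by left.
  case: (eqVneq eta.2 0) => e2; last by right.
  have PG : newton g = G.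
    rewrite GE eqEsubset; split=> x; last by case.
    by move=> Px; split=> // y Py; rewrite /pairing e1 e2 !mul0r.
  by have := affine_dim_uniq hdim; rewrite PG => /(_ _ d1).
pose dl := t2.2.1%:Z - t1.2.1%:Z; pose dm := t2.2.2%:Z - t1.2.2%:Z.
have dn : (dl, dm) <> (0, 0).
  move=> [/subr0_eq [h1] /subr0_eq [h2]]; apply: ne.
  by rewrite [LHS]surjective_pairing [RHS]surjective_pairing h1 h2.
have ed : eta.1 * dl%:~R + eta.2 * dm%:~R = 0.
  by move: e; rewrite /pairing /= /dl /dm !intrB -!pmulrn => e; lra.
have [N1 [N2 [k [k0 etaE Nd Nn]]]] := edge_direction dn ed etaN.
have pE t : pairing eta (pt t) = k * (N1 * t.1%:Z + N2 * t.2%:Z)%:~R.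
  by rewrite etaE /pairing /= intrD !intrM -!pmulrn; ring.
have Nmax t0 : t0 \in terms g -> pairing eta (pt t0.2) = pairing eta (pt t1.2) ->
    {in terms g, forall t, N1 * t.2.1%:Z + N2 * t.2.2%:Z <= N1 * t0.2.1%:Z + N2 * t0.2.2%:Z}.
  by move=> t0s e0 t /hmax; rewrite -e0 !pE ler_pM2l // ler_int.
have h1 := Nmax _ t1s erefl; have h2 := Nmax _ t2s e.
have Gx x : G x -> eta.1 * x.1 + eta.2 * x.2 = pairing eta (pt t1.2).
  rewrite GE => -[Px hx]; apply/le_anti/andP; split; last exact: (hx _ (newton_pt t1s)).
  exact: newton_half hmax _ Px.
have N10 : 0 <= N1.
  rewrite leNgt; apply/negP => n1.
  have l0 t : t \in terms g -> (forall t', t' \in terms g -> N1 * t'.2.1%:Z + N2 * t'.2.2%:Z <= N1 * t.2.1%:Z + N2 * t.2.2%:Z) -> t.2.1 = 0%N.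
    by move=> ts hm; have [k1 _] := rectangle_halfplane hm ts; move: k1; rewrite lerDr nmulr_rge0 // lez_nat leqn0 => /eqP.
  have l1 := l0 _ t1s h1; have l2 := l0 _ t2s h2.
  have dl0 : dl = 0 by rewrite /dl l1 l2 subrr.
  have dm0 : dm != 0 by apply/eqP => z; apply: dn; rewrite dl0 z.
  have n2 : N2 = 0 by move: Nd; rewrite dl0 mulr0 add0r => /eqP; rewrite mulf_eq0 (negbTE dm0) orbF => /eqP.
  apply: nax; left => x /Gx; rewrite pE l1 n2 mul0r mulr0 addr0 mulr0 etaE n2 /= mulr0 mul0r addr0.
  by move/eqP; rewrite !mulf_eq0 (gt_eqF k0) intr_eq0 (lt_eqF n1) /= => /eqP.
have N20 : 0 <= N2.
  rewrite leNgt; apply/negP => n2.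
  have m0 t : t \in terms g -> (forall t', t' \in terms g -> N1 * t'.2.1%:Z + N2 * t'.2.2%:Z <= N1 * t.2.1%:Z + N2 * t.2.2%:Z) -> t.2.2 = 0%N.
    by move=> ts hm; have [_ k1] := rectangle_halfplane hm ts; move: k1; rewrite lerDl nmulr_rge0 // lez_nat leqn0 => /eqP.
  have m1 := m0 _ t1s h1; have m2 := m0 _ t2s h2.
  have dm0 : dm = 0 by rewrite /dm m1 m2 subrr.
  have dl0 : dl != 0 by apply/eqP => z; apply: dn; rewrite dm0 z.
  have n1 : N1 = 0 by move: Nd; rewrite dm0 mulr0 addr0 => /eqP; rewrite mulf_eq0 (negbTE dl0) orbF => /eqP.
  apply: nax; right => x /Gx; rewrite pE m1 n1 mul0r mulr0 addr0 mulr0 etaE n1 /= mulr0 mul0r add0r.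
  by move/eqP; rewrite !mulf_eq0 (gt_eqF k0) intr_eq0 (lt_eqF n2) /= => /eqP.
have e12 : N1 * t2.2.1%:Z + N2 * t2.2.2%:Z = N1 * t1.2.1%:Z + N2 * t1.2.2%:Z.
  by apply/le_anti; rewrite h1 // h2.
have [al [be [c [q [hs q0 E1 E2]]]]] :=
  normal_cone_int exists_posX exists_posY t1s t2s ne N10 N20 Nn h1 e12.
exists al, be, c; split=> //; rewrite GE; apply: (@face_scale (k * q%:R)).
  by rewrite mulr_gt0 // ltr0n.
by rewrite etaE E1 E2 /= !PoszM !intrM -!pmulrn !mulrA.
Qed.

Section OneSide.
Variables al be c : nat.
Hypothesis hs : is_side (terms g) al be c.
Let G := face (newton g) (nrm al be).

Let hc : {in terms g, forall t, (al * t.2.1 + be * t.2.2 <= c)%N}.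
Proof. by case: hs. Qed.

Let exo : exists2 t, t \in terms g & online al be c t.
Proof. by case: hs => _ _ _ [t [t' [ts _ _ o _]]]; exists t. Qed.

Lemma side_level u v : G (u, v) -> al%:R * u + be%:R * v = c%:R.
Proof. by move/(faceE hc exo) => -[_]; rewrite pairing_nrm. Qed.

Lemma normal_collinear (l m l' m' : nat) (a1 a2 b1 b2 : int) : (l, m) <> (l', m') ->
  a1 * l%:Z + a2 * m%:Z = a1 * l'%:Z + a2 * m'%:Z ->
  b1 * l%:Z + b2 * m%:Z = b1 * l'%:Z + b2 * m'%:Z -> a1 * b2 = a2 * b1.
Proof.
move=> ne e e'; apply/eqP; rewrite -subr_eq0; apply/eqP.
have h1 : (l%:Z - l'%:Z) * (a1 * b2 - a2 * b1) = 0.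
  have -> : (l%:Z - l'%:Z) * (a1 * b2 - a2 * b1) =
     b2 * ((a1 * l%:Z + a2 * m%:Z) - (a1 * l'%:Z + a2 * m'%:Z)) - a2 * ((b1 * l%:Z + b2 * m%:Z) - (b1 * l'%:Z + b2 * m'%:Z)) by ring.
  by rewrite e e' !subrr !mulr0 subr0.
have h2 : (m%:Z - m'%:Z) * (a1 * b2 - a2 * b1) = 0.
  have -> : (m%:Z - m'%:Z) * (a1 * b2 - a2 * b1) =
     a1 * ((b1 * l%:Z + b2 * m%:Z) - (b1 * l'%:Z + b2 * m'%:Z)) - b1 * ((a1 * l%:Z + a2 * m%:Z) - (a1 * l'%:Z + a2 * m'%:Z)) by ring.
  by rewrite e e' !subrr !mulr0 subr0.
case: (eqVneq (l%:Z) (l'%:Z)) => [[el]|nl]; last first.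
  by move/eqP: h1; rewrite mulf_eq0 subr_eq0 (negbTE nl) => /eqP.
case: (eqVneq (m%:Z) (m'%:Z)) => [[em]|nm]; first by case: ne; rewrite el em.
by move/eqP: h2; rewrite mulf_eq0 subr_eq0 (negbTE nm) => /eqP.
Qed.

(** Both vectors are orthogonal to the segment between two terms, hence proportional; the origin,
    which lies in the polygon, fixes the sign, and primitivity the length. *)
Lemma outer_normal_uniq a : primitive_outer_normal (newton g) G a -> a = (al%:Z, be%:Z).
Proof.
move=> [cop ha]; have [cop' c0 _ [t [t' [ts ts' ne o o']]]] := hs.
have Gt : G (pt t.2) by apply/(face_pt hc exo).
have Gt' : G (pt t'.2) by apply/(face_pt hc exo).
have [t0 t0s t0E] := origin_term.
have ea : a.1 * t.2.1%:Z + a.2 * t.2.2%:Z = a.1 * t'.2.1%:Z + a.2 * t'.2.2%:Z.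
  apply/le_anti; rewrite -!(ler_int R) -!pairing_covec_pt.
  by rewrite !ha //; apply: newton_pt.
have eb : al%:Z * t.2.1%:Z + be%:Z * t.2.2%:Z = al%:Z * t'.2.1%:Z + be%:Z * t'.2.2%:Z.
  by rewrite -!PoszM -!PoszD (eqP o) (eqP o').
have ne' : (t.2.1, t.2.2) <> (t'.2.1, t'.2.2) by rewrite -!surjective_pairing.
have col := normal_collinear ne' ea eb.
have c'0 : 0 <= a.1 * t.2.1%:Z + a.2 * t.2.2%:Z.
  have := ha _ _ Gt (newton_pt t0s); rewrite !pairing_covec_pt ler_int t0E /= !mulr0 addr0 //.
case E : (a.1 * t.2.1%:Z + a.2 * t.2.2%:Z) c'0 => [n|//] _.
have cE : c%:Z = al%:Z * t.2.1%:Z + be%:Z * t.2.2%:Z by rewrite -!PoszM -PoszD (eqP o).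
have e1 : a.1 * c%:Z = al%:Z * n%:Z.
  rewrite cE -E [LHS](_ : _ = al%:Z * (a.1 * t.2.1%:Z) + (a.1 * be%:Z) * t.2.2%:Z); last by ring.
  by rewrite col; ring.
have e2 : a.2 * c%:Z = be%:Z * n%:Z.
  rewrite cE -E [LHS](_ : _ = be%:Z * (a.2 * t.2.2%:Z) + (a.2 * al%:Z) * t.2.1%:Z); last by ring.
  by rewrite -col; ring.
have pos z (m : nat) : z * c%:Z = m%:Z * n%:Z -> 0 <= z.
  by move=> e; rewrite -(@pmulr_lge0 _ c%:Z) ?e // ltz_nat.
case: a cop ha ea col E e1 e2 => [a1 a2] /= cop _ _ _ _ e1 e2.
case: a1 cop e1 (pos _ _ e1) => // a1 cop e1 _; case: a2 cop e2 (pos _ _ e2) => // a2 cop e2 _.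
have [{}e1] : (a1 * c)%N%:Z = (al * n)%N%:Z by rewrite !PoszM.
have [{}e2] : (a2 * c)%N%:Z = (be * n)%N%:Z by rewrite !PoszM.
have cn : c = n.
  have : (gcdn (c * a1) (c * a2) = gcdn (n * al) (n * be))%N.
    by rewrite [(c * a1)%N]mulnC [(c * a2)%N]mulnC e1 e2 ![(n * _)%N]mulnC.
  by rewrite -!muln_gcdr (eqP cop' : gcdn al be = 1%N) (eqP (cop : gcdn a1 a2 == 1%N)) !muln1.
rewrite -cn in e1 e2; congr (Posz _, Posz _).
  by apply/eqP; rewrite -(eqn_pmul2r c0) e1.
by apply/eqP; rewrite -(eqn_pmul2r c0) e2.
Qed.

(** On an axis the equation of the side leaves at most one point, since c > 0, whereas the side
    contains two terms. Their difference spans its direction. *)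
Lemma face_free_side : free_side (newton g) G.
Proof.
have [cop c0 _ [t [t' [ts ts' ne o o']]]] := hs.
have Gt : G (pt t.2) by apply/(face_pt hc exo).
have Gt' : G (pt t'.2) by apply/(face_pt hc exo).
pose v : plane R := (be%:R, - al%:R).
have vn : v != 0.
  apply/eqP => -[/eqP + /eqP]; rewrite oppr_eq0 !pnatr_eq0 => /eqP b0 /eqP a0.
  by move: cop; rewrite a0 b0.
have key (x y : plane R) : al%:R * x.1 + be%:R * x.2 = c%:R -> al%:R * y.1 + be%:R * y.2 = c%:R ->
    exists k, x - y = k *: v.
  move=> hx hy; case: (eqVneq be 0%N) => b0.
    have a0 : al%:R != 0 :> R by rewrite pnatr_eq0; move: cop; rewrite b0; case: (al).
    exists ((y.2 - x.2) / al%:R); rewrite /v b0; congr pair => /=.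
      rewrite scaler0; rewrite b0 !mul0r !addr0 in hx hy.
      by apply: (mulfI a0); rewrite mulrBr hx hy subrr mulr0.
    by rewrite /GRing.scale /= mulrN divfK // opprB.
  have b0' : be%:R != 0 :> R by rewrite pnatr_eq0.
  exists ((x.1 - y.1) / be%:R); congr pair => /=; first by rewrite /GRing.scale /= divfK.
  apply: (mulfI b0'); rewrite [RHS](_ : _ = - al%:R * ((x.1 - y.1) / be%:R * be%:R)); last first.
    by rewrite /GRing.scale /=; ring.
  by rewrite divfK //; lra.
have lev x : G x -> al%:R * x.1 + be%:R * x.2 = c%:R by case: x => x1 x2; exact: side_level.
split; last first.
  have axis (i j i' j' : nat) : (i, j) <> (i', j') -> i = 0%N -> i' = 0%N -> (j != j').
    by move=> k e1 e2; apply/eqP => ej; apply: k; rewrite e1 e2 ej.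
  have ne' : (t.2.1, t.2.2) <> (t'.2.1, t'.2.2) by rewrite -!surjective_pairing.
  have l1 := lev _ Gt; have l2 := lev _ Gt'; rewrite /= -!natrM -!natrD in l1 l2.
  move/eqP: l1; move/eqP: l2; rewrite !eqr_nat => /eqP l2 /eqP l1.
  case=> h; have := h _ Gt; have := h _ Gt'; move=> /= /eqP + /eqP; rewrite !pnatr_eq0 => /eqP z' /eqP z.
    have := axis _ _ _ _ ne' z z'; rewrite z muln0 add0n in l1; rewrite z' muln0 add0n in l2.
    case: (posnP be) => b0; first by rewrite -l1 b0 in c0.
    by move/eqP; apply; apply/eqP; rewrite -(eqn_pmul2l b0) l1 l2.
  have nn : t.2.1 != t'.2.1 by apply/eqP => e; apply: ne'; rewrite z z' e.
  rewrite z muln0 addn0 in l1; rewrite z' muln0 addn0 in l2.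
  case: (posnP al) => b0; first by rewrite -l1 b0 in c0.
  by move/eqP: nn; apply; apply/eqP; rewrite -(eqn_pmul2l b0) l1 l2.
split; first by exists (nrm al be).
exists (pt t.2), <[v]>%VS; split; last by rewrite dim_vline vn.
- move=> x Gx; have [k e] := key _ _ (lev _ Gx) (lev _ Gt).
  by exists (k *: v); rewrite /= ?memvZ ?memv_line // -e addrC subrK.
- move=> q W GW x [y /vlineP [k ->] <-].
  have [w1 w1W e1] := GW _ Gt; have [w2 w2W e2] := GW _ Gt'.
  have [k' e'] := key _ _ (lev _ Gt') (lev _ Gt).
  have k'0 : k' != 0.
    by apply/eqP => z; apply: ne; apply: pt_inj; apply/esym/eqP; rewrite -subr_eq0 e' z scale0r.
  have vW : v \in W.
    have : k' *: v \in W by rewrite -e' -e1 -e2 opprD addrACA subrr add0r memvB.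
    by move/(memvZ k'^-1); rewrite scalerA mulVf // scale1r.
  exists (w1 + k *: v); first by rewrite /= memvD // memvZ.
  by rewrite addrA e1.
Qed.

End OneSide.
End SidesOfNewtonPolygon.

(** * Lattice points of a side and the constants of its branches *)

Section LatticePoints.
Variable R : realType.
Notation term := (R[i] * (nat * nat))%type.
Notation A2 := {poly {poly R[i]}}.
Notation pt := (@pt R).
Notation nrm := (@nrm R).
Variable g : {poly {poly R[i]}}.
Hypothesis hdim : affine_dim (newton g) 2.
Hypothesis hrect : rectangle_closed (newton g).
Variables al be c : nat.
Hypothesis hs : is_side (terms g) al be c.
Let G := face (newton g) (nrm al be).

Let hc : {in terms g, forall t, (al * t.2.1 + be * t.2.2 <= c)%N}.
Proof. by case: hs. Qed.

Let exo : exists2 t, t \in terms g & online al be c t.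
Proof. by case: hs => _ _ _ [t [t' [ts _ _ o _]]]; exists t. Qed.

Let c0 : (0 < c)%N. Proof. by case: hs. Qed.

(** [Q] is [qhom] at u = 0 as a polynomial, with the inner variable for z and the outer one for w.
    It has the same values as the truncation, and its gradient comes from the derivation rules. *)
Lemma side_nondegenerate : newton_nondegenerate g -> forall Z W : R[i], Z != 0 -> W != 0 ->
  qhom (terms g) c al be id 0 Z W 0 = 0 ->
  ~ (qhomZ (terms g) c al be id 0 Z W = 0 /\ qhomW (terms g) c al be id 0 Z W = 0).
Proof.
move=> nd Z W Z0 W0 q0 [qZ qW].
pose Q : A2 := qhom (terms g) c al be (@io2 R) 0 ('X : {poly R[i]})%:P 'X 0.
have ev0 (x u : R[i]) : ev2 x u (0 : A2) = 0 by rewrite /ev2 !horner0.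
have QE (p : C2 R) : beval (trunc g (nrm al be)) p = ev2 p.1 p.2 Q.
  have -> : beval (trunc g (nrm al be)) p = qhom (terms g) c al be id 0 p.1 p.2 0.
    by rewrite (qhom0E hc) // (beval_trunc_nrm hc exo).
  have H (z w : R[i]) (phi : {rmorphism A2 -> R[i]}) : (forall e, phi (io2 e) = e) ->
      phi 'X = w -> phi 'X%:P = z -> qhom (terms g) c al be id 0 z w 0 = phi Q.
    move=> h1 <- <-; rewrite (qhom_morph (terms g) c al be 0 'X%:P 'X 0 h1).
    by rewrite rmorph0.
  exact: H (ev2_io p.1 p.2) (ev2_U p.1 p.2) (ev2_X1 p.1 p.2).
apply: (nd (nrm al be) (Z, W)) => //.
  by rewrite (beval_trunc_nrm hc exo) -(qhom0E hc _ _ 0).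
have D0 D : derivation_at (ev2 Z W) D -> D Q = 0.
  have H (phi : {rmorphism A2 -> R[i]}) : derivation_at phi D -> (forall e, phi (io2 e) = e) ->
      phi 'X = W -> phi 'X%:P = Z -> D Q = 0.
    move=> dD h1 h2 h3; rewrite /Q /qhom (derB dD) mul0r (der0 dD) subr0 (der_msum dD h1) (der0 dD) mulr0 add0r.
    by rewrite rmorph0 h2 h3; move: qZ qW; rewrite /qhomZ /qhomW => -> ->; rewrite !mul0r addr0.
  by move=> dD; exact: H dD (ev2_io Z W) (ev2_U Z W) (ev2_X1 Z W).
have -> : beval (trunc g (nrm al be)) = beval Q by apply/funext => p; rewrite QE.
have hd := beval_is_diff Q (Z, W).
rewrite diff_val /= (D0 _ (evX_der Z W)) (D0 _ (evU_der Z W)).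
by apply/funext => v; rewrite /lin2 !mul0r addr0.
Qed.

Let a := (bezout_pair al be).1.
Let b := (bezout_pair al be).2.
Let hab : a * al%:Z + b * be%:Z = 1.
Proof. by apply: bezout_pairP; case: hs. Qed.

Variables (t0 tn : term) (n : nat).
Hypotheses (t0G : t0 \in side_terms (terms g) al be c) (tnG : tn \in side_terms (terms g) al be c).
Hypothesis tmin : {in side_terms (terms g) al be c, forall t, rank_of a b t0.2 <= rank_of a b t.2}.
Hypothesis tmax : {in side_terms (terms g) al be c, forall t, rank_of a b t.2 <= rank_of a b tn.2}.
Hypothesis nE : rank_of a b tn.2 - rank_of a b t0.2 = n%:Z.

Let r0 := rank_of a b t0.2.

Definition lattice_pt (k : nat) : int * int :=
  (a * c%:Z + be%:Z * (r0 + k%:Z), b * c%:Z - al%:Z * (r0 + k%:Z)).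

Let in_terms t : t \in side_terms (terms g) al be c -> t \in terms g /\ (al * t.2.1 + be * t.2.2 = c)%N.
Proof. by rewrite mem_filter => /andP[/eqP h1 h2]. Qed.

Lemma lattice_ptE (x y : int) : al%:Z * x + be%:Z * y = c%:Z ->
  x = a * c%:Z + be%:Z * (b * x - a * y) /\ y = b * c%:Z - al%:Z * (b * x - a * y).
Proof.
move=> <-; split.
  by rewrite [RHS](_ : _ = (a * al%:Z + b * be%:Z) * x); [rewrite hab mul1r | ring].
by rewrite [RHS](_ : _ = (a * al%:Z + b * be%:Z) * y); [rewrite hab mul1r | ring].
Qed.

(** The rank is a linear functional, so its extremes over the terms of the side bound it on the
    whole face. *)
Lemma face_rank (x y : int) : G (x%:~R, y%:~R) ->
  al%:Z * x + be%:Z * y = c%:Z /\ exists2 k, (k <= n)%N & b * x - a * y = r0 + k%:Z.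
Proof.
move=> Gx; have e := side_level hs Gx.
have e' : al%:Z * x + be%:Z * y = c%:Z.
  by apply/eqP; rewrite -(eqr_int R) intrD !intrM; apply/eqP.
split=> //; move: Gx => [Px _].
have [|_ h] := @newton_lex R g (nrm al be) (covec R (b, - a)) c%:R r0%:~R (rank_of a b tn.2)%:~R _ _ Px.
  move=> t ts; rewrite pairing_nrm_pt ler_nat hc //; split=> // /eqP; rewrite eqr_nat => o.
  have tG : t \in side_terms (terms g) al be c by rewrite mem_filter ts andbT.
  rewrite pairing_covec_pt mulNr !ler_int; apply/andP; split; [exact: tmin | exact: tmax].
move: (h e); rewrite /pairing /= rmorphN mulNr -!intrM -intrB !ler_int => /andP[h1 h2].
pose d := b * x - a * y - r0; have d0 : 0 <= d by rewrite subr_ge0.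
exists `|d|%N; last by rewrite gez0_abs // /d [RHS]addrC subrK.
by rewrite -lez_nat gez0_abs // -nE lerD2r.
Qed.

Lemma lattice_pt_face k : (k <= n)%N -> G ((lattice_pt k).1%:~R, (lattice_pt k).2%:~R).
Proof.
move=> kn; have [t0s o0] := in_terms t0G; have [tns on] := in_terms tnG.
apply/(faceE hc exo); split; last first.
  have key (x y : int) : al%:Z * x + be%:Z * y = c%:Z -> al%:R * x%:~R + be%:R * y%:~R = c%:R :> R.
    by move=> e; rewrite -[c%:R]/(c%:Z%:~R) -e intrD !intrM.
  apply: key.
  by rewrite /lattice_pt /= [LHS](_ : _ = (a * al%:Z + b * be%:Z) * c%:Z); [rewrite hab mul1r | ring].
case: (posnP n) => n0.
  have -> : k = 0%N by apply/eqP; rewrite -leqn0 -n0.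
  have := newton_pt t0s; have [] := @lattice_ptE t0.2.1%:Z t0.2.2%:Z; first by rewrite -!PoszM -PoszD o0.
  rewrite -/(rank_of a b t0.2) -/r0 => e1 e2; rewrite /lattice_pt addr0 /= -e1 -e2; exact.
have := @conv_hull_between R _ (pt t0.2) (pt tn.2) (1 - k%:R / n%:R).
move=> /(_ _ _ (newton_pt t0s) (newton_pt tns)).
have nR : 0 < n%:R :> R by rewrite ltr0n.
have kR : k%:R / n%:R <= 1 :> R by rewrite ler_pdivrMr // mul1r ler_nat.
have kR0 : 0 <= k%:R / n%:R :> R by rewrite divr_ge0.
have q01 : 0 <= 1 - (k%:R / n%:R : R) <= 1 by apply/andP; split; lra.
move=> /(_ q01); set q := k%:R / n%:R; have qn : q * n%:R = k%:R by rewrite divfK // gt_eqF.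
have [e1 e2] : t0.2.1%:Z = a * c%:Z + be%:Z * r0 /\ t0.2.2%:Z = b * c%:Z - al%:Z * r0.
  by apply: lattice_ptE; rewrite -!PoszM -PoszD o0.
have [f1 f2] : tn.2.1%:Z = a * c%:Z + be%:Z * (r0 + n%:Z) /\ tn.2.2%:Z = b * c%:Z - al%:Z * (r0 + n%:Z).
  have -> : r0 + n%:Z = rank_of a b tn.2 by rewrite -nE addrC subrK.
  by apply: lattice_ptE; rewrite -!PoszM -PoszD on.
have key (A B : int) (l0 ln : nat) : l0%:Z = A + B * r0 -> ln%:Z = A + B * (r0 + n%:Z) ->
    (1 - q) * l0%:R + (1 - (1 - q)) * ln%:R = (A + B * (r0 + k%:Z))%:~R.
  move=> h1 h2; rewrite -[l0%:R]/(l0%:Z%:~R) -[ln%:R]/(ln%:Z%:~R) h1 h2 !(intrD, intrM).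
  by rewrite -[k%:Z%:~R]/(k%:R) -[n%:Z%:~R]/(n%:R) -qn; ring.
rewrite /between /lattice_pt /= (key _ _ _ _ e1 f1) (key (b * c%:Z) (- al%:Z) t0.2.2 tn.2.2) ?mulNr //.
Qed.

Lemma lattice_pt_inj : injective lattice_pt.
Proof.
move=> k k' [/addrI + /addrI /oppr_inj].
case: (posnP be) => b0; last first.
  move=> e _; move: e; have bn : be%:Z != 0 by rewrite -lt0n.
  by move=> /(mulfI bn) /addrI [].
have an : al%:Z != 0 by move: hab; rewrite b0 mulr0 addr0; case: (al) => //; rewrite mulr0.
by move=> _ /(mulfI an) /addrI [].
Qed.

Lemma side_nseg : nseg G = n.
Proof.
rewrite /nseg; have -> : [set p : int * int | G (p.1%:~R, p.2%:~R)] =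
    [set` seq_fset tt [seq lattice_pt k | k <- iota 0 n.+1]].
  rewrite eqEsubset; split=> p /=.
    move=> Gp; have [e [k kn rk]] := face_rank Gp; have [e1 e2] := lattice_ptE e.
    suff : p \in seq_fset tt [seq lattice_pt k | k <- iota 0 n.+1] by [].
    rewrite seq_fsetE; apply/mapP; exists k; first by rewrite mem_iota.
    by rewrite /lattice_pt -rk -e1 -e2; case: (p).
  move=> hp; have : p \in seq_fset tt [seq lattice_pt k | k <- iota 0 n.+1] by [].
  by rewrite seq_fsetE => /mapP [k]; rewrite mem_iota /= add0n ltnS => kn ->; exact: lattice_pt_face.
rewrite set_fsetK cardfE; have := size_seq_fset tt [seq lattice_pt k | k <- iota 0 n.+1].
by rewrite -cardfE => ->; rewrite undup_id ?map_inj_uniq ?iota_uniq ?size_map ?size_iota //; exact: lattice_pt_inj.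
Qed.

(** Also valid at lattice points of the side that carry no term: both coefficients are then 0. *)
Lemma side_coef_lattice (e : nat * nat) k : (al * e.1 + be * e.2 = c)%N -> rank_of a b e = r0 + k%:Z ->
  (side_poly (terms g) al be c a b t0)`_k = bcoef g e.1 e.2.
Proof.
move=> oe re; case: (boolP (has (fun t => deg_of a b t0 t == k) (side_terms (terms g) al be c))).
  move=> /hasP [t tG /eqP dt]; have [ts ot] := in_terms tG.
  rewrite -dt (side_poly_coef hab (terms_uniq g) tmin tG) -(terms_coef ts).
  have rt : rank_of a b t.2 = rank_of a b e by rewrite re -dt (deg_ofE tmin tG) addrC subrK.
  have [] := rank_step hab ot oe; rewrite rt subrr !mulr0 addr0 subr0 => /eqP e1 /eqP e2.
  by move: e1 e2; rewrite !eqz_nat => /eqP -> /eqP ->.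
move=> /hasPn h; rewrite /side_poly coef_sum big_seq big1; last first.
  by move=> t /h; rewrite coefZ coefXn eq_sym => /negbTE ->; rewrite mulr0.
apply/esym/eqP; apply: contraT => ne; have tg := mem_terms_coef ne.
have tG : (bcoef g e.1 e.2, (e.1, e.2)) \in side_terms (terms g) al be c.
  by rewrite mem_filter tg andbT /online /= oe.
case/eqP: (h _ tG); apply/eqP; rewrite -eqz_nat (deg_ofE tmin tG) /= -surjective_pairing re.
by rewrite [_ + k%:Z]addrC addrK.
Qed.

Lemma side_deg_pos : (0 < n)%N.
Proof.
rewrite lt0n; apply/eqP => n0; have [_ _ _ [t [t' [ts ts' ne o o']]]] := hs; apply: ne.
have tG : t \in side_terms (terms g) al be c by rewrite mem_filter ts andbT.
have t'G : t' \in side_terms (terms g) al be c by rewrite mem_filter ts' andbT.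
have e : rank_of a b tn.2 = rank_of a b t0.2 by apply/eqP; rewrite -subr_eq0 nE n0.
congr snd; apply: (rank_inj hab (terms_uniq g) tG t'G); apply/le_anti.
by rewrite (le_trans (tmax tG)) ?e ?tmin //= (le_trans (tmax t'G)) ?e ?tmin.
Qed.

Section UnitPoint.
Hypothesis abc : (al + be = c)%N.
Variables (disc : R[i]).
Hypothesis discE : disc = bcoef g 1 1 ^+ 2 - 4%:R * bcoef g 2 0 * bcoef g 0 2.
Hypothesis G11 : G (1, 1).
Let p := side_poly (terms g) al be c a b t0.
Let unit_eq (tau kap : R[i]) := kap * (tau ^ r0 * (tau * p^`().[tau])) = - (tau ^ b * tau ^ (- a)).

Let psize : size p = n.+1.
Proof. exact: (size_side_poly hab (terms_uniq g) (@terms_neq0 R g) tnG tmin tmax nE). Qed.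

Let p0_neq0 : p`_0 != 0.
Proof. by rewrite -horner_coef0; exact: (side_poly0 hab (terms_uniq g) (@terms_neq0 R g) t0G tmin). Qed.

Let pn_neq0 : p`_n != 0.
Proof. by have := lead_coef_eq0 p; rewrite lead_coefE psize /= => ->; rewrite -size_poly_eq0 psize. Qed.

Let root_neq0 tau : root p tau -> tau != 0.
Proof. by apply: contraTneq => ->; rewrite /root horner_coef0. Qed.

Let on11 : (al * 1 + be * 1 = c)%N. Proof. by rewrite !muln1. Qed.

Lemma unit_rank : exists2 k, (k <= n)%N & rank_of a b (1, 1)%N = r0 + k%:Z.
Proof. by have [|_ [k kn h]] := @face_rank 1 1 _; [exact: G11 | exists k]. Qed.

(** The exponent b - a of the right-hand side is the rank of (1, 1), so only tau^k remains after
    dividing by tau^r0. *)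
Lemma unit_eq_reduce tau kap k : root p tau -> rank_of a b (1, 1)%N = r0 + k%:Z ->
  unit_eq tau kap -> kap * (tau * p^`().[tau]) = - tau ^+ k.
Proof.
move=> rt rk; have tau0 := root_neq0 rt; have z0 : tau ^ r0 != 0 by exact: expfz_neq0.
rewrite /unit_eq -expfzDr // (_ : b - a = r0 + k%:Z); last by rewrite -rk /rank_of /= !mulr1.
rewrite expfzDr // => e; apply: (mulfI z0); rewrite mulrN -e; ring.
Qed.

(** A side with two lattice points cannot contain both (2, 0) and (0, 2), so the discriminant is the
    square of the coefficient at (1, 1). The sign of s depends on which end of the side (1, 1)
    is. *)
Lemma kappa_linear tau kap : n = 1%N -> root p tau -> unit_eq tau kap ->
  exists s, s ^+ 2 = disc /\ kap = - s^-1.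
Proof.
move=> n1 rt ue; have tau0 := root_neq0 rt; have [k kn rk] := unit_rank.
have prod0 : bcoef g 2 0 * bcoef g 0 2 = 0.
  apply/eqP; rewrite mulf_eq0; apply: contraT; rewrite negb_or => /andP[/mem_terms_coef h1 /mem_terms_coef h2].
  have := hc h1; have := hc h2; rewrite /= !muln0 add0n addn0 -abc => l1 l2.
  have key (x y : nat) : (y * 2 <= x + y -> x * 2 <= x + y -> x = y)%N by clear; lia.
  have ab1 := key _ _ l1 l2; have be1 : be = 1%N.
    by move: hs => [cop _ _ _]; move: cop; rewrite ab1 /coprime gcdnn => /eqP.
  have tG1 : (bcoef g 2 0, (2, 0)%N) \in side_terms (terms g) al be c.
    by rewrite mem_filter h1 andbT /online /= -abc ab1 be1.
  have tG2 : (bcoef g 0 2, (0, 2)%N) \in side_terms (terms g) al be c.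
    by rewrite mem_filter h2 andbT /online /= -abc ab1 be1.
  have key2 (x y r s : int) : x + y = 1 -> r - s = 1 -> y * 2 - x * 0 <= r -> s <= y * 0 - x * 2 -> False.
    by clear; move=> *; lia.
  have xy : a + b = 1 by move: hab; rewrite ab1 be1 !mulr1.
  by case: (key2 a b (rank_of a b tn.2) r0 xy _ (tmax tG1) (tmin tG2)); rewrite /r0 nE n1.
have dE : disc = bcoef g 1 1 ^+ 2 by rewrite discE -mulrA prod0 mulr0 subr0.
have pE : p = (p`_0)%:P + (p`_1)%:P * 'X.
  apply/polyP => j; rewrite coefD coefC coefCM coefX; case: j => [|[|j]] /=.
  - by rewrite mulr0 addr0.
  - by rewrite add0r mulr1.
  - by rewrite mulr0 addr0 nth_default // psize n1.
have rE : p`_0 + p`_1 * tau = 0.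
  by move: (rootP rt); rewrite {1}pE hornerD hornerC hornerM hornerC hornerX.
have dpE : p^`().[tau] = p`_1.
  by rewrite {1}pE derivD derivC derivM derivC derivX mul0r !add0r mulr1 hornerC.
have := unit_eq_reduce rt rk ue; rewrite dpE; move: pn_neq0; rewrite n1 => p1.
have a11 := @side_coef_lattice (1, 1)%N k on11 rk.
case: k kn rk a11 => [|[|k]] kn rk /= a11; last by rewrite n1 in kn.
  rewrite expr0 => e; exists (- bcoef g 1 1); rewrite sqrrN dE; split=> //; rewrite -a11.
  apply: (mulIf p0_neq0); rewrite invrN mulNr mulNr opprK mulVf //.
  by move/eqP: rE; rewrite addr_eq0 => /eqP ->; rewrite mulrN [p`_1 * _]mulrC e opprK.
rewrite expr1 => e; exists (bcoef g 1 1); rewrite dE; split=> //; rewrite -a11.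
by apply: (mulIf p1); apply: (mulfI tau0); rewrite mulNr mulVf // mulrN1 -e; ring.
Qed.

(** The side is the segment from (0, 2) to (2, 0), and kap p'(tau) = -1 at each root. For a
    quadratic polynomial p'(tau)^2 is the discriminant, and p' takes opposite values at the two
    roots. *)
Lemma kappa_quadratic tau1 tau2 kap1 kap2 : (1 < n)%N -> al != 0%N -> be != 0%N ->
  root p tau1 -> root p tau2 -> tau1 != tau2 -> unit_eq tau1 kap1 -> unit_eq tau2 kap2 ->
  n = 2%N /\ exists s, [/\ s ^+ 2 = disc, kap1 = - s^-1 & kap2 = s^-1].
Proof.
move=> n2 al0 be0 rt1 rt2 ne ue1 ue2; have [k kn rk] := unit_rank.
have [t0s o0] := in_terms t0G; have [tns on] := in_terms tnG.
have [e0 _] := @rank_step al be c a b hab t0.2 (1, 1)%N o0 on11.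
have [_ en] := @rank_step al be c a b hab (1, 1)%N tn.2 on11 on.
(* (1, 1) is k steps (be, - al) after t0 and n - k steps before tn. All coordinates being
   nonnegative, be k <= 1 and al (n - k) <= 1. *)
have [n2E k1 al1 be1] : [/\ n = 2, k = 1, al = 1 & be = 1]%N.
  have d0 : rank_of a b (1, 1)%N - rank_of a b t0.2 = k%:Z by rewrite rk addrC addKr.
  have dn : rank_of a b tn.2 - rank_of a b (1, 1)%N = (n - k)%N%:Z.
    by rewrite -subzn // -nE rk; ring.
  have key (x y l m i j : nat) : x != 0%N -> y != 0%N -> (1 < i)%N -> (j <= i)%N ->
      1%:Z = l%:Z + y%:Z * j%:Z -> m%:Z = 1%:Z - x%:Z * (i - j)%N%:Z -> [/\ i = 2, j = 1, x = 1 & y = 1]%N.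
    by clear; move=> x0 y0 i1 ji e1 e2; split; nia.
  move: e0 en; rewrite d0 dn => e0 en; exact: (key _ _ _ _ _ _ al0 be0 n2 kn e0 en).
rewrite k1 in rk; split=> //.
have ab1 : a + b = 1 by move: hab; rewrite al1 be1 !mulr1.
have c2 : c = 2%N by rewrite -abc al1 be1.
have r0E : r0 = b - a - 1 by move: rk; rewrite /rank_of /= !mulr1 => ->; rewrite addrK.
have rk0 : rank_of a b (0, 2)%N = r0 + 0%N%:Z.
  have key (x y : int) : x + y = 1 -> y * 0%N%:Z - x * 2%N%:Z = y - x - 1 + 0%N%:Z by clear; lia.
  by rewrite r0E; exact: key.
have rk2 : rank_of a b (2, 0)%N = r0 + 2%N%:Z.
  have key (x y : int) : x + y = 1 -> y * 2%N%:Z - x * 0%N%:Z = y - x - 1 + 2%N%:Z by clear; lia.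
  by rewrite r0E; exact: key.
have c0E := @side_coef_lattice (0, 2)%N 0 _ rk0; have c1E := @side_coef_lattice (1, 1)%N 1 _ rk.
have c2E := @side_coef_lattice (2, 0)%N 2 _ rk2.
have {}c0E : p`_0 = bcoef g 0 2 by apply: c0E; rewrite al1 be1 c2.
have {}c1E : p`_1 = bcoef g 1 1 by apply: c1E; rewrite al1 be1 c2.
have {}c2E : p`_2 = bcoef g 2 0 by apply: c2E; rewrite al1 be1 c2.
have pE : p = (bcoef g 0 2)%:P + (bcoef g 1 1)%:P * 'X + (bcoef g 2 0)%:P * 'X^2.
  apply/polyP => j; rewrite !coefD coefC !coefCM coefX coefXn; case: j => [|[|[|j]]] /=.
  - by rewrite !mulr0 !addr0.
  - by rewrite add0r mulr1 mulr0 addr0.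
  - by rewrite mulr0 !add0r mulr1.
  - by rewrite !mulr0 !addr0 nth_default // psize n2E.
have hE tau : p.[tau] = bcoef g 0 2 + bcoef g 1 1 * tau + bcoef g 2 0 * tau ^+ 2.
  by rewrite pE !hornerE -?expr2.
have dE tau : p^`().[tau] = bcoef g 1 1 + 2%:R * (bcoef g 2 0 * tau).
  by rewrite pE expr2 !derivD derivC !derivM !derivC !derivX !(hornerD, hornerM, hornerX, hornerC); ring.
have P tau kap : root p tau -> unit_eq tau kap -> kap * p^`().[tau] = -1.
  move=> rt ue; have tau0 := root_neq0 rt; have := unit_eq_reduce rt rk ue; rewrite expr1 => e.
  by apply: (mulfI tau0); rewrite mulrN1 -e; ring.
have sq tau : root p tau -> p^`().[tau] ^+ 2 = disc.
  move=> rt; rewrite dE discE.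
  have -> : (bcoef g 1 1 + 2%:R * (bcoef g 2 0 * tau)) ^+ 2 =
    bcoef g 1 1 ^+ 2 - 4%:R * bcoef g 2 0 * bcoef g 0 2 + 4%:R * bcoef g 2 0 * p.[tau] by rewrite hE; ring.
  by rewrite (rootP rt) mulr0 addr0.
have opp : p^`().[tau2] = - p^`().[tau1].
  have : (tau1 - tau2) * (bcoef g 1 1 + bcoef g 2 0 * (tau1 + tau2)) = 0.
    have -> : (tau1 - tau2) * (bcoef g 1 1 + bcoef g 2 0 * (tau1 + tau2)) = p.[tau1] - p.[tau2] by rewrite !hE; ring.
    by rewrite (rootP rt1) (rootP rt2) subrr.
  move/eqP; rewrite mulf_eq0 subr_eq0 (negbTE ne) /= => /eqP e.
  rewrite !dE; apply/eqP; rewrite -addr_eq0; apply/eqP.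
  have -> : bcoef g 1 1 + 2%:R * (bcoef g 2 0 * tau2) + (bcoef g 1 1 + 2%:R * (bcoef g 2 0 * tau1)) =
    2%:R * (bcoef g 1 1 + bcoef g 2 0 * (tau1 + tau2)) by ring.
  by rewrite e mulr0.
have k1E := P _ _ rt1 ue1; have k2E := P _ _ rt2 ue2.
have d1 : p^`().[tau1] != 0.
  by apply/eqP => z; move/eqP: k1E; rewrite z mulr0 eq_sym oppr_eq0 oner_eq0.
exists (p^`().[tau1]); split; first exact: sq.
  by apply: (mulIf d1); rewrite k1E mulNr mulVf.
by apply: (mulIf d1); rewrite mulVf //; apply: oppr_inj; rewrite -k2E opp mulrN.
Qed.

End UnitPoint.

Lemma unit_point_rectangle t : t \in terms g -> (0 < t.2.1)%N -> (0 < t.2.2)%N -> newton g (1, 1).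
Proof.
move=> ts l0 m0; apply: (hrect (newton_pt ts)).
set u : R := t.2.1%:R; set v : R := t.2.2%:R; set A := [set x | _].
have u1 : 1 <= u :> R by rewrite ler1n.
have v1 : 1 <= v :> R by rewrite ler1n.
have u0 : u != 0 by rewrite gt_eqF //; lra.
have v0 : v != 0 by rewrite gt_eqF //; lra.
have inv (y : R) : 1 <= y -> 0 <= y^-1 <= 1.
  move=> y1; have y0 : 0 < y by lra.
  by rewrite invr_ge0 ltW //= invf_le1.
have h1 : conv_hull A (between u^-1 (u, v) (0, v)).
  by apply: conv_hull_between (inv _ u1) _ _; apply: conv_hull_sub; [apply: Or44 | apply: Or43].
have h2 : conv_hull A (between u^-1 (u, 0) (0, 0)).
  by apply: conv_hull_between (inv _ u1) _ _; apply: conv_hull_sub; [apply: Or42 | apply: Or41].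
have := conv_hull_between (inv _ v1) h1 h2.
rewrite (_ : between _ _ _ = (1, 1)) // /between /=.
by congr pair; field; rewrite ?u0 ?v0.
Qed.

(* If [(1, 1)] is not in the polygon, then no term is divisible by [z w], so the
   side joins the two axes and cuts off a triangle. *)
Lemma axis_side : ~ newton g (1, 1) -> {in terms g, forall t, t.2.1 = 0%N \/ t.2.2 = 0%N} /\
  exists2 k, (0 < k)%N & [/\ c = (al * be * k)%N, (0 < al)%N, (0 < be)%N,
   exists2 t, t \in terms g & t.2 = ((be * k)%N, 0%N) & exists2 t, t \in terms g & t.2 = (0%N, (al * k)%N)].
Proof.
move=> n11; have ax : {in terms g, forall t, t.2.1 = 0%N \/ t.2.2 = 0%N}.
  move=> t ts; case: (posnP t.2.1) => l0; first by left.
  by case: (posnP t.2.2) => m0; [right | case: n11; exact: unit_point_rectangle ts l0 m0].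
split=> //; have [cop _ _ [t [t' [ts ts' ne o o']]]] := hs.
have W t1 t2 : t1 \in terms g -> t2 \in terms g -> t1.2.2 = 0%N -> t2.2.1 = 0%N -> online al be c t1 -> online al be c t2 ->
   exists2 k, (0 < k)%N & [/\ c = (al * be * k)%N, (0 < al)%N, (0 < be)%N,
   exists2 t, t \in terms g & t.2 = ((be * k)%N, 0%N) & exists2 t, t \in terms g & t.2 = (0%N, (al * k)%N)].
  move=> t1s t2s m1 l2 /eqP + /eqP; rewrite m1 l2 !muln0 addn0 add0n => e1 e2.
  have al0 : (0 < al)%N by case: (al) e1 c0 => // <-.
  have be0 : (0 < be)%N by case: (be) e2 c0 => // <-.
  have : (be %| al * t1.2.1)%N by rewrite e1 -e2 dvdn_mulr.
  rewrite Gauss_dvdr 1?coprime_sym // => /dvdnP [k ke].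
  have cE : c = (al * be * k)%N by rewrite -e1 ke -mulnA [(k * _)%N]mulnC.
  exists k; first by move: c0; rewrite cE muln_gt0 => /andP[].
  split=> //; first by exists t1 => //; rewrite [t1.2]surjective_pairing m1 ke mulnC.
  exists t2 => //; rewrite [t2.2]surjective_pairing l2; congr pair.
  by apply/eqP; rewrite -(eqn_pmul2l be0) e2 cE mulnCA mulnA.
have pE (q : nat * nat) : q = (q.1, q.2) by case: q.
case: (ax _ ts) => z; case: (ax _ ts') => z'.
- case: ne; rewrite (pE t.2) (pE t'.2) z z'; congr pair; apply/eqP.
  move: o o'; rewrite /online z z' !muln0 !add0n => /eqP o /eqP o'.
  have be0 : (0 < be)%N by case: (be) o c0 => // <-.
  by rewrite -(eqn_pmul2l be0) o o'.
- exact: (W t' t).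
- exact: (W t t').
- case: ne; rewrite (pE t.2) (pE t'.2) z z'; congr pair; apply/eqP.
  move: o o'; rewrite /online z z' !muln0 !addn0 => /eqP o /eqP o'.
  have al0 : (0 < al)%N by case: (al) o c0 => // <-.
  by rewrite -(eqn_pmul2l al0) o o'.
Qed.

(** If (1, 1) had level c outside the polygon, then al + be = al be k by [axis_side]. Each of al and
    be then divides the other, so al = be = 1 and k = 2, and (1, 1) is the midpoint of (2, 0) and
    (0, 2). *)
Lemma unit_point_online : (al + be = c)%N <-> G (1, 1).
Proof.
split=> [abc|/(side_level hs)]; last by rewrite !mulr1 -natrD => /eqP; rewrite eqr_nat => /eqP.
apply/(faceE hc exo); split; last by rewrite pairing_nrm /= !mulr1 -natrD abc.
apply: contrapT => n11; have [ax [k k0 [cE al0 be0 [t ts tE] [t' ts' t'E]]]] := axis_side n11.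
have [cop _ _ _] := hs.
have [a1 b1 k2] : [/\ al = 1, be = 1 & k = 2]%N.
  have da : (al %| be)%N.
    by rewrite -(dvdn_addr _ (dvdnn al)) abc cE -mulnA dvdn_mulr.
  have db : (be %| al)%N.
    by rewrite -(dvdn_addl _ (dvdnn be)) abc cE mulnAC dvdn_mull.
  have ab : al = be by apply/eqP; rewrite eqn_dvd da.
  have b1 : be = 1%N by move: cop; rewrite ab /coprime gcdnn => /eqP.
  have al1 : al = 1%N by rewrite ab.
  by split=> //; move: abc; rewrite cE al1 b1 !mul1n.
have := @conv_hull_between R _ _ _ (2^-1) _ (newton_pt ts) (newton_pt ts').
rewrite tE t'E a1 b1 k2 /between /= => H; apply: n11; rewrite /newton; move: H.
have -> : 2^-1 * (1 * 2)%N%:R + (1 - 2^-1) * 0%:R = 1 :> R by rewrite mul1n mulr0 addr0 mulVf ?pnatr_eq0.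
have -> : 2^-1 * 0%:R + (1 - 2^-1) * (1 * 2)%N%:R = 1 :> R by rewrite mul1n mulr0 add0r; field.
apply; lra.
Qed.

(** If al + be > c, then (1, 1) lies beyond the side, [axis_side] applies, and al be k < al + be
    forces k = 1 and al = 1 or be = 1. *)
Lemma sub_adapted_side : sub_adapted (terms g) c al be.
Proof.
case: (leqP (al + be) c) => abc; first by apply: Or31.
have n11 : ~ newton g (1, 1).
  move=> /(newton_below hc); rewrite pairing_nrm /= !mulr1 -natrD ler_nat leqNgt abc //.
have [ax [k k0 [cE al0 be0 _ _]]] := axis_side n11.
have key (x y z : nat) : (0 < x)%N -> (0 < y)%N -> (0 < z)%N -> (x * y * z < x + y)%N ->
    z = 1%N /\ (x = 1%N \/ y = 1%N).
  clear=> x0 y0 z0 h; have l1 : (x <= x * y)%N by rewrite leq_pmulr.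
  have l2 : (y <= x * y)%N by rewrite leq_pmull.
  case: z z0 h => [|[|z]] // _ h; last first.
    have : (x * y * 2 <= x * y * z.+2)%N by rewrite leq_mul2l orbT.
    by move: (x * y)%N h l1 l2 => q; lia.
  split=> //; case: x y x0 y0 l1 l2 h => [|[|x]] [|[|y]] // _ _ _ _; [by left | by left | by right |].
  by rewrite muln1 mulnSr mulSn; lia.
have lt : (al * be * k < al + be)%N by rewrite -cE.
have [k1 ab1] := key _ _ _ al0 be0 k0 lt.
rewrite k1 muln1 in cE; case: ab1 => e.
  apply: Or32; split=> //; first by rewrite cE e mul1n.
  move=> t ts; case: (posnP t.2.2) => m0; first by left.
  right; have := hc ts; case: (ax _ ts) => [l0|m]; last by rewrite m in m0.
  rewrite l0 muln0 add0n cE e mul1n -[X in (_ <= X)%N]muln1 leq_pmul2l // => m1.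
  by rewrite [t.2]surjective_pairing l0; congr pair; apply/eqP; rewrite eqn_leq m1 m0.
apply: Or33; split=> //; first by rewrite cE e muln1.
move=> t ts; case: (posnP t.2.1) => l0; first by left.
right; have := hc ts; case: (ax _ ts) => [l|m]; first by rewrite l in l0.
rewrite m muln0 addn0 cE e muln1 -[X in (_ <= X)%N]muln1 leq_pmul2l // => l1.
by rewrite [t.2]surjective_pairing m; congr pair; apply/eqP; rewrite eqn_leq l1 l0.
Qed.

End LatticePoints.

(** * Assembling the charts *)

Section Charts.
Variable R : realType.
Notation term := (R[i] * (nat * nat))%type.
Notation cabs := Normc.normc.

Record chart := Chart { ch_lam : R[i]; ch_tau : R[i]; ch_kap : R[i]; ch_rho : R; ch_M : R;
  ch_Z : R[i] -> R[i] -> R[i]; ch_ZX : R[i] -> R[i] -> R[i]; ch_ZU : R[i] -> R[i] -> R[i];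
  ch_W : R[i] -> R[i] -> R[i]; ch_WX : R[i] -> R[i] -> R[i]; ch_WU : R[i] -> R[i] -> R[i] }.

Definition ch_Z0 al be ch := ch_lam ch ^+ al * ch_tau ch ^ (bezout_pair al be).2.
Definition ch_W0 al be ch := ch_lam ch ^+ be * ch_tau ch ^ (- (bezout_pair al be).1).

Record is_chart (s : seq term) al be c ch : Prop := IsChart {
  chart_branch : branch s c al be (ch_kap ch) (ch_Z0 al be ch) (ch_W0 al be ch) (ch_rho ch) (ch_M ch)
    (ch_Z ch) (ch_ZX ch) (ch_ZU ch) (ch_W ch) (ch_WX ch) (ch_WU ch);
  chart_lam0 : ch_lam ch != 0;
  chart_tau0 : ch_tau ch != 0;
  chart_kap0 : ch_kap ch != 0;
  chart_smallZ : 2 * (ch_M ch * ch_rho ch) <= cabs (ch_Z0 al be ch);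
  chart_smallW : 2 * (ch_M ch * ch_rho ch) <= cabs (ch_W0 al be ch) }.

Lemma chart_Z0 s al be c ch : is_chart s al be c ch -> ch_Z0 al be ch != 0.
Proof. by move=> h; rewrite mulf_neq0 ?expf_neq0 ?expfz_neq0 ?(chart_lam0 h) ?(chart_tau0 h). Qed.

Lemma chart_W0 s al be c ch : is_chart s al be c ch -> ch_W0 al be ch != 0.
Proof. by move=> h; rewrite mulf_neq0 ?expf_neq0 ?expfz_neq0 ?(chart_lam0 h) ?(chart_tau0 h). Qed.

Lemma is_side_pos (s : seq term) al be c : is_side s al be c -> (0 < al + be)%N.
Proof. by case=> cop _ _ _; move: cop; case: al be => [|al] [|be]. Qed.

Lemma chart_exists (s : seq term) al be c (lam tau kap : R[i]) :
  let Z0 := lam ^+ al * tau ^ (bezout_pair al be).2 in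
  let W0 := lam ^+ be * tau ^ (- (bezout_pair al be).1) in
  is_side s al be c -> sub_adapted s c al be -> lam != 0 -> tau != 0 -> kap != 0 ->
  qhom s c al be id 0 Z0 W0 0 = 0 -> al%:R * Z0 = kap * qhomW s c al be id 0 Z0 W0 ->
  be%:R * W0 = - (kap * qhomZ s c al be id 0 Z0 W0) ->
  exists ch, [/\ is_chart s al be c ch, ch_tau ch = tau & ch_kap ch = kap].
Proof.
move=> Z0 W0 hs sa lam0 tau0 kap0 q0 q1 q2; have [cop c0 hc _] := hs.
have Z00 : Z0 != 0 by rewrite mulf_neq0 ?expf_neq0 ?expfz_neq0.
have W00 : W0 != 0 by rewrite mulf_neq0 ?expf_neq0 ?expfz_neq0.
have [rho [M [Zh [ZX [ZU [Wh [WX [WU hb]]]]]]]] :=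
  branch_exists_gen hc c0 (is_side_pos hs) Z00 W00 kap0 q0 q1 q2 sa.
have rho0 := br_rho hb; have M0 := br_M hb.
have zp : 0 < cabs Z0 by rewrite cabs_gt0.
have wp : 0 < cabs W0 by rewrite cabs_gt0.
pose m := Num.min (cabs Z0) (cabs W0); have m0 : 0 < m by rewrite lt_min zp wp.
have D0 : 0 < 2 * M + 1 by lra.
pose rho' := Num.min rho (m / (2 * M + 1)).
have rho'0 : 0 < rho' by rewrite lt_min rho0 divr_gt0.
have sm : 2 * (M * rho') <= m.
  have h1 : rho' * (2 * M + 1) <= m by rewrite -ler_pdivlMr // ge_min lexx orbT.
  by lra.
exists (Chart lam tau kap rho' M Zh ZX ZU Wh WX WU); split=> //; split=> //.
- by apply: branch_shrink hb; rewrite rho'0 ge_min lexx.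
- by apply: le_trans sm _; rewrite ge_min lexx.
- by apply: le_trans sm _; rewrite ge_min lexx orbT.
Qed.

Record side_family (f g : {poly {poly R[i]}}) (al be c : nat) (ch : nat -> chart) (kapp : nat -> R[i]) : Prop := SideFamily {
  sf_chart : forall i, (1 <= i <= nseg (face (newton g) (nrm R al be)))%N -> is_chart (terms g) al be c (ch i);
  sf_tau : forall i j, (1 <= i <= nseg (face (newton g) (nrm R al be)))%N ->
    (1 <= j <= nseg (face (newton g) (nrm R al be)))%N -> i <> j -> ch_tau (ch i) <> ch_tau (ch j);
  sf_kapp : forall i, (1 <= i <= nseg (face (newton g) (nrm R al be)))%N -> kapp i = ch_kap (ch i);
  sf_spec : kappa_spec f (face (newton g) (nrm R al be)) (al%:Z, be%:Z) kapp;
  sf_cover : forall K dl : R, 1 <= K -> 0 < dl -> exists2 d1 : R, 0 < d1 & forall v tau x : R[i],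
    cabs v <= d1 -> K^-1 <= cabs tau -> cabs tau <= K -> cabs x <= 1 ->
    qhom (terms g) c al be id v (tau ^ (bezout_pair al be).2) (tau ^ (- (bezout_pair al be).1)) x = 0 ->
    exists2 i, (1 <= i <= nseg (face (newton g) (nrm R al be)))%N & cabs (tau - ch_tau (ch i)) <= dl }.

Lemma side_family_exists (f g : {poly {poly R[i]}}) al be c :
  (forall l m, (l, m) != (0, 0)%N -> bcoef f l m = bcoef g l m) ->
  newton_nondegenerate g -> affine_dim (newton g) 2 -> rectangle_closed (newton g) ->
  is_side (terms g) al be c -> exists ch kapp, side_family f g al be c ch kapp.
Proof.
move=> fg nd hdim hrect hs; have [cop c0 hc [t1 [_ [t1s _ _ o1 _]]]] := hs.
have hab := bezout_pairP cop.
have nondeg := side_nondegenerate hs nd.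
set a := (bezout_pair al be).1 in hab *; set b := (bezout_pair al be).2 in hab *.
have sn : side_terms (terms g) al be c != [::].
  have : t1 \in side_terms (terms g) al be c by rewrite mem_filter o1.
  by case: (side_terms _ _ _ _).
have [t0 t0G tmin] := seq_argmin (fun t : term => rank_of a b t.2) sn.
have [tn tnG tmax'] := seq_argmin (fun t : term => - rank_of a b t.2) sn.
have tmax : {in side_terms (terms g) al be c, forall t, rank_of a b t.2 <= rank_of a b tn.2}.
  by move=> t /tmax'; rewrite lerN2.
have [n nE] : exists n : nat, rank_of a b tn.2 - rank_of a b t0.2 = n%:Z.
  pose d := rank_of a b tn.2 - rank_of a b t0.2; have d0 : 0 <= d by rewrite subr_ge0 tmin.
  by exists `|d|%N; rewrite gez0_abs.
have us := terms_uniq g; have s0 := @terms_neq0 R g.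
have nsegE := side_nseg hs t0G tnG tmin tmax nE.
have n0 := side_deg_pos hs tmin tmax nE.
have [r [pr rn ur rr]] := side_roots hab hc us s0 t0G tnG tmin tmax nE c0 nondeg.
set p := side_poly (terms g) al be c a b t0 in pr rr.
have sa := sub_adapted_side hrect hs.
pose ueq (tau kap : R[i]) := if (al + be == c)%N
  then kap * (tau ^ rank_of a b t0.2 * (tau * p^`().[tau])) = - (tau ^ b * tau ^ (- a)) else kap = 1.
have rt i : (1 <= i <= n)%N -> root p r`_i.-1.
  by case: i => // i /= hi; apply: rr; rewrite mem_nth // rn.
(* Branches are numbered from 1, so the i-th one belongs to the root at position i - 1; other
   indices receive a dummy chart. *)
have hq i : exists q, (1 <= i <= n)%N ->
    [/\ is_chart (terms g) al be c q, ch_tau q = r`_i.-1 & ueq r`_i.-1 (ch_kap q)].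
  case: (boolP (1 <= i <= n)%N) => hi; last first.
    by exists (Chart 0 0 0 0 0 (fun _ => id) (fun _ => id) (fun _ => id) (fun _ => id) (fun _ => id) (fun _ => id)).
  have [lam [kap [lam0 kap0 _ [q0 q1 q2] hk]]] := base_point hab hc us s0 t0G tmin c0 nondeg (rt i hi).
  have tau0 : r`_i.-1 != 0.
    by apply: contraTneq (rt i hi) => ->; rewrite /root (negbTE (side_poly0 hab us s0 t0G tmin)).
  have [q [hq1 hq2 hq3]] := chart_exists hs sa lam0 tau0 kap0 q0 q1 q2.
  by exists q => _; rewrite hq3.
have [ch hch] := choice hq.
have tauE i j : (1 <= i <= n)%N -> (1 <= j <= n)%N -> i <> j -> r`_i.-1 != r`_j.-1.
  case: i j => // i [//|j] /= hi hj ij; rewrite nth_uniq ?rn //.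
  by apply/eqP => e; apply: ij; rewrite e.
(* [kappa_spec] prescribes the value at 2 even for a side with a single branch; it is the opposite
   of the value at 1. *)
pose kapp i := if (n == 1%N) && (i == 2%N) then - ch_kap (ch 1%N) else ch_kap (ch i).
have kappE i : (1 <= i <= n)%N -> kapp i = ch_kap (ch i).
  by rewrite /kapp; case: (eqVneq n 1%N) => [->|//]; case: i => [|[|[|i]]].
exists ch, kapp; split; rewrite ?nsegE.
- by move=> i /hch [].
- move=> i j hi hj ij; have [_ -> _] := hch i hi; have [_ -> _] := hch j hj.
  exact/eqP/tauE.
- exact: kappE.
- split; rewrite nsegE.
  + by move=> i hi; rewrite kappE //; have [/chart_kap0] := hch i hi.
  + move=> n11 i hi; rewrite kappE //; have [_ _] := hch i hi; rewrite /ueq.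
    by case: eqP => // /(unit_point_online hrect hs) /n11.
  + move=> G11 hcase; have abc := (unit_point_online hrect hs).2 G11.
    have ue i : (1 <= i <= n)%N -> ch_kap (ch i) * (r`_i.-1 ^ rank_of a b t0.2 * (r`_i.-1 * p^`().[r`_i.-1])) =
        - (r`_i.-1 ^ b * r`_i.-1 ^ (- a)).
      by move=> hi; have [_ _] := hch i hi; rewrite /ueq abc eqxx.
    have dE : bcoef f 1 1 ^+ 2 - 4%:R * bcoef f 2 0 * bcoef f 0 2 = bcoef g 1 1 ^+ 2 - 4%:R * bcoef g 2 0 * bcoef g 0 2.
      by rewrite !fg.
    case: (eqVneq n 1%N) => n1.
      have h1 : (1 <= 1 <= n)%N by rewrite n1.
      have [w [w2 wk]] := kappa_linear hs t0G tnG tmin tmax nE abc erefl G11 n1 (rt _ h1) (ue _ h1).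
      by exists w; rewrite dE kappE // /kapp n1 /= wk opprK.
    have n2 : (1 < n)%N by rewrite ltn_neqAle eq_sym n1.
    have h1 : (1 <= 1 <= n)%N by rewrite n0.
    have h2 : (1 <= 2 <= n)%N by [].
    have [al0 be0] : al != 0%N /\ be != 0%N by case: hcase => // e; rewrite e eqxx in n1.
    have t12 : r`_0 != r`_1 by exact: (tauE 1%N 2%N).
    have [_ [w [w2 k1 k2]]] := kappa_quadratic hs t0G tnG tmin tmax nE abc erefl G11 n2 al0 be0
      (rt _ h1) (rt _ h2) t12 (ue _ h1) (ue _ h2).
    by exists w; rewrite dE !kappE.
- move=> K dl K1 dl0.
  have p0 : p != 0.
    by apply: contraNneq (side_poly0 hab us s0 t0G tmin) => e; rewrite -/p e horner0.
  have [d1 d10 hd] := side_near_root hc c0 t0G tmin p0 pr K1 dl0.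
  exists d1 => // v tau x h1 h2 h3 h4 h5; have [z zr hz] := hd v tau x h1 h2 h3 h4 h5.
  have ir : (1 <= (index z r).+1 <= n)%N by rewrite /= -rn index_mem.
  exists (index z r).+1; rewrite ?nsegE //; have [_ -> _] := hch _ ir.
  by rewrite /= nth_index.
Qed.

End Charts.

(** * The Euclidean norm and the two moduli *)

Section EuclideanNorm.
Variable R : realType.
Notation cabs := Normc.normc.

Lemma enorm_ltP (p : C2 R) (M : R) : 0 <= M ->
  (enorm p < M%:C) = (cabs p.1 ^+ 2 + cabs p.2 ^+ 2 < M ^+ 2).
Proof.
move=> M0; rewrite /enorm !norm_cabs -!rmorphXn -rmorphD /=.
have MC : 0 <= M%:C by rewrite lecR.
rewrite -[M%:C in LHS]sqrCK // ltr_sqrtC ?nnegrE ?exprn_ge0 //; last first.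
  by rewrite lecR addr_ge0 ?exprn_ge0 ?cabs_ge0.
by rewrite -rmorphXn /= ltcR.
Qed.

Lemma enorm_gtP (p : C2 R) (M : R) : 0 <= M ->
  (M%:C < enorm p) = (M ^+ 2 < cabs p.1 ^+ 2 + cabs p.2 ^+ 2).
Proof.
move=> M0; rewrite /enorm !norm_cabs -!rmorphXn -rmorphD /=.
have MC : 0 <= M%:C by rewrite lecR.
rewrite -[M%:C in LHS]sqrCK // ltr_sqrtC ?nnegrE ?exprn_ge0 //; last first.
  by rewrite lecR addr_ge0 ?exprn_ge0 ?cabs_ge0.
by rewrite -rmorphXn /= ltcR.
Qed.

Lemma enorm_gt (p : C2 R) (M : R) : M < cabs p.1 \/ M < cabs p.2 -> M%:C < enorm p.
Proof.
have e0 : 0 <= enorm p by rewrite sqrtC_ge0 addr_ge0 // exprn_ge0.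
case: (ltP M 0) => M0; first by move=> _; apply: lt_le_trans e0; rewrite ltcR.
have h1 := sqr_ge0 (cabs p.1); have h2 := sqr_ge0 (cabs p.2).
have key y : M < y -> M ^+ 2 < y ^+ 2.
  by move=> h; rewrite ltrXn2r.
by rewrite enorm_gtP //; case=> /key h; lra.
Qed.

Lemma outside_ball4 (p : C2 R) (M : R) : 0 <= M -> ~ ball4 (2 * M) p -> M <= cabs p.1 \/ M <= cabs p.2.
Proof.
move=> M0 h; case: (leP M (cabs p.1)) => h1; first by left.
case: (leP M (cabs p.2)) => h2; first by right.
case: h; rewrite /ball4 /= enorm_ltP ?mulr_ge0 //.
have k1 : cabs p.1 ^+ 2 < M ^+ 2 by rewrite ltrXn2r ?cabs_ge0.
have k2 : cabs p.2 ^+ 2 < M ^+ 2 by rewrite ltrXn2r ?cabs_ge0.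
by have := sqr_ge0 M; rewrite exprMn; lra.
Qed.

End EuclideanNorm.

(** * Assembly over all sides *)

Section Assembly.
Variable R : realType.
Notation term := (R[i] * (nat * nat))%type.
Notation cabs := Normc.normc.
Notation nrm := (@nrm R).

Lemma small_all (T : eqType) (L : seq T) (P : T -> R -> Prop) :
  {in L, forall x, exists2 r : R, 0 < r & forall e : R, 0 < e <= r -> P x e} ->
  exists2 r : R, 0 < r & forall e : R, 0 < e <= r -> {in L, forall x, P x e}.
Proof.
elim: L => [_|x L IH h]; first by exists 1.
have [r1 r10 h1] := h x (mem_head _ _).
have [|r2 r20 h2] := IH; first by move=> y yL; apply: h; rewrite inE yL orbT.
exists (Num.min r1 r2); first by rewrite lt_min r10.
move=> e /andP[e0]; rewrite le_min => /andP[e1 e2] y; rewrite inE => /orP[/eqP ->|yL].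
  by apply: h1; rewrite e0.
by apply: (h2 e) => //; rewrite e0.
Qed.

Lemma side_level_unique (s : seq term) al be c c' : is_side s al be c -> is_side s al be c' -> c = c'.
Proof.
move=> [_ _ h [t [_ [ts _ _ /eqP o _]]]] [_ _ h' [t' [_ [ts' _ _ /eqP o' _]]]].
by apply/eqP; rewrite eqn_leq -{1}o h' //= -o' h.
Qed.

Lemma side_bound (s : seq term) : exists B : nat, forall al be c, is_side s al be c ->
  [/\ (al <= B)%N, (be <= B)%N & (c <= B)%N].
Proof.
case: (eqVneq s [::]) => [s0|sn].
  by exists 0%N => al be c [_ _ _ [t [t' [ts _ _ _ _]]]]; rewrite s0 in ts.
have [t1 _ h1] := seq_argmin (fun t : term => - (t.2.1 + t.2.2)%N%:Z) sn.
set D := (t1.2.1 + t1.2.2)%N in h1.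
have hD : {in s, forall t : term, (t.2.1 <= D)%N /\ (t.2.2 <= D)%N}.
  move=> t /h1; rewrite lerN2 lez_nat => h.
  by split; apply: leq_trans h; rewrite ?leq_addr ?leq_addl.
exists (D + (D * D + D * D))%N => al be c hs.
have [alD beD] := is_side_le hD hs.
split; [exact: leq_trans alD (leq_addr _ _) | exact: leq_trans beD (leq_addr _ _) |].
have [_ _ _ [t [_ [ts _ _ /eqP <- _]]]] := hs; have [h2 h3] := hD _ ts.
by apply: leq_trans (leq_addl _ _); rewrite leq_add // leq_mul.
Qed.

Definition triples (B : nat) : seq (nat * nat * nat) :=
  [seq (p, c) | p <- [seq (a, b) | a <- iota 0 B.+1, b <- iota 0 B.+1], c <- iota 0 B.+1].

Lemma mem_triples B al be c : (al <= B)%N -> (be <= B)%N -> (c <= B)%N -> (al, be, c) \in triples B.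
Proof.
move=> h1 h2 h3; apply/allpairsP; exists ((al, be), c); split=> //; rewrite ?mem_iota //.
by apply/allpairsP; exists (al, be); split; rewrite ?mem_iota.
Qed.

Variables (f : {poly {poly R[i]}}) (xi0 : R[i]).
Let g := f - xi0%:P%:P.
Hypothesis nd : newton_nondegenerate g.
Hypothesis hdim : affine_dim (newton g) 2.
Hypothesis hrect : rectangle_closed (newton g).

Definition chart_map (al be : nat) (ch : chart R) : C2 R -> C2 R := Jmap xi0 al be (ch_Z ch) (ch_W ch).

Lemma coef_shift l m : (l, m) != (0, 0)%N -> bcoef f l m = bcoef g l m.
Proof. by move=> h; rewrite bcoefB_const (negbTE h) mulr0n subr0. Qed.

Lemma beval_shift (p : C2 R) : beval f p = beval g p + xi0.
Proof. by rewrite bevalB_const subrK. Qed.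

Section OneChart.
Variables (al be c : nat) (ch : chart R).
Hypothesis hs : is_side (terms g) al be c.
Hypothesis hch : is_chart (terms g) al be c ch.

Let hc : {in terms g, forall t, (al * t.2.1 + be * t.2.2 <= c)%N}.
Proof. by case: hs. Qed.

Let hb := chart_branch hch.
Let Z00 := chart_Z0 hch.
Let W00 := chart_W0 hch.

Lemma chart_level p : punctured_bidisc xi0 (ch_rho ch) p -> beval f (chart_map al be ch p) = p.1.
Proof.
move=> hp; have := Jmap_level hb hc hp; rewrite /qhom expr1n mulr1 => /eqP; rewrite subr_eq0 => /eqP e.
rewrite beval_shift -[p.1 in RHS](subrK xi0) -e beval_terms /msum; congr (_ + _).
by apply: eq_bigr => t _; rewrite expr1n mulr1.
Qed.

Lemma chart_embedding : exists2 r : R, 0 < r &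
  forall eps : R, 0 < eps <= r -> holomorphic_embedding (punctured_bidisc xi0 eps) (chart_map al be ch).
Proof.
have [cop _ _ _] := hs.
apply: (Jmap_embedding hb (chart_kap0 hch) Z00 W00 (chart_smallZ hch) (chart_smallW hch) cop (f := beval f)).
  exact: beval_continuous.
exact: chart_level.
Qed.

Lemma side_terms_shift (F : term -> R[i]) :
  \sum_(t <- side_terms (terms f) al be c) F t = \sum_(t <- side_terms (terms g) al be c) F t.
Proof.
have c0 : (0 < c)%N by case: hs.
apply: perm_big; apply: uniq_perm; [exact: filter_uniq (map_uniq (terms_uniq f)) | exact: filter_uniq (map_uniq (terms_uniq g)) |].
move=> t; rewrite [LHS]mem_filter [RHS]mem_filter; case: (boolP (online al be c t)) => //= o.
rewrite !mem_terms coef_shift //; apply/eqP => e; move: o.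
have [l0 m0] : t.2.1 = 0%N /\ t.2.2 = 0%N by case: e.
by rewrite /online l0 m0 !muln0 addn0 => /eqP z; rewrite -z in c0.
Qed.

Lemma chart_trunc (xi : Cplx R) : disc xi0 (ch_rho ch) xi ->
  beval (trunc f (nrm al be)) (Jhat xi0 (ch_Z ch) (ch_W ch) (xi, 0)) = 0.
Proof.
rewrite /disc /= cabs_ltP => hxi; have [_ c0 _ [t [_ [ts _ _ o _]]]] := hs.
have hcf : {in terms f, forall t, (al * t.2.1 + be * t.2.2 <= c)%N}.
  move=> t'; rewrite mem_terms => /andP[t0 /eqP e].
  case: (eqVneq (t'.2.1, t'.2.2) (0, 0)%N) => [[-> ->]|ne]; first by rewrite !muln0.
  by apply: hc; rewrite mem_terms t0 /= e coef_shift.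
have exf : exists2 t, t \in terms f & online al be c t.
  exists t => //; move: ts; rewrite !mem_terms coef_shift //; apply/eqP => e; move: o.
  have [l0 m0] : t.2.1 = 0%N /\ t.2.2 = 0%N by case: e.
  by rewrite /online l0 m0 !muln0 addn0 => /eqP z; rewrite -z in c0.
have hx : cabs (xi - xi0) <= ch_rho ch by exact: ltW.
rewrite (beval_trunc_nrm hcf exf) side_terms_shift /Jhat /= (br_Z0 hb hx) (br_W0 hb hx).
rewrite -(qhom0E hc _ _ 0 c0).
have x0 : cabs (0 : R[i]) <= ch_rho ch by rewrite cabs0 ltW // (br_rho hb).
by have := br_F hb x0 x0; rewrite (br_Z0 hb x0) (br_W0 hb x0).
Qed.

Lemma chart_large (M : R) : exists2 dl : R, 0 < dl &
  forall p, punctured_bidisc xi0 (ch_rho ch) p -> `|p.2| < dl%:C -> M%:C < enorm (chart_map al be ch p).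
Proof.
have [dl dl0 h] := Jmap_large xi0 hb Z00 W00 (chart_smallZ hch) (chart_smallW hch) M (is_side_pos hs).
by exists dl => // p hp; rewrite cabs_ltP => hp2; apply: enorm_gt; exact: h.
Qed.

End OneChart.

(** Proportional primitive normals are equal, so two charts differ either in direction or in the
    root of one and the same side polynomial. *)
Lemma charts_disjoint al be c ch al' be' c' ch' :
  is_side (terms g) al be c -> is_side (terms g) al' be' c' ->
  is_chart (terms g) al be c ch -> is_chart (terms g) al' be' c' ch' ->
  ((al, be) = (al', be') -> ch_tau ch <> ch_tau ch') ->
  exists2 r : R, 0 < r & forall p p', punctured_bidisc xi0 r p -> punctured_bidisc xi0 r p' ->
    chart_map al be ch p <> chart_map al' be' ch' p'.
Proof.
move=> hs hs' hch hch' hne.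
case: (eqVneq (al * be')%N (be * al')%N) => [e|/eqP ne]; last first.
  exact: (Jmap_disjoint_normals xi0 (chart_branch hch) (chart_branch hch') (chart_Z0 hch) (chart_W0 hch)
    (chart_Z0 hch') (chart_W0 hch') (chart_smallZ hch) (chart_smallW hch) (chart_smallZ hch') (chart_smallW hch')).
have [cop _ _ _] := hs; have [cop' _ _ _] := hs'.
have [e1 e2] : al = al' /\ be = be'.
  have d (x y x' y' : nat) : coprime x y -> (x * y' = y * x')%N -> (x %| x')%N.
    by move=> xy exy; rewrite -(Gauss_dvdr _ xy) -exy dvdn_mulr.
  have e' : (al' * be = be' * al)%N by rewrite [LHS]mulnC -e mulnC.
  split; apply/eqP; rewrite eqn_dvd.
    by rewrite (d _ _ _ _ cop e) (d _ _ _ _ cop' e').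
  by rewrite coprime_sym in cop; rewrite coprime_sym in cop'; rewrite (d _ _ _ _ cop (esym e)) (d _ _ _ _ cop' (esym e')).
subst al' be'; have ec := side_level_unique hs hs'; subst c'.
apply: (Jmap_disjoint_roots xi0 (chart_branch hch) (chart_branch hch') (chart_smallZ hch) (chart_smallW hch)
  (chart_smallZ hch') (chart_smallW hch')).
apply: (chart_separates (bezout_pairP cop) (chart_tau0 hch) (chart_tau0 hch') (chart_lam0 hch) (chart_lam0 hch')).
exact: hne.
Qed.

Variable fam : nat * nat * nat -> (nat -> chart R) * (nat -> R[i]).
Hypothesis hfam : forall al be c, is_side (terms g) al be c ->
  side_family f g al be c (fam (al, be, c)).1 (fam (al, be, c)).2.

Notation in_range al be i := (1 <= i <= nseg (face (newton g) (nrm al be)))%N.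

Definition valid (x : nat * nat * nat * nat) : Prop :=
  is_side (terms g) x.1.1.1 x.1.1.2 x.1.2 /\ in_range x.1.1.1 x.1.1.2 x.2.

Definition chart_of (x : nat * nat * nat * nat) : chart R := (fam x.1).1 x.2.

Lemma chart_ofP x : valid x -> is_chart (terms g) x.1.1.1 x.1.1.2 x.1.2 (chart_of x).
Proof. by case: x => [[[al be] c] i] [hs hi]; exact: (sf_chart (hfam hs)). Qed.

Lemma valid_finite : exists L : seq (nat * nat * nat * nat), forall x, valid x -> x \in L.
Proof.
have [B hB] := side_bound (terms g).
pose F (T : nat * nat * nat) := iota 1 (nseg (face (newton g) (nrm T.1.1 T.1.2))).
exists [seq (T, i) | T <- triples B, i <- F T].
move=> [[[al be] c] i] [hs /andP[i1 i2]]; have [h1 h2 h3] := hB _ _ _ hs.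
apply: (@allpairs_f_dep _ (fun _ => nat) _ (fun T i => (T, i)) (triples B) F (al, be, c) i (mem_triples h1 h2 h3)).
by rewrite mem_iota i1 add1n ltnS.
Qed.

Lemma common_radius (t00 : term) : t00.1 != 0 -> exists2 eps : R, 0 < eps &
  [/\ eps <= 1, eps <= cabs t00.1 / 2,
     forall x, valid x -> eps <= ch_rho (chart_of x) /\
       holomorphic_embedding (punctured_bidisc xi0 eps) (chart_map x.1.1.1 x.1.1.2 (chart_of x)) &
     forall x y, valid x -> valid y -> (x.1.1, x.2) <> (y.1.1, y.2) ->
       forall p p', punctured_bidisc xi0 eps p -> punctured_bidisc xi0 eps p' ->
         chart_map x.1.1.1 x.1.1.2 (chart_of x) p <> chart_map y.1.1.1 y.1.1.2 (chart_of y) p'].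
Proof.
move=> t0; have [L hL] := valid_finite.
have [|r1 r10 h1] := @small_all _ L (fun x e => valid x -> e <= ch_rho (chart_of x) /\
   holomorphic_embedding (punctured_bidisc xi0 e) (chart_map x.1.1.1 x.1.1.2 (chart_of x))).
  move=> x _; case: (pselect (valid x)) => [vx|nv]; last by exists 1.
  have hch := chart_ofP vx; have [hs _] := vx; have [r r0 hr] := chart_embedding hs hch.
  have rho0 := br_rho (chart_branch hch).
  exists (Num.min r (ch_rho (chart_of x))); first by rewrite lt_min r0.
  by move=> e /andP[e0]; rewrite le_min => /andP[e1 e2] _; split=> //; apply: hr; rewrite e0.
have [|r2 r20 h2] := @small_all _ [seq (x, y) | x <- L, y <- L] (fun xy e => valid xy.1 -> valid xy.2 ->
   (xy.1.1.1, xy.1.2) <> (xy.2.1.1, xy.2.2) -> forall p p', punctured_bidisc xi0 e p -> punctured_bidisc xi0 e p' ->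
   chart_map xy.1.1.1.1 xy.1.1.1.2 (chart_of xy.1) p <> chart_map xy.2.1.1.1 xy.2.1.1.2 (chart_of xy.2) p').
  move=> [x y] _ /=; case: (pselect [/\ valid x, valid y & (x.1.1, x.2) <> (y.1.1, y.2)]) => [[vx vy ne]|nv]; last first.
    by exists 1 => // e _ vx vy ne; case: nv.
  have hx := chart_ofP vx; have hy := chart_ofP vy.
  have [r r0 hr] : exists2 r : R, 0 < r & forall p p', punctured_bidisc xi0 r p -> punctured_bidisc xi0 r p' ->
      chart_map x.1.1.1 x.1.1.2 (chart_of x) p <> chart_map y.1.1.1 y.1.1.2 (chart_of y) p'.
    apply: charts_disjoint hx hy _; [by case: vx | by case: vy |].
    move: x y vx vy ne => [[[al be] c] i] [[[al' be'] c'] j] /= [/= hs hi] [/= hs' hj] ne [e1 e2].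
    subst al' be'; have ec := side_level_unique hs hs'; subst c'.
    by apply: (sf_tau (hfam hs)) => //= ij; apply: ne; rewrite /= ij.
  exists r => // e /andP[_ er] _ _ _ p p' /punctured_bidiscP [a1 a2 a3] /punctured_bidiscP [b1 b2 b3].
  by apply: hr; apply/punctured_bidiscP; split=> //; apply: lt_le_trans er.
have t1 : 0 < cabs t00.1 / 2 by rewrite divr_gt0 // cabs_gt0.
(* 1 is the bound on x in [sf_cover], and half the modulus of the constant term is the bound on x in
   [log_cover]. *)
pose eps := Num.min (Num.min r1 r2) (Num.min 1 (cabs t00.1 / 2)).
have eps0 : 0 < eps by rewrite !lt_min r10 r20 t1 ltr01.
exists eps => //; split.
- by rewrite !ge_min lexx !orbT.
- by rewrite !ge_min lexx !orbT.
- move=> x vx; apply: (h1 eps) => //; last exact: hL.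
  by rewrite eps0 !ge_min lexx.
- move=> x y vx vy ne p p' hp hp'.
  have m : (x, y) \in [seq (x, y) | x <- L, y <- L].
    by apply/allpairsP; exists (x, y); split=> //; exact: hL.
  apply: (h2 eps _ _ m) => //; by rewrite eps0 !ge_min lexx !orbT.
Qed.

Lemma charts_cover (t00 : term) (eps : R) : t00 \in terms g -> t00.2 = (0, 0)%N ->
  0 < eps -> eps <= 1 -> eps <= cabs t00.1 / 2 -> (forall x, valid x -> eps <= ch_rho (chart_of x)) ->
  exists2 r : R, 0 < r & forall q : C2 R, cabs (beval f q - xi0) < eps -> r <= cabs q.1 \/ r <= cabs q.2 ->
    exists x, valid x /\ exists2 p, punctured_bidisc xi0 eps p & chart_map x.1.1.1 x.1.1.2 (chart_of x) p = q.
Proof.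
move=> t00s t00E eps0 eps1 epst hrho; have [L hL] := valid_finite; have [B hB] := side_bound (terms g).
(* The order of choices matters: [K] determines the annulus for tau, the coverings of the annulus
   determine [dl], and only then does [dl] give the radius [r]. *)
have [K K1 hK] := log_cover (terms_uniq g) (@terms_neq0 R g) t00s t00E
  (exists_posX hdim) (exists_posY hdim) (rectangle_halfplane hrect).
pose good (T : nat * nat * nat) (dl : R) := is_side (terms g) T.1.1 T.1.2 T.2 ->
  forall v tau x : R[i], v != 0 -> tau != 0 -> cabs v <= dl -> K^-1 <= cabs tau -> cabs tau <= K ->
  cabs x < eps -> qhom (terms g) T.2 T.1.1 T.1.2 id v (tau ^ (bezout_pair T.1.1 T.1.2).2) (tau ^ (- (bezout_pair T.1.1 T.1.2).1)) x = 0 ->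
  exists i u, [/\ in_range T.1.1 T.1.2 i, u != 0 /\ cabs u < eps,
    u ^ (- T.1.1%:Z) * ch_Z (chart_of (T, i)) x u = v ^ (- T.1.1%:Z) * tau ^ (bezout_pair T.1.1 T.1.2).2 &
    u ^ (- T.1.2%:Z) * ch_W (chart_of (T, i)) x u = v ^ (- T.1.2%:Z) * tau ^ (- (bezout_pair T.1.1 T.1.2).1)].
have [|dl dl0 hdl] := @small_all _ (triples B) good.
  move=> [[al be] c] _; rewrite /good /=; case: (pselect (is_side (terms g) al be c)) => hs; last by exists 1.
  have [_ c0 hc _] := hs; have hF := hfam hs; set ab := bezout_pair al be.
  have [|d0 d00 hd0] := @small_all _ (iota 1 (nseg (face (newton g) (nrm al be)))) (fun i d => forall v tau x : R[i],
      v != 0 -> cabs v <= d -> tau != 0 -> cabs (tau - ch_tau (chart_of (al, be, c, i))) <= d -> cabs x < eps ->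
      qhom (terms g) c al be id v (tau ^ ab.2) (tau ^ (- ab.1)) x = 0 ->
      exists u : R[i], [/\ u != 0, cabs u < eps,
      u ^ (- al%:Z) * ch_Z (chart_of (al, be, c, i)) x u = v ^ (- al%:Z) * tau ^ ab.2 &
      u ^ (- be%:Z) * ch_W (chart_of (al, be, c, i)) x u = v ^ (- be%:Z) * tau ^ (- ab.1)]).
    move=> i; rewrite mem_iota add1n ltnS => hi.
    have vi : valid (al, be, c, i) by split.
    have hch := chart_ofP vi.
    have he : 0 < eps <= ch_rho (chart_of (al, be, c, i)) by rewrite eps0 hrho.
    have [d d00 hd] := branch_cover hc (chart_branch hch) (chart_lam0 hch) (chart_tau0 hch) (is_side_pos hs) he.
    by exists d => // e /andP[_ ed] v tau x v0 vd tau0 taud; apply: hd => //; [exact: le_trans ed | exact: le_trans ed].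
  have [d1 d10 hd1] := sf_cover hF K1 d00.
  exists (Num.min d0 d1); first by rewrite lt_min d00.
  move=> e /andP[e0]; rewrite le_min => /andP[ed0 ed1] _ v tau x v0 tau0 vd t1 t2 xe q0.
  have [i hi ti] := hd1 v tau x (le_trans vd ed1) t1 t2 (ltW (lt_le_trans xe eps1)) q0.
  have im : i \in iota 1 (nseg (face (newton g) (nrm al be))) by rewrite mem_iota add1n ltnS.
  have d0d : 0 < d0 <= d0 by rewrite d00 lexx.
  have [u [u0 ue e1 e2]] := hd0 d0 d0d i im v tau x v0 (le_trans vd ed0) tau0 ti xe q0.
  by exists i, u.
have [r r0 hr] := hK dl dl0; exists r => // q hq hbig; set x := beval f q - xi0 in hq.
have qe : \sum_(t <- terms g) t.1 * q.1 ^+ t.2.1 * q.2 ^+ t.2.2 = x.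
  by rewrite -beval_terms bevalB_const.
have [al [be [c [hs z0 w0 vd [t1 t2]]]]] := hr q.1 q.2 x (ltW (lt_le_trans hq epst)) qe hbig.
have [h1 h2 h3] := hB _ _ _ hs; have [cop _ hc _] := hs.
set ab := bezout_pair al be in vd; have hab := bezout_pairP cop; rewrite -/ab in hab.
(* The coordinates are inverted by z = v^-al tau^b and w = v^-be tau^-a, both consequences of the
   Bezout relation. *)
set v := q.1 ^ (- ab.1) * q.2 ^ (- ab.2) in vd; set tau := q.1 ^ be%:Z * q.2 ^ (- al%:Z) in t1 t2.
have v0 : v != 0 by rewrite mulf_neq0 // expfz_neq0.
have tau0 : tau != 0 by rewrite mulf_neq0 // expfz_neq0.
have mono (y1 y2 : R[i]) (i j k l m n : int) : y1 != 0 -> y2 != 0 ->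
    (y1 ^ i * y2 ^ j) ^ m * (y1 ^ k * y2 ^ l) ^ n = y1 ^ (i * m + k * n) * y2 ^ (j * m + l * n).
  by move=> y10 y20; rewrite !exprzMl ?unitfE ?expfz_neq0 // !exprz_exp !expfzDr //; ring.
have zE : v ^ (- al%:Z) * tau ^ ab.2 = q.1.
  rewrite /v /tau mono // (_ : - ab.1 * - al%:Z + be%:Z * ab.2 = 1); last by rewrite -hab; ring.
  by rewrite (_ : - ab.2 * - al%:Z + - al%:Z * ab.2 = 0) ?expr0z ?mulr1 ?expr1z //; ring.
have wE : v ^ (- be%:Z) * tau ^ (- ab.1) = q.2.
  rewrite /v /tau mono // (_ : - ab.1 * - be%:Z + be%:Z * - ab.1 = 0); last by ring.
  by rewrite (_ : - ab.2 * - be%:Z + - al%:Z * - ab.1 = 1) ?expr0z ?mul1r ?expr1z // -hab; ring.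
have q0 : qhom (terms g) c al be id v (tau ^ ab.2) (tau ^ (- ab.1)) x = 0.
  have cancel (k : nat) (y : R[i]) : v ^+ k * (v ^ (- k%:Z) * y) = y.
    by rewrite mulrA exprnP -expfzDr // subrr expr0z mul1r.
  have := qhom_scale hc v 1 q.1 q.2 x; rewrite mulr1.
  rewrite -{1}zE -{1}wE !cancel => ->.
  rewrite /qhom expr1n mulr1 /msum (eq_bigr (fun t => t.1 * q.1 ^+ t.2.1 * q.2 ^+ t.2.2)) ?qe ?subrr ?mulr0 //.
  by move=> t _; rewrite expr1n mulr1.
have dld : 0 < dl <= dl by rewrite dl0 lexx.
have [i [u [hi [u0 ue] e1 e2]]] := hdl dl dld (al, be, c) (mem_triples h1 h2 h3) hs v tau x v0 tau0 vd t1 t2 hq q0.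
exists (al, be, c, i); split; first by split.
exists (x + xi0, u); first by apply/punctured_bidiscP; rewrite /= addrK.
by rewrite /chart_map /Jmap /= addrK e1 e2 zE wE; case: (q).
Qed.

End Assembly.

Theorem mainTheorem1 (R : realType) (f : {poly {poly R[i]}}) (xi0 : Cplx R)
    (P : set (plane R)) :
  P = newton (f - (xi0 : R[i])%:P%:P) ->
  newton_nondegenerate (f - (xi0 : R[i])%:P%:P) ->
  affine_dim P 2 ->
  rectangle_closed P ->
  exists (eps r : R) (J : set (plane R) -> nat -> C2 R -> C2 R)
      (kappa : set (plane R) -> nat -> R[i]),
  [/\ 0 < eps /\ 0 < r,
    (* 1) *)
    forall (G : set (plane R)) (a : int * int),
      free_side P G -> primitive_outer_normal P G a ->
      kappa_spec f G a (kappa G) /\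
      forall n, (1 <= n <= nseg G)%N ->
      [/\ holomorphic_embedding (punctured_bidisc xi0 eps) (J G n),
          forall p, punctured_bidisc xi0 eps p -> torus (J G n p),
          forall p, punctured_bidisc xi0 eps p -> beval f (J G n p) = p.1,
          exists e : int,
            (forall u0 v0 : R, G (u0, v0) ->
              e%:~R = (u0 - 1) * a.1%:~R + (v0 - 1) * a.2%:~R - 1) /\
            forall p v1 v2, punctured_bidisc xi0 eps p ->
              pullback_area (J G n) p v1 v2 =
              kappa G n * (p.2 : R[i]) ^ e * area_form v1 v2
        & forall M : R, exists2 delta : R, 0 < delta &
            forall p, punctured_bidisc xi0 eps p -> `|p.2| < delta%:C ->
              M%:C < enorm (J G n p)],
    (* 2) *)
    (forall (G G' : set (plane R)) (n n' : nat),
      free_side P G -> free_side P G' ->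
      (1 <= n <= nseg G)%N -> (1 <= n' <= nseg G')%N ->
      (G, n) <> (G', n') ->
      (J G n @` punctured_bidisc xi0 eps) `&`
      (J G' n' @` punctured_bidisc xi0 eps) = set0) /\
    (beval f @^-1` disc xi0 eps) `\` ball4 r `<=`
      [set q | exists (G : set (plane R)) (n : nat),
        [/\ free_side P G, (1 <= n <= nseg G)%N &
            (J G n @` punctured_bidisc xi0 eps) q]]
  & (* 3) *)
    forall (G : set (plane R)) (a : int * int) (n : nat),
      free_side P G -> primitive_outer_normal P G a ->
      (1 <= n <= nseg G)%N ->
      exists Jhat : C2 R -> C2 R,
      [/\ holomorphic_on (bidisc xi0 eps) Jhat,
          forall p, bidisc xi0 eps p -> torus (Jhat p),
          forall p, punctured_bidisc xi0 eps p ->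
            Jhat p = ((p.2 : R[i]) ^ a.1 * (J G n p).1,
                      (p.2 : R[i]) ^ a.2 * (J G n p).2)
        & forall xi, disc xi0 eps xi ->
            beval (trunc f (covec R a)) (Jhat (xi, 0)) = 0]].
Proof.
move=> -> nd hdim hrect; set g := f - _ in nd hdim hrect *.
have [fam hfam] : {fam : nat * nat * nat -> (nat -> chart R) * (nat -> R[i]) & forall T, is_side (terms g) T.1.1 T.1.2 T.2 ->
    side_family f g T.1.1 T.1.2 T.2 (fam T).1 (fam T).2}.
  apply: (@choice _ _ (fun T F => is_side (terms g) T.1.1 T.1.2 T.2 ->
    side_family f g T.1.1 T.1.2 T.2 F.1 F.2)) => T.
  case: (pselect (is_side (terms g) T.1.1 T.1.2 T.2)) => hs; last first.
    by exists (fun _ => Chart 0 0 0 0 0 (fun _ => id) (fun _ => id) (fun _ => id) (fun _ => id) (fun _ => id) (fun _ => id), fun _ => 0).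
  have [ch [kapp h]] := side_family_exists (@coef_shift R f xi0) nd hdim hrect hs.
  by exists (ch, kapp).
have {}hfam al be c : is_side (terms g) al be c ->
    side_family f g al be c (fam (al, be, c)).1 (fam (al, be, c)).2 by exact: (hfam (al, be, c)).
have [N hN] : {N : set (plane R) -> nat * nat * nat & forall G, free_side (newton g) G ->
    is_side (terms g) (N G).1.1 (N G).1.2 (N G).2 /\ G = face (newton g) (nrm R (N G).1.1 (N G).1.2)}.
  apply: (@choice _ _ (fun G T => free_side (newton g) G ->
    is_side (terms g) T.1.1 T.1.2 T.2 /\ G = face (newton g) (nrm R T.1.1 T.1.2))) => G.
  case: (pselect (free_side (newton g) G)) => hG; last by exists (0, 0, 0)%N.
  by have [al [be [c h]]] := free_side_normal hdim hrect hG; exists (al, be, c).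
have [t00 t00s t00E] := origin_term hdim hrect.
have [eps eps0 [eps1 epst hval hdis]] := common_radius hfam (terms_neq0 t00s).
have [r r0 hcov] := charts_cover hdim hrect hfam t00s t00E eps0 eps1 epst (fun x vx => (hval x vx).1).
pose J G n := chart_map xi0 (N G).1.1 (N G).1.2 (chart_of fam (N G, n)).
pose kappa G := (fam (N G)).2.
have Gvalid G n : free_side (newton g) G -> (1 <= n <= nseg G)%N -> valid f xi0 (N G, n).
  by move=> /hN [h1 h2] hn; split=> //=; rewrite -h2.
have Ga G a : free_side (newton g) G -> primitive_outer_normal (newton g) G a ->
    a = ((N G).1.1%:Z, (N G).1.2%:Z).
  by move=> hG ha; have [h1 h2] := hN G hG; apply: (outer_normal_uniq hdim hrect h1); rewrite -h2.
have widen G n p : free_side (newton g) G -> (1 <= n <= nseg G)%N -> punctured_bidisc xi0 eps p ->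
    punctured_bidisc xi0 (ch_rho (chart_of fam (N G, n))) p.
  move=> hG hn /punctured_bidiscP [h1 h2 h3]; have [he _] := hval _ (Gvalid G n hG hn).
  by apply/punctured_bidiscP; split=> //; apply: lt_le_trans he.
have widen' G n p : free_side (newton g) G -> (1 <= n <= nseg G)%N -> bidisc xi0 eps p ->
    bidisc xi0 (ch_rho (chart_of fam (N G, n))) p.
  move=> hG hn /bidiscP [h1 h2]; have [he _] := hval _ (Gvalid G n hG hn).
  by apply/bidiscP; split=> //; apply: lt_le_trans he.
(* Outside the ball of radius 2 r one of the two moduli is at least r, as [charts_cover]
   requires. *)
exists eps, (2 * r), J, kappa; split; first by rewrite mulr_gt0.
- move=> G a hG ha; have [hs GE] := hN G hG; have hF := hfam _ _ _ hs; rewrite -!surjective_pairing in hF.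
  have aE := Ga G a hG ha; split; first by rewrite aE {1}GE; exact: sf_spec hF.
  move=> n hn; have vn := Gvalid G n hG hn; have hch := chart_ofP hfam vn.
  have hb := chart_branch hch.
  have [_ hemb] := hval _ vn; split=> //.
  + move=> p /(widen G n p hG hn); exact: (Jmap_torus hb (chart_Z0 hch) (chart_W0 hch) (chart_smallZ hch) (chart_smallW hch)).
  + by move=> p /(widen G n p hG hn); exact: (chart_level hs hch).
  (* The exponent c - al - be - 1, since u0 al + v0 be = c at every point (u0, v0) of the side. *)
  + exists ((N G).2%:Z - (N G).1.1%:Z - (N G).1.2%:Z - 1); split.
      move=> u0 v0 Guv; have e := side_level hs (eq_ind _ (fun S : set (plane R) => S (u0, v0)) Guv _ GE).
      rewrite aE /=.
      by rewrite !intrB -!pmulrn -e; ring.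
    move=> p v1 v2 hp; rewrite (Jmap_pullback hb v1 v2 (widen G n p hG hn hp)).
    by rewrite /kappa (sf_kapp hF) // -GE.
  + move=> M; have [dl dl0 h] := chart_large hs hch M.
    by exists dl => // p hp; apply: h; exact: widen.
- split.
    move=> G G' n n' hG hG' hn hn' ne; rewrite -subset0 => q [[p hp <-] [p' hp' /esym]].
    apply: (hdis (N G, n) (N G', n')) => //; try exact: Gvalid.
    move=> /= [e1 en]; apply: ne; rewrite en; congr pair.
    by apply: etrans (hN G hG).2 _; rewrite e1; exact: esym (hN G' hG').2.
  move=> q [hq hout]; have hq' : cabs (beval f q - xi0) < eps by move: hq; rewrite /disc /= cabs_ltP.
  have [[[[al be] c] n] [[/= hs hn] [p hp pq]]] := hcov q hq' (outside_ball4 (ltW r0) hout).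
  pose G := face (newton g) (nrm R al be); have hG : free_side (newton g) G := face_free_side hs.
  exists G, n; split=> //; exists p => //; rewrite -pq.
  have [hs' GE] := hN G hG; have [cop _ hc exo] := hs.
  have prim : primitive_outer_normal (newton g) G (al%:Z, be%:Z).
    by split=> [|x y [_ hx] /hx //]; exact: cop.
  have [e1 e2] := Ga G _ hG prim.
  (* The triple chosen for [G] is the one that covers the point: a side determines its primitive
     outer normal, and the normal determines the level. *)
  have NE : N G = (al, be, c).
    rewrite [N G]surjective_pairing [(N G).1]surjective_pairing -e1 -e2.
    by rewrite -e1 -e2 in hs'; rewrite (side_level_unique hs' hs).
  by rewrite /J NE.
- move=> G a n hG ha hn; have [hs GE] := hN G hG; have aE := Ga G a hG ha.
  have vn := Gvalid G n hG hn; have hch := chart_ofP hfam vn; have hb := chart_branch hch.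
  exists (Jhat xi0 (ch_Z (chart_of fam (N G, n))) (ch_W (chart_of fam (N G, n)))); split.
  + by move=> p /(widen' G n p hG hn); exact: Jhat_is_diff hb _.
  + by move=> p /(widen' G n p hG hn); exact: (Jhat_torus hb (chart_Z0 hch) (chart_W0 hch) (chart_smallZ hch) (chart_smallW hch)).
  + by move=> p /punctured_bidiscP [_ _ p20]; rewrite aE; exact: Jhat_Jmap.
  + move=> xi hxi; rewrite aE; apply: (chart_trunc hs hch).
    by move: hxi; rewrite /disc /= !cabs_ltP => h; apply: lt_le_trans h _; have [] := hval _ vn.
Qed.
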